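(* Assume that $$\zeta\ge\sqrt{(\lambda+2\mu)/\mu},\qquad \frac{\rho\gamma^2}{\eta^2}\ge 1,\qquad \zeta^2-1\ge 2\gamma\zeta,\qquad \zeta\ge\sqrt3,\qquad \alpha_0<\frac{\lambda+\mu}{2\gamma(\lambda+2\mu)} .$$ Then, for all frequencies $\omega\in\mathbb{C}$ except possibly those in a discrete set, the truncated PML problem $$\begin{aligned}\nabla\cdot(\tilde\sigma(\tilde{\boldsymbol{u}})A)+\rho\omega^2J\tilde{\boldsymbol{u}}-\gamma A\nabla\tilde p&=\mathbf{Q}&&\text{in }\Omega_2,\\ \nabla\cdot(K\nabla\tilde p)+qJ\tilde p+\mathbf{i}\omega\eta\,\nabla\cdot(A\tilde{\boldsymbol{u}})&=0&&\text{in }\Omega_2,\\ (\tilde{\boldsymbol{u}}^\top,\tilde p)^\top&=0&&\text{on }\partial\Omega\cup\partial B_2\end{aligned}$$ admits a unique (weak) solution $(\tilde{\boldsymbol{u}}^\top,\tilde p)^\top$ in the space $H_0^1(\Omega_2)^4$.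
   Context: Material constants: density $\rho>0$; Lamé constants $\lambda,\mu$ with $\mu>0$, $3\lambda+2\mu>0$; $\gamma=(3\lambda+2\mu)\alpha_T$ and $\eta=T_0\gamma/\lambda_0$ with constants $\alpha_T,T_0,\lambda_0>0$; $\kappa>0$; frequency $\omega$; $q=\mathbf{i}\omega/\kappa$, where $\mathbf{i}$ is the imaginary unit. Geometry: $\Omega\subset\mathbb{R}^3$ is a bounded domain with smooth boundary, $\overline\Omega\subset B_1$, where $B_1=\{x\in\mathbb{R}^3:|x_j|<l_j,\ j=1,2,3\}$ with $l_j>0$; $B_2=\{x\in\mathbb{R}^3:|x_j|<l_j+d_j,\ j=1,2,3\}$ with $d_j>0$; $\Omega_2=B_2\setminus\overline\Omega$. The source $\mathbf{Q}\in H^1(\mathbb{R}^3\setminus\overline\Omega)^3$ has compact support inside $B_1$. PML: $\alpha_0>0$ is a constant and $l_j<\bar l_j\le l_j+d_j$. With $h(s)=e^{-1/s}$ for $s>0$ and $h(s)=0$ for $s\le0$, the function $\alpha_j$ on $\mathbb{R}$ is $\alpha_j(t)=0$ for $|t|\le l_j$, $\alpha_j(t)=\alpha_0\,h(\tau)/(h(\tau)+h(1-\tau))$ with $\tau=(|t|-l_j)/(\bar l_j-l_j)$ for $l_j\le|t|\le\bar l_j$, and $\alpha_j(t)=\alpha_0$ for $|t|\ge\bar l_j$. Let $z=\zeta+\mathbf{i}$ with a fixed real $\zeta>0$, $s_j=s_j(x_j)=1+z\alpha_j(x_j)$, $J=s_1s_2s_3$, $A=\mathrm{diag}(s_2s_3,\,s_1s_3,\,s_1s_2)$,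 $B=\mathrm{diag}(s_1^{-1},s_2^{-1},s_3^{-1})$, $K=\mathrm{diag}(s_2s_3/s_1,\ s_1s_3/s_2,\ s_1s_2/s_3)$. For a vector field $\boldsymbol{u}$, $(\nabla\boldsymbol{u})_{ij}=\partial_{x_j}u_i$, $\tilde\epsilon(\boldsymbol{u})=\frac12(\nabla\boldsymbol{u}\,B^\top+B(\nabla\boldsymbol{u})^\top)$, $\tilde\sigma(\boldsymbol{u})=2\mu\,\tilde\epsilon(\boldsymbol{u})+\lambda\,\mathrm{tr}(\tilde\epsilon(\boldsymbol{u}))\,I$; the divergence of a matrix field is taken row-wise. Weak solution: $\Phi=(\tilde{\boldsymbol{u}}^\top,\tilde p)^\top\in H_0^1(\Omega_2)^4$ is a weak solution if for all $\Psi=(\boldsymbol{u}'^\top,p')^\top\in H_0^1(\Omega_2)^4$ one has $\mathcal{B}_{\Omega_2}(\Phi,\Psi)=-\int_{\Omega_2}\mathbf{Q}\cdot\overline{\boldsymbol{u}}'\,dx$, where $$\mathcal{B}_D(\Phi,\Psi)=\int_D\Big[\tilde\sigma(\tilde{\boldsymbol{u}})A:\nabla\overline{\boldsymbol{u}}'-\rho\omega^2J\tilde{\boldsymbol{u}}\cdot\overline{\boldsymbol{u}}'-\gamma \tilde p\,\nabla\cdot(A\overline{\boldsymbol{u}}')+\nabla\overline{p}'\cdot(K\nabla \tilde p)-qJ\tilde p\,\overline{p}'-\mathbf{i}\omega\eta\,\overline{p}'\,\nabla\cdot(A\tilde{\boldsymbol{u}})\Big]dx .$$ *)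

(* Defs.v *)
From HB Require Import structures.
From mathcomp Require Import all_boot all_order all_algebra.
From mathcomp Require Import complex.
From mathcomp Require Import all_classical all_reals all_analysis.

Set Implicit Arguments.
Unset Strict Implicit.
Unset Printing Implicit Defensive.

Import Order.TTheory GRing.Theory Num.Theory.
Import numFieldNormedType.Exports.

Local Open Scope classical_set_scope.
Local Open Scope ring_scope.
Local Open Scope complex_scope.

(* Points of R^3; products carry both the normed-space structure (with the sup
   norm) and the product sigma-algebra used by [leb3] below. *)
Notation pt R := (R * R * R)%type.

Section Calculus.
Context {R : realType}.
Implicit Types (D : set (pt R)) (f g : pt R -> R[i]).

Definition xcoord (x : pt R) (j : 'I_3) : R := [:: x.1.1; x.1.2; x.2]`_j.

Definition basis (j : 'I_3) : pt R :=
  ((j == 0 :> nat)%:R, (j == 1 :> nat)%:R, (j == 2 :> nat)%:R).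

Definition pd (j : 'I_3) (f : pt R -> R) : pt R -> R := fun x => 'D_(basis j) f x.

(* C^oo: every iterated partial derivative is differentiable everywhere. *)
Definition smooth (f : pt R -> R) : Prop :=
  forall (s : seq 'I_3) (x : pt R), differentiable (foldr pd f s) x.

Definition test_fun D (phi : pt R -> R) : Prop :=
  smooth phi /\
  exists K : set (pt R), [/\ compact K, K `<=` D & forall x, ~ K x -> phi x = 0].

Definition ctest_fun D f : Prop :=
  test_fun D (fun x => complex.Re (f x)) /\ test_fun D (fun x => complex.Im (f x)).

Definition leb3 : {measure set (pt (measurableTypeR R)) -> \bar R} :=
  ((@lebesgue_measure R \x @lebesgue_measure R) \x @lebesgue_measure R)%E.

Definition cint D f : R[i] :=
  (\int[leb3]_(x in D) complex.Re (f x)) +i* (\int[leb3]_(x in D) complex.Im (f x)).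

Definition l2norm2 D f : \bar R :=
  (\int[leb3]_(x in D) (complex.Re (f x) ^+ 2 + complex.Im (f x) ^+ 2)%:E)%E.

Definition L2 D f : Prop :=
  [/\ measurable_fun (D : set (pt (measurableTypeR R))) (fun x => complex.Re (f x)),
      measurable_fun (D : set (pt (measurableTypeR R))) (fun x => complex.Im (f x))
    & (l2norm2 D f < +oo)%E].

Definition is_wpd D (j : 'I_3) f g : Prop :=
  L2 D g /\
  forall phi : pt R -> R, test_fun D phi ->
    cint D (fun x => f x * (pd j phi x)%:C) = - cint D (fun x => g x * (phi x)%:C).

(* Weak partial derivatives are unique only up to null sets; [wpd] chooses one
   representative, and the zero function when no square-integrable weak
   derivative exists. *)
Definition wpd D (j : 'I_3) f : pt R -> R[i] :=
  xget (fun=> 0) [set g | is_wpd D j f g].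

Definition H1 D f : Prop := L2 D f /\ forall j, exists g, is_wpd D j f g.

Definition h1norm2 D f : \bar R :=
  (l2norm2 D f + \sum_(j < 3) l2norm2 D (wpd D j f))%E.

(* Closure of C_c^oo(D) in H^1(D), for functions considered modulo null sets and
   whose values outside D are irrelevant. *)
Definition H10 D f : Prop :=
  H1 D f /\
  exists phi : nat -> pt R -> R[i],
    (forall n, ctest_fun D (phi n)) /\
    (h1norm2 D (f \- phi n) @[n --> \oo] --> 0%E).

Definition is_domain (Om : set (pt R)) : Prop :=
  [/\ open Om, connected Om & Om !=set0].

(* Near each boundary point, Om is the sublevel set of a smooth function with
   nonzero gradient there; Om thus lies on one side of its boundary. *)
Definition smooth_boundary (Om : set (pt R)) : Prop :=
  forall x, (closure Om `\` interior Om) x ->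
  exists psi : pt R -> R,
    [/\ smooth psi, exists j, pd j psi x != 0
      & \forall y \near x, Om y <-> psi y < 0].

Definition box (a : 'I_3 -> R) : set (pt R) :=
  [set x | forall j, `|xcoord x j| < a j].

End Calculus.

Section VectorCalculus.
Context {R : realType}.
Implicit Types (D : set (pt R)) (p : pt R -> R[i]) (u : pt R -> 'cV[R[i]]_3).

Definition vgrad D u (x : pt R) : 'M[R[i]]_3 :=
  \matrix_(i, j) wpd D j (fun y => u y i 0) x.

Definition grad D p (x : pt R) : 'cV[R[i]]_3 := \col_j wpd D j p x.

Definition vdiv D u (x : pt R) : R[i] := \sum_(j < 3) wpd D j (fun y => u y j 0) x.

Definition vconj u : pt R -> 'cV[R[i]]_3 := fun x => map_mx (@conjc R) (u x).

(* Bilinear, without complex conjugation. *)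
Definition dotp (v w : 'cV[R[i]]_3) : R[i] := \sum_(i < 3) v i 0 * w i 0.

Definition frob (M N : 'M[R[i]]_3) : R[i] := \sum_(i < 3) \sum_(j < 3) M i j * N i j.

End VectorCalculus.

(* [lam] and [mu] are the Lame constants; [lam0] is the unrelated constant
   lambda_0 entering eta. *)
Record material (R : realType) := Material {
  rho : R; lam : R; mu : R; alphaT : R; T0 : R; lam0 : R; kappa : R }.

(* [ell], [thick], [ellbar] are the lengths l_j, d_j and bar l_j. *)
Record pml (R : realType) := Pml {
  ell : 'I_3 -> R; thick : 'I_3 -> R; ellbar : 'I_3 -> R; alpha0 : R; zeta : R }.

Section PML.
Context {R : realType}.
Variables (m : material R) (P : pml R).
Implicit Types (x : pt R) (p : pt R -> R[i]) (u : pt R -> 'cV[R[i]]_3).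

Definition gammaT : R := (3 * lam m + 2 * mu m) * alphaT m.
Definition etaT : R := T0 m * gammaT / lam0 m.

Definition hexp (t : R) : R := if 0 < t then expR (- t^-1) else 0.

Definition alpha (j : 'I_3) (t : R) : R :=
  if `|t| <= ell P j then 0
  else if ellbar P j <= `|t| then alpha0 P
  else let tau := (`|t| - ell P j) / (ellbar P j - ell P j) in
       alpha0 P * (hexp tau / (hexp tau + hexp (1 - tau))).

Definition zpml : R[i] := zeta P +i* 1.

Definition stretch (j : 'I_3) x : R[i] := 1 + zpml * (alpha j (xcoord x j))%:C.

Definition Jpml x : R[i] := \prod_(j < 3) stretch j x.
Definition Apml x : 'M[R[i]]_3 := diag_mx (\row_j \prod_(k < 3 | k != j) stretch k x).
Definition Bpml x : 'M[R[i]]_3 := diag_mx (\row_j (stretch j x)^-1).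
Definition Kpml x : 'M[R[i]]_3 :=
  diag_mx (\row_j ((\prod_(k < 3 | k != j) stretch k x) / stretch j x)).

Definition strain (D : set (pt R)) u x : 'M[R[i]]_3 :=
  2^-1 *: (vgrad D u x *m (Bpml x)^T + Bpml x *m (vgrad D u x)^T).

Definition stress (D : set (pt R)) u x : 'M[R[i]]_3 :=
  (2 * (mu m)%:C) *: strain D u x + ((lam m)%:C * \tr (strain D u x))%:M.

Definition Bform (omega : R[i]) (D : set (pt R))
    u p (u' : pt R -> 'cV[R[i]]_3) (p' : pt R -> R[i]) : R[i] :=
  let q := (0 +i* 1) * omega / (kappa m)%:C in
  cint D (fun x =>
      frob (stress D u x *m Apml x) (vgrad D (vconj u') x)
    - (rho m)%:C * omega ^+ 2 * Jpml x * dotp (u x) (vconj u' x)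
    - gammaT%:C * p x * vdiv D (fun y => Apml y *m vconj u' y) x
    + dotp (grad D (fun y => conjc (p' y)) x) (Kpml x *m grad D p x)
    - q * Jpml x * p x * conjc (p' x)
    - (0 +i* 1) * omega * etaT%:C * conjc (p' x) * vdiv D (fun y => Apml y *m u y) x).

Definition H10_4 (D : set (pt R)) u p : Prop :=
  (forall i, H10 D (fun x => u x i 0)) /\ H10 D p.

Definition weak_solution (omega : R[i]) (D : set (pt R)) (Q : pt R -> 'cV[R[i]]_3)
    u p : Prop :=
  H10_4 D u p /\
  forall u' p', H10_4 D u' p' ->
    Bform omega D u p u' p' = - cint D (fun x => dotp (Q x) (vconj u' x)).

End PML.

(* Main.v *)
From HB Require Import structures.
From mathcomp Require Import all_boot all_order all_algebra.
From mathcomp Require Import complex.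
From mathcomp Require Import all_classical all_reals all_analysis.
From mathcomp Require Import measurable_realfun.
From mathcomp Require Import ring lra.
Require Import Defs.

Set Implicit Arguments.
Unset Strict Implicit.
Unset Printing Implicit Defensive.

Import Order.TTheory GRing.Theory Num.Theory.
Import numFieldNormedType.Exports.

Local Open Scope classical_set_scope.
Local Open Scope ring_scope.
Local Open Scope complex_scope.

(* On the Hilbert space of pairs (u, p) in H^1_0, the PML form is a quadratic
   polynomial in the frequency whose linear and quadratic coefficients involve only one
   L^2 factor, hence are compact by Rellich's theorem. At omega = i s with s real and
   large, testing with (u, t p) for a suitable t > 0 makes it coercive: integration by
   parts, possible because the product of the s_k with k distinct from i, j is constant
   along x_i and x_j, turns the shear terms into divergence terms, and what remains is
   a pointwise inequality for the arguments of the stretchings s_j, which are smaller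
   than arctan (1 / zeta). By the Fredholm alternative the problem is then uniquely
   solvable unless the pencil has a kernel, and Bessel's inequality applied to an
   orthonormalised sequence of eigenvectors leaves only finitely many such frequencies
   in each disc. Rellich's theorem is proved by averaging over a grid of cells. *)

(** * Hermitian forms and the Lax-Milgram theorem *)

Section SquaredModulus.
Context {R : realType}.
Implicit Types z w : R[i].

(** At [omega = i s] the mass terms become [rho s^2 J] and [(s / kappa) J], whose real parts are
    positive because each stretching has argument below pi / 6. Two couplings remain. The term
    [p div(A u')] carries no power of the frequency and is absorbed by the elastic energy and by the
    pressure mass, which grows with [s]. The term [omega p' div(A u)] grows with [s] too; integrated
    by parts it pairs [u] with [grad p'], and absorbing it costs a multiple of [t s^2], against a
    mass [rho s^2] of [u]. Hence [t] is fixed small independently of [s], and only then [s] is taken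
    large. Eigenvectors [w] of a quadratic pencil for distinct [m] need not be independent, whereas
    the pairs [(w, m w)] are; counting takes place among these pairs. Since [wpd] picks an arbitrary
    representative of a weak derivative, which need not respect sums or conjugates, the analysis
    runs in a space whose elements carry their derivatives. *)

Definition sqn z : R := complex.Re z ^+ 2 + complex.Im z ^+ 2.

Lemma sqn_ge0 z : 0 <= sqn z.
Proof. by rewrite addr_ge0 ?sqr_ge0. Qed.

Lemma sqn0 : sqn 0 = 0.
Proof. by rewrite /sqn /= expr0n addr0. Qed.

Lemma sqn_eq0 z : sqn z = 0 -> z = 0.
Proof.
case: z => a b; rewrite /sqn /= => /eqP.
by rewrite paddr_eq0 ?sqr_ge0// !sqrf_eq0 => /andP[/eqP-> /eqP->].
Qed.

Lemma sqnM z w : sqn (z * w) = sqn z * sqn w.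
Proof. by case: z => a b; case: w => c d; rewrite /sqn /=; ring. Qed.

Lemma sqn_conj z : sqn (conjc z) = sqn z.
Proof. by case: z => a b; rewrite /sqn /= sqrrN. Qed.

Lemma sqnN z : sqn (- z) = sqn z.
Proof. by case: z => a b; rewrite /sqn /= !sqrrN. Qed.

Lemma sqn_real (a : R) : sqn a%:C = a ^+ 2.
Proof. by rewrite /sqn /= expr0n addr0. Qed.

Lemma sqnD z w : sqn (z + w) <= 2 * sqn z + 2 * sqn w.
Proof.
case: z => a b; case: w => c d; rewrite /sqn /= -subr_ge0.
rewrite (_ : _ - _ = (a - c) ^+ 2 + (b - d) ^+ 2); last by ring.
by rewrite addr_ge0 ?sqr_ge0.
Qed.

Lemma Re_sqn z : complex.Re z ^+ 2 <= sqn z.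
Proof. by rewrite lerDl sqr_ge0. Qed.

Lemma mul_conjc_sqn z : z * conjc z = (sqn z)%:C.
Proof. by case: z => a b; rewrite /sqn /=; simpc; congr (_ +i* _); ring. Qed.

Lemma sqnV z : sqn z^-1 = (sqn z)^-1.
Proof.
have [->|z0] := eqVneq z 0; first by rewrite invr0 sqn0 invr0.
have s0 : sqn z != 0 by apply: contra_neq z0 => /sqn_eq0.
by apply: (mulfI s0); rewrite -sqnM divff// divff// -[1]/(1%:C) sqn_real expr1n.
Qed.

Lemma sqn_gt0 z : z != 0 -> 0 < sqn z.
Proof. by move=> z0; rewrite lt0r sqn_ge0 andbT; apply: contra_neq z0 => /sqn_eq0. Qed.

(* A weighted sum-of-squares form of |z1|+|z2| <= c lets us avoid square roots. *)
Lemma Re_le_young (z : R[i]) (A B e : R) : 0 < e -> 0 <= A -> 0 <= B ->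
  sqn z <= A * B -> `|complex.Re z| <= e * A + e^-1 * B.
Proof.
move=> e0 A0 B0 h; have eV := divff (lt0r_neq0 e0).
have eV0 : 0 < e^-1 by rewrite invr_gt0.
have h2 : complex.Re z ^+ 2 <= (e * A + e^-1 * B) ^+ 2.
  apply: (le_trans (Re_sqn z)); apply: (le_trans h).
  have -> : A * B = (e * A) * (e^-1 * B) by rewrite mulrACA eV mul1r.
  have : 0 <= e * A by rewrite mulr_ge0// ltW.
  have : 0 <= e^-1 * B by rewrite mulr_ge0// ltW.
  move: (e * A) (e^-1 * B) => x y y0 x0.
  rewrite -subr_ge0 (_ : _ - _ = x ^+ 2 + y ^+ 2 + x * y); last by ring.
  by rewrite !addr_ge0 ?sqr_ge0 ?mulr_ge0.
have p : 0 <= e * A + e^-1 * B by rewrite addr_ge0// mulr_ge0// ltW.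
by rewrite -(ger0_norm p) -ler_sqr ?nnegrE// !real_normK ?num_real.
Qed.

End SquaredModulus.

(** Only semidefinite: the functions below are not identified modulo null sets, so nonzero vectors
    of zero seminorm exist, and two vectors count as equal when [nsq] of their difference
    vanishes. *)
Record hform (R : realType) (V : lmodType R[i]) := HForm {
  hip :> V -> V -> R[i];
  hipD : forall x y z, hip (x + y) z = hip x z + hip y z;
  hipZ : forall a x z, hip (a *: x) z = a * hip x z;
  hipC : forall x y, hip y x = conjc (hip x y);
  hip_ge0 : forall x, 0 <= complex.Re (hip x x) }.

Record sesqui (R : realType) (V : lmodType R[i]) (b : V -> V -> R[i]) : Prop := Sesqui {
  sesDl : forall x y z, b (x + y) z = b x z + b y z;
  sesZl : forall a x z, b (a *: x) z = a * b x z;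
  sesDr : forall x y z, b z (x + y) = b z x + b z y;
  sesZr : forall a x z, b z (a *: x) = conjc a * b z x }.

Section SesquiTheory.
Context {R : realType} {V : lmodType R[i]}.
Implicit Types (x y z : V) (a : R[i]).

Lemma ses0l (b : V -> V -> R[i]) z : sesqui b -> b 0 z = 0.
Proof. by move=> hb; rewrite -[X in b X](scale0r 0) (sesZl hb) mul0r. Qed.
Lemma ses0r (b : V -> V -> R[i]) z : sesqui b -> b z 0 = 0.
Proof. by move=> hb; rewrite -[X in b _ X](scale0r 0) (sesZr hb) conjc0 mul0r. Qed.
Lemma sesNl (b : V -> V -> R[i]) x z : sesqui b -> b (- x) z = - b x z.
Proof. by move=> hb; rewrite -scaleN1r (sesZl hb) mulN1r. Qed.
Lemma sesNr (b : V -> V -> R[i]) x z : sesqui b -> b z (- x) = - b z x.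
Proof. by move=> hb; rewrite -scaleN1r (sesZr hb) rmorphN rmorph1 mulN1r. Qed.
Lemma sesBl (b : V -> V -> R[i]) x y z : sesqui b -> b (x - y) z = b x z - b y z.
Proof. by move=> hb; rewrite (sesDl hb) sesNl. Qed.
Lemma sesBr (b : V -> V -> R[i]) x y z : sesqui b -> b z (x - y) = b z x - b z y.
Proof. by move=> hb; rewrite (sesDr hb) sesNr. Qed.
Lemma ses_suml (b : V -> V -> R[i]) (I : Type) (r : seq I) (P : pred I) (F : I -> V) z :
  sesqui b -> b (\sum_(i <- r | P i) F i) z = \sum_(i <- r | P i) b (F i) z.
Proof.
move=> hb; elim/big_ind2: _ => //; first exact: ses0l.
by move=> x1 x2 y1 y2 <- <-; rewrite (sesDl hb).
Qed.

Variable ip : hform V.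

Lemma hform_sesqui : sesqui ip.
Proof.
split; [exact: hipD|exact: hipZ| |].
- by move=> x y z; rewrite [LHS]hipC hipD rmorphD/= -!hipC.
- by move=> a x z; rewrite [LHS]hipC hipZ rmorphM/= -hipC.
Qed.
Let hs := hform_sesqui.

Definition nsq x : R := complex.Re (ip x x).

Lemma nsq_ge0 x : 0 <= nsq x. Proof. exact: hip_ge0. Qed.

Lemma hipxx x : ip x x = (nsq x)%:C.
Proof.
have := hipC ip x x; rewrite /nsq; case: (ip x x) => a b /= [/eqP].
by rewrite -addr_eq0 -mulr2n mulrn_eq0/= => /eqP->.
Qed.

Lemma nsqN x : nsq (- x) = nsq x.
Proof. by rewrite /nsq (sesNl _ _ hs) (sesNr _ _ hs) opprK. Qed.

Lemma nsq0 : nsq 0 = 0.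
Proof. by rewrite /nsq (ses0l _ hs). Qed.

Lemma nsqBC x y : nsq (x - y) = nsq (y - x).
Proof. by rewrite -nsqN opprB. Qed.

Lemma nsqZ a x : nsq (a *: x) = sqn a * nsq x.
Proof.
rewrite {1}/nsq (sesZl hs) (sesZr hs) hipxx mulrA mul_conjc_sqn.
by simpc; rewrite /= ?mul0r ?subr0.
Qed.

Lemma nsqB_scale (s : R) c x y : c = ip x y ->
  nsq (x - (s%:C * c) *: y) = nsq x - 2 * s * sqn c + s ^+ 2 * sqn c * nsq y.
Proof.
move=> ->; rewrite {1}/nsq (sesBl _ _ _ hs) !(sesBr _ _ _ hs) !(sesZl hs) !(sesZr hs).
rewrite [ip y x]hipC !hipxx; case: (ip x y) => a b; rewrite /sqn; simpc => /=; ring.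
Qed.

Lemma cauchy_schwarz x y : sqn (ip x y) <= nsq x * nsq y.
Proof.
have H s : 0 <= nsq x - 2 * s * sqn (ip x y) + s ^+ 2 * sqn (ip x y) * nsq y.
  by rewrite -(nsqB_scale s (erefl (ip x y))) nsq_ge0.
have c0 := sqn_ge0 (ip x y); have x0 := nsq_ge0 x; have y0 := nsq_ge0 y.
move: H c0 x0 y0; move: (sqn _) (nsq x) (nsq y) => c n k H c0 n0 k0.
have [k1|k1] := eqVneq k 0.
  (* For [nsq y = 0] the quadratic in [s] is affine; this [s] would give it the value -1 if [c] were
     positive. *)
  rewrite k1 mulr0; move: (H ((n + 1) / (2 * c))); rewrite k1 mulr0 addr0 => h.
  rewrite leNgt; apply/negP => cp.
  suff : 2 * ((n + 1) / (2 * c)) * c = n + 1 by move=> e; rewrite e in h; lra.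
  by field; rewrite gt_eqF.
have kp : 0 < k by rewrite lt0r k1.
move: (H k^-1); rewrite (_ : n - _ + _ = n - c / k); last by field.
by rewrite subr_ge0 ler_pdivrMr.
Qed.

Lemma parallelogram x y : nsq (x + y) + nsq (x - y) = 2 * nsq x + 2 * nsq y.
Proof.
rewrite /nsq (sesBl _ _ _ hs) !(sesBr _ _ _ hs) (sesDl hs) !(sesDr hs).
rewrite !raddfD/= !raddfN/=; lra.
Qed.

Lemma nsqD_le x y : nsq (x + y) <= 2 * nsq x + 2 * nsq y.
Proof. by rewrite -parallelogram lerDl nsq_ge0. Qed.

Lemma nsq_null_l x y : nsq x = 0 -> ip x y = 0.
Proof.
move=> x0; apply: sqn_eq0; apply/eqP; rewrite eq_le sqn_ge0 andbT.
by rewrite (le_trans (cauchy_schwarz _ _))// x0 mul0r.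
Qed.

Lemma nsq_null_r x y : nsq x = 0 -> ip y x = 0.
Proof. by move=> x0; rewrite hipC nsq_null_l// conjc0. Qed.

Definition cauchy_seq (x : nat -> V) := forall e : R, 0 < e ->
  exists N, forall p q, (N <= p)%N -> (N <= q)%N -> nsq (x p - x q) < e.
Definition cvg_seq (x : nat -> V) l := forall e : R, 0 < e ->
  exists N, forall p, (N <= p)%N -> nsq (x p - l) < e.
Definition complete_on (M : set V) := forall x : nat -> V, (forall n, M (x n)) ->
  cauchy_seq x -> exists2 l, M l & cvg_seq x l.
Definition subspace (M : set V) :=
  M 0 /\ forall a x y, M x -> M y -> M (a *: x + y).

Lemma eps_le0 (r : R) : 0 <= r -> (forall e, 0 < e -> r <= e) -> r = 0.
Proof.
move=> r0 H; apply/eqP; rewrite eq_le r0 andbT leNgt; apply/negP => rp.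
have := H (r / 2); lra.
Qed.

Lemma subspaceZ M a x : subspace M -> M x -> M (a *: x).
Proof. by move=> [h0 h] Mx; rewrite -[_ *: _]addr0; apply: h. Qed.

Lemma inv_small (e : R) : 0 < e ->
  exists N, forall n, (N <= n)%N -> n.+1%:R^-1 < e.
Proof.
move=> e0; exists (Num.truncn e^-1) => n hn.
rewrite -[e]invrK ltf_pV2 ?posrE ?invr_gt0//.
have := truncnS_gt e^-1; move=> h; apply: lt_le_trans h _; by rewrite ler_nat ltnS.
Qed.

(** A minimising sequence is Cauchy by the parallelogram law. Orthogonality is obtained with a rate
    along that sequence and passes to the limit by Cauchy-Schwarz, so continuity of the norm is
    never invoked. *)
Lemma projection (M : set V) x : subspace M -> complete_on M ->
  exists2 m, M m & forall y, M y -> ip (x - m) y = 0.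
Proof.
move=> sM cM.
pose S : set R := [set r | exists2 m, M m & r = nsq (x - m)].
have hS : has_inf S.
  split; first by exists (nsq (x - 0)), 0 => //; exact: sM.1.
  by exists 0 => _ [m _ ->]; exact: nsq_ge0.
have Sle m : M m -> inf S <= nsq (x - m) by move=> Mm; apply: (inf_lbound hS.2); exists m.
have ex n : exists m, M m /\ nsq (x - m) < inf S + n.+1%:R^-1.
  have n0 : 0 < n.+1%:R^-1 :> R by rewrite invr_gt0.
  by have [r [m Mm ->] lr] := inf_adherent n0 hS; exists m.
have /choice[m hm] := ex.
have mM n : M (m n) := (hm n).1.
have cm : cauchy_seq m.
  move=> e e0; have e40 : 0 < e / 4 by lra.
  have [N hN] := inv_small e40; exists N => p q /hN hp /hN hq.
  have := parallelogram (x - m p) (x - m q).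
  rewrite (_ : x - m p - (x - m q) = m q - m p); last first.
    by rewrite opprB addrC addrA subrK.
  have -> : (x - m p) + (x - m q) = 2 *: (x - 2^-1 *: (m p + m q)).
    rewrite scalerBr scalerA divff// scale1r scaler_nat mulr2n addrACA.
    by rewrite opprD.
  have : inf S <= nsq (x - 2^-1 *: (m p + m q)).
    apply: Sle; apply: subspaceZ => //; rewrite -[m p]scale1r; exact: sM.2.
  rewrite nsqZ (_ : sqn 2 = 4); last by rewrite -[2](rmorph_nat (@real_complex R)) sqn_real; ring.
  rewrite [nsq (m q - m p)]nsqBC.
  by move: hp hq (hm p).2 (hm q).2; move: (p.+1%:R^-1) (q.+1%:R^-1) => a b; lra.
have [l Ml ml] := cM _ mM cm.
exists l => // y My.
(* Moving [m n] by the optimal step along [y] lowers the squared distance by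
   [sqn (ip (x - m n) y) / nsq y], which cannot exceed the excess of [m n] over the infimum. *)
have near n : sqn (ip (x - m n) y) <= n.+1%:R^-1 * nsq y.
  have [y0|y0] := eqVneq (nsq y) 0; first by rewrite nsq_null_r// sqn0 y0 mulr0.
  have yp : 0 < nsq y by rewrite lt0r y0 nsq_ge0.
  rewrite -ler_pdivrMr//.
  have := nsqB_scale (nsq y)^-1 (erefl (ip (x - m n) y)).
  rewrite -addrA -opprD => h.
  have := Sle _ (sM.2 (((nsq y)^-1)%:C * ip (x - m n) y) _ _ My (mM n)).
  rewrite [_ *: _ + m n]addrC h.
  rewrite (_ : _ - _ + _ = nsq (x - m n) - sqn (ip (x - m n) y) / nsq y); last by field.
  by move: (hm n).2; move: (n.+1%:R^-1) (_ / _) => a b; lra.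
apply: sqn_eq0; apply: eps_le0 => [|e e0]; first exact: sqn_ge0.
pose k := nsq y + 1; have kp : 0 < k by rewrite ltr_wpDl ?nsq_ge0.
have e1 : 0 < e / (4 * k) by rewrite divr_gt0// mulr_gt0.
have [N1 h1] := inv_small e1; have [N2 h2] := ml _ e1.
pose n := maxn N1 N2.
have -> : x - l = (x - m n) + (m n - l) by rewrite addrA subrK.
rewrite (hipD ip); apply: le_trans (sqnD _ _) _.
have := near n; have := cauchy_schwarz (m n - l) y.
have := h1 n (leq_maxl _ _); have := h2 n (leq_maxr _ _).
have := nsq_ge0 (m n - l); have : 0 <= n.+1%:R^-1 :> R by rewrite invr_ge0.
have := nsq_ge0 y; rewrite /k in kp *.
move: (sqn _) (sqn _) (nsq y) (nsq (_ - _)) (n.+1%:R^-1) kp => A B t u v kp t0 v0 u0 hu hv hB hA.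
have Eu : u * t <= e / 4.
  apply: (@le_trans _ _ (e / (4 * (t + 1)) * t)); first by rewrite ler_wpM2r// ltW.
  rewrite -mulrA mulrC mulrAC -mulrA; rewrite -subr_ge0.
  rewrite (_ : _ - _ = e / (4 * (t + 1))); last by field; rewrite gt_eqF.
  by rewrite divr_ge0//; lra.
have Ev : v * t <= e / 4.
  apply: (@le_trans _ _ (e / (4 * (t + 1)) * t)); first by rewrite ler_wpM2r// ltW.
  rewrite -subr_ge0 (_ : _ - _ = e / (4 * (t + 1))); last by field; rewrite gt_eqF.
  by rewrite divr_ge0//; lra.
lra.
Qed.

(** Conjugate-linear, the kind of functional that a sesquilinear form defines through its second
    argument. *)
Definition clin (F : V -> R[i]) := forall a x y, F (a *: x + y) = conjc a * F x + F y.
Definition bounded_cfun (F : V -> R[i]) := exists C, forall x, sqn (F x) <= C * nsq x.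

Lemma clin0 F : clin F -> F 0 = 0.
Proof. by move=> hF; have := hF 1 0 0; rewrite scaler0 addr0 rmorph1 mul1r => /eqP; rewrite -subr_eq0 opprD addrA subrr add0r oppr_eq0 => /eqP. Qed.
Lemma clinZ F a x : clin F -> F (a *: x) = conjc a * F x.
Proof. by move=> hF; rewrite -[_ *: _]addr0 hF (clin0 hF) addr0. Qed.
Lemma clinB F x y : clin F -> F (x - y) = F x - F y.
Proof. by move=> hF; rewrite addrC -scaleN1r hF rmorphN rmorph1 mulN1r addrC. Qed.

Lemma bounded_cfun_pos F : bounded_cfun F -> exists2 C, 0 < C & forall x, sqn (F x) <= C * nsq x.
Proof.
move=> [C hC]; exists (`|C| + 1) => [|x]; first by rewrite ltr_wpDl.
apply: (le_trans (hC x)); apply: ler_wpM2r; first exact: nsq_ge0.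
by rewrite ler_wpDr// ler_norm.
Qed.

Lemma bounded_cfun_limit0 F (x : nat -> V) l : clin F -> bounded_cfun F -> cvg_seq x l ->
  (forall n, F (x n) = 0) -> F l = 0.
Proof.
move=> hF /bounded_cfun_pos[C C0 hC] xl F0; apply: sqn_eq0; apply: eps_le0 => [|e e0].
  exact: sqn_ge0.
have eC : 0 < e / C by rewrite divr_gt0.
have [N hN] := xl _ eC; have := hN N (leqnn _).
have := hC (x N - l); rewrite (clinB _ _ hF) F0 sub0r sqnN => h1 h2.
by apply: (le_trans h1); rewrite mulrC -ler_pdivlMr// ltW.
Qed.

Hypothesis complete : complete_on setT.

Lemma riesz F : clin F -> bounded_cfun F -> exists r, forall x, F x = ip r x.
Proof.
move=> hF bF; pose M : set V := [set x | F x = 0].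
have sM : subspace M.
  by split => [|a x y]; rewrite /M/=; [exact: clin0|rewrite hF => -> ->; rewrite mulr0 addr0].
have cM : complete_on M.
  move=> x Mx /(complete (fun n => I))[l _ xl]; exists l => //.
  exact: bounded_cfun_limit0 xl Mx.
have [[z Fz]|nz] := pselect (exists z, F z != 0); last first.
  exists 0 => x; rewrite (ses0l _ hs); apply/eqP; apply/negPn/negP => h.
  by apply: nz; exists x.
have [m Mm hm] := projection z sM cM.
pose y := z - m.
have Fy : F y = F z by rewrite (clinB _ _ hF) Mm subr0.
(* Boundedness sends every null vector into the kernel of [F], so [y] has positive seminorm although
   the form is only semidefinite. *)
have y0 : nsq y != 0.
  apply: contra_neq Fz => y0; rewrite -Fy; apply: sqn_eq0; have [C hC] := bF.
  by apply/eqP; rewrite eq_le sqn_ge0 andbT (le_trans (hC y))// y0 mulr0.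
exists ((F y / (nsq y)%:C) *: y) => x.
have : ip y (conjc (F x / F y) *: y - x) = 0.
  apply: hm; rewrite /M/= (clinB _ _ hF) (clinZ _ _ hF) conjcK.
  by rewrite divfK ?subrr// Fy.
rewrite (sesBr _ _ _ hs) (sesZr hs) conjcK hipxx => /eqP; rewrite subr_eq0 => /eqP e.
rewrite (sesZl hs) -e mulrACA -!mulrA mulrC.
have c0 : (nsq y)%:C != 0 by rewrite (fmorph_eq0 (real_complex R)).
rewrite -Fy in Fz.
by field; rewrite Fz c0.
Qed.

Definition bounded_form (b : V -> V -> R[i]) :=
  exists C, forall x y, sqn (b x y) <= C * (nsq x * nsq y).

Lemma sesqui_clin b x : sesqui b -> clin (b x).
Proof. by move=> hb a y z; rewrite (sesDr hb) (sesZr hb). Qed.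

Lemma bounded_form_pos b : bounded_form b ->
  exists2 C, 0 < C & forall x y, sqn (b x y) <= C * (nsq x * nsq y).
Proof.
move=> [C hC]; exists (`|C| + 1) => [|x y]; first by rewrite ltr_wpDl.
apply: (le_trans (hC x y)); apply: ler_wpM2r; first by rewrite mulr_ge0 ?nsq_ge0.
by rewrite ler_wpDr// ler_norm.
Qed.

Lemma bounded_form_cfun b x : bounded_form b -> bounded_cfun (b x).
Proof. by move=> [C hC]; exists (C * nsq x) => y; rewrite -mulrA. Qed.

Lemma bounded_formD b c : bounded_form b -> bounded_form c ->
  bounded_form (fun x y => b x y + c x y).
Proof.
move=> [B hB] [C hC]; exists (2 * B + 2 * C) => x y.
apply: (le_trans (sqnD _ _)); rewrite [leRHS]mulrDl.
by apply: lerD; rewrite -mulrA ler_pM2l ?ltr0n.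
Qed.

Lemma bounded_formZ (a : R[i]) b : bounded_form b -> bounded_form (fun x y => a * b x y).
Proof.
move=> [B hB]; exists (sqn a * B) => x y.
by rewrite sqnM -mulrA ler_wpM2l ?sqn_ge0.
Qed.

Lemma sesquiD b c : sesqui b -> sesqui c -> sesqui (fun x y => b x y + c x y).
Proof.
move=> hb hc; split=> [x y z|a x z|x y z|a x z].
- by rewrite (sesDl hb) (sesDl hc) addrACA.
- by rewrite (sesZl hb) (sesZl hc) mulrDr.
- by rewrite (sesDr hb) (sesDr hc) addrACA.
- by rewrite (sesZr hb) (sesZr hc) mulrDr.
Qed.

Lemma sesquiM (a : R[i]) b : sesqui b -> sesqui (fun x y => a * b x y).
Proof.
move=> hb; split=> [x y z|c x z|x y z|c x z].
- by rewrite (sesDl hb) mulrDr.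
- by rewrite (sesZl hb) mulrCA.
- by rewrite (sesDr hb) mulrDr.
- by rewrite (sesZr hb) mulrCA.
Qed.

Lemma rank_one_sesqui r : sesqui (fun x y => ip x r * conjc (ip y r)).
Proof.
split=> [x y z|c x z|x y z|c x z].
- by rewrite (sesDl hs) mulrDl.
- by rewrite (sesZl hs) mulrA.
- by rewrite (sesDl hs) rmorphD mulrDr.
- by rewrite (sesZl hs) rmorphM mulrCA.
Qed.

Lemma rank_one_bounded r : bounded_form (fun x y => ip x r * conjc (ip y r)).
Proof.
exists (nsq r ^+ 2) => x y; rewrite sqnM sqn_conj.
rewrite (_ : _ * (_ * _) = (nsq x * nsq r) * (nsq y * nsq r)); last by ring.
by rewrite ler_pM ?sqn_ge0 ?cauchy_schwarz.
Qed.

Lemma coercive_bound b (c : R) x y : sesqui b -> 0 < c ->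
  (forall x, c * nsq x <= complex.Re (b x x)) ->
  (forall z, ip y z = b x z) -> c ^+ 2 * nsq x <= nsq y.
Proof.
move=> hb c0 cb h.
have [x0|x0] := eqVneq (nsq x) 0; first by rewrite x0 mulr0 nsq_ge0.
have xp : 0 < nsq x by rewrite lt0r x0 nsq_ge0.
have h1 := cb x; have h2 : c ^+ 2 * nsq x ^+ 2 <= nsq y * nsq x.
  apply: (le_trans _ (cauchy_schwarz y x)); apply: (le_trans _ (Re_sqn _)).
  rewrite h -exprMn ler_sqr// ?nnegrE; first by rewrite mulr_ge0 ?nsq_ge0// ltW.
  by apply: le_trans h1; rewrite mulr_ge0 ?nsq_ge0// ltW.
by rewrite -(ler_pM2r xp) -mulrA -expr2.
Qed.

(** The vectors representing the functionals [b x] form a subspace [M], complete because coercivity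
    bounds [x] by its representative. The residue [r - m] of the projection onto [M] is orthogonal
    to the representative of [b (r - m)], and coercivity makes it null. *)
Lemma lax_milgram b (c : R) F : sesqui b -> bounded_form b -> 0 < c ->
  (forall x, c * nsq x <= complex.Re (b x x)) -> clin F -> bounded_cfun F ->
  exists x, forall y, b x y = F y.
Proof.
move=> hb bb c0 cb hF bF.
pose M : set V := [set y | exists x, forall z, ip y z = b x z].
have sM : subspace M.
  split => [|a x y [x' hx] [y' hy]].
    by exists 0 => z; rewrite (ses0l _ hs) (ses0l _ hb).
  exists (a *: x' + y') => z.
  by rewrite (sesDl hs) (sesZl hs) (sesDl hb) (sesZl hb) hx hy.
have cM : complete_on M.
  move=> y /choice[x hx] cy.
  have [l _ yl] := complete (fun n => I) cy.
  have cx : cauchy_seq x.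
    move=> e e0; have ec : 0 < e * c ^+ 2 by rewrite mulr_gt0 ?exprn_gt0.
    have [N hN] := cy _ ec; exists N => p q hp hq.
    rewrite -(@ltr_pM2r _ (c ^+ 2)) ?exprn_gt0// mulrC.
    apply: le_lt_trans (hN p q hp hq); apply: (coercive_bound hb) => // z.
    by rewrite (sesBl _ _ _ hs) (sesBl _ _ _ hb) !hx.
  have [k _ xk] := complete (fun n => I) cx.
  exists l => //; exists k => z; apply/eqP; rewrite -subr_eq0; apply/eqP.
  apply: sqn_eq0; apply: eps_le0 => [|e e0]; first exact: sqn_ge0.
  have [C C0 hC] := bounded_form_pos bb.
  pose k1 := nsq z + 1; have kp : 0 < k1 by rewrite ltr_wpDl ?nsq_ge0.
  have e1 : 0 < e / (4 * k1) by rewrite divr_gt0 ?mulr_gt0.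
  have e2 : 0 < e / (4 * k1 * C) by rewrite divr_gt0 ?mulr_gt0.
  have [N1 h1] := yl _ e1; have [N2 h2] := xk _ e2; pose n := maxn N1 N2.
  have -> : ip l z - b k z = - ip (y n - l) z + b (x n - k) z.
    by rewrite (sesBl _ _ _ hs) (sesBl _ _ _ hb) hx opprB addrA subrK.
  apply: (le_trans (sqnD _ _)); rewrite sqnN.
  have z0 := nsq_ge0 z.
  have A1 : sqn (ip (y n - l) z) <= e / 4.
    apply: (le_trans (cauchy_schwarz _ _)).
    apply: (@le_trans _ _ (e / (4 * k1) * k1)).
      by apply: ler_pM; rewrite ?nsq_ge0 ?lerDl// ltW// h1 ?leq_maxl.
    by rewrite le_eqVlt; apply/orP; left; apply/eqP; field; rewrite gt_eqF.
  have A2 : sqn (b (x n - k) z) <= e / 4.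
    apply: (le_trans (hC _ _)).
    apply: (@le_trans _ _ (C * (e / (4 * k1 * C) * k1))).
      apply: ler_wpM2l; first exact: ltW.
      by apply: ler_pM; rewrite ?nsq_ge0 ?lerDl// ltW// h2 ?leq_maxr.
    by rewrite le_eqVlt; apply/orP; left; apply/eqP; field; rewrite !gt_eqF.
  by move: A1 A2; move: (sqn _) (sqn _) => u v; lra.
have [r hr] := riesz hF bF.
have [m [x hx] hm] := projection r sM cM.
exists x => y; rewrite hr -hx.
have [z hz] := riesz (sesqui_clin (r - m) hb) (bounded_form_cfun (r - m) bb).
have Mz : M z by exists (r - m) => w; rewrite hz.
have := hm z Mz; rewrite hipC -hz => /(congr1 conjc); rewrite conjcK conjc0 => e.
have n0 : nsq (r - m) = 0.
  have := cb (r - m); rewrite e /= => h; apply/eqP; rewrite eq_le nsq_ge0 andbT.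
  by rewrite -(ler_pM2l c0) mulr0.
by have := nsq_null_l y n0; rewrite (sesBl _ _ _ hs) => /eqP; rewrite subr_eq0 => /eqP ->.
Qed.

End SesquiTheory.

(** * Fredholm alternative and quadratic pencils *)

Section Fredholm.
Context {R : realType} {V : lmodType R[i]}.
Variable ip : hform V.
Let hs := hform_sesqui ip.
Local Notation nsq_def := nsq.
Local Notation nsq := (nsq ip).

(* Compactness of the seminorm [e^(1/2)] with respect to the norm of [ip], with
   explicit finite-dimensional witnesses instead of subsequences. *)
Definition compact_sq (e : V -> R) := forall eps, 0 < eps ->
  exists n (r : 'I_n -> V), forall x, e x <= eps * nsq x + \sum_i sqn (ip x (r i)).

Lemma ses_combl (b : V -> V -> R[i]) (I : finType) (a : I -> R[i]) (g : I -> V) z :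
  sesqui b -> b (\sum_i a i *: g i) z = \sum_i a i * b (g i) z.
Proof. by move=> hb; rewrite (ses_suml _ _ _ _ hb); apply: eq_bigr => i _; rewrite (sesZl hb). Qed.

Lemma Re_sum (I : Type) (s : seq I) (P : pred I) (F : I -> R[i]) :
  complex.Re (\sum_(i <- s | P i) F i) = \sum_(i <- s | P i) complex.Re (F i).
Proof. by elim/big_ind2: _ => // x1 x2 y1 y2 <- <-; rewrite raddfD. Qed.

(** A finite-rank form added to [b] restores coercivity, so the perturbed problem is solvable by
    Lax-Milgram. Undoing the perturbation is a square linear system, invertible because [b] has only
    null vectors in its kernel. *)
Lemma fredholm (b : V -> V -> R[i]) (c K : R) (e : V -> R) (F : V -> R[i]) :
  complete_on ip setT ->
  sesqui b -> bounded_form ip b -> 0 < c -> 0 < K ->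
  (forall x, c * nsq x - K * e x <= complex.Re (b x x)) -> compact_sq e ->
  (forall x, (forall y, b x y = 0) -> nsq x = 0) ->
  clin F -> bounded_cfun ip F -> exists x, forall y, b x y = F y.
Proof.
move=> cpl hb bb c0 K0 gard ce inj hF bF.
(* With this tolerance the term [K * e x] costs at most half of the coercivity, up to finitely many
   functionals. *)
have eps0 : 0 < c / (2 * K) by rewrite divr_gt0 ?mulr_gt0.
have [n [r hr]] := ce _ eps0.
pose fr x y : R[i] := \sum_i K%:C * (ip x (r i) * conjc (ip y (r i))).
have hfr : sesqui fr /\ bounded_form ip fr.
  rewrite /fr; elim: (index_enum _) => [|i s [IH1 IH2]].
    split; first by split=> *; rewrite !big_nil ?mulr0 ?addr0.
    by exists 0 => x y; rewrite big_nil sqn0 mul0r.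
  have E : (fun x y => \sum_(j <- i :: s) K%:C * (ip x (r j) * conjc (ip y (r j)))) =
    (fun x y => K%:C * (ip x (r i) * conjc (ip y (r i))) +
                \sum_(j <- s) K%:C * (ip x (r j) * conjc (ip y (r j)))).
    by apply/funext => x; apply/funext => y; rewrite big_cons.
  rewrite E; split; first exact: sesquiD (sesquiM _ (rank_one_sesqui _ _)) IH1.
  exact: bounded_formD (bounded_formZ _ (rank_one_bounded _ _)) IH2.
pose b' x y := b x y + fr x y.
have hb' : sesqui b' by apply: sesquiD hfr.1.
have bb' : bounded_form ip b' by apply: bounded_formD hfr.2.
have cb' x : c / 2 * nsq x <= complex.Re (b' x x).
  rewrite /b' raddfD/= /fr Re_sum.
  rewrite (eq_bigr (fun i => K * sqn (ip x (r i)))) => [|i _]; last first.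
    by rewrite mul_conjc_sqn -rmorphM.
  rewrite -mulr_sumr; have := gard x; have := hr x.
  move: (\sum_i _) (complex.Re _) (nsq x) (e x) => S B N E h1 h2.
  have h3 : K * E <= K * (c / (2 * K) * N + S) by rewrite ler_pM2l.
  have h4 : K * (c / (2 * K) * N + S) = c / 2 * N + K * S by field; rewrite gt_eqF.
  by rewrite h4 in h3; lra.
have c20 : 0 < c / 2 by lra.
have [xF hxF] := lax_milgram cpl hb' bb' c20 cb' hF bF.
have ex i : exists g, forall y, b' g y = K%:C * conjc (ip y (r i)).
  apply: (lax_milgram cpl hb' bb' c20 cb').
    by move=> a x y; rewrite (sesDl hs) (sesZl hs) rmorphD rmorphM mulrDr mulrCA.
  exists (sqn K%:C * nsq (r i)) => x; rewrite sqnM sqn_conj -mulrA ler_wpM2l ?sqn_ge0//.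
  by rewrite mulrC cauchy_schwarz.
have [g hg] := choice ex.
(* On combinations of the [g i] the original form [b] acts through the functionals
   [conjc (ip y (r i))] alone, with coefficients multiplied by [A]; a row vector annihilated by [A]
   thus yields a kernel vector of [b]. *)
pose A : 'M[R[i]]_n := \matrix_(i, j) ((i == j)%:R - ip (g i) (r j)).
have mulA (a : 'rV_n) j : (a *m A) 0 j = a 0 j - ip (\sum_i a 0 i *: g i) (r j).
  rewrite mxE ses_combl//; under eq_bigr do rewrite mxE mulrBr.
  rewrite sumrB; congr (_ - _).
  rewrite (bigD1 j)//= eqxx mulr1 big1 ?addr0// => i /negPf ->.
  by rewrite mulr0.
have bcomb (a : 'rV_n) y : b (\sum_i a 0 i *: g i) y =
    \sum_i K%:C * ((a *m A) 0 i * conjc (ip y (r i))).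
  have -> : b (\sum_i a 0 i *: g i) y =
      b' (\sum_i a 0 i *: g i) y - fr (\sum_i a 0 i *: g i) y by rewrite /b' addrK.
  rewrite ses_combl// /fr -sumrB; apply: eq_bigr => i _.
  by rewrite hg mulA mulrBl mulrBr mulrCA.
have uA : A \in unitmx.
  rewrite -row_free_unit; apply: inj_row_free => a aA.
  have n0 : nsq (\sum_i a 0 i *: g i) = 0.
    by apply: inj => y; rewrite bcomb aA big1// => i _; rewrite mxE mul0r mulr0.
  apply/rowP => j; have := mulA a j.
  by rewrite aA (nsq_null_l _ n0) subr0 => <-.
pose a := (\row_i ip xF (r i)) *m invmx A.
have aA : a *m A = \row_i ip xF (r i) by rewrite mulmxKV.
exists (xF + \sum_i a 0 i *: g i) => y.
rewrite (sesDl hb) bcomb aA -hxF /b' /fr; congr (_ + _).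
by apply: eq_bigr => i _; rewrite mxE.
Qed.

Lemma bessel d (y : 'I_d -> V) r : (forall i j, ip (y i) (y j) = (i == j)%:R) ->
  \sum_i sqn (ip r (y i)) <= nsq r.
Proof.
move=> ony; pose s := \sum_i ip r (y i) *: y i.
have sy j : ip s (y j) = ip r (y j).
  rewrite /s ses_combl// (bigD1 j)//= ony eqxx mulr1 big1 ?addr0// => i /negPf ij.
  by rewrite ony ij mulr0.
have xs x : ip x s = \sum_i ip x (y i) * conjc (ip r (y i)).
  rewrite hipC /s ses_combl// rmorph_sum; apply: eq_bigr => i _.
  by rewrite [ip x (y i)]hipC rmorphM mulrC.
have orth : ip (r - s) s = 0.
  rewrite xs big1// => i _; by rewrite (sesBl _ _ _ hs) sy subrr mul0r.
have -> : \sum_i sqn (ip r (y i)) = nsq s.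
  rewrite /nsq_def xs Re_sum; apply: eq_bigr => i _.
  by rewrite sy mul_conjc_sqn.
have : nsq r = nsq (r - s) + nsq s.
  rewrite -[in LHS](subrK s r); move: (r - s) orth => w orth.
  rewrite /nsq_def (sesDl hs) !(sesDr hs) [ip s w]hipC orth conjc0 addr0 add0r.
  by rewrite raddfD.
by move=> ->; rewrite lerDr nsq_ge0.
Qed.

(** In the seminorm setting the residual [r'] of the next vector may be null. Its coefficient is
    then set to 0, which is harmless because a null vector is orthogonal to everything. *)
Lemma gram_schmidt_residual (x : nat -> V) k v : exists c : nat -> R[i],
  forall j, (j < k)%N -> ip (v - \sum_(i < k) c i *: x i) (x j) = 0.
Proof.
elim: k v => [|k IH] v; first by exists (fun=> 0).
have [c hc] := IH v; have [c' hc'] := IH (x k).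
set r := v - _ in hc; set r' := x k - _ in hc'.
pose t := if nsq r' == 0 then 0 else ip r r' / (nsq r')%:C.
pose f i := if i == k then t else c i - t * c' i.
exists f => j jk.
have E : v - \sum_(i < k.+1) f i *: x i = r - t *: r'.
  rewrite big_ord_recr/= /f eqxx /r /r' scalerBr opprB scaler_sumr.
  rewrite (eq_bigr (fun i : 'I_k => c i *: x i - t *: (c' i *: x i))); last first.
    by move=> i _; rewrite ltn_eqF// scalerBl scalerA.
  by rewrite sumrB !opprD opprK !addrA.
rewrite E; have rr : ip (r - t *: r') r' = 0.
  rewrite (sesBl _ _ _ hs) (sesZl hs) hipxx /t; case: eqVneq => [n0|n0].
    by rewrite mul0r subr0 nsq_null_r.
  by rewrite divfK ?subrr// (fmorph_eq0 (real_complex R)).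
have low i : (i < k)%N -> ip (r - t *: r') (x i) = 0.
  by move=> ik; rewrite (sesBl _ _ _ hs) (sesZl hs) hc// hc'// mulr0 subrr.
move: jk; rewrite ltnS leq_eqVlt => /orP[/eqP->|]; last exact: low.
have -> : x k = r' + \sum_(i < k) c' i *: x i by rewrite /r' subrK.
rewrite (sesDr hs) rr add0r hipC ses_combl// big1 ?conjc0// => i _.
by rewrite hipC low// conjc0 mulr0.
Qed.

(* Triangular orthonormalisation turns the multipliers [nu] into diagonal entries
   of a compact operator; Bessel's inequality then bounds how many can be large. *)
Lemma count_multipliers d (x : nat -> V) (nu : nat -> R[i]) (delta eps : R)
    n (r : 'I_n -> V) :
  (forall j, (j < d)%N -> delta <= sqn (nu j)) ->
  (forall c : nat -> R[i], nsq (\sum_(i < d) c i *: x i) = 0 ->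
     forall i, (i < d)%N -> c i = 0) ->
  (forall c : nat -> R[i], nsq (\sum_(i < d) (c i * nu i) *: x i) <=
     eps * nsq (\sum_(i < d) c i *: x i)
     + \sum_l sqn (ip (\sum_(i < d) c i *: x i) (r l))) ->
  d%:R * (delta - eps) <= \sum_l nsq (r l).
Proof.
move=> hnu indep est.
have ex (k : 'I_d) : exists c : nat -> R[i],
    [/\ forall i, (k < i)%N -> c i = 0, nsq (\sum_(i < d) c i *: x i) = 1
      & forall j, (j < k)%N -> ip (\sum_(i < d) c i *: x i) (x j) = 0].
  have [c hc] := gram_schmidt_residual x k (x k).
  pose c1 i : R[i] := if (i < k)%N then - c i else (i == k)%:R.
  have E : \sum_(i < d) c1 i *: x i = x k - \sum_(i < k) c i *: x i.
    rewrite (bigD1 k)//= {1}/c1 ltnn eqxx scale1r; congr (_ + _).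
    rewrite (big_ord_widen d (fun i => c i *: x i) (ltnW (ltn_ord k))) -sumrN.
    rewrite (bigID (fun i : 'I_d => (i < k)%N))/= [X in _ + X]big1 ?addr0.
      rewrite (eq_bigl (fun i : 'I_d => (i < k)%N)); last first.
        by move=> i; rewrite andb_idl// => ik; rewrite -val_eqE ltn_eqF.
      by apply: eq_bigr => i ik; rewrite /c1 ik scaleNr.
    by move=> i /andP[/negPf ik nik]; rewrite /c1 (negPf nik) val_eqE ik scale0r.
  have N0 : nsq (\sum_(i < d) c1 i *: x i) != 0.
    apply/eqP => /indep/(_ k (ltn_ord k)); rewrite /c1 ltnn eqxx => /eqP.
    by rewrite oner_eq0.
  have Np : 0 < nsq (\sum_(i < d) c1 i *: x i) by rewrite lt0r N0 nsq_ge0.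
  pose s : R := (Num.sqrt (nsq (\sum_(i < d) c1 i *: x i)))^-1.
  have E2 : \sum_(i < d) (s%:C * c1 i) *: x i = s%:C *: (\sum_(i < d) c1 i *: x i).
    by rewrite scaler_sumr; apply: eq_bigr => i _; rewrite scalerA.
  exists (fun i => s%:C * c1 i); split.
  - by move=> i ki; rewrite /c1 ltnNge (ltnW ki)/= gtn_eqF ?mulr0.
  - rewrite E2 nsqZ sqn_real /s exprVn sqr_sqrtr ?ltW// mulVf//.
  - by move=> j jk; rewrite E2 E (sesZl hs) hc// mulr0.
have [c hc] := choice ex.
pose y k := \sum_(i < d) c k i *: x i.
have y1 k : ip (y k) (y k) = 1 by rewrite hipxx; case: (hc k) => _ -> _.
have ylow (k : 'I_d) j : (j < k)%N -> ip (x j) (y k) = 0.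
  by move=> jk; rewrite hipC; case: (hc k) => _ _ -> //; rewrite conjc0.
have yy (k l : 'I_d) : (l < k)%N -> ip (y l) (y k) = 0.
  move=> lk; rewrite {1}/y ses_combl// big1// => i _.
  have [il|li] := leqP i l; first by rewrite ylow ?mulr0// (leq_ltn_trans il).
  by case: (hc l) => -> //; rewrite mul0r.
have ony k l : ip (y k) (y l) = (k == l)%:R.
  have [->|] := eqVneq k l; first exact: y1.
  rewrite -val_eqE neq_ltn => /orP[kl|lk]; first exact: yy.
  by rewrite hipC yy// conjc0.
(* [y k] is orthogonal to every earlier [x i], and its own expansion stops at index [k]: only the
   diagonal entry survives. *)
have diag (a : 'I_d -> R[i]) k : ip (\sum_(i < d) (c k i * a i) *: x i) (y k) =
    c k k * a k * ip (x k) (y k).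
  rewrite ses_combl// (bigD1 k)//= big1 ?addr0// => i.
  rewrite -val_eqE neq_ltn => /orP[ik|ki]; first by rewrite ylow ?mulr0.
  by case: (hc k) => -> //; rewrite !mul0r.
have diag1 k : c k k * ip (x k) (y k) = 1.
  rewrite -(y1 k) [in RHS]/y -[c k k]mulr1 -(diag (fun=> 1)).
  by under eq_bigr do rewrite mulr1.
have lower k : delta - eps <= \sum_l sqn (ip (y k) (r l)).
  have := cauchy_schwarz ip (\sum_(i < d) (c k i * nu i) *: x i) (y k).
  rewrite (diag (fun i => nu i)) mulrAC diag1 mul1r.
  have := est (c k); case: (hc k) => _ h1 _; rewrite -/(y k) in h1 *; rewrite h1 !mulr1.
  have := hnu k (ltn_ord k).
  move=> a1 a2 a3; rewrite lerBlDl; exact: (le_trans a1 (le_trans a3 a2)).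
have -> : d%:R * (delta - eps) = \sum_(k < d) (delta - eps).
  by rewrite sumr_const card_ord mulr_natl.
apply: (@le_trans _ _ (\sum_(k < d) \sum_l sqn (ip (y k) (r l)))); first exact: ler_sum.
rewrite exchange_big; apply: ler_sum => l _.
apply: le_trans (bessel (r l) ony); apply: ler_sum => k _.
by rewrite [ip (r l) _]hipC sqn_conj.
Qed.

End Fredholm.

Section Pencil.
Context {R : realType} {V : lmodType R[i]}.
Variable ip : hform V.
Let hs := hform_sesqui ip.

Definition prod_ip (x y : V * V) : R[i] := ip x.1 y.1 + ip x.2 y.2.

Definition prod_hform : hform (V * V)%type.
Proof.
apply: (@HForm _ _ prod_ip).
- by move=> x y z; rewrite /prod_ip/= !(hipD ip) addrACA.
- by move=> a x z; rewrite /prod_ip/= !(hipZ ip) mulrDr.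
- by move=> x y; rewrite /prod_ip rmorphD/= -!hipC.
- by move=> x; rewrite /prod_ip raddfD/= addr_ge0 ?hip_ge0.
Defined.

Lemma nsq_prod x : nsq prod_hform x = nsq ip x.1 + nsq ip x.2.
Proof. by rewrite /nsq /= /prod_ip raddfD. Qed.

Lemma compact_sq_prod e (L : R) : 0 < L -> compact_sq ip e ->
  compact_sq prod_hform (fun x => L * (e x.1 + e x.2)).
Proof.
move=> L0 ce eps eps0; have [|n [r hr]] := ce (eps / L); first by rewrite divr_gt0.
(* Scaling the witnesses by the square root of [L] multiplies the squared functionals by [L]. *)
pose s : V -> V := GRing.scale (Num.sqrt L)%:C.
exists (n + n)%N, (fun i => match fintype.split i with inl i => (s (r i), 0) | inr i => (0, s (r i)) end).
move=> x; rewrite big_split_ord/=.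
under eq_bigr => i _ do rewrite (unsplitK (inl i)).
under [X in _ + (_ + X)]eq_bigr => i _ do rewrite (unsplitK (inr i)).
rewrite /prod_ip/= nsq_prod.
have E y i : sqn (ip y (s (r i))) = L * sqn (ip y (r i)).
  by rewrite (sesZr hs) sqnM sqn_conj sqn_real sqr_sqrtr ?ltW.
under eq_bigr do rewrite (ses0r _ hs) addr0 E.
under [X in _ + (_ + X)]eq_bigr do rewrite (ses0r _ hs) add0r E.
rewrite -!mulr_sumr; have := hr x.1; have := hr x.2.
move: (\sum_i _) (\sum_i _) => S1 S2 h2 h1.
have := lerD h1 h2; rewrite -(ler_pM2l L0) => h; apply: (le_trans h).
rewrite le_eqVlt; apply/orP; left; apply/eqP; field; by rewrite gt_eqF.
Qed.

Variables (b c1 c2 : V -> V -> R[i]) (c K : R) (e : V -> R).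
Hypotheses (hb : sesqui b) (bb : bounded_form ip b) (c0 : 0 < c)
  (cb : forall x, c * nsq ip x <= complex.Re (b x x)).
Hypotheses (h1 : sesqui c1) (h2 : sesqui c2) (K0 : 0 < K).
Hypotheses (e_ge0 : forall x, 0 <= e x) (e_le : forall x, e x <= nsq ip x)
  (ce : compact_sq ip e).
Hypothesis c1_le : forall x y, sqn (c1 x y) <= K * (e x * nsq ip y).
Hypothesis c2_le : forall x y, sqn (c2 x y) <= K * (e x * nsq ip y).

Definition pencil (m : R[i]) x y := b x y + (m * c1 x y + m ^+ 2 * c2 x y).

Lemma pencil_sesqui m : sesqui (pencil m).
Proof. by apply: sesquiD => //; apply: sesquiD; apply: sesquiM. Qed.

Lemma lower_order_bounded f : (forall x y, sqn (f x y) <= K * (e x * nsq ip y)) ->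
  bounded_form ip f.
Proof.
move=> hf; exists K => x y; apply: (le_trans (hf x y)).
by rewrite ler_pM2l// ler_wpM2r ?nsq_ge0.
Qed.

Lemma pencil_bounded m : bounded_form ip (pencil m).
Proof.
apply: bounded_formD => //; apply: bounded_formD; apply: bounded_formZ;
  exact: lower_order_bounded.
Qed.

Lemma pencil_solvable m (F : V -> R[i]) : complete_on ip setT ->
  (forall x, (forall y, pencil m x y = 0) -> nsq ip x = 0) ->
  clin F -> bounded_cfun ip F -> exists x, forall y, pencil m x y = F y.
Proof.
move=> cpl inj hF bF.
pose d x y := m * c1 x y + m ^+ 2 * c2 x y.
pose L := 2 * sqn m * K + 2 * sqn (m ^+ 2) * K.
have L0 : 0 <= L by rewrite addr_ge0// !mulr_ge0 ?sqn_ge0// ltW.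
have hd x y : sqn (d x y) <= L * (e x * nsq ip y).
  apply: (le_trans (sqnD _ _)); rewrite /L [leRHS]mulrDl !sqnM -!(mulrA 2).
  by apply: lerD; rewrite ler_pM2l// -[leRHS]mulrA ler_wpM2l// ?mulr_ge0 ?sqn_ge0.
(* [L] bounds the lower-order part and [t * L <= c / 2], so half of the coercivity survives Young's
   inequality; the shift by 1 covers [L = 0]. *)
pose t := (c / 2) / (L + 1).
have t0 : 0 < t by rewrite divr_gt0 ?divr_gt0// ltr_wpDl.
pose K' := t^-1.
apply: (@fredholm _ _ ip (pencil m) (c / 2) (K' + 1) e) => //.
- exact: pencil_sesqui.
- exact: pencil_bounded.
- by rewrite divr_gt0.
- by rewrite ltr_wpDl// invr_ge0 ltW.
move=> x; rewrite /pencil raddfD/= -/(d x x).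
have A0 : 0 <= L * nsq ip x by rewrite mulr_ge0 ?nsq_ge0.
have hh : sqn (d x x) <= L * nsq ip x * e x by rewrite -mulrA [nsq ip x * _]mulrC.
have := Re_le_young t0 A0 (e_ge0 x) hh.
have : t * (L * nsq ip x) <= c / 2 * nsq ip x.
  rewrite mulrA ler_wpM2r ?nsq_ge0// /t -mulrA ler_piMr ?divr_ge0 ?(ltW c0)//.
  by rewrite mulrC ler_pdivrMr ?mul1r ?lerDl// ltr_wpDl.
have := cb x; have := e_ge0 x; rewrite -/K' (mulrDl K') mul1r.
have := ler_norm (- complex.Re (d x x)); rewrite normrN.
move: `|_|; move: (K' * e x) (t * _) => u v w.
have -> : c * nsq ip x = c / 2 * nsq ip x + c / 2 * nsq ip x by field.
by move: (c / 2 * _) => w'; lra.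
Qed.

(** Testing with [r] itself bounds the full norm of the solution by the weak seminorm [e] of the
    data. Together with the compactness of [e], this says that the solution operator is compact. *)
Lemma lower_order_solution p q r :
  (forall y, b r y = - (c1 p y + c2 q y)) -> nsq ip r <= 2 * K / c ^+ 2 * (e p + e q).
Proof.
move=> hr; have [r0|r0] := eqVneq (nsq ip r) 0.
  by rewrite r0 mulr_ge0 ?addr_ge0// divr_ge0 ?mulr_ge0 ?sqr_ge0// ltW.
have rp : 0 < nsq ip r by rewrite lt0r r0 nsq_ge0.
rewrite mulrAC ler_pdivlMr ?exprn_gt0// -(ler_pM2r rp).
have A : (c * nsq ip r) ^+ 2 <= sqn (b r r).
  apply: le_trans (Re_sqn _); rewrite ler_sqr ?nnegrE ?cb//.
    by rewrite mulr_ge0 ?ltW.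
  by apply: le_trans (cb r); rewrite mulr_ge0 ?ltW.
rewrite hr sqnN in A.
have := le_trans A (sqnD _ _); have := c1_le p r; have := c2_le q r.
rewrite (_ : nsq ip r * c ^+ 2 * nsq ip r = (c * nsq ip r) ^+ 2); last by ring.
rewrite (_ : 2 * K * (e p + e q) * nsq ip r =
  2 * (K * (e p * nsq ip r)) + 2 * (K * (e q * nsq ip r))); last by ring.
by move: (sqn _) (sqn _) (K * _) (K * _) (_ ^+ 2) => u v w z t; lra.
Qed.

Lemma nsq_null_comb x y t : nsq ip x = 0 -> nsq ip y = 0 -> nsq ip (x - t *: y) = 0.
Proof.
move=> x0 y0; apply/eqP; rewrite eq_le nsq_ge0 andbT.
by rewrite (le_trans (nsqD_le _ _ _))// nsqN nsqZ x0 y0 !mulr0 addr0.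
Qed.

(** Companion linearisation: let [(p, q)] be sent to [(r, p)] with [b r = - (c1 p + c2 q)]. An
    eigenvector [w] of the pencil at [m] gives the vector [(w, m w)], which is multiplied by
    [1 / m]. The second component is a mere copy of [p], so the map is applied twice: both
    components are then solutions with lower-order data, and the square has multipliers [1 / m^2],
    bounded below in a disc. The counting lemma applies to them. *)
Lemma pencil_eigenvalues_finite (M : R) : 0 < M -> exists N : nat,
  forall (d : nat) (m : nat -> R[i]) (w : nat -> V),
    (forall i j, (i < d)%N -> (j < d)%N -> m i = m j -> i = j) ->
    (forall i, (i < d)%N -> m i != 0 /\ sqn (m i) <= M) ->
    (forall i, (i < d)%N -> nsq ip (w i) != 0 /\ forall y, pencil (m i) (w i) y = 0) ->
    (d <= N)%N.
Proof.
move=> M0; pose A := 2 * K / c ^+ 2.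
have A0 : 0 < A by rewrite divr_gt0 ?mulr_gt0 ?exprn_gt0.
(* Applying [lower_order_solution] twice gives the bounds [A * (e p + e q)] for [r1] and
   [A * (A * (e p + e q) + e p)] for [s1]; their sum is at most [L * (e p + e q)]. *)
pose L := A ^+ 2 + 2 * A; have L0 : 0 < L by apply: addr_gt0; [exact: exprn_gt0|exact: mulr_gt0].
pose delta := M^-1 ^+ 2; have d0 : 0 < delta by rewrite exprn_gt0 ?invr_gt0.
have [|n [r hr]] := compact_sq_prod L0 ce (eps := delta / 2); first by rewrite divr_gt0.
exists (Num.truncn (2 * (\sum_l nsq prod_hform (r l)) / delta)) => d m w injm mM wk.
pose p (a : nat -> R[i]) := \sum_(i < d) a i *: w i.
pose q a := p (fun i => a i * m i).
pose r1 a := p (fun i => a i / m i).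
pose s1 a := p (fun i => a i / m i ^+ 2).
have bp f a y : sesqui f -> f (p a) y = \sum_(i < d) a i * f (w i) y.
  by move=> hf; rewrite /p ses_combl.
have Er a y : b (r1 a) y = - (c1 (p a) y + c2 (q a) y).
  apply/eqP; rewrite -subr_eq0 opprK !bp// -!big_split/= big1// => i _.
  have [m0 _] := mM i (ltn_ord i); have [_ /(_ y)] := wk i (ltn_ord i).
  rewrite /pencil => H.
  rewrite (_ : _ + _ = a i / m i * (b (w i) y + (m i * c1 (w i) y + m i ^+ 2 * c2 (w i) y))).
    by rewrite H mulr0.
  by field.
have Es a y : b (s1 a) y = - (c1 (r1 a) y + c2 (p a) y).
  apply/eqP; rewrite -subr_eq0 opprK !bp// -!big_split/= big1// => i _.
  have [m0 _] := mM i (ltn_ord i); have [_ /(_ y)] := wk i (ltn_ord i).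
  rewrite /pencil => H.
  rewrite (_ : _ + _ = a i / m i ^+ 2 * (b (w i) y + (m i * c1 (w i) y + m i ^+ 2 * c2 (w i) y))).
    by rewrite H mulr0.
  by field.
have nr a : nsq ip (r1 a) <= A * (e (p a) + e (q a)) by apply: lower_order_solution.
have ns a : nsq ip (s1 a) <= A * (e (r1 a) + e (p a)) by apply: lower_order_solution.
pose x i : V * V := (w i, m i *: w i).
have Ex (a : nat -> R[i]) : \sum_(i < d) a i *: x i = (p a, q a).
  rewrite /q /p; elim/big_rec3: _ => // i y1 y2 y3 _ ->.
  by rewrite /x; congr (_, _); rewrite /= scalerA.
have count := @count_multipliers _ _ prod_hform d x (fun i => (m i ^+ 2)^-1) delta (delta / 2) _ r.
have : d%:R * (delta - delta / 2) <= \sum_l nsq prod_hform (r l).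
  apply: count => [j jd|a|a].
  - have [m0 mj] := mM j jd; rewrite sqnV /delta expr2 sqnM -expr2 exprVn.
    rewrite lef_pV2 ?posrE ?exprn_gt0 ?mulr_gt0 ?sqn_gt0//.
    by rewrite ler_sqr ?nnegrE ?sqn_ge0// ltW.
  - rewrite Ex nsq_prod/= => /eqP; rewrite paddr_eq0 ?nsq_ge0// => /andP[/eqP p0 /eqP q0].
    (* Independence modulo null vectors: the map sends null pairs to null pairs, so subtracting [t]
       times the pair from its image multiplies each coefficient by [1 / m i - t] and preserves
       nullity. Letting [t] run over all [1 / m j] with [j != i] isolates the i-th term. *)
    have key (l : seq R[i]) : let a' := fun i => a i * \prod_(t <- l) ((m i)^-1 - t) in
        nsq ip (p a') = 0 /\ nsq ip (q a') = 0.
      elim: l => [|t l [IHp IHq]].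
        rewrite (_ : (fun i => _) = a)//.
        by apply/funext => i; rewrite big_nil mulr1.
      set a1 := fun i => a i * \prod_(t <- l) _ in IHp IHq.
      have e0 z : nsq ip z = 0 -> e z = 0.
        by move=> z0; apply/eqP; rewrite eq_le e_ge0 andbT -z0 e_le.
      have r0 : nsq ip (r1 a1) = 0.
        apply/eqP; rewrite eq_le nsq_ge0 andbT (le_trans (nr a1))//.
        by rewrite (e0 _ IHp) (e0 _ IHq) addr0 mulr0.
      split.
        have <- : r1 a1 - t *: p a1 = p (fun i => a i * \prod_(t <- t :: l) ((m i)^-1 - t)).
          rewrite /r1 /p scaler_sumr -sumrB; apply: eq_bigr => i _.
          rewrite scalerA -scalerBl; congr (_ *: _); rewrite big_cons /a1; ring.
        exact: nsq_null_comb.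
      have <- : p a1 - t *: q a1 = q (fun i => a i * \prod_(t <- t :: l) ((m i)^-1 - t)).
        rewrite /q /p scaler_sumr -sumrB; apply: eq_bigr => i _.
        have [m0 _] := mM i (ltn_ord i).
        rewrite scalerA -scalerBl; congr (_ *: _); rewrite big_cons /a1; by field.
      exact: nsq_null_comb.
    move=> i id; have [kp _] := key [seq (m j)^-1 | j <- iota 0 d & j != i].
    have Ei : p (fun k => a k * \prod_(t <- [seq (m j)^-1 | j <- iota 0 d & j != i]) ((m k)^-1 - t))
      = (a i * \prod_(t <- [seq (m j)^-1 | j <- iota 0 d & j != i]) ((m i)^-1 - t)) *: w i.
      rewrite /p (bigD1 (Ordinal id))//= [X in _ + X]big1 ?addr0// => k ki.
      have kin : (m k)^-1 \in [seq (m j)^-1 | j <- iota 0 d & j != i].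
        by apply: map_f; rewrite mem_filter mem_iota/= add0n ltn_ord andbT.
      by rewrite (perm_big _ (perm_to_rem kin)) big_cons/= subrr mul0r mulr0 scale0r.
    move: kp; rewrite Ei nsqZ => /eqP; rewrite mulf_eq0.
    have [wi _] := wk i id; rewrite (negPf wi) orbF => /eqP /sqn_eq0 /eqP.
    rewrite mulf_eq0 => /orP[/eqP//|]; rewrite prodf_seq_eq0 => /hasP[t] /mapP[j].
    rewrite mem_filter mem_iota add0n/= => /andP[ji jd] -> /=.
    rewrite subr_eq0 (inj_eq invr_inj) => /eqP /(injm _ _ id jd) ij.
    by rewrite ij eqxx in ji.
  rewrite Ex; apply: le_trans (hr _); rewrite /=.
  have -> : \sum_(i < d) (a i * (m i ^+ 2)^-1) *: x i = (s1 a, r1 a).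
    rewrite (Ex (fun i => a i * (m i ^+ 2)^-1)); congr (_, _).
    rewrite /q /p; apply: eq_bigr => i _; congr (_ *: _).
    by have [m0 _] := mM i (ltn_ord i); field.
  rewrite nsq_prod/=; have := nr a; have := ns a; have := e_le (r1 a).
  have := e_ge0 (p a); have := e_ge0 (q a); rewrite /L.
  move: (nsq _ _) (nsq _ _) (e _) (e _) (e _) => S2 S1 x3 x2 x1 p2 p1 a1 a2 a3.
  have a4 : A * x3 <= A * (A * (x2 + x1)) by rewrite ler_pM2l// (le_trans a1).
  have a5 : A * x2 <= A * (x2 + x1) by rewrite ler_pM2l// lerDl.
  rewrite [A * (x3 + x2)]mulrDr in a2.
  rewrite (_ : (A ^+ 2 + 2 * A) * _ = A * (A * (x2 + x1)) + A * (x2 + x1) + A * (x2 + x1));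
    last by ring.
  move: a2 a3 a4 a5.
  by move: (A * (A * _)) => u; move: (A * (_ + _)) (A * x2) (A * x3) => *; lra.
move: (\sum_l _) => S hS; apply: leq_trans (_ : Num.truncn d%:R <= _)%N; last first.
  apply: le_truncn; rewrite ler_pdivlMr//.
  have -> : d%:R * delta = 2 * (d%:R * (delta - delta / 2)) by field.
  by rewrite ler_pM2l.
by rewrite natrK.
Qed.

End Pencil.

(** Nested intervals: the sequence minus its geometric tail increases, plus its tail decreases. The
    explicit rate is what is later integrated. *)
Lemma geometric_limit (R : realType) (u : nat -> R) (c : R) :
  (forall k, `|u k.+1 - u k| <= c * 2^-1 ^+ k) ->
  exists l, forall k, `|u k - l| <= 2 * c * 2^-1 ^+ k.
Proof.
move=> hu; pose a k := u k - 2 * c * 2^-1 ^+ k; pose b k := u k + 2 * c * 2^-1 ^+ k.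
have c0 : 0 <= c by have := hu 0%N; rewrite expr0 mulr1; apply: le_trans.
have p k : 0 <= c * 2^-1 ^+ k by apply: (le_trans _ (hu k)).
have ha : {homo a : i j / (i <= j)%N >-> i <= j}.
  apply: homo_leq => [x|y x z|i]; [exact: lexx|exact: le_trans|].
  have := hu i; rewrite ler_norml => /andP[+ _]; rewrite /a exprS.
  by rewrite -!mulrA [c * (2^-1 * _)]mulrCA; move: (c * _) => t; lra.
have hb : {homo b : i j / (i <= j)%N >-> j <= i}.
  apply: homo_leq => [x|y x z|i]; [exact: lexx|by move=> + /le_trans; move=> h1 h2; apply: h2|].
  have := hu i; rewrite ler_norml => /andP[_]; rewrite /b exprS.
  by rewrite -!mulrA [c * (2^-1 * _)]mulrCA; move: (c * _) => t; lra.
have ab i j : a i <= b j.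
  apply: (le_trans (ha _ _ (leq_maxl i j))); apply: (le_trans _ (hb _ _ (leq_maxr i j))).
  by rewrite /a /b; have := p (maxn i j); rewrite -!mulrA; lra.
have hs : has_sup (range a).
  by split; [exists (a 0%N), 0%N|exists (b 0%N) => _ [i _ <-]].
exists (sup (range a)) => k; rewrite ler_norml.
have : sup (range a) <= b k by apply: ge_sup hs.1 _ => _ [i _ <-].
have : a k <= sup (range a) by apply: (ub_le_sup hs.2); exists k.
by rewrite /a /b => h1 h2; apply/andP; split; lra.
Qed.

(** * Completeness of the space of square-integrable functions *)

Section RealL2.
Context {d} {T : measurableType d} {R : realType}.
Variables (mu : {measure set T -> \bar R}) (D : set T).
Hypothesis mD : measurable D.
Implicit Types f g : T -> R.

Definition Lr2 f := measurable_fun D f /\ mu.-integrable D (fun x => (f x ^+ 2)%:E).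
Definition n2 f : R := \int[mu]_(x in D) (f x ^+ 2).

Lemma Lr2_mul f g : Lr2 f -> Lr2 g -> mu.-integrable D (fun x => (f x * g x)%:E).
Proof.
move=> [mf If] [mg Ig].
apply: (le_integrable mD _ _ (integrableD mD If Ig)).
  by apply/measurable_EFinP; apply: measurable_funM.
move=> x Dx; rewrite /= lee_fin [leRHS]ger0_norm ?addr_ge0 ?sqr_ge0// ler_norml.
rewrite -subr_ge0 -[X in _ && X]subr_ge0; apply/andP; split.
  rewrite (_ : _ - _ = (f x + g x) ^+ 2 / 2 + (f x ^+ 2 + g x ^+ 2) / 2); last by field.
  by rewrite addr_ge0 ?divr_ge0 ?addr_ge0 ?sqr_ge0.
rewrite (_ : _ - _ = (f x - g x) ^+ 2 / 2 + (f x ^+ 2 + g x ^+ 2) / 2); last by field.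
by rewrite addr_ge0 ?divr_ge0 ?addr_ge0 ?sqr_ge0.
Qed.

Lemma Lr2Z (a : R) f : Lr2 f -> Lr2 (fun x => a * f x).
Proof.
move=> [mf If]; split; first by apply: measurable_funM.
under eq_fun do rewrite exprMn EFinM; exact: integrableZl.
Qed.

Lemma Lr2D f g : Lr2 f -> Lr2 g -> Lr2 (fun x => f x + g x).
Proof.
move=> hf hg; have := Lr2_mul hf hg; case: hf hg => mf If [mg Ig] Ifg.
split; first exact: measurable_funD.
have -> : (fun x => ((f x + g x) ^+ 2)%:E) =
    ((fun x => (f x ^+ 2)%:E) \+ (fun x => (g x ^+ 2)%:E)) \+ (fun x => 2%:E * (f x * g x)%:E)%E.
  by apply/funext => x /=; rewrite -EFinM -!EFinD; congr EFin; ring.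
by apply: integrableD => //; [exact: integrableD|exact: integrableZl].
Qed.

Lemma Lr2N f : Lr2 f -> Lr2 (fun x => - f x).
Proof. by move=> /(Lr2Z (-1)); under eq_fun do rewrite mulN1r. Qed.

Lemma Lr2B f g : Lr2 f -> Lr2 g -> Lr2 (fun x => f x - g x).
Proof. by move=> hf /Lr2N; apply: Lr2D. Qed.

Lemma Lr2_bounded (a : R) (c f : T -> R) : measurable_fun D c -> (forall x, D x -> `|c x| <= a) ->
  Lr2 f -> Lr2 (fun x => c x * f x).
Proof.
move=> mc ca [mf If]; split; first exact: measurable_funM.
apply: (le_integrable mD _ _ (integrableZl mD (a ^+ 2) If)).
  by apply/measurable_EFinP; apply: measurable_funX; apply: measurable_funM.
move=> x Dx; rewrite /= lee_fin [leLHS]ger0_norm ?sqr_ge0//.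
rewrite ger0_norm; last by apply: mulr_ge0; exact: sqr_ge0.
rewrite exprMn.
rewrite ler_wpM2r ?sqr_ge0// -real_normK ?num_real// ler_sqr ?nnegrE ?ca//.
exact: le_trans (ca x Dx).
Qed.

Lemma n2_ge0 f : 0 <= n2 f.
Proof. by apply: Rintegral_ge0 => x _; rewrite sqr_ge0. Qed.

Lemma EFin_n2 f : Lr2 f -> (n2 f)%:E = (\int[mu]_(x in D) (f x ^+ 2)%:E)%E.
Proof. by move=> [mf If]; rewrite /n2 /Rintegral fineK// integrable_fin_num. Qed.

Lemma n2D_le f g : Lr2 f -> Lr2 g -> n2 (fun x => f x + g x) <= 2 * n2 f + 2 * n2 g.
Proof.
move=> hf hg; have hfg := Lr2D hf hg; rewrite /n2 -!RintegralZl ?hf.2 ?hg.2//.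
have I2 h : Lr2 h -> mu.-integrable D (EFin \o (fun x => 2 * h x ^+ 2)).
  by move=> hh; exact: (integrableZl mD 2 hh.2).
rewrite -RintegralD//; try exact: I2.
apply: le_Rintegral => //; first exact: hfg.2.
  exact: (integrableD mD (I2 _ hf) (I2 _ hg)).
move=> x Dx; rewrite -subr_ge0 (_ : _ - _ = (f x - g x) ^+ 2) ?sqr_ge0//; ring.
Qed.

(** Along a fast subsequence the series [S] of weighted squared increments has finite integral.
    Where [S] is finite the increments decay geometrically, so the subsequence converges with a rate
    governed by [S], and integrating this rate gives convergence in mean. *)
Lemma Lr2_complete (f : nat -> T -> R) : (forall n, Lr2 (f n)) ->
  (forall e, 0 < e -> exists N, forall p q, (N <= p)%N -> (N <= q)%N ->
     n2 (fun x => f p x - f q x) < e) ->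
  exists2 g, Lr2 g & forall e, 0 < e -> exists N, forall p, (N <= p)%N ->
     n2 (fun x => f p x - g x) < e.
Proof.
move=> Lf cf.
(* After the weight [4 ^+ k] the k-th term costs at most [2 / 2 ^ k.+1]; these add up to 2, the
   bound on the integral of [S]. *)
pose e k : R := 2 / (2 ^ k.+1)%:R / 4 ^+ k.
have e0 k : 0 < e k by rewrite divr_gt0 ?exprn_gt0 ?divr_gt0// ltr0n expn_gt0.
have /choice[N hN] := fun k => cf _ (e0 k).
pose nk k := (\sum_(i < k.+1) N i + k)%N.
have nkS k : (nk k <= nk k.+1)%N.
  by rewrite /nk [X in (_ <= X + _)%N]big_ord_recr/= leq_add// leq_addr.
have nkN k : (N k <= nk k)%N.
  by rewrite /nk big_ord_recr/= -addnA addnCA leq_addr.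
pose h k := f (nk k).
have Lh k : Lr2 (h k) by exact: Lf.
pose F k x : \bar R := (4 ^+ k * (h k.+1 x - h k x) ^+ 2)%:E.
have F0 k x : (0 <= F k x)%E by rewrite lee_fin mulr_ge0 ?sqr_ge0 ?exprn_ge0.
have mF k : measurable_fun D (F k).
  apply/measurable_EFinP; apply: measurable_funM => //; apply: measurable_funX.
  by apply: measurable_funB; [exact: (Lh _).1|exact: (Lh _).1].
pose S x : \bar R := (\sum_(k <oo) F k x)%E.
have FS k x : (F k x <= S x)%E.
  apply: le_trans (nneseries_lim_ge (P := xpredT) (m := 0) k.+1 _) => //.
  by rewrite big_nat_recr//= leeDr// sume_ge0.
have S0 x : (0 <= S x)%E by apply: le_trans (FS 0%N x).
have mS : measurable_fun D S by apply: ge0_emeasurable_sum.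
have IS : (\int[mu]_(x in D) S x <= 2%:E)%E.
  rewrite /S integral_nneseries//.
  apply: le_trans (epsilon_trick0 xpredT (ler0n R 2)).
  apply: lee_nneseries => // [i _ _|k _]; first exact: integral_ge0.
  have Ld := Lr2B (Lh k.+1) (Lh k).
  rewrite /F; under eq_integral do rewrite EFinM.
  rewrite ge0_integralZl//; last 2 first.
  - by apply/measurable_EFinP; apply: measurable_funX; exact: Ld.1.
  - by move=> x _; rewrite lee_fin sqr_ge0.
  rewrite -(EFin_n2 Ld) -EFinM lee_fin mulrC -ler_pdivlMr ?exprn_gt0//.
  by apply: ltW; apply: hN; rewrite // (leq_trans (nkN k)).
(* The upper limit is measurable whether or not the sequence converges, and it agrees with the limit
   wherever [S] is finite. *)
pose g x : R := fine (limn_esup (fun k => (h k x)%:E)).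
have mg : measurable_fun D g.
  apply: (measurableT_comp (fine_measurable measurableT)).
  apply: measurable_fun_limn_esup => n; apply/measurable_EFinP; exact: (Lh n).1.
have key k x : (((h k x - g x) ^+ 2)%:E <= (4 * 4^-1 ^+ k)%:E * S x)%E.
  case: (S x) (S0 x) (FS ^~ x) => [s| |]//; last first.
    by move=> _ _; rewrite gt0_muley ?leey// lte_fin mulr_gt0 ?exprn_gt0.
  rewrite lee_fin => s0 hs.
  have [l hl] : exists l, forall k, `|h k x - l| <= 2 * Num.sqrt s * 2^-1 ^+ k.
    apply: geometric_limit => j; rewrite -ler_sqr ?nnegrE ?mulr_ge0 ?sqrtr_ge0 ?exprn_ge0//.
    rewrite real_normK ?num_real// exprMn sqr_sqrtr// exprAC.
    have := hs j; rewrite lee_fin mulrC -ler_pdivlMr ?exprn_gt0//.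
    by rewrite (_ : 2^-1 ^+ 2 = 4^-1 :> R) ?exprVn//; field.
  have gl : g x = l.
    rewrite /g; have -> : limn_esup (fun k => (h k x)%:E) = l%:E; last by [].
    apply: (cvg_limn_einf_sup _).2; apply/fine_cvgP; split; first exact: nearW.
    apply/cvgrPdist_le => eps eps0; near=> j; rewrite distrC.
    apply: (le_trans (hl j)); near: j.
    have : (2 * Num.sqrt s * 2^-1 ^+ n @[n --> \oo] --> (2 * Num.sqrt s * 0 : R)).
      by apply: cvgMr; apply: cvg_expr; rewrite ger0_norm// invf_lt1// ltr1n.
    rewrite mulr0 => /cvgrPdist_le/(_ _ eps0); apply: filterS => j.
    by rewrite sub0r normrN; apply: le_trans (ler_norm _).
  rewrite -EFinM lee_fin gl.
  have : (h k x - l) ^+ 2 <= (2 * Num.sqrt s * 2^-1 ^+ k) ^+ 2.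
    rewrite -real_normK ?num_real// ler_sqr ?hl ?nnegrE ?mulr_ge0 ?sqrtr_ge0 ?exprn_ge0//.
  rewrite !exprMn sqr_sqrtr// [(2^-1 ^+ k) ^+ 2]exprAC.
  rewrite (_ : 2^-1 ^+ 2 = 4^-1 :> R); last by field.
  have -> : 2 ^+ 2 = 4 :> R by ring.
  by rewrite [4 * s * _]mulrAC.
have ISk k : (\int[mu]_(x in D) ((h k x - g x) ^+ 2)%:E <= (8 * 4^-1 ^+ k)%:E)%E.
  apply: (@le_trans _ _ (\int[mu]_(x in D) ((4 * 4^-1 ^+ k)%:E * S x)))%E.
    apply: ge0_le_integral => //.
    - by move=> x _; rewrite lee_fin sqr_ge0.
    - apply/measurable_EFinP; apply: measurable_funX; apply: measurable_funB => //.
      exact: (Lh k).1.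
    - by apply: measurable_funeM.
  rewrite ge0_integralZl// ?lee_fin ?mulr_ge0 ?exprn_ge0//.
  apply: (le_trans (lee_pmul _ _ (lexx _) IS)); rewrite ?lee_fin ?mulr_ge0 ?exprn_ge0 ?integral_ge0//.
  by move: (4^-1 ^+ k) => t; lra.
have Lhg k : Lr2 (fun x => h k x - g x).
  split; first by apply: measurable_funB => //; exact: (Lh k).1.
  apply/integrableP; split.
    apply/measurable_EFinP; apply: measurable_funX; apply: measurable_funB => //.
    exact: (Lh k).1.
  under eq_integral do rewrite /= ger0_norm ?sqr_ge0//.
  by apply: le_lt_trans (ISk k) _; rewrite ltry.
have Lg : Lr2 g.
  have := Lr2B (Lh 0%N) (Lhg 0%N); under eq_fun do rewrite opprB addrC subrK.
  by [].
exists g => // eps eps0.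
have [N1 hN1] : exists k, 8 * 4^-1 ^+ k < eps / 4 :> R.
  have : (8 * 4^-1 ^+ n @[n --> \oo] --> (8 * 0 : R)).
    by apply: cvgMr; apply: cvg_expr; rewrite ger0_norm// invf_lt1// ltr1n.
  rewrite mulr0 => /cvgrPdist_lt/(_ (eps / 4)); case; first by rewrite divr_gt0.
  move=> k _ /(_ k (leqnn k)) /=; rewrite sub0r normrN => hk; exists k.
  exact: le_lt_trans (ler_norm _) hk.
have [N2 hN2] : exists N, forall p q, (N <= p)%N -> (N <= q)%N ->
    n2 (fun x => f p x - f q x) < eps / 4 by apply: cf; rewrite divr_gt0.
pose k := maxn N1 N2.
exists N2 => p hp.
have kN2 : (N2 <= nk k)%N by rewrite (leq_trans (leq_maxr N1 N2))// leq_addl.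
have -> : (fun x => f p x - g x) = (fun x => (f p x - h k x) + (h k x - g x)).
  by apply/funext => x; rewrite addrA subrK.
apply: (le_lt_trans (n2D_le (Lr2B (Lf p) (Lh k)) (Lhg k))).
have h1 : n2 (fun x => f p x - h k x) < eps / 4 by apply: hN2.
have h2 : n2 (fun x => h k x - g x) <= 8 * 4^-1 ^+ k.
  by rewrite -lee_fin EFin_n2.
have h3 : 4^-1 ^+ k <= 4^-1 ^+ N1 :> R.
  by apply: ler_wiXn2l; rewrite ?invr_ge0// ?invf_le1 ?ler1n ?leq_maxl.
by move: hN1 h1 h2 h3; move: (n2 _) (n2 _) (_ ^+ k) (_ ^+ N1) => a b c e'; lra.
Unshelve. all: by end_near. Qed.

End RealL2.

(** * Borel sets of three-space and complex integrals over bounded open sets *)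

Notation mpt R := (pt (measurableTypeR R)).

Section OpenMeasurable.
Context {R : realType}.

Lemma measurable_xcoord (j : 'I_3) (D : set (mpt R)) :
  measurable_fun D (fun x : mpt R => xcoord x j).
Proof.
apply: (@measurable_funS _ _ _ _ setT) => //.
have m0 : measurable_fun setT (fun x : mpt R => x.1.1 : R).
  exact: (measurableT_comp measurable_fst measurable_fst).
have m1 : measurable_fun setT (fun x : mpt R => x.1.2 : R).
  exact: (measurableT_comp measurable_snd measurable_fst).
have m2 : measurable_fun setT (fun x : mpt R => x.2 : R) by exact: measurable_snd.
by rewrite /xcoord; case: j => -[|[|[|]]].
Qed.

Definition rbox (a b : pt R) : set (pt R) :=
  [set x | [/\ a.1.1 < x.1.1 < b.1.1, a.1.2 < x.1.2 < b.1.2 & a.2 < x.2 < b.2]].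

Lemma rbox_prod (a b : pt R) :
  rbox a b = (`]a.1.1, b.1.1[ `*` `]a.1.2, b.1.2[) `*` `]a.2, b.2[.
Proof.
apply/seteqP; split => x /=; rewrite /rbox /= !in_itv/=; first by case.
by move=> [[]].
Qed.

Lemma measurable_rbox (a b : pt R) : measurable (rbox a b : set (mpt R)).
Proof.
rewrite rbox_prod; apply: measurableX; last exact: measurable_itv.
by apply: measurableX; exact: measurable_itv.
Qed.

Definition ratbox (q : (rat * rat * rat) * (rat * rat * rat)) : set (pt R) :=
  rbox (ratr q.1.1.1, ratr q.1.1.2, ratr q.1.2) (ratr q.2.1.1, ratr q.2.1.2, ratr q.2.2).

Definition cbox (a b : pt R) : set (pt R) :=
  [set x | [/\ a.1.1 <= x.1.1 <= b.1.1, a.1.2 <= x.1.2 <= b.1.2 & a.2 <= x.2 <= b.2]].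

Lemma rbox_sub_cbox a b : rbox a b `<=` cbox a b.
Proof.
by move=> x [/andP[? ?] /andP[? ?] /andP[? ?]]; split; apply/andP; split; exact: ltW.
Qed.

Definition ratcbox (q : (rat * rat * rat) * (rat * rat * rat)) : set (pt R) :=
  cbox (ratr q.1.1.1, ratr q.1.1.2, ratr q.1.2) (ratr q.2.1.1, ratr q.2.1.2, ratr q.2.2).

(** Countably many boxes suffice to exhaust an open set. The closed box is required to lie in [D]
    because bump functions are supported on closed boxes. *)
Lemma nbhs_ratbox (D : set (pt R)) x : open D -> D x ->
  exists q, ratcbox q `<=` D /\ ratbox q x.
Proof.
move=> oD Dx; have : nbhs x D by apply: open_nbhs_nbhs.
move=> /nbhs_ballP[e /= e0 he].
have rl (t : R) : exists q : rat, t - e < ratr q < t.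
  have [|q] := @rat_in_itvoo R (t - e) t; first lra.
  by rewrite in_itv/= => hq; exists q.
have rr (t : R) : exists q : rat, t < ratr q < t + e.
  have [|q] := @rat_in_itvoo R t (t + e); first lra.
  by rewrite in_itv/= => hq; exists q.
have [a1 /andP[h1 h1']] := rl x.1.1; have [b1 /andP[g1 g1']] := rr x.1.1.
have [a2 /andP[h2 h2']] := rl x.1.2; have [b2 /andP[g2 g2']] := rr x.1.2.
have [a3 /andP[h3 h3']] := rl x.2; have [b3 /andP[g3 g3']] := rr x.2.
exists ((a1, a2, a3), (b1, b2, b3)); split; last first.
  by rewrite /ratbox /rbox/=; split; apply/andP; split.
move=> y; rewrite /ratcbox /cbox/= => -[/andP[k1 k1'] /andP[k2 k2'] /andP[k3 k3']].
apply: he; split; [split|]; rewrite /= -ball_normE/= ltr_norml; apply/andP; split; lra.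
Qed.

(** Links the topology with the product sigma-algebra: an open set is a countable union of open
    rational boxes, which are measurable rectangles. *)
Lemma open_measurable3 (D : set (pt R)) : open D -> measurable (D : set (mpt R)).
Proof.
move=> oD; have -> : D = \bigcup_(q in [set q | ratcbox q `<=` D]) ratbox q.
  apply/seteqP; split => [x Dx|x [q qD qx]]; last by apply: qD; exact: rbox_sub_cbox.
  by have [q [qD qx]] := nbhs_ratbox oD Dx; exists q.
rewrite bigcup_mkcond; apply: countable_bigcupT_measurable => // q.
case: ifPn => _; [exact: measurable_rbox|exact: measurable0].
Qed.

Lemma continuous_measurable3 (f : pt R -> R) (D : set (mpt R)) : measurable D ->
  continuous f -> measurable_fun D (f : mpt R -> R).
Proof.
move=> mD cf; apply: (@measurable_funS _ _ _ _ setT) => //.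
apply: (measurability _ (RGenOpens.measurableE R)).
move=> _ [_ [a [b ->] <-]]; rewrite setTI; apply: open_measurable3.
by move/continuousP : cf; apply; exact: interval_open.
Qed.

End OpenMeasurable.


Section Leb3.
Context {R : realType}.

Lemma leb3_rbox (a b : pt R) : (leb3 (rbox a b : set (mpt R)) < +oo)%E.
Proof.
have mI (u v : R) : measurable (`]u, v[ : set (measurableTypeR R)) by exact: measurable_itv.
have -> : leb3 (rbox a b : set (mpt R)) = (@lebesgue_measure R `]a.1.1, b.1.1[ *
    @lebesgue_measure R `]a.1.2, b.1.2[ * @lebesgue_measure R `]a.2, b.2[)%E.
  rewrite rbox_prod; etransitivity.
    exact: (product_measure1E _ _ (measurableX (mI _ _) (mI _ _)) (mI _ _)).
  by congr (_ * _)%E; exact: (product_measure1E _ _ (mI _ _) (mI _ _)).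
have fin (u v : R) : exists2 r, 0 <= r & @lebesgue_measure R `]u, v[ = r%:E.
  rewrite lebesgue_measure_itv/= lte_fin; case: ifPn => [uv|_]; last by exists 0.
  by exists (v - u); rewrite ?subr_ge0 ?ltW.
have [r1 _ ->] := fin a.1.1 b.1.1; have [r2 _ ->] := fin a.1.2 b.1.2.
have [r3 _ ->] := fin a.2 b.2.
by rewrite -!EFinM ltry.
Qed.

(* Bundling openness and boundedness lets [L2t] below be a type indexed by D alone. *)
Record bdom := BDom {
  dset :> set (pt R);
  dset_open : open dset;
  dset_bdd : exists M, forall x, dset x -> forall j, `|xcoord x j| < M }.

Arguments dset_open : clear implicits.
Arguments dset_bdd : clear implicits.
Variable D : bdom.

Lemma bdom_measurable : measurable (D : set (mpt R)).
Proof. exact: (open_measurable3 (dset_open D)). Qed.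
Let mD := bdom_measurable.

Lemma bdom_sub_box : exists2 M, 0 < M & (D : set (pt R)) `<=` rbox (- M, - M, - M) (M, M, M).
Proof.
have [M hM] := dset_bdd D; exists (`|M| + 1); first by rewrite ltr_wpDl.
move=> x Dx; have h j : `|xcoord x j| < `|M| + 1.
  by apply: (lt_le_trans (hM x Dx j)); rewrite ler_wpDr// ler_norm.
have := h ord0; have := h (Ordinal (isT : 1 < 3)%N); have := h (Ordinal (isT : 2 < 3)%N).
by rewrite /xcoord /= !ltr_norml => /andP[a1 a2] /andP[b1 b2] /andP[c1 c2]; split; rewrite /= ?a1 ?a2 ?b1 ?b2 ?c1 ?c2.
Qed.

Lemma bdom_finite : (leb3 (D : set (mpt R)) < +oo)%E.
Proof.
have [M _ hM] := bdom_sub_box.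
apply: le_lt_trans (leb3_rbox (- M, - M, - M) (M, M, M)).
by apply: le_measure => //; rewrite inE//; exact: measurable_rbox.
Qed.

Definition rpart (f : pt R -> R[i]) : mpt R -> R := fun x => complex.Re (f x).
Definition ipart (f : pt R -> R[i]) : mpt R -> R := fun x => complex.Im (f x).

Lemma L2P (E : set (pt R)) f : measurable (E : set (mpt R)) ->
  L2 E f <-> Lr2 leb3 E (rpart f) /\ Lr2 leb3 E (ipart f).
Proof.
move=> mE; split=> [[m1 m2 h]|[[m1 h1] [m2 h2]]].
  have key (g : mpt R -> R) : measurable_fun (E : set (mpt R)) g ->
      (forall x, g x ^+ 2 <= complex.Re (f x) ^+ 2 + complex.Im (f x) ^+ 2) -> Lr2 leb3 E g.
    move=> mg hg; split=> //; apply/integrableP; split.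
      by apply/measurable_EFinP; apply: measurable_funX.
    apply: le_lt_trans h; apply: ge0_le_integral => //.
    - by apply: measurableT_comp => //; apply/measurable_EFinP; apply: measurable_funX.
    - apply/measurable_EFinP; apply: measurable_funD; exact: measurable_funX.
    - by move=> x _; rewrite lee_fin ger0_norm ?sqr_ge0.
  by split; apply: key => // x; rewrite ?lerDl ?lerDr sqr_ge0.
split=> //; rewrite /l2norm2; under eq_integral do rewrite EFinD.
rewrite ge0_integralD//; first last.
- by apply/measurable_EFinP; exact: measurable_funX.
- by move=> x _; rewrite lee_fin sqr_ge0.
- by apply/measurable_EFinP; exact: measurable_funX.
- by move=> x _; rewrite lee_fin sqr_ge0.
by apply: lte_add_pinfty; apply: integrable_lty.
Qed.

Definition cintegrable (f : pt R -> R[i]) :=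
  leb3.-integrable (D : set (mpt R)) (EFin \o rpart f) /\
  leb3.-integrable (D : set (mpt R)) (EFin \o ipart f).

Lemma cint_eq f g : (forall x, (D : set _) x -> f x = g x) -> cint D f = cint D g.
Proof.
by move=> fg; rewrite /cint; congr (_ +i* _); apply: eq_Rintegral => x /set_mem Dx; rewrite fg.
Qed.

Lemma cintD f g : cintegrable f -> cintegrable g ->
  cint D (fun x => f x + g x) = cint D f + cint D g.
Proof.
move=> [f1 f2] [g1 g2]; rewrite /cint; simpc; congr (_ +i* _); rewrite -RintegralD//;
 by apply: eq_Rintegral => x _; rewrite raddfD.
Qed.

Lemma cintZ a f : cintegrable f -> cint D (fun x => a * f x) = a * cint D f.
Proof.
move=> [f1 f2]; case: a => a b; rewrite /cint; simpc.
have I c (h : mpt R -> R) : leb3.-integrable (D : set (mpt R)) (EFin \o h) ->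
    leb3.-integrable (D : set (mpt R)) (EFin \o (fun x => c * h x)).
  by move=> hh; exact: (integrableZl mD c hh).
rewrite -!RintegralZl// -RintegralB ?I// -RintegralD ?I//; congr (_ +i* _);
 by apply: eq_Rintegral => x _; case: (f x) => u v; simpc.
Qed.

Lemma cintegrableD f g : cintegrable f -> cintegrable g -> cintegrable (fun x => f x + g x).
Proof.
move=> [f1 f2] [g1 g2]; split.
- apply: (eq_integrable mD _ _ _ (integrableD mD f1 g1)) => x _.
  by rewrite /= /rpart raddfD.
- apply: (eq_integrable mD _ _ _ (integrableD mD f2 g2)) => x _.
  by rewrite /= /ipart raddfD.
Qed.

Lemma cintegrableZ a f : cintegrable f -> cintegrable (fun x => a * f x).
Proof.
move=> [f1 f2]; case: a => a b; split.
- apply: (eq_integrable mD _ _ _ (integrableD mD (integrableZl mD a f1) (integrableZl mD (- b) f2))) => x _.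
  by rewrite /= /rpart /ipart; case: (f x) => u v; simpc; rewrite -!EFinM -EFinD mulNr.
- apply: (eq_integrable mD _ _ _ (integrableD mD (integrableZl mD a f2) (integrableZl mD b f1))) => x _.
  by rewrite /= /rpart /ipart; case: (f x) => u v; simpc; rewrite -!EFinM -EFinD.
Qed.

Lemma cintegrable_sum (I : Type) (r : seq I) (P : pred I) (F : I -> pt R -> R[i]) :
  (forall i, cintegrable (F i)) -> cintegrable (fun x => \sum_(i <- r | P i) F i x).
Proof.
move=> h; elim: r => [|i r IH].
  under eq_fun do rewrite big_nil.
  by split; apply: (eq_integrable mD _ _ _ (integrable0 _ _)).
under eq_fun do rewrite big_cons; case: (P i) => //; exact: cintegrableD.
Qed.

Lemma cint_sum (I : Type) (r : seq I) (P : pred I) (F : I -> pt R -> R[i]) :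
  (forall i, cintegrable (F i)) ->
  cint D (fun x => \sum_(i <- r | P i) F i x) = \sum_(i <- r | P i) cint D (F i).
Proof.
move=> h; elim: r => [|i r IH].
  rewrite big_nil; under eq_fun do rewrite big_nil.
  by rewrite /cint /Rintegral/= integral0.
rewrite big_cons; under eq_fun do rewrite big_cons.
case: (P i) => //; rewrite cintD ?IH//; exact: cintegrable_sum.
Qed.

Lemma cint_conj f : cintegrable f -> cint D (fun x => conjc (f x)) = conjc (cint D f).
Proof.
move=> [f1 f2]; rewrite /cint /=; congr (_ +i* _).
  by apply: eq_Rintegral => x _; case: (f x).
rewrite -mulN1r -RintegralZl//.
by apply: eq_Rintegral => x _; case: (f x) => u v; rewrite /= mulN1r.
Qed.

Lemma L2_mul f g : L2 D f -> L2 D g -> cintegrable (fun x => f x * g x).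
Proof.
move=> /(L2P _ mD)[f1 f2] /(L2P _ mD)[g1 g2].
have A := Lr2_mul mD f1 g1; have B := Lr2_mul mD f2 g2.
have E := Lr2_mul mD f1 g2; have F := Lr2_mul mD f2 g1.
split.
- apply: (eq_integrable mD _ _ _ (integrableB mD A B)) => x _ /=.
  by rewrite /rpart /ipart; case: (f x) => a b; case: (g x) => c d; simpc.
- apply: (eq_integrable mD _ _ _ (integrableD mD E F)) => x _ /=.
  by rewrite /rpart /ipart; case: (f x) => a b; case: (g x) => c d; simpc.
Qed.

Lemma L2_conj f : L2 D f -> L2 D (fun x => conjc (f x)).
Proof.
move=> /(L2P _ mD)[f1 f2]; apply/(L2P _ mD); split.
  by rewrite (_ : rpart _ = rpart f)//; apply/funext => x; rewrite /rpart; case: (f x).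
rewrite (_ : ipart _ = fun x => - ipart f x); first exact: Lr2N.
by apply/funext => x; rewrite /ipart; case: (f x).
Qed.

Lemma L2D f g : L2 D f -> L2 D g -> L2 D (fun x => f x + g x).
Proof.
move=> /(L2P _ mD)[f1 f2] /(L2P _ mD)[g1 g2]; apply/(L2P _ mD); split.
  rewrite (_ : rpart _ = fun x => rpart f x + rpart g x); first exact: Lr2D.
  by apply/funext => x; rewrite /rpart raddfD.
rewrite (_ : ipart _ = fun x => ipart f x + ipart g x); first exact: Lr2D.
by apply/funext => x; rewrite /ipart raddfD.
Qed.

Definition cmeas (c : pt R -> R[i]) :=
  measurable_fun (D : set (mpt R)) (rpart c) /\ measurable_fun (D : set (mpt R)) (ipart c).
Definition cbdd (c : pt R -> R[i]) := exists M, forall x, (D : set _) x -> sqn (c x) <= M.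

Lemma L2_bounded c f : cmeas c -> cbdd c -> L2 D f -> L2 D (fun x => c x * f x).
Proof.
move=> [m1 m2] [M hM] /(L2P _ mD)[f1 f2]; apply/(L2P _ mD).
have b (u : R) x : (D : set _) x -> u ^+ 2 <= sqn (c x) -> `|u| <= `|M| + 1.
  move=> Dx h; rewrite -ler_sqr ?nnegrE ?addr_ge0// real_normK ?num_real//.
  apply: (le_trans h); apply: (le_trans (hM x Dx)).
  apply: (le_trans (ler_norm M)); move: `|M| (normr_ge0 M) => t t0.
  rewrite -subr_ge0 (_ : _ - _ = t ^+ 2 + t + 1); last by ring.
  by rewrite !addr_ge0 ?sqr_ge0.
have b1 x : (D : set _) x -> `|rpart c x| <= `|M| + 1.
  by move=> Dx; apply: (b _ x) => //; exact: Re_sqn.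
have b2 x : (D : set _) x -> `|ipart c x| <= `|M| + 1.
  by move=> Dx; apply: (b _ x) => //; rewrite /sqn lerDr sqr_ge0.
have A := Lr2_bounded mD m1 b1 f1; have B := Lr2_bounded mD m2 b2 f2.
have E := Lr2_bounded mD m1 b1 f2; have F := Lr2_bounded mD m2 b2 f1.
split.
  rewrite (_ : rpart _ = fun x => rpart c x * rpart f x - ipart c x * ipart f x).
    exact: Lr2B.
  by apply/funext => x; rewrite /rpart /ipart; case: (f x) => u v; case: (c x) => a d; simpc.
rewrite (_ : ipart _ = fun x => rpart c x * ipart f x + ipart c x * rpart f x).
  exact: Lr2D.
by apply/funext => x; rewrite /rpart /ipart; case: (f x) => u v; case: (c x) => a d; simpc.
Qed.

Lemma cmeas_cst a : cmeas (fun=> a).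
Proof. by split; exact: measurable_cst. Qed.

Lemma L2Z a f : L2 D f -> L2 D (fun x => a * f x).
Proof. by apply: L2_bounded; [exact: cmeas_cst|exists (sqn a)]. Qed.

Lemma L20 : L2 D (fun=> 0).
Proof.
apply/(L2P _ mD); have : Lr2 leb3 (D : set (mpt R)) (fun=> 0); last by [].
split; first exact: measurable_cst.
under eq_fun do rewrite expr0n; exact: integrable0.
Qed.

End Leb3.

Arguments bdom : clear implicits.

(** * The space of square-integrable functions as a complete semi-inner-product space *)

Section L2Type.
Context {R : realType}.

Definition l2pred (D : bdom R) : {pred (pt R -> R[i]^o)} := fun f => `[< L2 D f >].

Lemma l2pred_submod D : GRing.submod_closed (l2pred D).
Proof.
split; first by apply/asboolP; exact: L20.
by move=> a f g /asboolP Lf /asboolP Lg; apply/asboolP; apply: L2D => //; exact: L2Z.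
Qed.

HB.instance Definition _ (D : bdom R) :=
  GRing.isSubmodClosed.Build R[i] (pt R -> R[i]^o) (l2pred D) (l2pred_submod D).

Record L2t (D : bdom R) := MkL2 { l2val :> pt R -> R[i]^o; l2valP : l2val \in l2pred D }.

HB.instance Definition _ (D : bdom R) := [isSub for @l2val D].
HB.instance Definition _ (D : bdom R) := [Choice of L2t D by <:].
HB.instance Definition _ (D : bdom R) := [SubChoice_isSubLmodule of L2t D by <:].

Variable D : bdom R.
Implicit Types f g h : L2t D.

Definition toL2 (f : pt R -> R[i]) (Lf : L2 D f) : L2t D := MkL2 (introT (asboolP _) Lf : f \in l2pred D).

Lemma L2tP f : L2 D f.
Proof. by have /asboolP := l2valP f. Qed.

Lemma L2tDE f g x : (f + g : L2t D) x = f x + g x. Proof. by []. Qed.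
Lemma L2tZE a f x : (a *: f : L2t D) x = a * f x. Proof. by []. Qed.
Lemma L2tNE f x : (- f : L2t D) x = - f x. Proof. by []. Qed.

Definition l2ip f g : R[i] := cint D (fun x => f x * conjc (g x)).

Lemma l2ip_integrable f g : cintegrable D (fun x => f x * conjc (g x)).
Proof. by apply: L2_mul; [exact: L2tP|apply: L2_conj; exact: L2tP]. Qed.

Definition l2hform : hform (L2t D).
Proof.
apply: (@HForm _ _ l2ip).
- move=> f g h; rewrite /l2ip -cintD; try exact: l2ip_integrable.
  by apply: cint_eq => x _; rewrite L2tDE mulrDl.
- move=> a f h; rewrite /l2ip -cintZ; last exact: l2ip_integrable.
  by apply: cint_eq => x _; rewrite L2tZE mulrA.
- move=> f g; rewrite /l2ip -cint_conj; last exact: l2ip_integrable.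
  by apply: cint_eq => x _; rewrite rmorphM/= conjcK mulrC.
- move=> f; rewrite /l2ip /cint/=; apply: Rintegral_ge0 => x _.
  by rewrite mul_conjc_sqn/= sqn_ge0.
Defined.

Lemma nsq_l2 f : nsq l2hform f = n2 leb3 D (rpart f) + n2 leb3 D (ipart f).
Proof.
have mD := bdom_measurable D; have /(L2P _ mD)[f1 f2] := L2tP f.
rewrite /nsq /= /l2ip /cint/= /n2 -RintegralD//; [|exact: f1.2|exact: f2.2].
by apply: eq_Rintegral => x _; rewrite mul_conjc_sqn.
Qed.

Lemma l2_complete : complete_on l2hform setT.
Proof.
move=> x _ cx; have mD := bdom_measurable D.
have L1 n : Lr2 leb3 (D : set (mpt R)) (rpart (x n)) by have /(L2P _ mD)[] := L2tP (x n).
have L2 n : Lr2 leb3 (D : set (mpt R)) (ipart (x n)) by have /(L2P _ mD)[] := L2tP (x n).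
have rB (f g : L2t D) : rpart (f - g : L2t D) = fun x => rpart f x - rpart g x.
  by apply/funext => t; rewrite /rpart L2tDE L2tNE raddfB.
have iB (f g : L2t D) : ipart (f - g : L2t D) = fun x => ipart f x - ipart g x.
  by apply/funext => t; rewrite /ipart L2tDE L2tNE raddfB.
have [g1 Lg1 h1] : exists2 g, Lr2 leb3 (D : set (mpt R)) g & forall e, 0 < e -> exists N, forall p, (N <= p)%N ->
    n2 leb3 D (fun t => rpart (x p) t - g t) < e.
  apply: Lr2_complete => // e e0; have [N hN] := cx e e0; exists N => p q hp hq.
  by have := hN p q hp hq; rewrite nsq_l2 rB; apply: le_lt_trans; rewrite lerDl n2_ge0.
have [g2 Lg2 h2] : exists2 g, Lr2 leb3 (D : set (mpt R)) g & forall e, 0 < e -> exists N, forall p, (N <= p)%N ->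
    n2 leb3 D (fun t => ipart (x p) t - g t) < e.
  apply: Lr2_complete => // e e0; have [N hN] := cx e e0; exists N => p q hp hq.
  by have := hN p q hp hq; rewrite nsq_l2 iB; apply: le_lt_trans; rewrite lerDr n2_ge0.
have Lg : Defs.L2 D (fun t => g1 t +i* g2 t) by apply/(L2P _ mD).
exists (toL2 Lg) => // e e0.
have e20 : 0 < e / 2 by lra.
have [N1 hN1] := h1 _ e20; have [N2 hN2] := h2 _ e20.
exists (maxn N1 N2) => p; rewrite geq_max => /andP[p1 p2].
rewrite nsq_l2 rB iB; have := hN1 p p1; have := hN2 p p2.
by rewrite /= -/(rpart _); move: (n2 _ _ _) (n2 _ _ _) => a b; lra.
Qed.

Lemma nsq_l2_ae f : nsq l2hform f = 0 ->
  {ae leb3, forall x : mpt R, (D : set (mpt R)) x -> f x = 0}.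
Proof.
have mD := bdom_measurable D; have /(L2P _ mD)[f1 f2] := L2tP f.
rewrite nsq_l2 => /eqP; rewrite paddr_eq0 ?n2_ge0// => /andP[/eqP z1 /eqP z2].
have key (g : mpt R -> R) : Lr2 leb3 (D : set (mpt R)) g -> n2 leb3 D g = 0 ->
    {ae leb3, forall x : mpt R, (D : set (mpt R)) x -> g x = 0}.
  move=> Lg g0; have := EFin_n2 mD Lg; rewrite g0 => /esym h.
  have : (\int[leb3]_(x in (D : set (mpt R))) `|(g x ^+ 2)%:E| = 0)%E.
    by rewrite -[RHS]h; apply: eq_integral => x _; rewrite /= ger0_norm ?sqr_ge0.

  have mg : measurable_fun (D : set (mpt R)) (fun x => (g x ^+ 2)%:E).
    by apply/measurable_EFinP; apply: measurable_funX; exact: Lg.1.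
  move/(ae_eq_integral_abs _ mD mg); apply: filterS => x hx Dx.
  by have := hx Dx => -[] /eqP; rewrite sqrf_eq0 => /eqP.
have a1 := key _ f1 z1; have a2 := key _ f2 z2.
apply: filterS2 a1 a2 => x h1 h2 Dx.
have := h1 Dx; have := h2 Dx; rewrite /rpart /ipart; by case: (f x) => a b /= -> ->.
Qed.

End L2Type.

(** * Finite direct sums *)

Section DirectSum.
Context {R : realType} (I : finType) (V : lmodType R[i]) (ip : hform V).
Let hs := hform_sesqui ip.

Definition sum_ip (x y : I -> V) : R[i] := \sum_i ip (x i) (y i).

Definition sum_hform : hform (I -> V).
Proof.
apply: (@HForm _ _ sum_ip).
- by move=> x y z; rewrite /sum_ip -big_split; apply: eq_bigr => i _; rewrite /= (hipD ip).
- by move=> a x z; rewrite /sum_ip mulr_sumr; apply: eq_bigr => i _; rewrite /= (hipZ ip).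
- move=> x y; rewrite /sum_ip rmorph_sum; apply: eq_bigr => i _; exact: hipC.
- by move=> x; rewrite /sum_ip Re_sum sumr_ge0// => i _; exact: hip_ge0.
Defined.

Lemma nsq_sum x : nsq sum_hform x = \sum_i nsq ip (x i).
Proof. by rewrite /nsq /= /sum_ip Re_sum. Qed.

Lemma nsq_comp_le x i : nsq ip (x i) <= nsq sum_hform x.
Proof. by rewrite nsq_sum (bigD1 i)//= lerDl sumr_ge0// => j _; exact: nsq_ge0. Qed.

Lemma sum_complete : complete_on ip setT -> complete_on sum_hform setT.
Proof.
move=> cpl x _ cx.
have ex i : exists l, cvg_seq ip (fun n => x n i) l.
  have [|l _ hl] := cpl (fun n => x n i) (fun=> Logic.I); last by exists l.
  move=> e e0; have [N hN] := cx e e0; exists N => p q hp hq.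
  exact: le_lt_trans (nsq_comp_le (x p - x q) i) (hN p q hp hq).
have [l hl] := choice ex; exists l => // e e0.
have e1 : 0 < e / (#|I|%:R + 1) by rewrite divr_gt0// ltr_wpDl.
have [N hN] := choice (fun i => hl i _ e1).
exists (\max_i N i) => p hp; rewrite nsq_sum.
apply: (@le_lt_trans _ _ (\sum_(i : I) (e / (#|I|%:R + 1)))).
  apply: ler_sum => i _; apply/ltW/hN; exact: leq_trans (leq_bigmax i) hp.
rewrite sumr_const -[X in X < _]mulr_natl mulrA ltr_pdivrMr ?ltr_wpDl// mulrC ltr_pM2l//.
by rewrite ltrDl.
Qed.

(** Lets the witnesses be indexed by any finite type, such as the cells of a grid. *)
Lemma compact_sq_fin (W : lmodType R[i]) (jp : hform W) (e : W -> R) :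
  (forall eps, 0 < eps -> exists (J : finType) (r : J -> W),
     forall x, e x <= eps * nsq jp x + \sum_j sqn (jp x (r j))) -> compact_sq jp e.
Proof.
move=> h eps e0; have [J [r hr]] := h eps e0.
exists #|J|, (fun k => r (enum_val k)) => x; apply: (le_trans (hr x)).
by rewrite (reindex (@enum_val J predT)) //; exists enum_rank => j _; rewrite ?enum_valK ?enum_rankK.
Qed.

Lemma compact_sq_sum e : compact_sq ip e ->
  compact_sq sum_hform (fun x => \sum_i e (x i)).
Proof.
move=> ce; apply: compact_sq_fin => eps e0; have [n [r hr]] := ce _ e0.
exists (I * 'I_n)%type, (fun k => fun i => if i == k.1 then r k.2 else 0) => x.
rewrite nsq_sum mulr_sumr -(pair_bigA _ (fun i l => sqn (sum_hform x (fun k => if k == i then r l else 0)))).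
rewrite -big_split/=; apply: ler_sum => i _; apply: (le_trans (hr (x i))).
rewrite lerD2l; apply: ler_sum => l _; rewrite /sum_ip (bigD1 i)//= eqxx big1 ?addr0// => k /negPf ->.
exact: ses0r.
Qed.

End DirectSum.

(** * Integration along coordinates and by parts *)

Section CoordinateFubini.
Context {R : realType}.
Local Notation leb := (@lebesgue_measure R).

Lemma bounded_support_integrable d (T : measurableType d) (mu : {measure set T -> \bar R})
    (A : set T) (f : T -> R) (M : R) :
  measurable A -> (mu A < +oo)%E -> measurable_fun setT f ->
  (forall x, `|f x| <= M) -> (forall x, ~ A x -> f x = 0) ->
  mu.-integrable setT (EFin \o f).
Proof.
move=> mA fA mf fM f0.

have I1 : mu.-integrable setT (fun x => M%:E * (\1_A x : R)%:E)%E.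
  apply: integrableZl => //; apply/integrableP; split.
    by apply/measurable_EFinP; exact: measurable_indic.
  under eq_integral do rewrite gee0_abs ?lee_fin//.
  by rewrite integral_indic// setIT.
apply: (le_integrable measurableT _ _ I1).
  exact/measurable_EFinP.
move=> x _; rewrite /= lee_fin indicE; case: (boolP (x \in A)) => [|/negP] xA.
  by rewrite mulr1; apply: (le_trans (fM x)); exact: ler_norm.
by rewrite mulr0 normr0 f0 ?normr0// => Ax; apply: xA; rewrite inE.
Qed.

Definition upd (j : 'I_3) (t : R) (x : pt R) : pt R :=
  (if j == 0 :> nat then t else x.1.1, if j == 1 :> nat then t else x.1.2,
   if j == 2 :> nat then t else x.2).

Lemma upd_upd j s t x : upd j s (upd j t x) = upd j s x.
Proof. by case: x => -[a b] c; rewrite /upd/=; do 3 case: eqP => //. Qed.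

Lemma xcoord_upd j t x : xcoord (upd j t x) j = t.
Proof. by rewrite /xcoord /upd; case: j => -[|[|[|]]]. Qed.

Lemma xcoord_upd_neq i j t x : i != j -> xcoord (upd j t x) i = xcoord x i.
Proof. by rewrite /xcoord /upd; case: i => -[|[|[|]]]//= ?; case: j => -[|[|[|]]]//=. Qed.

Lemma upd_xcoord j x : upd j (xcoord x j) x = x.
Proof. by case: x => -[a b] c; rewrite /upd /xcoord; case: j => -[|[|[|]]]. Qed.

Lemma measurable_upd j : measurable_fun setT
  (fun z : mpt R * measurableTypeR R => upd j z.2 z.1 : mpt R).
Proof.
have m1 : measurable_fun setT (fun z : mpt R * measurableTypeR R => z.2 : measurableTypeR R).
  exact: measurable_snd.
have mx : measurable_fun setT (fun z : mpt R * measurableTypeR R => z.1 : mpt R).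
  exact: measurable_fst.
have mx2 := measurableT_comp measurable_snd mx.
have mx1 := measurableT_comp measurable_fst mx.
have mx11 := measurableT_comp measurable_fst mx1.
have mx12 := measurableT_comp measurable_snd mx1.
apply: measurable_fun_pair; last by case: j => -[|[|[|]]].
by apply: measurable_fun_pair; case: j => -[|[|[|]]].
Qed.

Lemma measurable_coord_integral (j : 'I_3) (F : mpt R -> R) (k : R -> R) :
  measurable_fun setT F -> measurable_fun setT (k : measurableTypeR R -> R) ->
  measurable_fun setT (fun x : mpt R => \int[leb]_t (k t * F (upd j t x))).
Proof.
move=> mF mk; pose G (z : mpt R * measurableTypeR R) := (k z.2 * F (upd j z.2 z.1))%:E.
have mG : measurable_fun setT G.
  apply/measurable_EFinP; apply: measurable_funM.
    exact: (measurableT_comp mk measurable_snd).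
  exact: (measurableT_comp mF (measurable_upd j)).
apply: (measurableT_comp (fine_measurable measurableT)).
under eq_fun do rewrite integralE.
have pos (h : mpt R * measurableTypeR R -> \bar R) : measurable_fun setT h ->
    (forall z, 0 <= h z)%E -> measurable_fun setT (fun x => \int[leb]_t h (x, t))%E.
  by move=> mh h0; exact: (measurable_fun_fubini_tonelli_F (m2 := leb) h mh h0).
apply: emeasurable_funB.
- have h := pos (G^\+)%E (measurable_funepos mG) (funepos_ge0 G).
  rewrite [X in measurable_fun _ X](_ : _ = fun x => \int[leb]_t (G^\+ (x, t)))%E.
    apply: h.
  by apply/funext => x; apply: eq_integral => t _; rewrite !funeposE.
- have h := pos (G^\-)%E (measurable_funeneg mG) (funeneg_ge0 G).
  rewrite [X in measurable_fun _ X](_ : _ = fun x => \int[leb]_t (G^\- (x, t)))%E.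
    apply: h.
  by apply/funext => x; apply: eq_integral => t _; rewrite !funenegE.
Qed.

(** Bounded, measurable, supported in a cube: every iterated integral of such a function converges
    absolutely. One [M] serves both as bound and as half side of the cube. *)
Definition bcs (F : mpt R -> R) := measurable_fun setT F /\ exists2 M, 0 < M &
  (forall x, `|F x| <= M) /\ (forall x, ~ rbox (- M, - M, - M) (M, M, M) x -> F x = 0).

Lemma bcs_integrable F : bcs F -> leb3.-integrable setT (EFin \o F).
Proof.
move=> [mF [M M0 [FM F0]]].
apply: (@bounded_support_integrable _ (mpt R) leb3 (rbox (- M, - M, - M) (M, M, M)) _ M) => //.
- exact: measurable_rbox.
- exact: leb3_rbox.
Qed.

Lemma leb_itv_fin (u v : R) : (leb `]u, v[ < +oo)%E.
Proof. by rewrite lebesgue_measure_itv/= lte_fin; case: ifP => _; rewrite -?EFinB ltry. Qed.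

Lemma bcs_slice j F x : bcs F -> leb.-integrable setT (fun t => (F (upd j t x))%:E).
Proof.
move=> [mF [M M0 [FM F0]]].
apply: (@bounded_support_integrable _ (measurableTypeR R) leb `](- M), M[ _ M) => //.
- exact: leb_itv_fin.
- apply: (measurableT_comp mF).
  exact: (measurableT_comp (measurable_upd j) (pair1_measurable x)).
move=> t ht; apply: F0 => -[h1 h2 h3]; apply: ht; rewrite /= in_itv/=.
by move: h1 h2 h3; rewrite /upd/=; case: j => -[|[|[|]]].
Qed.

Let mI (u v : R) : measurable (`]u, v[ : set (measurableTypeR R)).
Proof. exact: measurable_itv. Qed.

Lemma leb2_square (u v : R) :
  ((leb \x leb) (`]u, v[ `*` `]u, v[ : set (measurableTypeR R * measurableTypeR R)) < +oo)%E.
Proof.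
rewrite (product_measure1E _ _ (mI _ _) (mI _ _)).
have fin : leb `]u, v[%classic \is a fin_num by rewrite ge0_fin_numE ?leb_itv_fin.
by rewrite ltey_eq fin_numM.
Qed.

(* The library's sigma-finiteness instance for products only resolves for
   subprobabilities, whence this copy of the planar Lebesgue measure. *)
Definition leb2 : set (measurableTypeR R * measurableTypeR R) -> \bar R := (leb \x leb)%E.

HB.instance Definition _ := Measure.copy leb2 (leb \x leb)%E.

Lemma leb2_sigma_finite : sigma_finite setT leb2.
Proof.
exists (fun n : nat => `](- n%:R), n%:R[ `*` `](- n%:R), n%:R[) => [|n]; last first.
  by split; [exact: measurableX|exact: leb2_square].
apply/esym/seteqP; split=> // -[a b] _.
exists (Num.truncn (`|a| + `|b|)).+1 => //=; rewrite !in_itv/= -!ltr_norml.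
have := truncnS_gt (`|a| + `|b|) => h.
by split; apply: le_lt_trans h; rewrite ?lerDl ?lerDr.
Qed.

HB.instance Definition _ := Measure_isSigmaFinite.Build _ _ _ leb2 leb2_sigma_finite.

Lemma leb3_fubini12 (F : mpt R -> \bar R) : leb3.-integrable setT F ->
  (\int[leb3]_x F x = \int[leb2]_y \int[leb]_t F (y, t))%E.
Proof. by move=> IF; have H := @integral12_prod_meas1 _ _ _ _ R leb2 leb F IF. Qed.

Lemma leb3_fubini21 (F : mpt R -> \bar R) : leb3.-integrable setT F ->
  (\int[leb3]_x F x = \int[leb]_t \int[leb2]_y F (y, t))%E.
Proof. by move=> IF; have H := @integral21_prod_meas1 _ _ _ _ R leb2 leb F IF. Qed.

Lemma leb2_fubini12 (F : measurableTypeR R * measurableTypeR R -> \bar R) :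
  leb2.-integrable setT F ->
  (\int[leb2]_x F x = \int[leb]_y \int[leb]_t F (y, t))%E.
Proof. by move=> IF; have H := @integral12_prod_meas1 _ _ _ _ R leb leb F IF. Qed.

Lemma leb2_fubini21 (F : measurableTypeR R * measurableTypeR R -> \bar R) :
  leb2.-integrable setT F ->
  (\int[leb2]_x F x = \int[leb]_t \int[leb]_y F (y, t))%E.
Proof. by move=> IF; have H := @integral21_prod_meas1 _ _ _ _ R leb leb F IF. Qed.

(** Fubini with the j-th variable innermost; the order of integration on the two nested products is
    selected by [j]. *)
Lemma coord_fubini (j : 'I_3) F : bcs F ->
  (forall x, \int[leb]_t F (upd j t x) = 0) -> \int[leb3]_x F x = 0.
Proof.
move=> bF h; have IF := bcs_integrable bF.
have e0 x : (\int[leb]_t (F (upd j t x))%:E = 0)%E.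
  have := h x; rewrite /Rintegral => h0.
  by rewrite -[LHS]fineK ?h0// integrable_fin_num//; exact: bcs_slice.
suff : (\int[leb3]_x (F x)%:E = 0)%E by rewrite /Rintegral => ->.
have [mF [M M0 [FM F0]]] := bF.
have [j2|j2] := eqVneq (j : nat) 2.
  rewrite (leb3_fubini12 IF); apply: integral0_eq => -[a b] _.
  have := e0 (a, b, 0).
  by rewrite /upd /= j2 /=.
rewrite (leb3_fubini21 IF); apply: integral0_eq => c _.
pose F2 (y : measurableTypeR R * measurableTypeR R) := F (y, c).
have mF2 : measurable_fun setT F2.
  exact: (measurableT_comp mF (pair2_measurable c)).
have I2 : leb2.-integrable setT (EFin \o F2).
  apply: (@bounded_support_integrable _ (measurableTypeR R * measurableTypeR R)%type
    leb2 (`](- M), M[ `*` `](- M), M[) F2 M) => //.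
  - exact: measurableX.
  - exact: leb2_square.
  - by move=> y; exact: FM.
  - by move=> [a b] hab; apply: F0 => -[h1 h2 h3]; apply: hab; rewrite /= !in_itv.
have [j1|j1] := eqVneq (j : nat) 1.
  rewrite (leb2_fubini12 I2); apply: integral0_eq => a _.
  have := e0 (a, 0, c).
  by rewrite /upd /= j1 /=.
have j0 : (j : nat) = 0 by move: j1 j2; case: (j) => -[|[|[|]]].
rewrite (leb2_fubini21 I2); apply: integral0_eq => b _.
have := e0 (0, b, c).
by rewrite /upd /= j0 /=.
Qed.

End CoordinateFubini.

(** * Derivatives along coordinate lines and vanishing integrals of derivatives *)

Section TestCalculus.
Context {R : realType}.
Local Notation leb := (@lebesgue_measure R).
Implicit Types (f g chi phi : pt R -> R) (x : pt R) (j : 'I_3).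

Definition C1c chi := [/\ forall x, differentiable chi x, forall j, continuous (pd j chi)
  & exists2 K : set (pt R), compact K & forall x, ~ K x -> chi x = 0].

Lemma smooth_differentiable f x : smooth f -> differentiable f x.
Proof. by move=> /(_ [::]). Qed.

Lemma smooth_continuous f : smooth f -> continuous f.
Proof. by move=> sf x; apply: differentiable_continuous; exact: smooth_differentiable. Qed.

Lemma smooth_pd j f : smooth f -> smooth (pd j f).
Proof. by move=> sf s x; have := sf (rcons s j) x; rewrite foldr_rcons. Qed.

Lemma test_C1c (D : set (pt R)) phi : test_fun D phi -> C1c phi.
Proof.
move=> [sphi [K [cK KD K0]]]; split; last by exists K.
  by move=> x; exact: smooth_differentiable.
by move=> j; apply: smooth_continuous; exact: smooth_pd.
Qed.

Lemma pdM j f g x : differentiable f x -> differentiable g x ->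
  pd j (fun y => f y * g y) x = pd j f x * g x + f x * pd j g x.
Proof.
move=> df dg; rewrite /pd (_ : (fun y => f y * g y) = f * g)//.
rewrite deriveM; [|exact: diff_derivable|exact: diff_derivable].
by rewrite addrC [g x *: _]mulrC.
Qed.

Lemma pd_supp (K : set (pt R)) j f x : compact K -> (forall x, ~ K x -> f x = 0) ->
  ~ K x -> pd j f x = 0.
Proof.
move=> cK f0 nKx; rewrite /pd (@near_eq_derive _ _ _ f (cst 0)) ?derive_cst//.
have oK : open (~` K).
  by apply: closed_openC; apply: compact_closed => //; exact: norm_hausdorff.
have : nbhs x (~` K) by apply: open_nbhs_nbhs.
by apply: filterS => y; exact: f0.
Qed.

Lemma C1c_mul f g : C1c f -> C1c g -> C1c (fun x => f x * g x).
Proof.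
move=> [df cf [K cK K0]] [dg cg _]; split.
- by move=> x; rewrite (_ : (fun y => f y * g y) = f * g)//; exact: differentiableM.
- move=> j; rewrite (_ : pd j _ = fun x => pd j f x * g x + f x * pd j g x).
    move=> x; apply: cvgD; apply: cvgM.
    + exact: cf.
    + exact: differentiable_continuous.
    + exact: differentiable_continuous.
    + exact: cg.
  by apply/funext => x; exact: pdM.
- by exists K => // x nK; rewrite K0// mul0r.
Qed.

Lemma compact_rbox (K : set (pt R)) : compact K ->
  exists2 M, 0 < M & K `<=` rbox (- M, - M, - M) (M, M, M).
Proof.
move=> /compact_bounded [M [Mr hM]]; exists (`|M| + 1); first by rewrite ltr_wpDl.
move=> x Kx; have MM : M < `|M| + 1/2 by have := ler_norm M; lra.
have h : `|x| <= `|M| + 1 / 2 := hM _ MM x Kx.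
have h1 : `|x.1.1| <= `|x| by rewrite !prod_normE/= !le_max lexx.
have h2 : `|x.1.2| <= `|x| by rewrite !prod_normE/= !le_max lexx orbT.
have h3 : `|x.2| <= `|x| by rewrite !prod_normE/= !le_max lexx orbT.
have lt u : u <= `|x| -> u < `|M| + 1 by move=> ux; apply: (le_lt_trans ux); lra.
by split; rewrite /= -ltr_norml lt.
Qed.

Lemma continuous_supp_bcs f (K : set (pt R)) : continuous f -> compact K ->
  (forall x, ~ K x -> f x = 0) -> bcs f.
Proof.
move=> cf cK f0; split; first exact: (continuous_measurable3 measurableT cf).
have [M M0 hM] := compact_rbox cK.
have cfK : compact (f @` K).
  by apply: continuous_compact => //; apply: continuous_subspaceT.
have [B [Br hB]] := compact_bounded cfK.
pose C := M + (`|B| + 1); have BC : B < C by have := ler_norm B; rewrite /C; lra.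
exists C; first by rewrite /C; have := normr_ge0 B; lra.
split=> [x|x nx].
  have [Kx|nK] := pselect (K x); last by rewrite f0// normr0 /C; have := normr_ge0 B; lra.
  by apply: (hB _ BC); exists x.
apply: f0 => /hM [h1 h2 h3]; apply: nx; move: h1 h2 h3; rewrite /rbox /= /C.
have := normr_ge0 B; move: `|B| => b b0 /andP[? ?] /andP[? ?] /andP[? ?].
by split; apply/andP; split; lra.
Qed.

Lemma C1c_bcs chi : C1c chi -> bcs chi.
Proof.
move=> [d c [K cK K0]]; apply: continuous_supp_bcs cK K0 => x.
exact: differentiable_continuous.
Qed.

Lemma C1c_pd_bcs j chi : C1c chi -> bcs (pd j chi).
Proof.
move=> [d c [K cK K0]]; apply: (continuous_supp_bcs (c j) cK) => x.
exact: pd_supp.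
Qed.

Lemma upd_line j t h x : h *: basis j + upd j t x = upd j (t + h) x.
Proof.
by rewrite /basis /upd; case: j => -[|[|[|//]]] ?; congr (_, _, _); rewrite /= /GRing.scale /=
  ?mulr1 ?mulr0 ?add0r // addrC.
Qed.

Lemma is_derive_line chi j x t : differentiable chi (upd j t x) ->
  is_derive t 1 (fun s => chi (upd j s x)) (pd j chi (upd j t x)).
Proof.
move=> dchi; have : derivable chi (upd j t x) (basis j) by exact: diff_derivable.
have E : (fun h : R => h^-1 *: (chi (upd j (h *: 1 + t) x) - chi (upd j t x))) =
         (fun h : R => h^-1 *: (chi (h *: basis j + upd j t x) - chi (upd j t x))).
  by apply/funext => h; rewrite upd_line [h%:A]mulr1 [h + t]addrC.
rewrite /derivable => dd; split; rewrite /derivable /pd /derive /=.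
  by move: dd; rewrite /= -E.
by congr lim; rewrite -E.
Qed.

Lemma C1c_line_continuous (f : pt R -> R) j x : continuous f -> continuous (fun t => f (upd j t x)).
Proof.
move=> cf t; apply: (@continuous_comp _ _ _ (fun t => upd j t x) f); last exact: cf.
rewrite (_ : (upd j)^~ x = fun s => s *: basis j + upd j 0 x); last first.
  by apply/funext => s; rewrite upd_line add0r.
by apply: cvgD; [apply: cvgZr_tmp; exact: cvg_id|exact: cvg_cst].
Qed.

Lemma line_FTC chi j x (a b : R) : C1c chi -> a < b ->
  (\int[leb]_(t in `[a, b]) (pd j chi (upd j t x))%:E =
   (chi (upd j b x))%:E - (chi (upd j a x))%:E)%E.
Proof.
move=> [d c _] ab.
have dl t := is_derive_line (d (upd j t x)).
have cl : continuous (fun t => chi (upd j t x)).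
  by apply: C1c_line_continuous => y; exact: differentiable_continuous.
apply: (@continuous_FTC2 _ (fun t => pd j chi (upd j t x)) (fun t => chi (upd j t x))) => //.
- by apply: continuous_subspaceT; apply: C1c_line_continuous.
- split.
  + by move=> t _; have [] := dl t.
  + by apply: cvg_at_right_filter; exact: cl.
  + by apply: cvg_at_left_filter; exact: cl.
- by move=> t _; rewrite derive1E; have [_ ->] := dl t.
Qed.

Lemma line_integral0 chi j x : C1c chi -> (\int[leb]_t (pd j chi (upd j t x))%:E = 0)%E.
Proof.
move=> Cchi; have [_ [M M0 [_ h0]]] := C1c_bcs Cchi.
have [d c [K cK K0]] := Cchi.
have [_ [N N0 [_ g0]]] := C1c_pd_bcs j Cchi.
pose B : R := M + N.
have nin (t : R) (L : R) : ~ (- L < t < L) -> ~ rbox (- L, - L, - L) (L, L, L) (upd j t x).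
  move=> ht -[/= h1 h2 h3]; apply: ht; move: h1 h2 h3.
  by rewrite /upd; have := ltn_ord j; case: (nat_of_ord j) => [|[|[|]]].
have -> : (\int[leb]_t (pd j chi (upd j t x))%:E =
          \int[leb]_(t in `[(- B)%R, B]) (pd j chi (upd j t x))%:E)%E.
  rewrite [RHS]integral_mkcond; apply: eq_integral => t _; rewrite patchE.
  case: ifPn => // /negP tB; rewrite g0//; apply: nin => /andP[t1 t2]; apply: tB.
  by rewrite inE/= in_itv/=; apply/andP; split; rewrite /B; lra.
rewrite line_FTC//; last by rewrite /B; lra.
rewrite !h0 ?sube0//; apply: nin => /andP[]; rewrite /B; lra.
Qed.

Definition indep j (a : pt R -> R) := forall t x, a (upd j t x) = a x.

Lemma bcs_mul (a : mpt R -> R) F : measurable_fun setT a ->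
  (exists M, forall x, `|a x| <= M) -> bcs F -> bcs (fun x => a x * F x).
Proof.
move=> ma [B hB] [mF [M M0 [FM F0]]]; split; first exact: measurable_funM.
pose C := M + `|B| * M; have C0 : 0 < C by rewrite ltr_wpDr// mulr_ge0 // ltW.
exists C => //; split=> [x|x nx].
  rewrite normrM; apply: (@le_trans _ _ (`|B| * M)); last by rewrite lerDr ltW.
  by apply: ler_pM => //; apply: (le_trans (hB x)); exact: ler_norm.
rewrite F0 ?mulr0// => -[h1 h2 h3]; apply: nx; move: h1 h2 h3; rewrite /rbox /=.
have : M <= C by rewrite lerDl mulr_ge0// ltW.
by move: C {C0} => C' ? /andP[? ?] /andP[? ?] /andP[? ?]; split; apply/andP; split; lra.
Qed.

(* Only invariance of the weight along the j-axis is used, never its smoothness. *)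
Lemma weighted_pd_integral0 chi j (a : mpt R -> R) : C1c chi -> measurable_fun setT a ->
  (exists M, forall x, `|a x| <= M) -> indep j a ->
  \int[leb3]_x (a x * pd j chi x) = 0.
Proof.
move=> Cchi ma ba ia; apply: (coord_fubini (j := j)).
  by apply: bcs_mul => //; exact: C1c_pd_bcs.
move=> x; rewrite /Rintegral; under eq_integral do rewrite ia EFinM.
rewrite integralZl//; first by rewrite line_integral0// mule0.
exact: bcs_slice (C1c_pd_bcs j Cchi).
Qed.

End TestCalculus.

(** * Du Bois-Reymond lemma *)

Section Bump.
Context {R : realType}.
Implicit Types (f g : R -> R) (n : nat).

(** Derivatives are supplied as witnesses, so stability under sums, products and affine
    substitutions is an induction on the order. *)
Fixpoint smooth1 n f : Prop :=
  if n is n'.+1 then exists2 df, (forall t, is_derive t (1 : R) f (df t)) & smooth1 n' df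
  else True.

Lemma smooth1S n f : smooth1 n.+1 f -> smooth1 n f.
Proof. by elim: n f => [|n IH] f // [df hdf sdf]; exists df => //; exact: IH. Qed.

Lemma smooth1D n f g : smooth1 n f -> smooth1 n g -> smooth1 n (fun t => f t + g t).
Proof.
elim: n f g => [|n IH] f g // [df hf sf] [dg hg sg].
by exists (fun t => df t + dg t); [move=> t; exact: is_deriveD|exact: IH].
Qed.

Lemma smooth1M n f g : smooth1 n f -> smooth1 n g -> smooth1 n (fun t => f t * g t).
Proof.
elim: n f g => [|n IH] f g // sf sg; have [sf' sg'] := (smooth1S sf, smooth1S sg).
case: sf sg => [df hf sf] [dg hg sg].
exists (fun t => f t * dg t + g t * df t); first by move=> t; exact: is_deriveM.
by apply: smooth1D; apply: IH.
Qed.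

Lemma smooth1_cst n (c : R) : smooth1 n (fun=> c).
Proof.
elim: n c => [|n IH] c //; exists (fun=> 0) => //.
by move=> t; exact: is_derive_cst.
Qed.

Lemma smooth1_affine n f (a b : R) : smooth1 n f -> smooth1 n (fun t => f (a * t + b)).
Proof.
elim: n f => [|n IH] f // [df hf sf]; exists (fun t => df (a * t + b) * a).
  move=> t; have h := hf (a * t + b).
  have ha : is_derive t (1 : R) (fun s => a * s + b) a.
    apply: (is_derive_eq (is_deriveD (is_deriveZ a (is_derive_id t (1 : R))) (is_derive_cst b t 1))).
    by rewrite addr0 /GRing.scale/= mulr1.
  exact: (@is_derive1_comp _ f (fun s => a * s + b) t _ _ h ha).
by apply: smooth1M; [exact: IH|exact: smooth1_cst].
Qed.

(* [flat k t = t^-k exp(-1/t)]: closed under differentiation up to linear combination. *)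
Definition flat k (t : R) : R := if 0 < t then t^-1 ^+ k * expR (- t^-1) else 0.

Lemma flat_ge0 k t : 0 <= flat k t.
Proof. by rewrite /flat; case: ifP => // t0; rewrite mulr_ge0 ?exprn_ge0 ?invr_ge0 ?expR_ge0// ltW. Qed.

(** With [x = 1 / t], the inequality [exp (x / (k + 1)) >= x / (k + 1)] raised to the power [k + 1]
    beats [x ^ k] with one power of [x] to spare. *)
Lemma flat_le k t : 0 < t -> flat k t <= k.+1%:R ^+ k.+1 * t.
Proof.
move=> t0; rewrite /flat t0 expRN; set x := t^-1.
have x0 : 0 < x by rewrite invr_gt0.
have h : (x / k.+1%:R) ^+ k.+1 <= expR x.
  have -> : expR x = expR (x / k.+1%:R) ^+ k.+1 by rewrite -expRM_natl mulrC divfK.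
  apply: lerXn2r; rewrite ?nnegrE ?expR_ge0 ?divr_ge0 ?(ltW x0)//.
  by apply: le_trans (expR_ge1Dx _); rewrite lerDr.
rewrite ler_pdivrMr ?expR_gt0//.
have -> : x ^+ k = k.+1%:R ^+ k.+1 * t * (x / k.+1%:R) ^+ k.+1.
  rewrite /x exprMn [t^-1 ^+ k.+1]exprSr !exprVn; field.
  by rewrite ?expf_neq0 ?pnatr_eq0// gt_eqF.
by apply: ler_wpM2l => //; rewrite mulr_ge0 ?exprn_ge0// ltW.
Qed.

(** Away from 0 this is calculus. At 0 the difference quotient from the right is [flat k.+1], which
    tends to 0 by [flat_le]. *)
Lemma flat_derive k t : is_derive t (1 : R) (flat k) (flat k.+2 t - k%:R * flat k.+1 t).
Proof.
have [t0|t0|->] := ltrgtP t 0.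
- have E : \near t, cst 0 t = flat k t.
    near=> s; rewrite /flat/= ifF//; apply/negbTE; rewrite -leNgt ltW//.
    by near: s; exact: lt_nbhsl.
  rewrite {2 3}/flat !ifF ?mulr0 ?subr0; try by apply/negbTE; rewrite -leNgt ltW.
  by apply: (near_eq_is_derive E); exact: is_derive_cst.
- have E : \near t, (fun s => s^-1 ^+ k * expR (- s^-1)) t = flat k t.
    near=> s; rewrite /flat/= ifT//.
    by near: s; exact: lt_nbhsr.
  rewrite {2 3}/flat !t0.
  apply: (near_eq_is_derive E).
  have tn0 : t != 0 by rewrite gt_eqF.
  have dV : is_derive t (1 : R) (fun s => s^-1) (- t^-1 ^+ 2).
    apply: (is_derive_eq (@is_deriveV _ id t 1 1 tn0 (is_derive_id t (1 : R)))).
    by rewrite /GRing.scale/= mulr1 exprVn.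
  have dE := @is_derive1_comp _ expR (fun s => - s^-1) t _ _ (is_derive_expR (- t^-1)) (is_deriveN dV).
  have dX : is_derive t (1 : R) (fun s => s^-1 ^+ k) (- (k%:R * t^-1 ^+ k.+1)).
    elim: (k) => [|m IH].
      by rewrite mul0r oppr0; exact: (is_derive_cst (1 : R) t (1 : R)).
    rewrite (_ : (fun s => s^-1 ^+ m.+1) = (fun s : R => s^-1 * s^-1 ^+ m)); last first.
      by apply/funext => s; rewrite exprS.
    apply: (is_derive_eq (is_deriveM dV IH)).
    by rewrite /GRing.scale/= !exprS; ring.
  apply: (is_derive_eq (is_deriveM dX dE)).
  rewrite /GRing.scale/= !exprS; ring.
- rewrite {2 3}/flat ltxx mulr0 subr0.
  have H : (fun h : R => h^-1 *: ((flat k \o shift 0) (h *: 1) - flat k 0)) @ 0^' --> (0 : R).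
    apply/cvgrPdist_le => e e0; near=> h.
    rewrite sub0r normrN /= addr0 [h%:A]mulr1 {2}/flat ltxx subr0.
    have h0 : h != 0 by near: h; exact: nbhs_dnbhs_neq.
    have [hp|hp] := ltrP 0 h; last by rewrite {1}/flat ltNge hp/= scaler0 normr0 ltW.
    have -> : h^-1 *: flat k h = flat k.+1 h.
      by rewrite /flat hp /GRing.scale/= exprS mulrA.
    rewrite ger0_norm ?flat_ge0//; apply: (le_trans (flat_le k.+1 hp)).
    rewrite mulrC -ler_pdivlMr ?exprn_gt0//.
    rewrite -(gtr0_norm hp); near: h.
    apply: (@nbhs_dnbhs R); apply/nbhs_normP; exists (e / k.+2%:R ^+ k.+2).
      by rewrite /= divr_gt0 ?exprn_gt0.
    by move=> y /=; rewrite sub0r normrN; exact: ltW.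
  by split; [apply/cvg_ex; exists 0|exact: cvg_lim].
Unshelve. all: by end_near. Qed.

Lemma flat_smooth1 n k : smooth1 n (flat k).
Proof.
elim: n k => [|n IH] k //; exists (fun t => flat k.+2 t - k%:R * flat k.+1 t).
  exact: flat_derive.
apply: smooth1D => //.
rewrite (_ : (fun t => - _) = fun t => (- k%:R) * flat k.+1 t).
  by apply: smooth1M => //; exact: smooth1_cst.
by apply/funext => t; rewrite mulNr.
Qed.

End Bump.

Section Tensor.
Context {R : realType}.
Implicit Types (f g : R -> R) (F : 'I_3 -> R -> R) (x : pt R).

Definition smooth1o f := forall n, smooth1 n f.
Definition der f : R -> R := fun t => 'D_1 f t.

Lemma smooth1o_der f : smooth1o f -> (forall t, is_derive t (1 : R) f (der f t)) /\ smooth1o (der f).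
Proof.
move=> sf; split=> [t|n].
  by have [df hdf _] := sf 1%N; rewrite /der (@derive_val _ _ _ _ _ _ _ (hdf t)).
have [df hdf sdf] := sf n.+1; rewrite (_ : der f = df)//.
by apply/funext => t; rewrite /der (@derive_val _ _ _ _ _ _ _ (hdf t)).
Qed.

Definition tens F : pt R -> R := fun x => \prod_(j < 3) F j (xcoord x j).

Lemma differentiable_xcoord j x : differentiable (fun y : pt R => xcoord y j) x.
Proof.
have d1 (y : pt R) : differentiable (fun z : pt R => z.1) y.
  by apply: linear_differentiable; move=> z; exact: cvg_fst.
have d2 (y : pt R) : differentiable (fun z : pt R => z.2) y.
  by apply: linear_differentiable; move=> z; exact: cvg_snd.
have d3 (y : R * R) : differentiable (fun z : R * R => z.1) y.
  by apply: linear_differentiable; move=> z; exact: cvg_fst.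
have d4 (y : R * R) : differentiable (fun z : R * R => z.2) y.
  by apply: linear_differentiable; move=> z; exact: cvg_snd.
case: j => -[|[|[|//]]] ? ; rewrite /xcoord /=.
- exact: (differentiable_comp (d1 x) (d3 x.1)).
- exact: (differentiable_comp (d1 x) (d4 x.1)).
- exact: d2.
Qed.

Lemma differentiable_tens F x : (forall j, smooth1o (F j)) -> differentiable (tens F) x.
Proof.
move=> sF; rewrite /tens.
have dF j : differentiable (fun y : pt R => F j (xcoord y j)) x.
  apply: (@differentiable_comp _ _ _ _ (fun y : pt R => xcoord y j) (F j)).
    exact: differentiable_xcoord.
  apply/derivable1_diffP; have [h _] := smooth1o_der (sF j).
  exact: (@ex_derive _ _ _ _ _ _ _ (h _)).
rewrite (_ : (fun y => _) = (fun y : pt R => F ord0 (xcoord y ord0)) *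
  ((fun y : pt R => F (lift ord0 ord0) (xcoord y (lift ord0 ord0))) *
   (fun y : pt R => F (lift ord0 (lift ord0 ord0)) (xcoord y (lift ord0 (lift ord0 ord0)))))).
  by apply: differentiableM => //; exact: differentiableM.
by apply/funext => y; rewrite !big_ord_recl big_ord0 mulr1.
Qed.

Lemma pd_tens F j : (forall j, smooth1o (F j)) ->
  pd j (tens F) = tens (fun i => if i == j then der (F j) else F i).
Proof.
move=> sF; apply/funext => x; set t := xcoord x j.
have h1 : is_derive t (1 : R) (fun s => tens F (upd j s x)) (pd j (tens F) (upd j t x)).
  by apply: is_derive_line; exact: differentiable_tens.
have [hd _] := smooth1o_der (sF j).
have E s : tens F (upd j s x) = (\prod_(i < 3 | i != j) F i (xcoord x i)) * F j s.
  rewrite /tens (bigD1 j)//= xcoord_upd mulrC; congr (_ * _).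
  by apply: eq_bigr => i ij; rewrite xcoord_upd_neq.
have h2 : is_derive t (1 : R) (fun s => tens F (upd j s x))
    ((\prod_(i < 3 | i != j) F i (xcoord x i)) * der (F j) t).
  by under eq_fun do rewrite E; exact: is_deriveZ.
have := @derive_val _ _ _ _ _ _ _ h1; rewrite (@derive_val _ _ _ _ _ _ _ h2).
rewrite /t upd_xcoord => <-; rewrite /tens [RHS](bigD1 j)//= eqxx mulrC; congr (_ * _).
by apply: eq_bigr => i /negbTE ->.
Qed.

Lemma smooth_tens F : (forall j, smooth1o (F j)) -> smooth (tens F).
Proof.
move=> sF s; suff [G [sG ->]] : exists G, (forall j, smooth1o (G j)) /\ foldr pd (tens F) s = tens G.
  by move=> x; exact: differentiable_tens.
elim: s => [|j s [G [sG IH]]]; first by exists F.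
exists (fun i => if i == j then der (G j) else G i); split=> [i|]; last by rewrite /= IH pd_tens.
by case: ifP => // _; have [] := smooth1o_der (sG j).
Qed.

(** For a product of functions of one variable each derivative acts on its own factor, so
    commutation is algebraic. Symmetry for general test functions is deduced from this case by
    duality. *)
Lemma pd_tensC F i j : (forall j, smooth1o (F j)) -> pd i (pd j (tens F)) = pd j (pd i (tens F)).
Proof.
move=> sF; have [->//|ij] := eqVneq i j.
have sD a k : smooth1o (if k == a then der (F a) else F k).
  by case: ifP => // _; have [] := smooth1o_der (sF a).
rewrite !pd_tens//; congr tens; apply/funext => k.
have ji : j != i by rewrite eq_sym.
have [->|ki] := eqVneq k i; first by rewrite !ifN_eq.
by rewrite (ifN_eq _ _ ji).
Qed.

(** On the interval this is [exp (- 1 / ((n + 1) (t - a)))] times [exp (- 1 / ((n + 1) (b - t)))],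
    which tends to the indicator of the open interval as [n] grows. The arguments are in the form
    [a * t + b] expected by [smooth1_affine]. *)
Definition bump1 (n : nat) (a b : R) : R -> R :=
  fun t => flat 0 (n.+1%:R * t + - (n.+1%:R * a)) * flat 0 (- n.+1%:R * t + n.+1%:R * b).
Definition bump n (a b : pt R) : pt R -> R :=
  tens (fun j => bump1 n (xcoord a j) (xcoord b j)).

Lemma smooth1o_bump1 n a b : smooth1o (bump1 n a b).
Proof. by move=> k; apply: smooth1M; apply: smooth1_affine; exact: flat_smooth1. Qed.

Lemma flat0_le1 t : flat 0 t <= 1 :> R.
Proof.
rewrite /flat; case: ifP => // t0; rewrite expr0 mul1r -(expR0 R) ler_expR oppr_le0 invr_ge0.
exact: ltW.
Qed.

Lemma bump1_ge0 n a b t : 0 <= bump1 n a b t. 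
Proof. by rewrite mulr_ge0 ?flat_ge0. Qed.

Lemma bump1_le1 n a b t : bump1 n a b t <= 1. 
Proof. by rewrite mulr_ile1 ?flat_ge0 ?flat0_le1. Qed.

Lemma bump1_out n a b t : ~~ (a < t < b) -> bump1 n a b t = 0.
Proof.
have flat0 (u : R) : u <= 0 -> flat 0 u = 0 by rewrite leNgt /flat => /negbTE ->.
rewrite negb_and -!leNgt /bump1 => /orP[h|h].
  by rewrite flat0 ?mul0r// -mulrBr pmulr_rle0// subr_le0.
by rewrite [X in _ * X]flat0 ?mulr0// mulNr addrC -mulrBr pmulr_rle0// subr_le0.
Qed.

Lemma cvg_flat0 (u : R) : 0 < u -> flat 0 (n.+1%:R * u) @[n --> \oo] --> (1 : R).
Proof.
move=> u0; have E : (fun n : nat => flat 0 (n.+1%:R * u)) = expR \o (fun n => - (@harmonic R n * u^-1)).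
  by apply/funext => n; rewrite /flat mulr_gt0// expr0 mul1r invfM.
rewrite E -(expR0 R); apply: continuous_cvg; first exact: continuous_expR.
have h : harmonic n * u^-1 @[n --> \oo] --> (0 * u^-1 : R).
  by apply: cvgMr_tmp; exact: cvg_harmonic.
rewrite -[X in _ --> X]oppr0 -[X in - X](mul0r u^-1).
exact: (cvgN h).
Qed.

Lemma cvg_bump1 (a b t : R) : bump1 n a b t @[n --> \oo] --> ((a < t < b)%R%:R : R).
Proof.
have [/andP[at_ tb]|h] := boolP (a < t < b); last first.
  by under eq_fun do rewrite bump1_out//; exact: cvg_cst.
rewrite /bump1 -[X in _ --> X]mulr1; apply: cvgM.
  by under eq_fun do rewrite -mulrBr; apply: cvg_flat0; rewrite subr_gt0.
by under eq_fun do rewrite mulNr addrC -mulrBr; apply: cvg_flat0; rewrite subr_gt0.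
Qed.

Lemma rboxE (a b x : pt R) : (\prod_(j < 3) (xcoord a j < xcoord x j < xcoord b j)%R%:R : R) =
  \1_(rbox a b) x.
Proof.
rewrite !big_ord_recl big_ord0 mulr1 /= /xcoord /= -!natrM !mulnb indicE; congr ((_ : bool)%:R).
apply/idP/idP => [/and3P[h1 h2 h3]|/set_mem[h1 h2 h3]]; last exact/and3P.
by apply/mem_set; split.
Qed.

Lemma cvg_bump (a b x : pt R) : bump n a b x @[n --> \oo] --> (\1_(rbox a b) x : R).
Proof.
rewrite -rboxE /bump /tens; under eq_fun do rewrite !big_ord_recl big_ord0.
rewrite !big_ord_recl big_ord0; apply: cvgM; first exact: cvg_bump1.
apply: cvgM; first exact: cvg_bump1.
by apply: cvgM; [exact: cvg_bump1|exact: cvg_cst].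
Qed.

Lemma smooth_bump n a b : smooth (bump n a b).
Proof. by apply: smooth_tens => j; exact: smooth1o_bump1. Qed.

Lemma bump_ge0 n a b x : 0 <= bump n a b x.
Proof. by apply: prodr_ge0 => j _; exact: bump1_ge0. Qed.

Lemma bump_le1 n a b x : bump n a b x <= 1.
Proof. by apply: prodr_ile1 => j _; rewrite bump1_ge0 bump1_le1. Qed.

Lemma compact_cbox (a b : pt R) : compact (cbox a b).
Proof.
rewrite (_ : cbox a b = (`[a.1.1, b.1.1] `*` `[a.1.2, b.1.2]) `*` `[a.2, b.2]).
  by apply: compact_setX; [apply: compact_setX|]; exact: segment_compact.
by apply/seteqP; split => x /=; rewrite /cbox /= !in_itv/=; [case|move=> [[]]].
Qed.

Lemma bump_out n a b x : ~ cbox a b x -> bump n a b x = 0.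
Proof.
move=> nx; have [h|/existsNP [j hj]] := pselect (forall j, xcoord a j < xcoord x j < xcoord b j).
  exfalso; apply: nx; apply: rbox_sub_cbox; split.
  - exact: (h ord0).
  - exact: (h (Ordinal (isT : 1 < 3)%N)).
  - exact: (h (Ordinal (isT : 2 < 3)%N)).
by rewrite /bump /tens (bigD1 j)//= bump1_out ?mul0r//; apply/negP.
Qed.

Lemma test_bump (D : set (pt R)) n a b : cbox a b `<=` D -> test_fun D (bump n a b).
Proof.
move=> hD; split; first exact: smooth_bump.
by exists (cbox a b); split => //; [exact: compact_cbox|exact: bump_out].
Qed.

End Tensor.

Section DuBoisReymond.
Context {R : realType}.

Definition rboxes : set (set (mpt R)) := [set A | exists a b, A = rbox a b].

Lemma measurable_rboxes : @measurable _ (mpt R) = <<s rboxes >>.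
Proof.
apply/seteqP; split => [A mA|]; last first.
  apply: smallest_sub; first exact: sigma_algebra_measurable.
  by move=> _ [a [b ->]]; exact: measurable_rbox.
pose T := g_sigma_algebraType rboxes.
have mx j : measurable_fun (setT : set T) (fun x : T => xcoord (x : pt R) j).
  apply: (measurability _ (RGenOpens.measurableE R)).
  move=> _ [_ [u [v ->]] <-]; rewrite setTI.
  rewrite (_ : _ @^-1` _ = \bigcup_n (rbox (upd j u (- n%:R, - n%:R, - n%:R)) (upd j v (n%:R, n%:R, n%:R)))).
    apply: bigcup_measurable => n _; apply: sub_sigma_algebra.
    by exists (upd j u (- n%:R, - n%:R, - n%:R)), (upd j v (n%:R, n%:R, n%:R)).
  apply/seteqP; split => x /=.
    rewrite in_itv/= => hx.
    pose M : R := `|x.1.1| + `|x.1.2| + `|x.2|.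
    have [n hn] : exists n : nat, M < n%:R.
      by exists (Num.truncn M).+1; exact: truncnS_gt.
    exists n => //.
    have [g1 g2 g3] : [/\ - n%:R < x.1.1 < n%:R, - n%:R < x.1.2 < n%:R & - n%:R < x.2 < n%:R].
      have := normr_ge0 x.1.1; have := normr_ge0 x.1.2; have := normr_ge0 x.2.
      move: hn; rewrite /M -!ltr_norml; move: `|_| `|_| `|_| => p q r *; split; lra.
    by move: hx; rewrite /rbox /upd /xcoord; case: (j) => -[|[|[|//]]] ? /= hx; split.
  move=> [n _]; rewrite in_itv/= /rbox /upd /xcoord.
  by case: (j) => -[|[|[|//]]] ? /= [].
have : measurable_fun (setT : set T) (fun x : T => (x : mpt R)).
  rewrite (_ : (fun x : T => _) = fun x => ((xcoord (x : pt R) ord0,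
    xcoord (x : pt R) (Ordinal (isT : 1 < 3)%N)), xcoord (x : pt R) (Ordinal (isT : 2 < 3)%N))).
    apply: measurable_fun_pair; last exact: mx.
    by apply: measurable_fun_pair; exact: mx.
  by apply/funext => -[[]].
by move=> /(_ measurableT A mA); rewrite setTI.
Qed.

Lemma rbox_setI (a b c d : pt R) : exists a' b',
  rbox a b `&` rbox c d = rbox a' b' /\ cbox a' b' `<=` cbox a b.
Proof.
exists (Order.max a.1.1 c.1.1, Order.max a.1.2 c.1.2, Order.max a.2 c.2),
  (Order.min b.1.1 d.1.1, Order.min b.1.2 d.1.2, Order.min b.2 d.2).
split; last first.
  move=> x; rewrite /cbox /= !ge_max !le_min.
  by move=> [/andP[/andP[-> _] /andP[-> _]] /andP[/andP[-> _] /andP[-> _]] /andP[/andP[-> _] /andP[-> _]]].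
apply/seteqP; split => x; rewrite /rbox /= !gt_max !lt_min.
  by move=> [[/andP[-> ->] /andP[-> ->] /andP[-> ->]] [/andP[-> ->] /andP[-> ->] /andP[-> ->]]].
by move=> [/andP[/andP[-> ->] /andP[-> ->]] /andP[/andP[-> ->] /andP[-> ->]] /andP[/andP[-> ->] /andP[-> ->]]].
Qed.

Lemma rboxes_setI : setI_closed rboxes.
Proof.
move=> _ _ [a [b ->]] [c [d ->]].
by have [a' [b' [-> _]]] := rbox_setI a b c d; exists a', b'.
Qed.

(* Du Bois-Reymond: it is enough to test against bumps that are products. *)
Lemma bump_ae0 (D : set (pt R)) (F : mpt R -> R) : open D ->
  leb3.-integrable (D : set (mpt R)) (EFin \o F) ->
  (forall n a b, cbox a b `<=` D -> \int[leb3]_(x in (D : set (mpt R))) (F x * bump n a b x) = 0) ->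
  {ae leb3, forall x : mpt R, (D : set (mpt R)) x -> F x = 0}.
Proof.
move=> oD iF h; have mD : measurable (D : set (mpt R)) := open_measurable3 oD.
have mF : measurable_fun (D : set (mpt R)) F by apply/measurable_EFinP; exact: measurable_int iF.
(* The bumps stay between 0 and 1 and converge to the indicator of the open box, so [F]
   dominates. *)
have step1 a b : cbox a b `<=` D -> (\int[leb3]_(x in (rbox a b : set (mpt R))) (F x)%:E = 0)%E.
  move=> abD; have rD : rbox a b `<=` D by move=> x /rbox_sub_cbox; exact: abD.
  rewrite -[LHS](_ : \int[leb3]_(x in (D : set (mpt R))) (F x * \1_(rbox a b) x)%:E = _)%E; last first.
    rewrite integral_mkcond [RHS]integral_mkcond; apply: eq_integral => x _.
    rewrite !patchE indicE; have [xr|_] := boolP (x \in rbox a b).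
      by rewrite mem_set ?mulr1//; apply: rD; exact: set_mem.
    by case: ifP => // _; rewrite mulr0.
  pose f_ n (x : mpt R) := (F x * bump n a b x)%:E.
  have mb n : measurable_fun (D : set (mpt R)) (bump n a b : mpt R -> R).
    by apply: continuous_measurable3 => //; apply: smooth_continuous; exact: smooth_bump.
  have ab1 n x : `|bump n a b x| <= 1 by rewrite ger0_norm ?bump_ge0// bump_le1.
  have mf n : measurable_fun (D : set (mpt R)) (f_ n).
    by apply/measurable_EFinP; exact: measurable_funM.
  have mi : measurable_fun (D : set (mpt R)) (fun x => (F x * \1_(rbox a b) x)%:E).
    apply/measurable_EFinP; apply: measurable_funM => //.
    by apply: measurable_indic; exact: measurable_rbox.
  have cf x : (D : set (mpt R)) x -> f_ ^~ x @ \oo --> (F x * \1_(rbox a b) x)%:E.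
    move=> _; apply: cvg_EFin; first by near=> n.
    by apply: cvgMl_tmp; exact: cvg_bump.
  have df x n : (D : set (mpt R)) x -> (`|f_ n x| <= `|(F x)%:E|)%E.
    by move=> _; rewrite lee_fin normrM ler_piMr.
  have [_ _] := dominated_convergence mD mf mi (aeW _ cf) (integrable_abse iF) (aeW _ df).
  have f0 n : (\int[leb3]_(x in (D : set (mpt R))) f_ n x = 0)%E.
    have if_ : leb3.-integrable (D : set (mpt R)) (f_ n).
      by apply: (le_integrable mD (mf n) _ (integrable_abse iF)) => x Dx; rewrite abse_id; exact: df.
    have := h n a b abD; rewrite /Rintegral => h0.
    by rewrite -[LHS]fineK ?integrable_fin_num// h0.
  under eq_cvg do rewrite /= f0.
  by move/(cvg_unique _ (cvg_cst _)) => <-//; exact: ereal_hausdorff.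
(* Boxes form a pi-system generating the sigma-algebra, so Dynkin's lemma extends the vanishing from
   boxes to every measurable part of a fixed box. *)
have step2 a b : cbox a b `<=` D -> forall C : set (mpt R), measurable C ->
    (\int[leb3]_(x in (rbox a b `&` C : set (mpt R))) (F x)%:E = 0)%E.
  move=> abD; have rD : rbox a b `<=` D by move=> x /rbox_sub_cbox; exact: abD.
  have mr : measurable (rbox a b : set (mpt R)) := measurable_rbox a b.
  have iS (E : set (mpt R)) : measurable E -> E `<=` rbox a b -> leb3.-integrable E (EFin \o F).
    by move=> mE Er; apply: (integrableS mD) => //; exact: subset_trans Er rD.
  rewrite measurable_rboxes; apply: (dynkin_induction measurable_rboxes rboxes_setI).
  - by rewrite setIT; exact: step1.
  - move=> _ [c [d ->]].
    have [a' [b' [-> sub]]] := rbox_setI a b c d.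
    by apply: step1; exact: subset_trans sub abD.
  - move=> S mS hS.
    have := @integral_setU _ _ _ leb3 (rbox a b `&` S) (rbox a b `&` ~` S) (EFin \o F)
      (measurableI _ _ mr mS) (measurableI _ _ mr (measurableC mS)).
    rewrite -setIUr setUv setIT => /(_ (measurable_int _ (iS _ mr (@subset_refl _ _)))).
    rewrite /= step1// hS add0e => <- //.
    by apply/disj_set2P; rewrite setIACA setICr setI0.
  - move=> S mS tS hS; rewrite setI_bigcupr.
    rewrite integral_bigcup.
    + by rewrite eseries0// => i _ _; exact: hS.
    + exact: trivIset_setIl.
    + by move=> k; exact: measurableI.
    + by apply: iS; [apply: bigcup_measurable => k _; exact: measurableI|move=> x [k _ []]].
have step3 a b : cbox a b `<=` D -> {ae leb3, forall x : mpt R, (rbox a b : set (mpt R)) x -> F x = 0}.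
  move=> abD; have rD : rbox a b `<=` D by move=> x /rbox_sub_cbox; exact: abD.
  have mr : measurable (rbox a b : set (mpt R)) := measurable_rbox a b.
  have := @integral_ae_eq _ _ _ leb3 (rbox a b) mr (cst 0%E) (EFin \o F) (integrableS mD mr rD iF)
    (measurable_cst _) _.
  have h0 E : E `<=` (rbox a b : set (mpt R)) -> measurable E ->
      (\int[leb3]_(x in E) (EFin \o F) x = \int[leb3]_(x in E) cst 0%E x)%E.
    by move=> Er mE; rewrite integral0 -(setIidr Er); exact: step2.
  move=> /(_ h0); apply: filterS => x hx rx; have := hx rx => -[]//.
(* The rational boxes are enumerated by [unpickle], so countably many exceptional null sets are
   united. *)
have : {ae leb3, forall x : mpt R, forall n, forall q, unpickle n = Some q ->
    ratcbox q `<=` D -> (ratbox q : set (pt R)) x -> F x = 0}.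
  apply: ae_foralln => n; case E : (unpickle n) => [q|]; last by apply: aeW => x q.
  have [qD|nqD] := pselect (ratcbox q `<=` D); last by apply: aeW => x q' [<-].
  by apply: filterS (step3 _ _ qD) => x hx q' [<-] _ /hx.
apply: filterS => x hx Dx; have [q [qD qx]] := nbhs_ratbox oD Dx.
exact: (hx (pickle q) q (pickleK q) qD qx).
Unshelve. all: by end_near. Qed.

End DuBoisReymond.

(** * The space of functions vanishing on the boundary *)

Section Closure.
Context {R : realType} {V : lmodType R[i]}.
Variables (ip : hform V) (G : set V).
Notation nsq := (nsq ip).

Definition hclosure : set V := [set w | forall e, 0 < e -> exists2 v, G v & nsq (w - v) < e].

Lemma hclosureD : (forall v w, G v -> G w -> G (v + w)) ->
  forall v w, hclosure v -> hclosure w -> hclosure (v + w).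
Proof.
move=> hG v w cv cw e e0; have e40 : 0 < e / 4 by rewrite divr_gt0.
have [v' Gv hv] := cv _ e40; have [w' Gw hw] := cw _ e40.
exists (v' + w'); first exact: hG.
rewrite opprD addrACA; apply: (le_lt_trans (nsqD_le _ _ _)).
move: (nsq _) (nsq _) hv hw => a b *; lra.
Qed.

Lemma hclosureZ a : (forall v, G v -> G (a *: v)) -> forall v, hclosure v -> hclosure (a *: v).
Proof.
move=> hG v cv e e0.
have K0 : 0 < sqn a + 1 by rewrite ltr_wpDl// sqn_ge0.
have [v' Gv hv] := cv (e / (sqn a + 1)) (divr_gt0 e0 K0).
exists (a *: v'); first exact: hG.
rewrite -scalerBr nsqZ; move: hv; rewrite ltr_pdivlMr//; apply: le_lt_trans.
by rewrite mulrC ler_wpM2l ?nsq_ge0// lerDl.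
Qed.

Lemma sub_hclosure : G `<=` hclosure.
Proof. by move=> v Gv e e0; exists v => //; rewrite subrr nsq0. Qed.

Lemma hclosure_complete : complete_on ip setT -> complete_on ip hclosure.
Proof.
move=> cT x Gx cx; have [l _ hl] := cT x (fun _ => I) cx; exists l => // e e0.
have e40 : 0 < e / 4 by rewrite divr_gt0.
have [N hN] := hl _ e40; have [v Gv hv] := Gx N _ e40; exists v => //.
rewrite (_ : l - v = - (x N - l) + (x N - v)); last by rewrite opprB addrA subrK.
apply: (le_lt_trans (nsqD_le _ _ _)); rewrite nsqN; have := hN N (leqnn N).
by move: (nsq _) (nsq _) hv => a b *; lra.
Qed.

(** Boundedness carries the vanishing from the dense set to its closure in one argument at a
    time. *)
Lemma dense_form0 b : sesqui b -> bounded_form ip b ->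
  (forall v w, G v -> G w -> b v w = 0) -> forall v w, hclosure v -> hclosure w -> b v w = 0.
Proof.
move=> sb /bounded_form_pos[C C0 hC] h0.
have small (K : R) (z : R[i]) : 0 <= K -> (forall e, 0 < e -> sqn z <= e * K) -> z = 0.
  move=> K0 hz; apply: sqn_eq0; apply: eps_le0 => [|e e0]; first exact: sqn_ge0.
  apply: (le_trans (hz (e / (K + 1)) _)); first by rewrite divr_gt0// ltr_wpDl.
  by rewrite mulrAC ler_pdivrMr ?ltr_wpDl// ler_wpM2l ?(ltW e0)// lerDl.
have h1 v w : hclosure v -> G w -> b v w = 0.
  move=> cv Gw; apply: (small (C * nsq w)) => [|e e0]; first by rewrite mulr_ge0 ?nsq_ge0// ltW.
  have [v' Gv hv] := cv e e0.
  have -> : b v w = b (v - v') w by rewrite sesBl ?(h0 v')// subr0.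
  apply: (le_trans (hC _ _)); rewrite mulrCA; apply: ler_wpM2r; last exact: ltW.
  by rewrite mulr_ge0 ?nsq_ge0// ltW.
move=> v w cv cw; apply: (small (C * nsq v)) => [|e e0]; first by rewrite mulr_ge0 ?nsq_ge0// ltW.
have [w' Gw hw] := cw e e0.
have -> : b v w = b v (w - w') by rewrite sesBr ?(h1 _ w')// subr0.
apply: (le_trans (hC _ _)); rewrite [leLHS]mulrA [leLHS]mulrC; apply: ler_wpM2r; last exact: ltW.
by rewrite mulr_ge0 ?nsq_ge0// ltW.
Qed.

End Closure.

(** * Sesquilinear forms given by bounded coefficients, and calculus of test functions *)

Section MultForm.
Context {R : realType} (D : bdom R).
Implicit Types (f g : L2t D) (c : pt R -> R[i]).

Lemma cmeasM c c' : cmeas D c -> cmeas D c' -> cmeas D (fun x => c x * c' x).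
Proof.
move=> [a b] [a' b']; split.
  rewrite (_ : rpart _ = (rpart c \* rpart c') \- (ipart c \* ipart c')).
    by apply: measurable_funB; exact: measurable_funM.
  by apply/funext => x; rewrite /rpart /ipart /=; case: (c x) => u v; case: (c' x) => p q.
rewrite (_ : ipart _ = (rpart c \* ipart c') \+ (ipart c \* rpart c')).
  by apply: measurable_funD; exact: measurable_funM.
by apply/funext => x; rewrite /rpart /ipart /=; case: (c x) => u v; case: (c' x) => p q.
Qed.

Lemma cmeas_conj c : cmeas D c -> cmeas D (fun x => conjc (c x)).
Proof.
move=> [a b]; split.
  by rewrite (_ : rpart _ = rpart c)//; apply/funext => x; rewrite /rpart; case: (c x).
rewrite (_ : ipart _ = \- ipart c); first exact: measurableT_comp.
by apply/funext => x; rewrite /ipart /=; case: (c x).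
Qed.

Lemma cbddM c c' : cbdd D c -> cbdd D c' -> cbdd D (fun x => c x * c' x).
Proof.
by move=> [a ha] [b hb]; exists (a * b) => x Dx; rewrite sqnM ler_pM ?sqn_ge0 ?ha ?hb.
Qed.

Lemma cbdd_cst a : cbdd D (fun=> a).
Proof. by exists (sqn a). Qed.

Lemma L2_sqn_integrable (f : pt R -> R[i]) : L2 D f ->
  leb3.-integrable (D : set (mpt R)) (fun x => (sqn (f x))%:E).
Proof.
have mD := bdom_measurable D; move=> /(L2P _ mD)[f1 f2].
by apply: (eq_integrable mD _ _ _ (integrableD mD f1.2 f2.2)).
Qed.

Lemma nsq_l2E f : nsq (l2hform D) f = \int[leb3]_(x in (D : set (mpt R))) sqn (f x).
Proof. by rewrite /nsq /= /l2ip /cint/=; apply: eq_Rintegral => x _; rewrite mul_conjc_sqn. Qed.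

Definition mform c f g : R[i] := cint D (fun x => c x * f x * conjc (g x)).

Section Bounded.
Variables (c : pt R -> R[i]) (mc : cmeas D c) (bc : cbdd D c).

Lemma mform_integrable f g : cintegrable D (fun x => c x * f x * conjc (g x)).
Proof.
apply: L2_mul; first by apply: L2_bounded => //; exact: L2tP.
by apply: L2_conj; exact: L2tP.
Qed.

Lemma mform_sesqui : sesqui (mform c).
Proof.
have I := mform_integrable; split.
- move=> f g h; rewrite /mform -cintD//; apply: cint_eq => x _.
  by rewrite L2tDE mulrDr mulrDl.
- move=> a f h; rewrite /mform -cintZ//; apply: cint_eq => x _.
  by rewrite L2tZE; ring.
- move=> f g h; rewrite /mform -cintD//; apply: cint_eq => x _.
  by rewrite L2tDE rmorphD/= mulrDr.
- move=> a f h; rewrite /mform -cintZ//; apply: cint_eq => x _.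
  by rewrite L2tZE rmorphM/=; ring.
Qed.

Lemma mform_le M : (forall x, (D : set _) x -> sqn (c x) <= M) ->
  forall f g, sqn (mform c f g) <= M * (nsq (l2hform D) f * nsq (l2hform D) g).
Proof.
move=> hM f g; have Lcf := L2_bounded mc bc (L2tP f).
have -> : mform c f g = l2hform D (toL2 Lcf) g by [].
apply: (le_trans (cauchy_schwarz _ _ _)); rewrite mulrA; apply: ler_wpM2r; first exact: nsq_ge0.
have mD := bdom_measurable D; rewrite !nsq_l2E -RintegralZl//; last exact: L2_sqn_integrable (L2tP f).
apply: le_Rintegral => //.
- exact: L2_sqn_integrable Lcf.
- exact: (integrableZl mD M (L2_sqn_integrable (L2tP f))).
- by move=> x Dx; rewrite /= sqnM ler_wpM2r ?sqn_ge0// hM.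
Qed.

Lemma mform_bounded : bounded_form (l2hform D) (mform c).
Proof. by have [M hM] := bc; exists M; exact: mform_le. Qed.

End Bounded.

Lemma mformZ a c f g : cmeas D c -> cbdd D c ->
  mform (fun x => a * c x) f g = a * mform c f g.
Proof.
move=> ? ?; rewrite /mform -cintZ; last exact: mform_integrable.
by apply: cint_eq => x _; ring.
Qed.

End MultForm.

Section TestSpace.
Context {R : realType} (D : set (pt R)).
Implicit Types (f g phi psi : pt R -> R) (a : R).

Lemma pd_lin a j f g : (forall x, differentiable f x) -> (forall x, differentiable g x) ->
  pd j (fun x => a * f x + g x) = fun x => a * pd j f x + pd j g x.
Proof.
move=> df dg; apply/funext => x; rewrite /pd.
rewrite (_ : (fun y => a * f y + g y) = (a *: f) + g)//.
rewrite deriveD; [|apply: derivableZ; exact: diff_derivable|exact: diff_derivable].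
by rewrite deriveZ//; exact: diff_derivable.
Qed.

Lemma smooth_lin a f g : smooth f -> smooth g -> smooth (fun x => a * f x + g x).
Proof.
move=> sf sg s; suff -> : foldr pd (fun x => a * f x + g x) s =
    fun x => a * foldr pd f s x + foldr pd g s x.
  move=> x; rewrite (_ : (fun y => a * _ y + _ y) = (a *: foldr pd f s) + foldr pd g s)//.
  by apply: differentiableD; [apply: differentiableZ; exact: sf|exact: sg].
elim: s => [//|j s IH]; rewrite /= IH pd_lin//.
Qed.

Lemma test_lin a phi psi : test_fun D phi -> test_fun D psi ->
  test_fun D (fun x => a * phi x + psi x).
Proof.
move=> [s1 [K [cK KD K0]]] [s2 [L [cL LD L0]]]; split; first exact: smooth_lin.
exists (K `|` L); split; first exact: compactU.
  by move=> x [/KD|/LD].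
by move=> x nKL; rewrite K0 ?L0 ?mulr0 ?addr0//; apply: contra_not nKL; [right|left].
Qed.

Lemma test0 : test_fun D (fun=> 0).
Proof.
split; last by exists set0; split => //; exact: compact0.
have pd0 (j : 'I_3) : pd j (fun=> 0 : R) = fun=> 0.
  by apply/funext => x; rewrite /pd (derive_cst (V := pt R) (W := R^o)).
move=> s; suff -> : foldr pd (fun=> 0 : R) s = fun=> 0 by move=> x; exact: differentiable_cst.
by elim: s => //= j s ->.
Qed.

Lemma test_pd j phi : test_fun D phi -> test_fun D (pd j phi).
Proof.
move=> [s1 [K [cK KD K0]]]; split; first exact: smooth_pd.
by exists K; split => // x; exact: pd_supp.
Qed.

Definition cpd j (f : pt R -> R[i]) : pt R -> R[i] :=
  fun x => pd j (fun y => complex.Re (f y)) x +i* pd j (fun y => complex.Im (f y)) x.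

Lemma ctest_cpd j (f : pt R -> R[i]) : ctest_fun D f -> ctest_fun D (cpd j f).
Proof. by move=> [h1 h2]; split; exact: test_pd. Qed.

Lemma ctest_real phi : test_fun D phi -> ctest_fun D (fun x => (phi x)%:C).
Proof. by move=> h; split => //; exact: test0. Qed.

Lemma ctest_lin (a : R[i]) (f g : pt R -> R[i]) : ctest_fun D f -> ctest_fun D g ->
  ctest_fun D (fun x => a * f x + g x).
Proof.
case: a => a b [f1 f2] [g1 g2]; split.
  rewrite (_ : (fun x => complex.Re _) = fun x => a * complex.Re (f x) +
     ((- b) * complex.Im (f x) + complex.Re (g x))); first by do 2! apply: test_lin => //.
  by apply/funext => x; case: (f x) => u v; case: (g x) => p q; simpc; rewrite /=; ring.
rewrite (_ : (fun x => complex.Im _) = fun x => a * complex.Im (f x) +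
   (b * complex.Re (f x) + complex.Im (g x))); first by do 2! apply: test_lin => //.
by apply/funext => x; case: (f x) => u v; case: (g x) => p q; simpc; rewrite /=; ring.
Qed.

Lemma test_differentiable phi x : test_fun D phi -> differentiable phi x.
Proof. by move=> [s _]; exact: smooth_differentiable. Qed.

Lemma cpd_lin (a : R[i]) j (f g : pt R -> R[i]) : ctest_fun D f -> ctest_fun D g ->
  cpd j (fun x => a * f x + g x) = fun x => a * cpd j f x + cpd j g x.
Proof.
case: a => a b [f1 f2] [g1 g2]; apply/funext => x; rewrite /cpd.
rewrite (_ : (fun x => complex.Re _) = fun x => a * complex.Re (f x) +
   ((- b) * complex.Im (f x) + complex.Re (g x))); last first.
  by apply/funext => y; case: (f y) => u v; case: (g y) => p q; simpc; rewrite /=; ring.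
rewrite (_ : (fun x => complex.Im _) = fun x => a * complex.Im (f x) +
   (b * complex.Re (f x) + complex.Im (g x))); last first.
  by apply/funext => y; case: (f y) => u v; case: (g y) => p q; simpc; rewrite /=; ring.
rewrite !pd_lin; try by move=> y; apply: test_differentiable => //; exact: test_lin.
by simpc; congr (_ +i* _); ring.
Qed.

Lemma bcsM (f g : pt R -> R) : bcs f -> bcs g -> bcs (fun x => f x * g x).
Proof. by move=> [mf [M M0 [fM f0]]] bg; apply: bcs_mul => //; exists M. Qed.

Lemma bcs_supp0 F : bcs F -> forall E : set (mpt R), measurable E ->
  leb3.-integrable E (EFin \o F).
Proof. by move=> /bcs_integrable h E mE; exact: integrableS h. Qed.

Lemma Rintegral_supp F : measurable (D : set (mpt R)) -> (forall x, ~ D x -> F x = 0) ->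
  \int[leb3]_(x in (D : set (mpt R))) F x = \int[leb3]_x F x.
Proof.
move=> mD F0; rewrite /Rintegral integral_mkcond; congr fine; apply: eq_integral => x _.
by rewrite patchE; case: ifPn => // /negP xD; rewrite F0// => Dx; apply: xD; rewrite inE.
Qed.

Lemma test_out phi x : test_fun D phi -> ~ D x -> phi x = 0.
Proof. by move=> [_ [K [cK KD K0]]] nD; apply: K0 => /KD. Qed.

Lemma test_pd_out j phi x : test_fun D phi -> ~ D x -> pd j phi x = 0.
Proof. by move=> /(test_pd j); exact: test_out. Qed.

Lemma test_bcs phi : test_fun D phi -> bcs phi.
Proof. by move=> /test_C1c; exact: C1c_bcs. Qed.

End TestSpace.

(** * Symmetry of second derivatives and complex integration by parts *)

Section MixedDerivatives.
Context {R : realType} (D : bdom R).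
Implicit Types (phi psi : pt R -> R).
Let mD := bdom_measurable D.
Local Notation DD := (D : set (mpt R)).

Lemma pd_by_parts phi psi j (a : mpt R -> R) : test_fun D phi -> test_fun D psi ->
  measurable_fun setT a -> (exists M, forall x, `|a x| <= M) -> indep j a ->
  \int[leb3]_(x in DD) (a x * (pd j phi x * psi x)) = - \int[leb3]_(x in DD) (a x * (phi x * pd j psi x)).
Proof.
move=> tp ts ma ba ia.
have [cp cs] := (test_C1c tp, test_C1c ts).
have := weighted_pd_integral0 (C1c_mul cp cs) ma ba ia (j := j).
have bM (f g : pt R -> R) : bcs f -> bcs g -> bcs (fun x => a x * (f x * g x)).
  by move=> bf bg; apply: bcs_mul => //; exact: bcsM.
have [cdp cds] := (C1c_pd_bcs j cp, C1c_pd_bcs j cs).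
have [b1 b2] := (bM _ _ cdp (C1c_bcs cs), bM _ _ (C1c_bcs cp) cds).
rewrite -(@Rintegral_supp _ D)//; last first.
  move=> x nD; rewrite pdM; try exact: test_differentiable tp; try exact: test_differentiable ts.
  by rewrite (test_out tp)// (test_out ts)// mulr0 mul0r addr0 mulr0.
move=> h; apply/eqP; rewrite -addr_eq0; apply/eqP.
rewrite -RintegralD//; try exact: bcs_supp0.
rewrite -[RHS]h; apply: eq_Rintegral => x _; rewrite pdM ?mulrDr//.
  exact: test_differentiable tp.
exact: test_differentiable ts.
Qed.

(** Schwarz's theorem by duality: two integrations by parts move the derivatives onto a bump, where
    they commute, and the Du Bois-Reymond lemma concludes. Equality almost everywhere suffices, as
    second derivatives only occur under integrals. *)
Lemma test_pdC_ae i j phi : test_fun D phi ->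
  {ae leb3, forall x : mpt R, DD x -> pd i (pd j phi) x = pd j (pd i phi) x}.
Proof.
move=> tp.
have [ti tj] := (test_pd i tp, test_pd j tp).
have [tij tji] := (test_pd i tj, test_pd j ti).
have c1 : measurable_fun setT (fun _ : mpt R => (1 : R)) by exact: measurable_cst.
have c2 : exists M : R, forall x : mpt R, `|(1 : R)| <= M by exists 1; rewrite normr1.
have c3 k : indep k (fun=> (1 : R)) by [].
have E (b : pt R -> R) : test_fun D b -> pd i (pd j b) = pd j (pd i b) ->
    \int[leb3]_(x in DD) ((pd i (pd j phi) x - pd j (pd i phi) x) * b x) = 0.
  move=> tb bC.
  have [tbi tbj] := (test_pd i tb, test_pd j tb).
  have ibp k f g : test_fun D f -> test_fun D g ->
      \int[leb3]_(x in DD) (pd k f x * g x) = - \int[leb3]_(x in DD) (f x * pd k g x).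
    move=> tf tg; have := pd_by_parts tf tg c1 c2 (c3 k).
    by under eq_Rintegral do rewrite mul1r; under [in RHS]eq_Rintegral do rewrite mul1r.

  under eq_Rintegral do rewrite mulrBl.
  have bI f g : test_fun D f -> test_fun D g -> leb3.-integrable DD (EFin \o (fun x => f x * g x)).
    by move=> /test_bcs bf /test_bcs bg; exact: (bcs_supp0 (bcsM bf bg) mD).
  rewrite (RintegralB mD (bI _ _ tij tb) (bI _ _ tji tb)).
  have e1 := etrans (ibp i _ _ tj tb) (congr1 -%R (ibp j _ _ tp tbi)).
  have e2 := etrans (ibp j _ _ ti tb) (congr1 -%R (ibp i _ _ tp tbj)).
  rewrite bC in e2; apply/eqP; rewrite subr_eq0; apply/eqP.
  exact: (etrans e1 (esym e2)).
have iF : leb3.-integrable DD (EFin \o (fun x => pd i (pd j phi) x - pd j (pd i phi) x)).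
  exact: (integrableB mD (bcs_supp0 (test_bcs tij) mD) (bcs_supp0 (test_bcs tji) mD)).
have h := bump_ae0 (@dset_open R D) iF.
apply: filterS (h _) => [x hx Dx|n a b abD].
  by apply/eqP; rewrite -subr_eq0; apply/eqP; exact: hx.
apply: E; first exact: test_bump.
by apply: pd_tensC => k; exact: smooth1o_bump1.
Qed.

End MixedDerivatives.

Section ComplexByParts.
Context {R : realType} (D : bdom R).
Implicit Types (f g : pt R -> R[i]) (phi psi : pt R -> R).
Let mD := bdom_measurable D.
Local Notation DD := (D : set (mpt R)).

(** The real and imaginary parts of a complex product rule are each a signed sum of four real ones;
    this property is stable under such sums and keeps track of integrability on the way. *)
Definition rnull (F : mpt R -> R) :=
  leb3.-integrable DD (EFin \o F) /\ \int[leb3]_(x in DD) F x = 0.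

Lemma rnullD F G : rnull F -> rnull G -> rnull (fun x => F x + G x).
Proof.
move=> [iF F0] [iG G0]; split; first exact: (integrableD mD iF iG).
by rewrite RintegralD// F0 G0 addr0.
Qed.

Lemma rnullN F : rnull F -> rnull (fun x => - F x).
Proof.
move=> [iF F0]; split.
  by apply: (eq_integrable mD _ _ _ (integrableZl mD (-1) iF)) => x _ /=; rewrite -EFinM mulN1r.
by under eq_Rintegral do rewrite -mulN1r; rewrite RintegralZl// F0 mulr0.
Qed.

Lemma pd_mul_rnull phi psi j (a : mpt R -> R) : test_fun D phi -> test_fun D psi ->
  measurable_fun setT a -> (exists M, forall x, `|a x| <= M) -> indep j a ->
  rnull (fun x => a x * (pd j phi x * psi x + phi x * pd j psi x)).
Proof.
move=> tp ts ma ba ia.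
have i1 := bcs_supp0 (bcs_mul ma ba (bcsM (test_bcs (test_pd j tp)) (test_bcs ts))) mD.
have i2 := bcs_supp0 (bcs_mul ma ba (bcsM (test_bcs tp) (test_bcs (test_pd j ts)))) mD.
have E : (fun x => a x * (pd j phi x * psi x + phi x * pd j psi x)) =
   (fun x => a x * (pd j phi x * psi x) + a x * (phi x * pd j psi x)).
  by apply/funext => x; rewrite mulrDr.
rewrite E; split; first exact: (integrableD mD i1 i2).
by rewrite RintegralD//; apply/eqP; rewrite addr_eq0; apply/eqP; exact: pd_by_parts.
Qed.

(** The multipliers that commute with the j-th weak derivative. The j-th diagonal entry of the
    matrix [A] is one of them, since it omits [s_j]. *)
Definition weight j (c : pt R -> R[i]) :=
  [/\ measurable_fun setT (rpart c), measurable_fun setT (ipart c),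
      exists M, forall x, sqn (c x) <= M & forall t x, c (upd j t x) = c x].

Lemma weight_cmeas j c : weight j c -> cmeas D c.
Proof. by move=> [m1 m2 _ _]; split; apply: measurable_funS m1 || apply: measurable_funS m2. Qed.

Lemma weight_cbdd j c : weight j c -> cbdd D c.
Proof. by move=> [_ _ [M hM] _]; exists M => x _. Qed.

Lemma weight_conj j c : weight j c -> weight j (fun x => conjc (c x)).
Proof.
move=> [m1 m2 [M hM] ic]; split.
- by rewrite (_ : rpart _ = rpart c)//; apply/funext => x; rewrite /rpart; case: (c x).
- rewrite (_ : ipart _ = \- ipart c); first exact: measurableT_comp.
  by apply/funext => x; rewrite /ipart /=; case: (c x).
- by exists M => x; rewrite sqn_conj.
- by move=> t x; rewrite ic.
Qed.

Lemma weight_cst j a : weight j (fun=> a).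
Proof. by split; [exact: measurable_cst|exact: measurable_cst|exists (sqn a)|]. Qed.

Lemma ctest_L2 f : ctest_fun D f -> L2 D f.
Proof.
have key phi : test_fun D phi -> Lr2 leb3 DD phi.
  move=> tp; have bp := test_bcs tp; split; first exact: measurable_funS bp.1.
  by under eq_fun do rewrite expr2; exact: (bcs_supp0 (bcsM bp bp) mD).
by move=> [f1 f2]; apply/(L2P _ mD); split; exact: key.
Qed.

Lemma ctest_by_parts f g j c : ctest_fun D f -> ctest_fun D g -> weight j c ->
  cint D (fun x => c x * f x * conjc (cpd j g x)) = - cint D (fun x => c x * cpd j f x * conjc (g x)).
Proof.
move=> [f1 f2] [g1 g2] [m1 m2 [M hM] ic].
have bd (u : mpt R -> R) : (forall x, u x ^+ 2 <= sqn (c x)) -> exists M, forall x, `|u x| <= M.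
  move=> hu; exists (M + 1) => x; have := le_trans (hu x) (hM x) => h.
  have M0 : 0 <= M := le_trans (sqn_ge0 _) (hM x).
  rewrite -ler_sqr ?nnegrE ?addr_ge0// real_normK ?num_real//; apply: (le_trans h).
  rewrite -subr_ge0 (_ : _ - _ = M ^+ 2 + M + 1); last by ring.
  by rewrite !addr_ge0 ?sqr_ge0.
have b1 : exists M, forall x, `|rpart c x| <= M by apply: bd => x; exact: Re_sqn.
have b2 : exists M, forall x, `|ipart c x| <= M by apply: bd => x; rewrite /sqn lerDr sqr_ge0.
have i1 : indep j (rpart c) by move=> t x; rewrite /rpart ic.
have i2 : indep j (ipart c) by move=> t x; rewrite /ipart ic.
have N1 phi psi tp ts := @pd_mul_rnull phi psi j (rpart c) tp ts m1 b1 i1.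
have N2 phi psi tp ts := @pd_mul_rnull phi psi j (ipart c) tp ts m2 b2 i2.
have P1 := rnullD (rnullD (N1 _ _ f1 g1) (N1 _ _ f2 g2)) (rnullD (N2 _ _ f1 g2) (rnullN (N2 _ _ f2 g1))).
have P2 := rnullD (rnullD (N2 _ _ f1 g1) (N2 _ _ f2 g2)) (rnullD (N1 _ _ f2 g1) (rnullN (N1 _ _ f1 g2))).

have [cf cg] : ctest_fun D f /\ ctest_fun D g by [].
have wc : cmeas D c /\ cbdd D c by split; [apply: (@weight_cmeas j); split => //; exists M|exists M => x _].
have I1 : cintegrable D (fun x => c x * f x * conjc (cpd j g x)).
  by apply: L2_mul; [exact: (L2_bounded wc.1 wc.2 (ctest_L2 cf))|apply: L2_conj; apply: ctest_L2; exact: ctest_cpd].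
have I2 : cintegrable D (fun x => c x * cpd j f x * conjc (g x)).
  by apply: L2_mul; [exact: (L2_bounded wc.1 wc.2 (ctest_L2 (ctest_cpd j cf)))|apply: L2_conj; exact: ctest_L2].
apply/eqP; rewrite -addr_eq0 -cintD//; apply/eqP.
apply/eqP; rewrite eq_complex; apply/andP; split; apply/eqP; rewrite /cint [LHS]/= [RHS]/=.
- rewrite -[RHS]P1.2; apply: eq_Rintegral => x _; rewrite /cpd /rpart /ipart.
  by case: (c x) => a b; case: (f x) => u v; case: (g x) => p q; rewrite /=; ring.
- rewrite -[RHS]P2.2; apply: eq_Rintegral => x _; rewrite /cpd /rpart /ipart.
  by case: (c x) => a b; case: (f x) => u v; case: (g x) => p q; rewrite /=; ring.
Qed.

Lemma cint_ae f g : cmeas D f -> cmeas D g ->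
  {ae leb3, forall x : mpt R, DD x -> f x = g x} -> cint D f = cint D g.
Proof.
move=> [mf1 mf2] [mg1 mg2] fg; rewrite /cint; congr (_ +i* _); congr fine.
  apply: ae_eq_integral => //; [exact/measurable_EFinP|exact/measurable_EFinP|].
  by apply: filterS fg => x h Dx; rewrite h.
apply: ae_eq_integral => //; [exact/measurable_EFinP|exact/measurable_EFinP|].
by apply: filterS fg => x h Dx; rewrite h.
Qed.

Lemma L2_cmeas f : L2 D f -> cmeas D f.
Proof. by move=> [? ? _]. Qed.

(** Each side is minus the integral of [c * f] against the conjugate of a mixed second derivative of
    [g], and the two mixed derivatives agree almost everywhere. *)
Lemma ctest_swap f g i j c : ctest_fun D f -> ctest_fun D g -> weight i c -> weight j c ->
  cint D (fun x => c x * cpd i f x * conjc (cpd j g x)) =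
  cint D (fun x => c x * cpd j f x * conjc (cpd i g x)).
Proof.
move=> tf tg wi wj; apply: oppr_inj.
have e1 := ctest_by_parts tf (ctest_cpd j tg) wi.
have e2 := ctest_by_parts tf (ctest_cpd i tg) wj.
apply: (etrans (esym e1)); apply: (etrans _ e2); have mc := weight_cmeas wi.
have mm k l : cmeas D (fun x => c x * f x * conjc (cpd k (cpd l g) x)).
  apply: cmeasM; first by apply: cmeasM => //; exact: L2_cmeas (ctest_L2 tf).
  by apply: cmeas_conj; apply: L2_cmeas; apply: ctest_L2; do 2! apply: ctest_cpd.
apply: cint_ae; [exact: mm|exact: mm|].
have [g1 g2] := tg; have a1 := test_pdC_ae i j g1; have a2 := test_pdC_ae i j g2.
apply: filterS2 a1 a2 => x h1 h2 Dx; apply: (congr1 (fun z => c x * f x * conjc z)).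
exact: (congr2 (@Complex R) (h1 Dx) (h2 Dx)).
Qed.

End ComplexByParts.

(** * The energy space as a closed space of graphs *)

Section H0.
Context {R : realType} (D : bdom R).

Definition jform : hform (option 'I_3 -> L2t D) := sum_hform (option 'I_3) (l2hform D).

(** Graph of the gradient over test functions; its closure consists of the functions of H^1_0
    together with their weak derivatives. *)
Definition tgraph : set (option 'I_3 -> L2t D) :=
  [set v | ctest_fun D (v None) /\ forall j x, v (Some j) x = cpd j (v None) x].

Lemma tgraph_lin (a : R[i]) v w : tgraph v -> tgraph w -> tgraph (a *: v + w).
Proof.
move=> [tv hv] [tw hw]; split; first exact: ctest_lin.
move=> j x; rewrite -[LHS]/(a * v (Some j) x + w (Some j) x) hv hw.
by rewrite -[X in _ = cpd j X x]/(fun x => a * v None x + w None x) (cpd_lin _ _ tv tw).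
Qed.

Lemma ctest0 (E : set (pt R)) : ctest_fun E (fun=> 0).
Proof. by split; exact: test0. Qed.

Lemma tgraph_ex f : ctest_fun D f -> exists2 v, tgraph v & (v None : pt R -> R[i]) = f.
Proof.
move=> tf; pose v (o : option 'I_3) : L2t D :=
  if o is Some j then toL2 (ctest_L2 (ctest_cpd j tf)) else toL2 (ctest_L2 tf).
by exists v.
Qed.

Definition h0pred : {pred (option 'I_3 -> L2t D)} := fun w => `[< hclosure jform tgraph w >].

Lemma tgraph0 : tgraph 0.
Proof.
have [v gv _] := tgraph_ex (ctest0 D).
by have := tgraph_lin (-1) gv gv; rewrite scaleN1r addNr.
Qed.

Lemma tgraphZ a v : tgraph v -> tgraph (a *: v).
Proof. by move=> gv; have := tgraph_lin a gv tgraph0; rewrite addr0. Qed.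

Lemma tgraphD v w : tgraph v -> tgraph w -> tgraph (v + w).
Proof. by move=> gv gw; have := tgraph_lin 1 gv gw; rewrite scale1r. Qed.

Lemma h0pred_submod : GRing.submod_closed h0pred.
Proof.
split; first by apply/asboolP; apply: sub_hclosure; exact: tgraph0.
move=> a v w /asboolP cv /asboolP cw; apply/asboolP.
exact: (hclosureD tgraphD (hclosureZ (@tgraphZ a) cv) cw).
Qed.

HB.instance Definition _ :=
  GRing.isSubmodClosed.Build R[i] (option 'I_3 -> L2t D) h0pred h0pred_submod.

(* H^1_0(D): an element carries its value (index [None]) and its weak derivatives. *)
Record H0t := MkH0 { h0val :> option 'I_3 -> L2t D; h0valP : h0val \in h0pred }.

HB.instance Definition _ := [isSub for h0val].
HB.instance Definition _ := [Choice of H0t by <:].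
HB.instance Definition _ := [SubChoice_isSubLmodule of H0t by <:].

Implicit Types f g : H0t.

Lemma H0tP f : hclosure jform tgraph f.
Proof. by have /asboolP := h0valP f. Qed.

Definition toH0 w (hw : hclosure jform tgraph w) : H0t := MkH0 (introT (asboolP _) hw : w \in h0pred).

Definition h0form : hform H0t.
Proof.
apply: (@HForm _ _ (fun f g => jform f g)).
- by move=> f g h; exact: hipD.
- by move=> a f h; exact: hipZ.
- by move=> f g; exact: hipC.
- by move=> f; exact: hip_ge0.
Defined.

Lemma nsq_h0 f : nsq h0form f = \sum_o nsq (l2hform D) (f o).
Proof. exact: (nsq_sum (l2hform D) f). Qed.

Lemma h0_complete : complete_on h0form setT.
Proof.
move=> x _ cx.
have cj : cauchy_seq jform (fun n => h0val (x n)).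
  by move=> e e0; have [N hN] := cx e e0; exists N.
have [l cl hl] := hclosure_complete (sum_complete (@l2_complete _ D)) (fun n => H0tP (x n)) cj.
by exists (toH0 cl).
Qed.

Lemma h0_dense0 b : sesqui b -> bounded_form jform b ->
  (forall v w, tgraph v -> tgraph w -> b v w = 0) -> forall f g, b f g = 0.
Proof. by move=> sb bb h0 f g; exact: (dense_form0 sb bb h0 (H0tP f) (H0tP g)). Qed.

End H0.

Section ComponentForm.
Context {R : realType} (I : finType) (V : lmodType R[i]) (ip : hform V).
Variables (b : V -> V -> R[i]) (i k : I).

Lemma comp_sesqui : sesqui b -> sesqui (fun x y : I -> V => b (x i) (y k)).
Proof.
move=> sb; split.
- by move=> x y z; exact: (sesDl sb (x i)).
- by move=> a x z; exact: (sesZl sb a (x i)).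
- by move=> x y z; exact: (sesDr sb (x k)).
- by move=> a x z; exact: (sesZr sb a (x k)).
Qed.

Lemma comp_bounded : bounded_form ip b ->
  bounded_form (sum_hform I ip) (fun x y : I -> V => b (x i) (y k)).
Proof.
move=> /bounded_form_pos[C C0 hC]; exists C => x y; apply: (le_trans (hC _ _)).
apply: ler_wpM2l; first exact: ltW.
by apply: ler_pM; rewrite ?nsq_ge0// nsq_comp_le.
Qed.

End ComponentForm.

Section H0Facts.
Context {R : realType} (D : bdom R).
Local Notation DD := (D : set (mpt R)).
Implicit Types (f g : H0t D) (c : pt R -> R[i]).
Let mD := bdom_measurable D.

Lemma h0_by_parts f g j c : weight j c ->
  mform c (f None) (g (Some j)) = - mform c (f (Some j)) (g None).
Proof.
move=> wc; have [mc bc] := (weight_cmeas D wc, weight_cbdd D wc).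
have sc := mform_sesqui mc bc; have bb := mform_bounded mc bc.
apply/eqP; rewrite -addr_eq0; apply/eqP; move: f g.
apply: (@h0_dense0 _ D (fun v w => mform c (v None) (w (Some j)) + mform c (v (Some j)) (w None))).
- by apply: sesquiD; exact: (comp_sesqui _ _ sc).
- by apply: bounded_formD; exact: comp_bounded.
- move=> v w [tv hv] [tw hw]; apply/eqP; rewrite addr_eq0; apply/eqP.
  have := ctest_by_parts tv tw wc; rewrite /mform => h; apply: etrans (etrans h _).
    by apply: cint_eq => x _; rewrite hw.
  by congr -%R; apply: cint_eq => x _; rewrite hv.
Qed.

(** The identity behind the treatment of shear: for a coefficient constant along both axes, [d_i f]
    against [d_j g] may be traded for [d_j f] against [d_i g]. It is checked on test functions and
    extended by density. *)
Lemma h0_swap f g i j c : weight i c -> weight j c ->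
  mform c (f (Some i)) (g (Some j)) = mform c (f (Some j)) (g (Some i)).
Proof.
move=> wi wj; have [mc bc] := (weight_cmeas D wi, weight_cbdd D wi).
have sc := mform_sesqui mc bc; have bb := mform_bounded mc bc.
apply/eqP; rewrite -subr_eq0 -mulN1r; apply/eqP; move: f g.
apply: (@h0_dense0 _ D (fun v w => mform c (v (Some i)) (w (Some j)) + -1 * mform c (v (Some j)) (w (Some i)))).
- by apply: sesquiD; [|apply: sesquiM]; exact: (comp_sesqui _ _ sc).
- by apply: bounded_formD; [|apply: bounded_formZ]; exact: comp_bounded.
- move=> v w [tv hv] [tw hw]; rewrite mulN1r; apply/eqP; rewrite subr_eq0; apply/eqP.
  have := ctest_swap tv tw wi wj; rewrite /mform => h; apply: etrans (etrans h _).
    by apply: cint_eq => x _; rewrite hw hv.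
  by apply: cint_eq => x _; rewrite hv hw.
Qed.

Lemma tgraphH0 v : tgraph v -> {g : H0t D | g = v :> (option 'I_3 -> L2t D)}.
Proof. by move=> tv; exists (toH0 (sub_hclosure (jform D) tv)). Qed.

Lemma h0_wpd f j c : weight j c ->
  is_wpd D j (fun x => c x * f None x) (fun x => c x * f (Some j) x).
Proof.
move=> wc; have [mc bc] := (weight_cmeas D wc, weight_cbdd D wc).
split=> [|phi tp]; first by apply: L2_bounded => //; exact: L2tP.
have [v tv hv] := tgraph_ex (ctest_real tp); have [g hg] := tgraphH0 tv.
have h := h0_by_parts f g wc.
have E1 x : g None x = (phi x)%:C by rewrite hg hv.
have E2 x : g (Some j) x = (pd j phi x)%:C.
  rewrite hg tv.2 /cpd hv /=; apply: (congr1 (fun z => _ +i* z)).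
  by rewrite /pd (derive_cst (V := pt R) (W := R^o)).
apply: etrans (etrans h _); rewrite /mform.
  by apply: cint_eq => x _; rewrite E2 conjc_real.
by congr -%R; apply: cint_eq => x _; rewrite E1 conjc_real.
Qed.

Lemma L2_one : L2 D (fun=> 1).
Proof.
apply/(L2P _ mD); split; split; try exact: measurable_cst.
  under eq_fun do rewrite /rpart/= expr1n; apply/integrableP; split.
    exact: measurable_cst.
  by under eq_integral do rewrite /= normr1; rewrite integral_cst// mul1e; exact: bdom_finite.
by under eq_fun do rewrite /ipart/= expr0n; exact: integrable0.
Qed.

Lemma L2_integrable (h : pt R -> R[i]) : L2 D h -> cintegrable D h.
Proof. by move=> Lh; have := L2_mul L2_one Lh; under eq_fun do rewrite mul1r. Qed.

Lemma L2_test_ae0 h : L2 D h -> (forall phi, test_fun D phi -> cint D (fun x => h x * (phi x)%:C) = 0) ->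
  {ae leb3, forall x : mpt R, DD x -> h x = 0}.
Proof.
move=> Lh h0; have [i1 i2] := L2_integrable Lh.
have k1 n a b : cbox a b `<=` D -> \int[leb3]_(x in DD) (rpart h x * bump n a b x) = 0.
  move=> /(test_bump n)/h0/(congr1 (@complex.Re R)) /= <-.
  by apply: eq_Rintegral => x _; rewrite /rpart; case: (h x) => u v; simpc.
have k2 n a b : cbox a b `<=` D -> \int[leb3]_(x in DD) (ipart h x * bump n a b x) = 0.
  move=> /(test_bump n)/h0/(congr1 (@complex.Im R)) /= <-.
  by apply: eq_Rintegral => x _; rewrite /ipart; case: (h x) => u v; simpc.
have a1 := bump_ae0 (@dset_open R D) i1 k1; have a2 := bump_ae0 (@dset_open R D) i2 k2.
apply: filterS2 a1 a2 => x h1 h2 Dx; have := h1 Dx; have := h2 Dx.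
by rewrite /rpart /ipart; case: (h x) => u v /= -> ->.
Qed.

Lemma is_wpd_unique j (f g g' : pt R -> R[i]) : is_wpd D j f g -> is_wpd D j f g' ->
  {ae leb3, forall x : mpt R, DD x -> g x = g' x}.
Proof.
move=> [Lg hg] [Lg' hg'].
have LB : L2 D (fun x => g x + -1 * g' x) by apply: L2D => //; exact: L2Z.
have := L2_test_ae0 LB _ => h.
apply: filterS (h _) => [x hx Dx|phi tp].
  by apply/eqP; rewrite -subr_eq0 -mulN1r; apply/eqP; exact: hx.
have Lp : L2 D (fun x => (phi x)%:C) := ctest_L2 (ctest_real tp).
under cint_eq do rewrite mulrDl -mulrA.
rewrite cintD; last 2 first; first exact: L2_mul.
  by apply: cintegrableZ; exact: L2_mul.
rewrite cintZ; last exact: L2_mul.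
by have := hg phi tp; rewrite hg'// mulN1r => /oppr_inj ->; rewrite subrr.
Qed.

Lemma wpd_ae j (f g : pt R -> R[i]) : is_wpd D j f g -> {ae leb3, forall x : mpt R, DD x -> wpd D j f x = g x}.
Proof.
move=> wg; apply: (is_wpd_unique _ wg).
exact: (@xgetPex _ (fun=> 0) [set g : pt R -> R[i] | is_wpd D j f g] (ex_intro _ g wg)).
Qed.

Lemma is_wpd_wpd j (f : pt R -> R[i]) : (exists g : pt R -> R[i], is_wpd D j f g) -> is_wpd D j f (wpd D j f).
Proof. by move=> h; exact: (@xgetPex _ (fun=> 0) [set g : pt R -> R[i] | is_wpd D j f g] h). Qed.

Lemma is_wpd_conj j (f g : pt R -> R[i]) : L2 D f -> is_wpd D j f g ->
  is_wpd D j (fun x => conjc (f x)) (fun x => conjc (g x)).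
Proof.
move=> Lf [Lg hg]; split=> [|phi tp]; first exact: L2_conj.
have Lp : L2 D (fun x => (phi x)%:C) := ctest_L2 (ctest_real tp).
have Ld : L2 D (fun x => (pd j phi x)%:C) := ctest_L2 (ctest_real (test_pd j tp)).
have E (u : pt R -> R[i]) (r : pt R -> R) : L2 D u -> L2 D (fun x => (r x)%:C) ->
    cint D (fun x => conjc (u x) * (r x)%:C) = conjc (cint D (fun x => u x * (r x)%:C)).
  move=> Lu Lr; rewrite -cint_conj; last exact: L2_mul.
  by apply: cint_eq => x _; case: (u x) => p q; simpc.
by rewrite !E// hg// rmorphN.
Qed.

End H0Facts.

Lemma sum_option (M : nmodType) (I : finType) (F : option I -> M) :
  \sum_o F o = F None + \sum_i F (Some i).
Proof.
rewrite (bigD1 None)//=; congr (_ + _).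
rewrite (reindex_omap Some id)/=; last by case.
by apply: eq_bigl => i; rewrite eqxx.
Qed.

(** * Agreement of the graph space with H^1_0 defined by approximation *)

Section Identification.
Context {R : realType} (D : bdom R).
Local Notation DD := (D : set (mpt R)).
Let mD := bdom_measurable D.

Lemma l2norm2E (f : L2t D) : l2norm2 D f = (nsq (l2hform D) f)%:E.
Proof.
rewrite nsq_l2E /Rintegral fineK//; apply: (integrable_fin_num mD).
exact: (L2_sqn_integrable (L2tP f)).
Qed.

Lemma l2norm2_ae (f g : pt R -> R[i]) : cmeas D f -> cmeas D g ->
  {ae leb3, forall x : mpt R, DD x -> f x = g x} -> l2norm2 D f = l2norm2 D g.
Proof.
have m (h : pt R -> R[i]) : cmeas D h -> measurable_fun DD (fun x => (sqn (h x))%:E).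
  by move=> [h1 h2]; apply/measurable_EFinP; apply: measurable_funD; exact: measurable_funX.
move=> mf mg fg; apply: ae_eq_integral => //; [exact: m|exact: m|].
by apply: filterS fg => x h Dx; rewrite h.
Qed.

Lemma h1norm2_graph (w : option 'I_3 -> L2t D) : (forall j, is_wpd D j (w None) (w (Some j))) ->
  h1norm2 D (w None) = (nsq (jform D) w)%:E.
Proof.
move=> hw; rewrite /h1norm2 l2norm2E nsq_sum sum_option EFinD; congr (_ + _)%E.
rewrite -sumEFin; apply: eq_bigr => j _; rewrite -l2norm2E; apply: l2norm2_ae.
- by apply: L2_cmeas; have [] := is_wpd_wpd (ex_intro _ _ (hw j)).
- by apply: L2_cmeas; exact: L2tP.
- exact: wpd_ae.
Qed.

Lemma weight1 j : weight j (fun=> 1 : R[i]).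
Proof. exact: weight_cst. Qed.

Lemma h0_is_wpd (f : H0t D) j : is_wpd D j (f None) (f (Some j)).
Proof.
have := h0_wpd f (weight1 j).
rewrite (_ : (fun x => 1 * f None x) = f None); last by apply/funext => x; rewrite mul1r.
by rewrite (_ : (fun x => 1 * f (Some j) x) = f (Some j))//; apply/funext => x; rewrite mul1r.
Qed.

Lemma is_wpdB j (f f' g g' : pt R -> R[i]) : L2 D f -> L2 D f' -> is_wpd D j f g -> is_wpd D j f' g' ->
  is_wpd D j (fun x => f x - f' x) (fun x => g x - g' x).
Proof.
move=> Lf Lf' [Lg hg] [Lg' hg'].
have LB (u v : pt R -> R[i]) : L2 D u -> L2 D v -> L2 D (fun x => u x - v x).
  move=> Lu Lv; rewrite (_ : (fun x => _) = (fun x => u x + -1 * v x)).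
    by apply: L2D => //; exact: L2Z.
  by apply/funext => x; rewrite mulN1r.
have E (u v w : pt R -> R[i]) : L2 D u -> L2 D v -> L2 D w ->
    cint D (fun x => (u x - v x) * w x) = cint D (fun x => u x * w x) - cint D (fun x => v x * w x).
  move=> Lu Lv Lw; rewrite -[in RHS]mulN1r -cintZ; last exact: L2_mul.
  rewrite -cintD; [|exact: L2_mul|by apply: cintegrableZ; exact: L2_mul].
  by apply: cint_eq => x _; ring.
split=> [|phi tp]; first exact: LB.
have Lp : L2 D (fun x => (phi x)%:C) := ctest_L2 (ctest_real tp).
have Ld : L2 D (fun x => (pd j phi x)%:C) := ctest_L2 (ctest_real (test_pd j tp)).
apply: (etrans (E _ _ _ Lf Lf' Ld)); apply: (etrans _ (congr1 -%R (esym (E _ _ _ Lg Lg' Lp)))).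
by rewrite opprB addrC; apply: (congr2 +%R); [rewrite (hg' _ tp) opprK|exact: hg].
Qed.

(** The derivative components are set to the very representatives chosen by [wpd], so both
    equalities hold pointwise and [Bform] can later be rewritten without exceptional sets on the
    trial side. *)
Lemma H10_h0 (u : pt R -> R[i]) : H10 D u ->
  exists h : H0t D, h None = u :> (pt R -> R[i]) /\ forall j, h (Some j) = wpd D j u :> (pt R -> R[i]).
Proof.
move=> [[Lu wu] [phi [tphi cphi]]].
have Lw j : L2 D (wpd D j u) by have [] := is_wpd_wpd (wu j).
pose w (o : option 'I_3) : L2t D := if o is Some j then toL2 (Lw j) else toL2 Lu.
suff cw : hclosure (jform D) (@tgraph _ D) w by exists (toH0 cw).
move=> e e0.
have [N _ hN] : \forall n \near \oo, (h1norm2 D (u \- phi n)%R < e%:E)%E.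
  exact: (cphi _ (@nbhs_open_ereal_lt _ 0 (fun=> e) e0)).
have := hN N (leqnn N); have [v tv hv] := tgraph_ex (tphi N); exists v => //.
have [g hg] := tgraphH0 tv.
have := @h1norm2_graph (w - v); rewrite -lte_fin => <-; last first.
  move=> j; have wv := h0_is_wpd g j; rewrite hg in wv.
  exact: (is_wpdB Lu (L2tP (v None)) (is_wpd_wpd (wu j)) wv).
by rewrite (_ : ((w - v) None : L2t D) = (u \- phi N) :> (pt R -> R[i]))// -hv.
Qed.

Lemma h0_H10 (f : H0t D) : H10 D (f None).
Proof.
split; first by split; [exact: L2tP|move=> j; exists (f (Some j)); exact: h0_is_wpd].
have h (n : nat) : exists v : option 'I_3 -> L2t D, tgraph v /\ nsq (jform D) (h0val f - v) < n.+1%:R^-1.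
  by have n0 : 0 < (n.+1%:R^-1 : R) by []; have [v tv hv] := H0tP f n0; exists v.
have [v hv] := choice h.
exists (fun n => v n None); split; first by move=> n; have [[]] := hv n.
have E n : h1norm2 D (f None \- v n None) = (nsq (jform D) (h0val f - v n))%:E.
  have [tv _] := hv n; have [g hg] := tgraphH0 tv.
  apply: (@h1norm2_graph (h0val f - v n)) => j; have wv := h0_is_wpd g j; rewrite hg in wv.
  exact: (is_wpdB (L2tP (f None)) (L2tP (v n None)) (h0_is_wpd f j) wv).
under eq_cvg do rewrite E.
apply: cvg_EFin; first by near=> n.
apply: (@squeeze_cvgr _ _ _ _ (fun=> 0) (@harmonic R)); last exact: cvg_harmonic.
  by near=> n; rewrite nsq_ge0/= ltW//; have [] := hv n.
exact: cvg_cst.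
Unshelve. all: by end_near. Qed.

End Identification.

Lemma sum3 (M : nmodType) (F : 'I_3 -> M) :
  \sum_j F j = F (@Ordinal 3 0 isT) + F (@Ordinal 3 1 isT) + F (@Ordinal 3 2 isT).
Proof.
rewrite !big_ord_recl big_ord0 addr0 addrA.
by congr (_ + _ + _); congr F; exact: val_inj.
Qed.

(** Arithmetic of the four-term decomposition in [N2_cell_le]: two applications of
    [(a + b)^2 <= 2 a^2 + 2 b^2] produce the factor 4. *)
Lemma four_terms (R : realDomainType) (H ab cg ra rb rc g rb1 rc1 p0 p1 p2 S : R) :
  ab <= 2 * ra + 2 * rb -> cg <= 2 * rc + 2 * g ->
  ra <= H * p0 -> rb1 <= H * p1 -> rc1 <= H * p2 -> rb <= rb1 -> rc <= rc1 -> g <= S ->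
  2 * ab + 2 * cg <= 4 * H * (p0 + p1 + p2) + 4 * S.
Proof.
move=> h1 h2 h3 h4 h5 h6 h7 h8; have h4' := le_trans h6 h4; have h5' := le_trans h7 h5.
have -> : 4 * H * (p0 + p1 + p2) + 4 * S = 4 * (H * p0) + 4 * (H * p1) + 4 * (H * p2) + 4 * S by ring.
move: (H * p0) (H * p1) (H * p2) h1 h2 h3 h4' h5' h8 => x y z *; lra.
Qed.

(** * Rellich compactness by cell averages *)

Section LineAverage.
Context {R : realType}.
Local Notation leb := (@lebesgue_measure R).
Variables (L h : R) (N : nat).
Hypotheses (h0 : 0 < h) (hN : N%:R * h = 2 * L).

(** Half-open, so that the first [N] cells partition the half-open interval from [- L] to [L]. *)
Definition cell (i : nat) : set R := `[(- L + i%:R * h), (- L + i.+1%:R * h)[.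
Definition chi (i : nat) (t : R) : R := \1_(cell i) t.

Lemma cellP i t : reflect (- L + i%:R * h <= t < - L + i.+1%:R * h) (t \in cell i).
Proof. by apply: (iffP idP); rewrite /cell; [move=> /set_mem/=; rewrite in_itv|move=> ?; apply/mem_set; rewrite /= in_itv]. Qed.

Lemma chi_in i t : - L + i%:R * h <= t < - L + i.+1%:R * h -> chi i t = 1.
Proof. by move=> /cellP ti; rewrite /chi indicE ti. Qed.

Lemma chi01 i t : chi i t = 0 \/ chi i t = 1 /\ - L + i%:R * h <= t < - L + i.+1%:R * h.
Proof. by rewrite /chi indicE; case: cellP => H; [right|left]. Qed.

Lemma chi_ge0 i t : 0 <= chi i t.
Proof. by case: (chi01 i t) => [->|[->]]. Qed.

Lemma chi_le1 i t : `|chi i t| <= 1.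
Proof. by case: (chi01 i t) => [->|[->]]; rewrite ?normr0 ?normr1. Qed.

Lemma chi_orth i k t : i != k -> chi i t * chi k t = 0.
Proof.
move=> ik; case: (chi01 i t) => [->|[-> /andP[a1 a2]]]; first by rewrite mul0r.
case: (chi01 k t) => [->|[_ /andP[b1 b2]]]; first by rewrite mulr0.
exfalso; move: ik; rewrite neq_ltn => /orP[ik|ik].
  have : i.+1%:R * h <= k%:R * h by rewrite ler_wpM2r ?ler_nat// ltW.
  by lra.
have : k.+1%:R * h <= i%:R * h by rewrite ler_wpM2r ?ler_nat// ltW.
by lra.
Qed.

Lemma chi_sum (t : R) : - L <= t < L -> \sum_(i < N) chi i t = 1.
Proof.
move=> /andP[t1 t2]; pose k := Num.truncn ((t + L) / h).
have q0 : 0 <= (t + L) / h by rewrite divr_ge0 ?(ltW h0)//; lra.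
have /andP[k1 k2] : k%:R <= (t + L) / h < k.+1%:R by exact: truncn_itv.
rewrite ler_pdivlMr// in k1; rewrite ltr_pdivrMr// in k2.
have kN : (k < N)%N.
  rewrite -(ltr_nat R) -(ltr_pM2r h0) hN; apply: (le_lt_trans k1); lra.
have ck : chi k t = 1 by apply: chi_in; apply/andP; split; lra.
rewrite (bigD1 (Ordinal kN))//= ck big1 ?addr0// => i ik.
by rewrite -[LHS]mulr1 -ck chi_orth.
Qed.

Lemma measurable_chi i : measurable_fun setT (chi i : measurableTypeR R -> R).
Proof. by apply: measurable_indic; exact: measurable_itv. Qed.

Definition bm d (T : measurableType d) (F : T -> R) :=
  measurable_fun setT F /\ exists M, forall x, `|F x| <= M.

Section BoundedMeasurable.
Context d (T : measurableType d).
Implicit Types F G : T -> R.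

Lemma bmD F G : bm F -> bm G -> bm (fun x => F x + G x).
Proof.
move=> [mF [M hM]] [mG [M' hM']]; split; first exact: measurable_funD.
by exists (M + M') => x; apply: (le_trans (ler_normD _ _)); exact: lerD.
Qed.

Lemma bmM F G : bm F -> bm G -> bm (fun x => F x * G x).
Proof.
move=> [mF [M hM]] [mG [M' hM']]; split; first exact: measurable_funM.
by exists (M * M') => x; rewrite normrM ler_pM.
Qed.

Lemma bm_cst (c : R) : bm (fun _ : T => c).
Proof. by split; [exact: measurable_cst|exists `|c|]. Qed.

Lemma bmB F G : bm F -> bm G -> bm (fun x => F x - G x).
Proof.
move=> bF bG; rewrite (_ : (fun x => _) = fun x => F x + -1 * G x).
  by apply: bmD => //; apply: bmM => //; exact: bm_cst.
by apply/funext => x; rewrite mulN1r.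
Qed.

Lemma bm_norm F : bm F -> bm (fun x => `|F x|).
Proof.
move=> [mF [M hM]]; split; first exact: measurableT_comp.
by exists M => x; rewrite normr_id.
Qed.

Lemma bm_sum (I : Type) (r : seq I) (F : I -> T -> R) : (forall i, bm (F i)) ->
  bm (fun x => \sum_(i <- r) F i x).
Proof.
move=> bF; elim: r => [|i r IH].
  by under eq_fun do rewrite big_nil; exact: bm_cst.
by under eq_fun do rewrite big_cons; exact: bmD.
Qed.

End BoundedMeasurable.

(** An integral over the cell, not yet an average: the normalisation [h^-1] is applied in
    [cmean]. *)
Definition cavg i (g : R -> R) : R := \int[leb]_t (chi i t * g t).
Local Notation T1 := (measurableTypeR R).
Implicit Types g : R -> R.

Lemma leb_cell i : leb (cell i) = h%:E.
Proof.
rewrite lebesgue_measure_itv/= lte_fin -subr_gt0.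
rewrite (_ : _ - (_ + _) = h); last by rewrite -natr1; ring.
by rewrite h0 -EFinB -natr1; congr EFin; ring.
Qed.

Lemma cell_finite i : (leb (cell i) < +oo)%E.
Proof. by rewrite leb_cell ltry. Qed.

Lemma bm_chi i : bm (chi i : T1 -> R).
Proof. by split; [exact: measurable_chi|exists 1; exact: chi_le1]. Qed.

Lemma cavg_integrable i g : bm (g : T1 -> R) -> leb.-integrable setT (fun t => (chi i t * g t)%:E).
Proof.
move=> bg; have [mF [M hM]] := bmM (bm_chi i) bg.
apply: (@bounded_support_integrable _ _ T1 leb (cell i) _ M) => //.
- exact: measurable_itv.
- exact: cell_finite.
- by move=> t nt; rewrite /chi indicE memNset// mul0r.
Qed.

Lemma cavgD i g g' : bm (g : T1 -> R) -> bm (g' : T1 -> R) ->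
  cavg i (fun t => g t + g' t) = cavg i g + cavg i g'.
Proof.
move=> bg bg'; rewrite /cavg -RintegralD//; try exact: cavg_integrable.
by apply: eq_Rintegral => t _; rewrite mulrDr.
Qed.

Lemma cavgZ i c g : bm (g : T1 -> R) -> cavg i (fun t => c * g t) = c * cavg i g.
Proof.
move=> bg; rewrite /cavg -RintegralZl//; last exact: cavg_integrable.
by apply: eq_Rintegral => t _; rewrite mulrCA.
Qed.

Lemma cavgB i g g' : bm (g : T1 -> R) -> bm (g' : T1 -> R) ->
  cavg i (fun t => g t - g' t) = cavg i g - cavg i g'.
Proof.
move=> bg bg'; under [X in cavg i X]eq_fun do rewrite -mulN1r.
rewrite cavgD// ?cavgZ ?mulN1r//; apply: bmM => //; exact: bm_cst.
Qed.

Lemma cavg_le i g g' : bm (g : T1 -> R) -> bm (g' : T1 -> R) ->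
  (forall t, - L + i%:R * h <= t < - L + i.+1%:R * h -> g t <= g' t) -> cavg i g <= cavg i g'.
Proof.
move=> bg bg' gg'; apply: le_Rintegral => //; try exact: cavg_integrable.
by move=> t _; case: (chi01 i t) => [->|[-> ti]]; rewrite ?mul0r// !mul1r gg'.
Qed.

Lemma cavg1 i : cavg i (fun=> 1) = h.
Proof.
rewrite /cavg; under eq_Rintegral do rewrite mulr1.
rewrite /Rintegral integral_indic//; last exact: measurable_itv.
by rewrite setIT; exact: (congr1 fine (leb_cell i)).
Qed.

Lemma cavg_cst i c : cavg i (fun=> c) = c * h.
Proof. by rewrite -(cavg1 i) -cavgZ; [under [in RHS]eq_fun do rewrite mulr1|exact: bm_cst]. Qed.

Lemma cavg_ge0 i g : (forall t, 0 <= g t) -> 0 <= cavg i g.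
Proof. by move=> g0; apply: Rintegral_ge0 => t _; rewrite mulr_ge0// chi_ge0. Qed.

Lemma cavg_norm i g : bm (g : T1 -> R) -> `|cavg i g| <= cavg i (fun t => `|g t|).
Proof.
move=> bg; rewrite ler_norml; apply/andP; split; last first.
  by apply: cavg_le => //; [exact: bm_norm|move=> t _; exact: ler_norm].
rewrite -[X in - X]mul1r -mulNr -cavgZ; last exact: bm_norm.
apply: cavg_le => //; first by apply: bmM; [exact: bm_cst|exact: bm_norm].
by move=> t _; rewrite mulN1r lerNl -normrN ler_norm.
Qed.

(** Nonnegativity of the variance about the cell mean [W / h]. *)
Lemma cavg_cs i g : bm (g : T1 -> R) -> cavg i g ^+ 2 <= h * cavg i (fun t => g t ^+ 2).
Proof.
move=> bg; set W := cavg i g; have bc := @bm_cst _ T1.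
have bgg : bm (fun t : T1 => g t ^+ 2) by under eq_fun do rewrite expr2; exact: bmM.
have : 0 <= cavg i (fun t => (g t - W / h) ^+ 2) by apply: cavg_ge0 => t; exact: sqr_ge0.
have -> : cavg i (fun t => (g t - W / h) ^+ 2) = cavg i (fun t => g t ^+ 2) - W ^+ 2 / h.
  have -> : (fun t => (g t - W / h) ^+ 2) = (fun t => g t ^+ 2 + ((- 2 * (W / h)) * g t + (W / h) ^+ 2)).
    by apply/funext => t; ring.
  rewrite cavgD//; last by apply: bmD => //; exact: bmM.
  rewrite cavgD//; last exact: bmM.
  rewrite cavgZ// cavg_cst -/W; field; exact: lt0r_neq0.
by rewrite subr_ge0 ler_pdivrMr// mulrC.
Qed.

End LineAverage.

Section CellAverage.
Context {R : realType}.
Local Notation leb := (@lebesgue_measure R).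
Variables (L h : R) (N : nat).
Hypotheses (h0 : 0 < h) (hN : N%:R * h = 2 * L).
Local Notation T1 := (measurableTypeR R).
Local Notation chi := (chi L h).
Local Notation cavg := (cavg L h).
Implicit Types (F G : mpt R -> R) (x : pt R) (i : nat) (j : 'I_3).

Definition cint1 j i F : mpt R -> R := fun x => cavg i (fun t => F (upd j t x)).
(** Averages in direction [j] only; the averages over three-dimensional cells are reached by
    composing the three directions. *)
Definition cmean j F : mpt R -> R :=
  fun x => h^-1 * \sum_(i < N) chi i (xcoord x j) * cint1 j i F x.

Lemma bm_line F j x : bm F -> bm (fun t : T1 => F (upd j t x)).
Proof.
move=> [mF [M hM]]; split; last by exists M.
apply: (measurableT_comp mF); exact: (measurableT_comp (measurable_upd j) (pair1_measurable x)).
Qed.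

Lemma bm_cint1 j i F : bm F -> bm (cint1 j i F).
Proof.
move=> bF; have [mF [M hM]] := bF; split.
  exact: (measurable_coord_integral j mF (measurable_chi L h i)).
exists (M * h) => x; rewrite -(cavg_cst L h0 i).
apply: (le_trans (cavg_norm L h0 i (bm_line j x bF))); apply: cavg_le => //.
- exact: bm_norm (bm_line j x bF).
- exact: bm_cst.
Qed.

Lemma bm_chix j i : bm (fun x : mpt R => chi i (xcoord x j)).
Proof.
split; last by exists 1 => x; exact: chi_le1.
have mx : measurable_fun setT (fun x : mpt R => xcoord x j : T1) by exact: measurable_xcoord.
exact: (measurableT_comp (measurable_chi L h i) mx).
Qed.

Lemma bm_cmean j F : bm F -> bm (cmean j F).
Proof.
move=> bF; apply: bmM; first exact: bm_cst.
by apply: bm_sum => i; apply: bmM; [exact: bm_chix|exact: bm_cint1].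
Qed.

Lemma cint1_upd j i F s x : cint1 j i F (upd j s x) = cint1 j i F x.
Proof. by rewrite /cint1; congr cavg; apply/funext => t; rewrite upd_upd. Qed.

Lemma updC j k s t x : j != k -> upd j s (upd k t x) = upd k t (upd j s x).
Proof.
by case: x => -[a b] c; rewrite /upd/=; case: j k => -[|[|[|//]]] ? [[|[|[|//]]] ?].
Qed.

Lemma cint1_indep j k i F : indep k F -> indep k (cint1 j i F).
Proof.
move=> iF t x; have [->|jk] := eqVneq j k; first exact: cint1_upd.
by rewrite /cint1; congr cavg; apply/funext => s; rewrite updC// iF.
Qed.

Lemma cint1Z j i a F x : bm F -> cint1 j i (fun y => a * F y) x = a * cint1 j i F x.
Proof. by move=> bF; rewrite /cint1 -(cavgZ L h0)//; exact: bm_line. Qed.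

Definition pbox x := forall j, - L <= xcoord x j < L.
Definition bms F := bm F /\ forall x, ~ pbox x -> F x = 0.

Lemma bms_mul F G : bm F -> bms G -> bms (fun x => F x * G x).
Proof. by move=> bF [bG G0]; split; [exact: bmM|move=> x nx; rewrite G0// mulr0]. Qed.

Lemma bmsD F G : bms F -> bms G -> bms (fun x => F x + G x).
Proof. by move=> [bF F0] [bG G0]; split; [exact: bmD|move=> x nx; rewrite F0// G0// addr0]. Qed.

Lemma bmsB F G : bms F -> bms G -> bms (fun x => F x - G x).
Proof. by move=> [bF F0] [bG G0]; split; [exact: bmB|move=> x nx; rewrite F0// G0// subr0]. Qed.

Lemma bms_sqr F : bms F -> bms (fun x => F x ^+ 2).
Proof. by move=> bF; under eq_fun do rewrite expr2; apply: bms_mul => //; case: bF. Qed.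

Lemma bms_sum (I : Type) (r : seq I) (F : I -> mpt R -> R) : (forall k, bms (F k)) ->
  bms (fun x => \sum_(i <- r) F i x).
Proof.
move=> bF; split; first by apply: bm_sum => i; case: (bF i).
by move=> x nx; rewrite big1// => i _; exact: (bF i).2.
Qed.

Lemma bms_bcs F : bms F -> bcs F.
Proof.
move=> [[mF [M hM]] F0]; split => //.
have n0 := normr_ge0 M; have n1 := normr_ge0 L; have n2 := ler_norm L.
exists (`|M| + (`|L| + 1)); first by rewrite ltr_wpDl// ltr_wpDl.
split=> x; first by apply: (le_trans (hM x)); have := ler_norm M; lra.
move=> nx; apply: F0 => px; apply: nx.
have b j : - (`|M| + (`|L| + 1)) < xcoord x j < `|M| + (`|L| + 1).
  by have /andP[a1 a2] := px j; apply/andP; split; lra.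
split.
- exact: b ord0.
- exact: (b (Ordinal (isT : 1 < 3)%N)).
- exact: (b (Ordinal (isT : 2 < 3)%N)).
Qed.

Lemma bms_integrable F : bms F -> leb3.-integrable setT (EFin \o F).
Proof. by move=> /bms_bcs; exact: bcs_integrable. Qed.

Lemma bms_cmean j F : bms F -> bms (cmean j F).
Proof.
move=> [bF F0]; split; first exact: bm_cmean.
move=> x /existsNP[k nk]; rewrite /cmean; apply/eqP; rewrite mulf_eq0; apply/orP; right; apply/eqP.
rewrite big1// => i _; have [kj|kj] := eqVneq k j; last first.
  rewrite [cint1 _ _ _ _](_ : _ = 0) ?mulr0// /cint1 -[RHS](mul0r h) -(cavg_cst L h0 i).
  congr cavg; apply/funext => t; apply: F0 => /(_ k); rewrite xcoord_upd_neq//.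
rewrite -kj; case: (chi01 L h i (xcoord x k)) => [->|[_ /andP[a1 a2]]]; first by rewrite mul0r.
exfalso; apply: nk; apply/andP; split.
  apply: le_trans a1; rewrite lerDl mulr_ge0// ltW//.
apply: (lt_le_trans a2); have : i.+1%:R * h <= N%:R * h by rewrite ler_pM2r// ler_nat.
rewrite hN; lra.
Qed.

Lemma line_split F j x : bms F -> \int[leb]_t F (upd j t x) = \sum_(i < N) cint1 j i F x.
Proof.
move=> [bF F0]; rewrite /cint1 /Defs.cint.
have E t : F (upd j t x) = \sum_(i < N) chi i t * F (upd j t x).
  rewrite -mulr_suml; have [pt_|npt] := pselect (- L <= t < L); first by rewrite (chi_sum h0 hN)// mul1r.
  by rewrite F0 ?mulr0// => /(_ j); rewrite xcoord_upd.
under eq_Rintegral do rewrite E.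
have key (r : seq 'I_N) :
    leb.-integrable setT (fun t : T1 => (\sum_(i <- r) chi i t * F (upd j t x))%:E) /\
    \int[leb]_t (\sum_(i <- r) chi i t * F (upd j t x)) = \sum_(i <- r) cavg i (fun t => F (upd j t x)).
  elim: r => [|i r [IH1 IH2]].
    rewrite big_nil; under eq_fun do rewrite big_nil.
    under eq_Rintegral do rewrite big_nil.
    by split; [exact: integrable0|rewrite /Rintegral integral0].
  have Ii := cavg_integrable L h0 i (bm_line j x bF).
  rewrite big_cons -IH2; under eq_fun do rewrite big_cons.
  under eq_Rintegral do rewrite big_cons.
  by split; [exact: (integrableD measurableT Ii IH1)|rewrite RintegralD].
by have [_ ->] := key (index_enum 'I_N).
Qed.

Lemma chi_cell (t : R) : - L <= t < L -> exists i : 'I_N, chi i t = 1.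
Proof.
move=> ht; have := chi_sum h0 hN ht; apply: contraPP => /forallNP nx.
rewrite big1 => [|i _]; first by move/esym/eqP; rewrite oner_eq0.
by case: (chi01 L h i t) => // -[c1 _]; case: (nx i).
Qed.

Lemma cmean_cell j F x (i : 'I_N) : chi i (xcoord x j) = 1 -> cmean j F x = h^-1 * cint1 j i F x.
Proof.
move=> ci; rewrite /cmean (bigD1 i)//= ci mul1r big1 ?addr0// => k ki.
by rewrite -[chi k _]mulr1 -ci (chi_orth L h0)// mul0r.
Qed.

Lemma cmean_out j F x : (forall i : 'I_N, chi i (xcoord x j) = 0) -> cmean j F x = 0.
Proof. by move=> h1; rewrite /cmean big1 ?mulr0// => i _; rewrite h1 mul0r. Qed.

Lemma cmean_case j x : (exists i : 'I_N, chi i (xcoord x j) = 1) \/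
  (forall i : 'I_N, chi i (xcoord x j) = 0).
Proof.
have [[i hi]|/forallNP nx] := pselect (exists i : 'I_N, chi i (xcoord x j) = 1); first by left; exists i.
by right => i; case: (chi01 L h i (xcoord x j)) => // -[ci _]; case: (nx i).
Qed.

Lemma cmean_sqr_le j F x : bm F -> cmean j F x ^+ 2 <= cmean j (fun y => F y ^+ 2) x.
Proof.
move=> bF; case: (cmean_case j x) => [[i ci]|nc]; last by rewrite !cmean_out// expr0n.
rewrite !(cmean_cell _ ci) exprMn [h^-1 ^+ 2]expr2 -mulrA ler_wpM2l ?invr_ge0 ?(ltW h0)//.
by rewrite ler_pdivrMl//; exact: (cavg_cs L h0 i (bm_line j x bF)).
Qed.

Lemma cmean_integral j F : bms F -> \int[leb3]_x cmean j F x = \int[leb3]_x F x.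
Proof.
move=> sF; have [bF F0] := sF; have sA := bms_cmean j sF.
apply/eqP; rewrite -subr_eq0 -RintegralB//; [|exact: bms_integrable|exact: bms_integrable].
apply/eqP; have sB := bmsB sA sF; apply: (coord_fubini (j := j)) (bms_bcs sB) _ => x.
rewrite (line_split j x sB) big1// => i _.
rewrite /cint1 (cavgB L h0)//; [|exact: bm_line sA.1|exact: bm_line].
apply/eqP; rewrite subr_eq0; apply/eqP; transitivity (cavg i (fun=> h^-1 * cint1 j i F x)).
  apply: eq_Rintegral => t _; case: (chi01 L h i t) => [->|[ci _]]; first by rewrite !mul0r.
  by rewrite (@cmean_cell _ _ _ i) ?xcoord_upd// cint1_upd.
by rewrite (cavg_cst L h0) mulrAC mulVf ?mul1r// lt0r_neq0.
Qed.

Definition N2 F : R := \int[leb3]_x (F x ^+ 2).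

Lemma N2_le F G : bms F -> bms G -> (forall x, F x ^+ 2 <= G x) -> N2 F <= \int[leb3]_x G x.
Proof.
move=> bF bG FG; apply: le_Rintegral => //; [|exact: bms_integrable].
exact: bms_integrable (bms_sqr bF).
Qed.

Lemma N2_cmean j F : bms F -> N2 (cmean j F) <= N2 F.
Proof.
move=> sF; rewrite /N2 -(cmean_integral j (bms_sqr sF)); apply: N2_le.
- exact: bms_cmean.
- by apply: bms_cmean; exact: bms_sqr.
- by move=> x; apply: cmean_sqr_le; case: sF.
Qed.

Lemma N2D F G : bms F -> bms G -> N2 (fun x => F x + G x) <= 2 * N2 F + 2 * N2 G.
Proof.
move=> sF sG; have [i1 i2] := (bms_integrable (bms_sqr sF), bms_integrable (bms_sqr sG)).
rewrite /N2 -!RintegralZl// -RintegralD//; first last.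
- exact: (integrableZl measurableT 2 i2).
- exact: (integrableZl measurableT 2 i1).
apply: le_Rintegral => //.
- exact: bms_integrable (bms_sqr (bmsD sF sG)).
- exact: (integrableD measurableT (integrableZl measurableT 2 i1) (integrableZl measurableT 2 i2)).
- move=> x _; rewrite -subr_ge0 (_ : _ - _ = (F x - G x) ^+ 2) ?sqr_ge0//; ring.
Qed.

Lemma line_oscillation f j i x s t : C1c f -> 
  - L + i%:R * h <= s < - L + i.+1%:R * h -> - L + i%:R * h <= t < - L + i.+1%:R * h ->
  `|f (upd j s x) - f (upd j t x)| <= cint1 j i (fun y => `|pd j f y|) x.
Proof.
move=> Cf; wlog : s t / t < s => [H|ts /andP[s1 s2] /andP[t1 t2]].
  move=> hs ht; have [ts|st|->] := ltrgtP t s; first exact: H.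
    by rewrite distrC; exact: H.
  by rewrite subrr normr0; apply: cavg_ge0.
have [mp [M M0 [pM _]]] := C1c_pd_bcs j Cf.
have bp : bm (pd j f : mpt R -> R) by split => //; exact: ex_intro pM.
have bl := bm_line j x bp; have bn := bm_norm bl.
have ft := line_FTC j x Cf ts.
have itv : measurable (`[t, s] : set T1) by exact: measurable_itv.
have sub : `[t, s] `<=` cell L h i.
  by move=> u; rewrite /cell /= !in_itv/= => /andP[u1 u2]; apply/andP; split; lra.
have mc : measurable (cell L h i : set T1) by exact: measurable_itv.
have ic := cavg_integrable L h0 i bn.
have E : (\int[leb]_(u in (cell L h i : set T1)) (`|pd j f (upd j u x)|)%:E =
    \int[leb]_u (chi i u * `|pd j f (upd j u x)|)%:E)%E.
  rewrite integral_mkcond; apply: eq_integral => u _; rewrite patchE /chi indicE.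
  by case: ifP => _; rewrite ?mul1r ?mul0r.
have fc : (\int[leb]_u (chi i u * `|pd j f (upd j u x)|)%:E)%E \is a fin_num by exact: integrable_fin_num.
rewrite -lee_fin /cint1 /cavg /Rintegral fineK//.
have -> : (`|f (upd j s x) - f (upd j t x)|)%:E =
   `|\int[leb]_(u in (`[t, s] : set T1)) (pd j f (upd j u x))%:E|%E by rewrite ft -EFinB.
have mpu : measurable_fun (`[t, s] : set T1) (fun u => (pd j f (upd j u x))%:E).
  by apply/measurable_EFinP; exact: measurable_funS bl.1.
apply: (le_trans (le_abse_integral _ itv mpu)); rewrite -E.
apply: ge0_subset_integral => //.
by apply/measurable_EFinP; exact: measurable_funS bn.1.
Qed.

(** Poincare inequality on one cell: there [f] differs from its mean by at most the integral of the
    modulus of its derivative, and Cauchy-Schwarz on a cell of length [h] yields the factor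
    [h ^+ 2]. *)
Lemma pd_cmean j f x : C1c f -> bms f ->
  (f x - cmean j f x) ^+ 2 <= h ^+ 2 * cmean j (fun y => pd j f y ^+ 2) x.
Proof.
move=> Cf [bf f0]; case: (cmean_case j x) => [[i ci]|nc]; last first.
  rewrite !cmean_out// f0 ?subr0 ?expr0n ?mulr0// => /(_ j)/chi_cell[i ci].
  by have := nc i; rewrite ci => /eqP; rewrite oner_eq0.
rewrite !(cmean_cell _ ci).
have [mp [M M0 [pM _]]] := C1c_pd_bcs j Cf.
have bp : bm (pd j f : mpt R -> R) by split => //; exact: ex_intro pM.
have hx : - L + i%:R * h <= xcoord x j < - L + i.+1%:R * h.
  by case: (chi01 L h i (xcoord x j)) ci => [->/esym/eqP|[]//]; rewrite oner_eq0.
set W := cint1 j i (fun y => `|pd j f y|) x.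
have W0 : 0 <= W by apply: cavg_ge0.
have osc : `|f x - h^-1 * cint1 j i f x| <= W.
  have -> : f x - h^-1 * cint1 j i f x = h^-1 * cavg i (fun t => f x - f (upd j t x)).
    rewrite (cavgB L h0) ?(cavg_cst L h0)//; [|exact: bm_cst|exact: bm_line].
    by rewrite mulrBr mulrCA mulVf ?mulr1// lt0r_neq0.
  rewrite normrM ger0_norm ?invr_ge0 ?(ltW h0)// ler_pdivrMl// mulrC -(cavg_cst L h0 i).
  have bd : bm (fun t : T1 => f x - f (upd j t x)) by apply: bmB; [exact: bm_cst|exact: bm_line].
  apply: (le_trans (cavg_norm L h0 i bd)); apply: cavg_le => //; [exact: bm_norm|exact: bm_cst|].
  by move=> t ht; rewrite -[X in f X - _](upd_xcoord j x); exact: line_oscillation.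
apply: (@le_trans _ _ (W ^+ 2)).
  by rewrite -[leLHS]real_normK ?num_real// lerXn2r ?nnegrE.
have := cavg_cs L h0 i (bm_norm (bm_line j x bp)).
have -> : h ^+ 2 * (h^-1 * cint1 j i (fun y => pd j f y ^+ 2) x) = h * cint1 j i (fun y => pd j f y ^+ 2) x.
  by rewrite expr2 -mulrA mulVKf// lt0r_neq0.
move/le_trans; apply; rewrite ler_pM2l// /cint1.
by under eq_fun do rewrite real_normK ?num_real//.
Qed.

Lemma N2_sub_cmean j f : C1c f -> bms f -> bms (pd j f) ->
  N2 (fun x => f x - cmean j f x) <= h ^+ 2 * N2 (pd j f).
Proof.
move=> Cf sf sp; have sA := bms_cmean j (bms_sqr sp).
rewrite /N2 -(cmean_integral j (bms_sqr sp)) -RintegralZl//; last exact: bms_integrable.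
apply: N2_le.
- by apply: bmsB => //; exact: bms_cmean.
- by apply: bms_mul => //; exact: bm_cst.
- by move=> x; exact: pd_cmean.
Qed.

Definition chiq (q : {ffun 'I_3 -> 'I_N}) : mpt R -> R := fun x => \prod_(j < 3) chi (q j) (xcoord x j).

Lemma bm_prod (I : Type) (r : seq I) (P : pred I) (F : I -> mpt R -> R) : (forall k, bm (F k)) ->
  bm (fun x => \prod_(k <- r | P k) F k x).
Proof.
move=> bF; elim: r => [|k r IH].
  by under eq_fun do rewrite big_nil; exact: bm_cst.
by case Pk : (P k); under eq_fun do rewrite big_cons Pk; [exact: (bmM (bF k) IH)|exact: IH].
Qed.

Lemma bms_chiq q : bms (chiq q).
Proof.
split; first by apply: bm_prod => k; exact: bm_chix.
move=> x /existsNP[j nj]; rewrite /chiq (bigD1 j)//=.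
case: (chi01 L h (q j) (xcoord x j)) => [->|[_ /andP[a1 a2]]]; first by rewrite mul0r.
exfalso; apply: nj; apply/andP; split.
  by apply: le_trans a1; rewrite lerDl mulr_ge0// ltW.
apply: (lt_le_trans a2); have : (q j).+1%:R * h <= N%:R * h by rewrite ler_pM2r// ler_nat.
rewrite hN; lra.
Qed.

(** Along a line in direction [j] the function [chiq q] is a constant times [chi (q j)], so [F] may
    be replaced by its mean over that cell. *)
Lemma chiq_step q j F : bm F ->
  \int[leb3]_x (chiq q x * F x) = h^-1 * \int[leb3]_x (chiq q x * cint1 j (q j) F x).
Proof.
move=> bF; have bC := bm_cint1 j (q j) bF; have sq := bms_chiq q.
have s1 : bms (fun x => chiq q x * F x) by under eq_fun do rewrite mulrC; exact: bms_mul.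
have s2 : bms (fun x => chiq q x * cint1 j (q j) F x) by under eq_fun do rewrite mulrC; exact: bms_mul.
have s3 : bms (fun x => h^-1 * (chiq q x * cint1 j (q j) F x)) by apply: bms_mul => //; exact: bm_cst.
rewrite -RintegralZl//; last exact: bms_integrable.
apply/eqP; rewrite -subr_eq0 -RintegralB//; try exact: bms_integrable.
apply/eqP; apply: (coord_fubini (j := j)) (bms_bcs (bmsB s1 s3)) _ => x.
pose r := \prod_(k < 3 | k != j) chi (q k) (xcoord x k).
have E t : chiq q (upd j t x) = chi (q j) t * r.
  rewrite /chiq (bigD1 j)//= xcoord_upd; congr (_ * _).
  by apply: eq_bigr => k kj; rewrite xcoord_upd_neq.
transitivity (cavg (q j) (fun t => r * F (upd j t x) - h^-1 * (r * cint1 j (q j) F x))).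
  by apply: eq_Rintegral => t _; rewrite E cint1_upd; ring.
have bl := bm_line j x bF; have bc := bm_cst T1.
rewrite (cavgB L h0)//; last exact: bmM.
rewrite (cavgZ L h0)// (cavg_cst L h0) mulrAC mulVf ?mul1r ?subrr// lt0r_neq0//.
Qed.

Local Notation o0 := (@Ordinal 3 0 isT).
Local Notation o1 := (@Ordinal 3 1 isT).
Local Notation o2 := (@Ordinal 3 2 isT).

Definition cmean3 F := cmean o0 (cmean o1 (cmean o2 F)).
(** Formally still a function of the point, it is constant by [cint3_cst]; the value at 0 stands for
    it from then on. *)
Definition cint3 (q : {ffun 'I_3 -> 'I_N}) F := cint1 o0 (q o0) (cint1 o1 (q o1) (cint1 o2 (q o2) F)).

Lemma cint3_cst q F x y : cint3 q F x = cint3 q F y.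
Proof.
have i0 : indep o0 (cint3 q F) by move=> t z; exact: cint1_upd.
have i1 : indep o1 (cint3 q F) by apply: cint1_indep => t z; exact: cint1_upd.
have i2 : indep o2 (cint3 q F).
  by do 2! apply: cint1_indep; move=> t z; exact: cint1_upd.
have -> : x = upd o0 (xcoord x o0) (upd o1 (xcoord x o1) (upd o2 (xcoord x o2) y)).
  by case: x => -[].
by rewrite i0 i1 i2.
Qed.

Lemma cmean3_cell (q : {ffun 'I_3 -> 'I_N}) F x : bm F -> (forall j, chi (q j) (xcoord x j) = 1) ->
  cmean3 F x = h^-1 ^+ 3 * cint3 q F x.
Proof.
move=> bF cq; have b2 := bm_cint1 o2 (q o2) bF; have b1 := bm_cint1 o1 (q o1) b2.
have E2 y : chi (q o2) (xcoord y o2) = 1 -> cmean o2 F y = h^-1 * cint1 o2 (q o2) F y.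
  exact: cmean_cell.
have E1 y : chi (q o1) (xcoord y o1) = 1 -> chi (q o2) (xcoord y o2) = 1 ->
    cmean o1 (cmean o2 F) y = h^-1 ^+ 2 * cint1 o1 (q o1) (cint1 o2 (q o2) F) y.
  move=> c1 c2; rewrite (cmean_cell _ c1) expr2 -mulrA; congr (_ * _).
  rewrite -cint1Z//; congr cavg; apply/funext => t; apply: E2.
  by rewrite xcoord_upd_neq.
rewrite /cmean3 (cmean_cell _ (cq o0)) exprS -mulrA; congr (_ * _).
rewrite /cint3 -cint1Z//; congr cavg; apply/funext => t.
by apply: E1; rewrite xcoord_upd_neq.
Qed.

Lemma chiq_integral q F : bm F ->
  \int[leb3]_x (chiq q x * F x) = h^-1 ^+ 3 * (cint3 q F 0 * \int[leb3]_x chiq q x).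
Proof.
move=> bF; have b2 := bm_cint1 o2 (q o2) bF; have b1 := bm_cint1 o1 (q o1) b2.
rewrite (chiq_step q o2 bF) (chiq_step q o1 b2) (chiq_step q o0 b1) -/(cint3 q F).
rewrite !mulrA -!expr2 -exprSr -mulrA; congr (_ * _).
rewrite -RintegralZl//; last exact: bms_integrable (bms_chiq q).
by apply: eq_Rintegral => x _; rewrite mulrC (cint3_cst q F x 0).
Qed.

Lemma N2_cmean3 F : bms F ->
  N2 (cmean3 F) <= \sum_q h^-1 ^+ 6 * cint3 q F 0 ^+ 2 * \int[leb3]_x chiq q x.
Proof.
move=> sF; have sG : bms (cmean3 F) by do 3! apply: bms_cmean.
have sq q : bms (fun x => h^-1 ^+ 6 * cint3 q F 0 ^+ 2 * chiq q x).
  by apply: bms_mul; [exact: bm_cst|exact: bms_chiq].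
apply: (@le_trans _ _ (\int[leb3]_x (\sum_q h^-1 ^+ 6 * cint3 q F 0 ^+ 2 * chiq q x))).
  apply: N2_le => //; first exact: bms_sum.
  have pos q x : 0 <= h^-1 ^+ 6 * cint3 q F 0 ^+ 2 * chiq q x.
    apply: mulr_ge0; last by apply: prodr_ge0 => j _; exact: chi_ge0.
    by rewrite mulr_ge0 ?sqr_ge0// exprn_ge0// invr_ge0 ltW.
  move=> x; have [px|npx] := pselect (pbox x); last first.
    by rewrite sG.2// expr0n; apply: sumr_ge0 => q _; exact: pos.
  have /choice[q hq] : forall j, exists i : 'I_N, chi i (xcoord x j) = 1.
    by move=> j; exact: chi_cell.
  pose qq : {ffun 'I_3 -> 'I_N} := [ffun j => q j].
  have cq j : chi (qq j) (xcoord x j) = 1 by rewrite ffunE.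
  rewrite (cmean3_cell sF.1 cq) (bigD1 qq)//= (cint3_cst qq F x 0).
  have -> : chiq qq x = 1 by rewrite /chiq big1// => j _; exact: cq.
  have alg (a c S : R) : 0 <= S -> (a ^+ 3 * c) ^+ 2 <= a ^+ 6 * c ^+ 2 * 1 + S.
    by move=> S0; rewrite (_ : _ ^+ 2 = a ^+ 6 * c ^+ 2 * 1); [rewrite lerDl|ring].
  by apply: alg; apply: sumr_ge0 => k _; exact: pos.
have key (r : seq {ffun 'I_3 -> 'I_N}) : \int[leb3]_x (\sum_(q <- r) h^-1 ^+ 6 * cint3 q F 0 ^+ 2 * chiq q x) =
     \sum_(q <- r) h^-1 ^+ 6 * cint3 q F 0 ^+ 2 * \int[leb3]_x chiq q x.
  elim: r => [|q r IH].
    by rewrite big_nil; under eq_Rintegral do rewrite big_nil; rewrite /Rintegral integral0.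
  under eq_Rintegral do rewrite big_cons.
  rewrite big_cons -IH RintegralD//; [|exact: bms_integrable|apply: bms_integrable; exact: bms_sum].
  by rewrite RintegralZl//; exact: bms_integrable (bms_chiq q).
by rewrite key.
Qed.

(** Indicator of the cell divided by the square root of its volume, so that the squared functional
    is the squared L^2 norm of the mean on that cell. The factor 2 supplies the 4 of the four-term
    decomposition. *)
Definition cellw (q : {ffun 'I_3 -> 'I_N}) : mpt R -> R :=
  fun x => 2 * (Num.sqrt (\int[leb3]_x chiq q x))^-1 * chiq q x.

Lemma cellw_integral q F : bms F -> (\int[leb3]_x (cellw q x * F x)) ^+ 2 =
  4 * (h^-1 ^+ 6 * cint3 q F 0 ^+ 2 * \int[leb3]_x chiq q x).
Proof.
move=> sF; set m := \int[leb3]_x chiq q x.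
have m0 : 0 <= m by apply: Rintegral_ge0 => x _; apply: prodr_ge0 => j _; exact: chi_ge0.
have -> : \int[leb3]_x (cellw q x * F x) = 2 * (Num.sqrt m)^-1 * \int[leb3]_x (chiq q x * F x).
  rewrite -RintegralZl//; first by apply: eq_Rintegral => x _; rewrite mulrA.
  apply: bms_integrable; rewrite (_ : (fun x => _) = fun x => F x * chiq q x).
    by apply: bms_mul; [case: sF|exact: bms_chiq].
  by apply/funext => x; rewrite mulrC.
rewrite (chiq_integral q sF.1) -/m; move: m m0 (cint3 q F 0) => m m0 c.
have -> : (2 * (Num.sqrt m)^-1 * (h^-1 ^+ 3 * (c * m))) ^+ 2 =
   4 * (h^-1 ^+ 6 * c ^+ 2 * ((Num.sqrt m ^+ 2)^-1 * m ^+ 2)) by rewrite -exprVn; ring.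
rewrite sqr_sqrtr// expr2; congr (4 * (_ * _)).
have [->|mn0] := eqVneq m 0; first by rewrite expr0n mulr0.
by rewrite expr2 mulKf.
Qed.

(** With [A_j] the average in direction [j], the function is telescoped as [f - A_0 f], plus
    [A_0 (f - A_1 f)], plus [A_0 A_1 (f - A_2 f)], plus the full cell average. Averages contract the
    L^2 norm, so each of the first three terms obeys the one-dimensional Poincare bound, and the
    last is a finite sum of squared functionals. *)
Lemma N2_cell_le f : C1c f -> bms f -> (forall j, bms (pd j f)) ->
  N2 f <= 4 * h ^+ 2 * (\sum_j N2 (pd j f)) + \sum_q (\int[leb3]_x (cellw q x * f x)) ^+ 2.
Proof.
move=> Cf sf sp; set a := fun x => f x - cmean o0 f x.
set b1 := fun x => f x - cmean o1 f x; set c1 := fun x => f x - cmean o2 f x.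
have A j F : bms F -> bms (cmean j F) by exact: bms_cmean.
pose b := cmean o0 b1; pose c := cmean o0 (cmean o1 c1).
have [sa sb1 sc1] : [/\ bms a, bms b1 & bms c1] by split; apply: bmsB => //; exact: A.
have [sb sc] : bms b /\ bms c by split; [exact: A|exact: (A _ _ (A _ _ sc1))].
have cB j F G x : bms F -> bms G -> cmean j (fun y => F y - G y) x = cmean j F x - cmean j G x.
  move=> [bF _] [bG _]; rewrite /cmean -mulrBr -sumrB; congr (_ * _); apply: eq_bigr => i _.
  by rewrite -mulrBr /cint1 (cavgB L h0)//; exact: bm_line.
have fE : f = fun x => (a x + b x) + (c x + cmean3 f x).
  have A1 := A o1 _ sf; have A2 := A o2 _ sf; have A12 := A o1 _ A2.
  apply/funext => x; rewrite /b /c (cB o0 _ _ x sf A1).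
  have -> : cmean o1 c1 = fun y => cmean o1 f y - cmean o1 (cmean o2 f) y.
    by apply/funext => y; exact: (cB o1 _ _ y sf A2).
  rewrite (cB o0 _ _ x A1 A12) /a /cmean3.
  have alg (p q r s : R) : p = (p - q + (q - r)) + ((r - s) + s) by ring.
  exact: alg.
have sG : bms (cmean3 f) := A _ _ (A _ _ (A _ _ sf)).
have e1 := N2D (bmsD sa sb) (bmsD sc sG).
have e2 := N2D sa sb; have e3 := N2D sc sG.
have f1 := N2_sub_cmean Cf sf (sp o0); have f2 := N2_sub_cmean Cf sf (sp o1).
have f3 := N2_sub_cmean Cf sf (sp o2).
have g2 := N2_cmean o0 sb1.
have g3 := le_trans (N2_cmean o0 (A o1 _ sc1)) (N2_cmean o1 sc1).
have g4 := N2_cmean3 sf.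
have -> : \sum_j N2 (pd j f) = N2 (pd o0 f) + N2 (pd o1 f) + N2 (pd o2 f).
  exact: sum3.
have -> : \sum_q (\int[leb3]_x (cellw q x * f x)) ^+ 2 =
    4 * \sum_q h^-1 ^+ 6 * cint3 q f 0 ^+ 2 * \int[leb3]_x chiq q x.
  by rewrite mulr_sumr; apply: eq_bigr => q _; exact: cellw_integral.
have E : N2 f = N2 (fun x => (a x + b x) + (c x + cmean3 f x)) by rewrite -fE.
rewrite -E in e1; apply: (le_trans e1).
exact: (four_terms e2 e3 f1 f2 f3 g2 g3 g4).
Qed.

End CellAverage.

Section Rellich.
Context {R : realType} (D : bdom R).
Local Notation DD := (D : set (mpt R)).
Let mD := bdom_measurable D.
Local Notation l2 := (l2hform D).

Lemma test_bms (L : R) phi : (D : set (pt R)) `<=` rbox (- L, - L, - L) (L, L, L) ->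
  test_fun D phi -> bms L phi.
Proof.
move=> DL tp; have [mp [M M0 [pM _]]] := test_bcs tp.
split; first by split => //; exact: ex_intro pM.
move=> x nx; apply: (test_out tp) => /DL[/andP[a1 a2] /andP[b1 b2] /andP[c1 c2]]; apply: nx.
by rewrite /pbox /xcoord => -[[|[|[|//]]]] ? /=; rewrite ltW.
Qed.

Lemma test_cells e : 0 < e -> exists (J : finType) (w : J -> mpt R -> R), (forall q, bm (w q)) /\
  forall phi, test_fun D phi -> n2 leb3 DD phi <=
    e * (\sum_j n2 leb3 DD (pd j phi)) + \sum_q (\int[leb3]_(x in DD) (w q x * phi x)) ^+ 2.
Proof.
move=> e0; have [L L0 DL] := bdom_sub_box D.
(* Chosen so that [4 * h ^+ 2 = 16 * L ^+ 2 / N ^+ 2] is at most [e]; the successor ensures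
   [N >= 1], whence [N <= N ^+ 2]. *)
pose N := (Num.truncn (16 * L ^+ 2 / e)).+1; pose h := 2 * L / N%:R.
have N0 : 0 < N%:R :> R by rewrite ltr0n.
have h0 : 0 < h by rewrite divr_gt0// mulr_gt0.
have hN : N%:R * h = 2 * L by rewrite /h mulrCA divff ?mulr1// lt0r_neq0.
have he : 4 * h ^+ 2 <= e.
  have h1 : 16 * L ^+ 2 / e <= N%:R by rewrite ltW// truncnS_gt.
  rewrite ler_pdivrMr// in h1.
  have -> : 4 * h ^+ 2 = 16 * L ^+ 2 / N%:R ^+ 2 by rewrite /h; field; exact: lt0r_neq0.
  rewrite ler_pdivrMr ?exprn_gt0//; apply: (le_trans h1).
  by rewrite mulrC ler_pM2l// expr2 ler_peMl ?ler1n// ltW.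
have sq q : bms L (@cellw R L h N q) by apply: bms_mul; [exact: bm_cst|exact: bms_chiq h0 hN q].
exists {ffun 'I_3 -> 'I_N}, (@cellw R L h N); split=> [q|phi tp]; first by have [] := sq q.
have sup F : (forall x, ~ (D : set (pt R)) x -> F x = 0) -> n2 leb3 DD F = N2 F.
  by move=> F0; apply: Rintegral_supp => // x nD; rewrite F0// expr0n.
rewrite (sup phi); last by move=> x; exact: (test_out tp).
have -> : \sum_j n2 leb3 DD (pd j phi) = \sum_j N2 (pd j phi).
  by apply: eq_bigr => j _; apply: sup => x; exact: (test_pd_out j tp).
have -> : \sum_q (\int[leb3]_(x in DD) (@cellw R L h N q x * phi x)) ^+ 2 =
  \sum_q (\int[leb3]_x (@cellw R L h N q x * phi x)) ^+ 2.
  by apply: eq_bigr => q _; congr (_ ^+ 2); apply: Rintegral_supp => // x nD; rewrite (test_out tp)// mulr0.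
apply: (le_trans (N2_cell_le h0 hN (test_C1c tp) (test_bms DL tp) (fun j => test_bms DL (test_pd j tp)))).
rewrite lerD2r ler_wpM2r//; apply: sumr_ge0 => j _; apply: Rintegral_ge0 => x _; exact: sqr_ge0.
Qed.

Lemma bm_L2 (w : mpt R -> R) : bm w -> L2 D (fun x => (w x)%:C).
Proof.
move=> [mw [M hM]].
have L1 := L2_one D.
rewrite (_ : (fun x => _) = fun x => (w x)%:C * 1); last by apply/funext => x; rewrite mulr1.
apply: L2_bounded L1.
  split; first by apply: measurable_funS mw.
  exact: measurable_cst.
exists (M ^+ 2) => x _; rewrite /sqn/= expr0n addr0 -real_normK ?num_real//.
by rewrite lerXn2r ?nnegrE// (le_trans _ (hM x)).
Qed.

Lemma graph_cells e : 0 < e -> exists (J : finType) (w : J -> L2t D),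
  forall v, tgraph v -> nsq l2 (v None) <=
    e * nsq (jform D) v + \sum_q sqn (l2 (w q) (v None)).
Proof.
move=> e0; have [J [w [bw hw]]] := test_cells e0.
exists J, (fun q => toL2 (bm_L2 (bw q))) => v [[t1 t2] hv].
rewrite nsq_l2; apply: (le_trans (lerD (hw _ t1) (hw _ t2))).
rewrite addrACA -mulrDr -!big_split/=; apply: lerD.
  apply: ler_wpM2l; first exact: ltW.
  rewrite nsq_sum sum_option ler_wpDl ?nsq_ge0//; apply: ler_sum => j _.
  rewrite nsq_l2 (_ : rpart (v (Some j)) = pd j (fun x => complex.Re (v None x))); last first.
    by apply/funext => x; rewrite /rpart hv.
  rewrite (_ : ipart (v (Some j)) = pd j (fun x => complex.Im (v None x)))//.
  by apply/funext => x; rewrite /ipart hv.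
apply: ler_sum => q _; rewrite /sqn /= /l2ip /cint /=; apply: lerD.
  rewrite le_eqVlt; apply/orP; left; apply/eqP; congr (_ ^+ 2); apply: eq_Rintegral => x _.
  by rewrite /rpart; case: (v None x) => a b; rewrite /= mul0r subr0.
rewrite -sqrrN le_eqVlt; apply/orP; left; apply/eqP; congr (_ ^+ 2).
rewrite -[LHS]mulN1r -RintegralZl//.
  apply: eq_Rintegral => x _.
  by rewrite /ipart; case: (v None x) => a b; rewrite /= mul0r addr0 mulN1r mulrN.
exact: (bcs_supp0 (bcs_mul (bw q).1 (bw q).2 (test_bcs t2)) mD).
Qed.

Lemma le_of_eps (x y K : R) : 0 <= K -> (forall d, 0 < d -> x <= y + d * K) -> x <= y.
Proof.
move=> K0 H; rewrite leNgt; apply/negP => yx.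
have K1 : 0 < K + 1 by rewrite ltr_wpDl.
have := H ((x - y) / 2 / (K + 1)); rewrite !divr_gt0 ?subr_gt0// => /(_ isT).
rewrite mulrAC; have : (x - y) / 2 * K / (K + 1) <= (x - y) / 2.
  by rewrite ler_pdivrMr// ler_wpM2l ?lerDl// divr_ge0// subr_ge0 ltW.
move: (_ / (K + 1)) => z *; lra.
Qed.

(* Rellich's theorem in the quantitative form needed for [compact_sq]. *)
Lemma h0_compact : compact_sq (h0form D) (fun f => nsq l2 (f None)).
Proof.
apply: compact_sq_fin => e e0; have e40 : 0 < e / 4 by rewrite divr_gt0.
have [J [w hw]] := graph_cells e40.
(* The cell functionals are L^2 products; Riesz turns them into products of the energy space, as
   [compact_sq] demands. *)
have Fr q : exists r : H0t D, forall f : H0t D, l2 (w q) (f None) = h0form D r f.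
  apply: (riesz (@h0_complete _ D)).
    move=> a x y; rewrite -[LHS]/(l2 (w q) (a *: (x None) + y None)).
    by rewrite (sesDr (hform_sesqui l2)) (sesZr (hform_sesqui l2)).
  exists (nsq l2 (w q)) => x; apply: (le_trans (cauchy_schwarz _ _ _)).
  rewrite ler_wpM2l ?nsq_ge0// nsq_h0 sum_option lerDl; apply: sumr_ge0 => j _; exact: nsq_ge0.
have [r hr] := choice Fr.
(* Replacing [f] by a nearby test function costs a factor 2 in the squared L^2 norm and another in
   the squared cell functionals; doubling the witnesses supplies the 4. *)
exists J, (fun q => (2 : R)%:C *: r q) => f.
have -> : \sum_q sqn (h0form D f ((2 : R)%:C *: r q)) = 4 * \sum_q sqn (l2 (w q) (f None)).
  rewrite mulr_sumr; apply: eq_bigr => q _.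
  rewrite (hipC (h0form D)) sqn_conj hipZ -hr sqnM; congr (_ * _).
  by rewrite sqn_real; ring.
(* Total coefficient of the approximation error [d], which is arbitrary and hence disappears. *)
have K0 : 0 <= 2 + e + 4 * \sum_q nsq l2 (w q).
  by rewrite !addr_ge0 ?(ltW e0)// mulr_ge0// sumr_ge0// => q _; exact: nsq_ge0.
apply: (le_of_eps K0) => d d0; have [v tv hv] := H0tP f d0.
pose u := (h0val f - v); have Ef : h0val f = v + u by rewrite /u addrC subrK.
have Ev : v = h0val f - u by rewrite /u opprB addrC subrK.
have un : nsq l2 (u None) <= d by apply: (le_trans (nsq_comp_le l2 u None)); exact: ltW.
have h1 : nsq l2 (f None) <= 2 * nsq l2 (v None) + 2 * nsq l2 (u None).
  by rewrite [X in nsq l2 (X None)]Ef; exact: nsqD_le.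
have h2 : nsq (jform D) v <= 2 * nsq (h0form D) f + 2 * d.
  rewrite Ev; apply: (le_trans (nsqD_le _ _ _)); rewrite nsqN lerD2l ler_pM2l//; exact: ltW.
have h3 : \sum_q sqn (l2 (w q) (v None)) <=
   2 * (\sum_q sqn (l2 (w q) (f None))) + 2 * (d * \sum_q nsq l2 (w q)).
  rewrite !mulr_sumr -big_split/=; apply: ler_sum => q _.
  have E : l2ip (w q) (v None) = l2ip (w q) (f None) - l2ip (w q) (u None).
    have E0 : v None = f None - u None by rewrite Ev.
    by rewrite E0; exact: (sesBr (f None) (u None) (w q) (hform_sesqui l2)).
  rewrite E.
  apply: (le_trans (sqnD _ _)); rewrite sqnN lerD2l ler_pM2l//.
  apply: (le_trans (cauchy_schwarz l2 (w q) (u None))); rewrite mulrC.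
  by apply: ler_wpM2r => //; exact: nsq_ge0.
have h4 := hw v tv.
have h5 : e / 4 * nsq (jform D) v <= e / 4 * (2 * nsq (h0form D) f + 2 * d) by rewrite ler_pM2l.
move: (nsq (jform D) v) (nsq (h0form D) f) h5 h2 h4 => a b h5 h2 h4.
have -> : d * (2 + e + 4 * \sum_q nsq l2 (w q)) = 2 * d + d * e + 4 * (d * \sum_q nsq l2 (w q)) by ring.
move: (d * \sum_q _) h3 h4 => S h3 h4.
have E5 : e / 4 * (2 * b + 2 * d) = (e * b) / 2 + (d * e) / 2 by field.
rewrite E5 in h5; move: (e / 4 * a) (e * b) (d * e) h5 h4 => p q r' h5 h4.
move: (\sum_q _) (\sum_q _) h3 h4 => S1 S2 h3 h4.
move: (nsq _ _) (nsq _ _) (nsq _ _) h1 un h4 => n1 n2 n3 h1 un h4.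
lra.
Qed.

End Rellich.

(** * PML coefficients and coercivity *)

Section Coefficients.
Context {R : realType}.
Local Notation T1 := (measurableTypeR R).

Lemma measurable_ifpos (f : R -> R) (g : R -> R) : measurable_fun setT (f : T1 -> R) ->
  (forall t, 0 < t -> f t = g t) -> measurable_fun setT (fun t : T1 => if 0 < (t : R) then g t else 0).
Proof.
move=> mf fg; rewrite (_ : (fun t => _) = fun t : T1 => if 0 < (t : R) then f t else 0).
  by apply: measurable_fun_ifT => //; apply: measurable_fun_ltr.
by apply/funext => t; case: ifPn => // /fg.
Qed.

(** On the positive half-line the inverse is [exp (- ln t)], a composite of measurable functions. *)
Lemma measurable_pinv : measurable_fun setT (fun t : T1 => if 0 < (t : R) then (t : R)^-1 else 0).
Proof.
apply: (@measurable_ifpos (fun t => expR (- ln t))) => [|t t0]; last by rewrite expRN lnK.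
apply: measurableT_comp => //; apply: measurableT_comp => //; exact: measurable_ln.
Qed.

Lemma measurable_inv_pos d (T : measurableType d) (f : T -> R) : measurable_fun setT f ->
  (forall x, 0 < f x) -> measurable_fun setT (fun x => (f x)^-1).
Proof.
move=> mf f0; rewrite (_ : (fun x => _) = fun x => if 0 < f x then (f x)^-1 else 0).
  exact: (measurableT_comp measurable_pinv (mf : measurable_fun setT (f : T -> T1))).
by apply/funext => x; rewrite f0.
Qed.

Lemma hexp_ge0 (t : R) : 0 <= hexp t.
Proof. by rewrite /hexp; case: ifP => // _; exact: expR_ge0. Qed.

Lemma hexp_sum_gt0 (t : R) : 0 < hexp t + hexp (1 - t).
Proof.
have [t0|t0] := ltrP 0 t.
  by rewrite ltr_pwDl ?hexp_ge0// /hexp t0 expR_gt0.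
by rewrite ltr_wpDl ?hexp_ge0// /hexp ifT ?expR_gt0//; lra.
Qed.

Lemma measurable_hexp : measurable_fun setT (@hexp R : T1 -> R).
Proof.
apply: (@measurable_ifpos (fun t => expR (- (if 0 < t then t^-1 else 0)))) => [|t t0]; last by rewrite t0.
by apply: measurableT_comp => //; apply: measurableT_comp => //; exact: measurable_pinv.
Qed.

Variable P : pml R.
Hypotheses (a0 : 0 < alpha0 P) (z0 : 0 < zeta P).

Lemma measurable_alpha j : measurable_fun setT (alpha P j : T1 -> R).
Proof.
have mn : measurable_fun setT (fun t : T1 => `|(t : R)|) by exact: measurableT_comp.
apply: measurable_fun_ifT; [exact: measurable_fun_ler|exact: measurable_cst|].
apply: measurable_fun_ifT; [exact: measurable_fun_ler|exact: measurable_cst|].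
pose tau (t : R) := (`|t| - ell P j) / (ellbar P j - ell P j).
have mt : measurable_fun setT (tau : T1 -> R).
  by apply: measurable_funM => //; apply: measurable_funB.
have mh : measurable_fun setT (fun t : T1 => hexp (tau t)).
  exact: (measurableT_comp measurable_hexp (mt : measurable_fun setT (tau : T1 -> T1))).
have mh1 : measurable_fun setT (fun t : T1 => hexp (1 - tau t)).
  have m1 : measurable_fun setT (fun t : T1 => 1 - tau t : T1) by apply: measurable_funB.
  exact: (measurableT_comp measurable_hexp m1).
apply: measurable_funM => //; apply: measurable_funM => //; apply: measurable_inv_pos.
  exact: measurable_funD.
by move=> t; exact: hexp_sum_gt0.
Qed.

Lemma alpha_ge0 j t : 0 <= alpha P j t.
Proof.
rewrite /alpha; case: ifP => // _; case: ifP => _; first exact: ltW.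
by rewrite mulr_ge0 ?(ltW a0)// divr_ge0 ?addr_ge0 ?hexp_ge0.
Qed.

Lemma alpha_le j t : alpha P j t <= alpha0 P.
Proof.
rewrite /alpha; case: ifP => [_|_]; first exact: ltW.
case: ifP => // _; rewrite ler_piMr ?(ltW a0)// ler_pdivrMr ?hexp_sum_gt0//.
by rewrite mul1r lerDl hexp_ge0.
Qed.

(** [srad] is the real part of [s_j] and [stan] the tangent of its argument, so that
    [s_j = srad * (1 + i stan)]. In these variables all sign conditions become polynomial. *)
Definition srad j (x : pt R) : R := 1 + zeta P * alpha P j (xcoord x j).
Definition stan j (x : pt R) : R := alpha P j (xcoord x j) / srad j x.

Lemma srad_ge1 j x : 1 <= srad j x.
Proof. by rewrite /srad lerDl mulr_ge0 ?alpha_ge0// ltW. Qed.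

Lemma srad_le j x : srad j x <= 1 + zeta P * alpha0 P.
Proof. by rewrite lerD2l ler_wpM2l ?alpha_le// ltW. Qed.

Lemma stan_ge0 j x : 0 <= stan j x.
Proof. by rewrite divr_ge0 ?alpha_ge0// (le_trans ler01)// srad_ge1. Qed.

(** The tangent [alpha / (1 + zeta alpha)] increases with [alpha], which is at most [alpha0]. *)
Lemma stan_le j x : stan j x <= alpha0 P / (1 + zeta P * alpha0 P).
Proof.
have h1 : 0 < srad j x by apply: lt_le_trans (srad_ge1 j x).
rewrite /stan ler_pdivrMr// mulrAC ler_pdivlMr; last by rewrite ltr_pwDl// mulr_ge0// ltW.
rewrite /srad -subr_ge0 (_ : _ - _ = alpha0 P - alpha P j (xcoord x j)); last by ring.
by rewrite subr_ge0 alpha_le.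
Qed.

Lemma stretchE j x : stretch P j x = (srad j x)%:C * (1 +i* stan j x).
Proof.
have h1 : srad j x != 0 by rewrite lt0r_neq0// (lt_le_trans ltr01)// srad_ge1.
rewrite /stretch /zpml /stan; simpc; congr (_ +i* _).
by rewrite mulrCA divff// mulr1.
Qed.

Lemma weight_stretch j k : j != k -> weight j (stretch P k).
Proof.
move=> jk; have mx : measurable_fun setT (fun x : mpt R => alpha P k (xcoord x k)).
  have m : measurable_fun setT (fun x : mpt R => xcoord x k : T1) by exact: measurable_xcoord.
  exact: (measurableT_comp (measurable_alpha k) m).
split.
- rewrite (_ : rpart _ = fun x => 1 + zeta P * alpha P k (xcoord x k)).
    by apply: measurable_funD => //; apply: measurable_funM.
  by apply/funext => x; rewrite /rpart /stretch /zpml; simpc.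
- rewrite (_ : ipart _ = fun x => alpha P k (xcoord x k)) //.
  by apply/funext => x; rewrite /ipart /stretch /zpml; simpc.
- exists ((1 + zeta P * alpha0 P) ^+ 2 + alpha0 P ^+ 2) => x.
  rewrite /sqn /stretch /zpml; simpc; rewrite /=; apply: lerD.
    by rewrite lerXn2r ?nnegrE ?srad_le// addr_ge0// mulr_ge0 ?alpha_ge0// ltW.
  by rewrite lerXn2r ?nnegrE ?alpha_le ?alpha_ge0// ltW.
- by move=> t x; rewrite /stretch xcoord_upd_neq// eq_sym.
Qed.

Lemma weightM j (c c' : pt R -> R[i]) : weight j c -> weight j c' -> weight j (fun x => c x * c' x).
Proof.
move=> [m1 m2 [M hM] ic] [m1' m2' [M' hM'] ic']; split.
- rewrite (_ : rpart _ = (rpart c \* rpart c') \- (ipart c \* ipart c')).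
    by apply: measurable_funB; exact: measurable_funM.
  by apply/funext => x; rewrite /rpart /ipart /=; case: (c x) => u v; case: (c' x) => p q.
- rewrite (_ : ipart _ = (rpart c \* ipart c') \+ (ipart c \* rpart c')).
    by apply: measurable_funD; exact: measurable_funM.
  by apply/funext => x; rewrite /rpart /ipart /=; case: (c x) => u v; case: (c' x) => p q.
- by exists (M * M') => x; rewrite sqnM ler_pM ?sqn_ge0.
- by move=> t x; rewrite ic ic'.
Qed.

Lemma weight_prod j (Q : pred 'I_3) : (forall k, Q k -> j != k) ->
  weight j (fun x => \prod_(k < 3 | Q k) stretch P k x).
Proof.
move=> hQ; elim: (index_enum _) => [|k r IH].
  by under eq_fun do rewrite big_nil; exact: weight_cst.
case Qk : (Q k); under eq_fun do rewrite big_cons Qk; last exact: IH.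
by apply: weightM => //; apply: weight_stretch; exact: hQ.
Qed.

Definition acoef j (x : pt R) : R[i] := \prod_(k < 3 | k != j) stretch P k x.
Definition kcoef j (x : pt R) : R[i] := acoef j x / stretch P j x.
(** This is [acoef j / stretch i]. For distinct [i] and [j] the quotient is written as a product
    over the remaining index, which shows that it is constant along both axes. *)
Definition mcoef i j (x : pt R) : R[i] :=
  if i == j then kcoef i x else \prod_(k < 3 | (k != i) && (k != j)) stretch P k x.

Lemma weight_acoef j : weight j (acoef j).
Proof. by apply: weight_prod => k; rewrite eq_sym. Qed.

Variable D : bdom R.

Lemma good_stretch j : cmeas D (stretch P j) /\ cbdd D (stretch P j).
Proof.
have [k kj] : exists k : 'I_3, k != j.
  by have [->|] := eqVneq j ord0; [exists ord_max|exists ord0; rewrite eq_sym].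
by split; [exact: weight_cmeas (weight_stretch kj)|exact: weight_cbdd (weight_stretch kj)].
Qed.

Lemma sqn_stretch_ge1 j x : 1 <= sqn (stretch P j x).
Proof.
rewrite stretchE sqnM sqn_real /sqn /= expr1n; have := srad_ge1 j x => h.
have h2 : 1 <= srad j x ^+ 2 by rewrite expr_ge1// (le_trans ler01).
by apply: (le_trans h2); rewrite ler_peMr ?sqr_ge0// lerDl sqr_ge0.
Qed.

Lemma stretch_neq0 j x : stretch P j x != 0.
Proof.
by apply/eqP => h; have := sqn_stretch_ge1 j x; rewrite h sqn0 ler10.
Qed.

Lemma good_stretchV j : cmeas D (fun x => (stretch P j x)^-1) /\ cbdd D (fun x => (stretch P j x)^-1).
Proof.
split; last by exists 1 => x _; rewrite sqnV invf_le1 ?sqn_stretch_ge1// (lt_le_trans ltr01)// sqn_stretch_ge1.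
have [k kj] : exists k : 'I_3, k != j.
  by have [->|] := eqVneq j ord0; [exists ord_max|exists ord0; rewrite eq_sym].
have [m1 m2 _ _] := weight_stretch kj.
have mq : measurable_fun setT (fun x : mpt R => sqn (stretch P j x)).
  by apply: measurable_funD; exact: measurable_funX.
have mi : measurable_fun setT (fun x : mpt R => (sqn (stretch P j x))^-1).
  by apply: measurable_inv_pos => // x; apply: lt_le_trans (sqn_stretch_ge1 j x).
have E x : (stretch P j x)^-1 = (sqn (stretch P j x))^-1%:C * conjc (stretch P j x).
  apply: (mulfI (stretch_neq0 j x)); rewrite divff ?stretch_neq0// mulrCA mul_conjc_sqn.
  by rewrite -rmorphM/= mulVf// lt0r_neq0// (lt_le_trans ltr01)// sqn_stretch_ge1.
split; apply: (@measurable_funS _ _ _ _ setT) => //.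
- rewrite (_ : rpart _ = fun x => (sqn (stretch P j x))^-1 * rpart (stretch P j) x).
    exact: measurable_funM.
  by apply/funext => x; rewrite /rpart E; case: (stretch P j x) => a b /=; ring.
- rewrite (_ : ipart _ = fun x => - 1 * ((sqn (stretch P j x))^-1 * ipart (stretch P j) x)).
    by apply: measurable_funM => //; exact: measurable_funM.
  by apply/funext => x; rewrite /ipart E; case: (stretch P j x) => a b /=; ring.
Qed.

Definition good (c : pt R -> R[i]) := cmeas D c /\ cbdd D c.

Lemma goodM c c' : good c -> good c' -> good (fun x => c x * c' x).
Proof. by move=> [? ?] [? ?]; split; [exact: cmeasM|exact: cbddM]. Qed.

Lemma good_cst a : good (fun=> a).
Proof. by split; [exact: cmeas_cst|exact: cbdd_cst]. Qed.

Lemma good_prod (Q : pred 'I_3) : good (fun x => \prod_(k < 3 | Q k) stretch P k x).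
Proof.
elim: (index_enum _) => [|k r IH]; first by under eq_fun do rewrite big_nil; exact: good_cst.
case Qk : (Q k); under eq_fun do rewrite big_cons Qk; last exact: IH.
by apply: goodM => //; exact: good_stretch.
Qed.

Lemma good_acoef j : good (acoef j). Proof. exact: good_prod. Qed.
Lemma good_J : good (Jpml P). Proof. exact: good_prod. Qed.
Lemma good_kcoef j : good (kcoef j).
Proof. by apply: goodM; [exact: good_acoef|exact: good_stretchV]. Qed.
Lemma good_mcoef i j : good (mcoef i j).
Proof. by rewrite /mcoef; case: eqP => _; [exact: good_kcoef|exact: good_prod]. Qed.

End Coefficients.

(** * Pointwise inequalities for the stretchings *)

Section Pointwise.
Context {R : realType}.
Local Notation o0 := (@Ordinal 3 0 isT).
Local Notation o1 := (@Ordinal 3 1 isT).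
Local Notation o2 := (@Ordinal 3 2 isT).

(** Real part of [s_j s_l / s_i] when each [s_k] is written as [r_k (1 + i t_k)]. *)
Definition kre (ri rj rl ti tj tl : R) : R :=
  rj * rl / ri * ((1 - tj * tl + ti * (tj + tl)) / (1 + ti ^+ 2)).

(** The numerator is at least [1 - T^2] and the denominator at most [1 + T^2]; their ratio is at
    least 1/2 once [3 T^2 < 1]. *)
Lemma kre_lower B T ri rj rl ti tj tl : 1 <= ri <= B -> 1 <= rj -> 1 <= rl ->
  0 <= ti -> 0 <= tj <= T -> 0 <= tl <= T -> ti <= T -> 3 * T ^+ 2 < 1 ->
  (2 * B)^-1 <= kre ri rj rl ti tj tl.
Proof.
move=> /andP[ri1 riB] rj1 rl1 ti0 /andP[tj0 tjT] /andP[tl0 tlT] tiT T1.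
have B0 : 0 < B by lra.
rewrite /kre invfM mulrC; apply: ler_pM; rewrite ?invr_ge0 ?ler0n ?(ltW B0)//.
  have jl : 1 <= rj * rl by rewrite mulr_ege1.
  rewrite -[leLHS]mul1r; apply: ler_pM; rewrite ?invr_ge0 ?(ltW B0)//.
  by rewrite lef_pV2 ?posrE//; lra.
have p0 : 0 < 1 + ti ^+ 2 by rewrite ltr_pwDl// sqr_ge0.
rewrite ler_pdivlMr//.
have h1 : tj * tl <= T ^+ 2 by rewrite expr2 ler_pM.
have h2 : ti ^+ 2 <= T ^+ 2 by rewrite lerXn2r ?nnegrE// (le_trans tj0).
have h3 : 0 <= ti * (tj + tl) by rewrite mulr_ge0// addr_ge0.
move: (tj * tl) (ti * _) (ti ^+ 2) (T ^+ 2) h1 h2 h3 T1 => *; lra.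
Qed.

(** By the identity [1 - tj tl + ti (tj + tl) = 1 + ti^2 - (ti - tj) (ti - tl)], the share [la + mu]
    of the coefficient, needed below to complete a square, splits off exactly. The remainder is
    positive since the tangents differ by at most [T] and [(la + 2 mu) T^2 < mu]. *)
Lemma kre_diag_lower la mu B T ri rj rl ti tj tl : 1 <= ri <= B -> 1 <= rj -> 1 <= rl ->
  0 <= ti -> 0 <= tj <= T -> 0 <= tl <= T -> ti <= T -> 3 * T ^+ 2 < 1 -> 0 < mu ->
  0 <= la + 2 * mu -> (la + 2 * mu) * T ^+ 2 < mu ->
  (la + mu) * (rj * rl / ri) + (mu - (la + 2 * mu) * T ^+ 2) / (2 * B) <=
  (la + 2 * mu) * kre ri rj rl ti tj tl.
Proof.
move=> /andP[ri1 riB] rj1 rl1 ti0 /andP[tj0 tjT] /andP[tl0 tlT] tiT T1 mu0 lm lT.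
have B0 : 0 < B by lra.
have p0 : 0 < 1 + ti ^+ 2 by rewrite ltr_pwDl// sqr_ge0.
have i0 : ri != 0 by rewrite lt0r_neq0//; lra.
have -> : (la + 2 * mu) * kre ri rj rl ti tj tl = (la + mu) * (rj * rl / ri) +
    rj * rl / ri * ((mu * (1 + ti ^+ 2) - (la + 2 * mu) * ((ti - tj) * (ti - tl))) / (1 + ti ^+ 2)).
  by rewrite /kre; field; rewrite i0 lt0r_neq0.
rewrite lerD2l; have h2 : ti ^+ 2 <= T ^+ 2 by rewrite lerXn2r ?nnegrE// (le_trans tj0).
have d0 : 0 <= mu - (la + 2 * mu) * T ^+ 2 by rewrite subr_ge0 ltW.
have -> : (mu - (la + 2 * mu) * T ^+ 2) / (2 * B) = B^-1 * ((mu - (la + 2 * mu) * T ^+ 2) / 2).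
  by field; rewrite lt0r_neq0.
apply: ler_pM; [by rewrite invr_ge0 ltW|by rewrite divr_ge0| |].
  have jl : 1 <= rj * rl by rewrite mulr_ege1.
  rewrite -[leLHS]mul1r; apply: ler_pM; rewrite ?invr_ge0 ?(ltW B0)//.
  by rewrite lef_pV2 ?posrE//; lra.
rewrite ler_pdivlMr//.
have h3 : (ti - tj) * (ti - tl) <= T ^+ 2.
  have [a1 a2] : `|ti - tj| <= T /\ `|ti - tl| <= T by rewrite !ler_norml; split; apply/andP; split; lra.
  by apply: (le_trans (ler_norm _)); rewrite normrM expr2 ler_pM.
have h4 := ler_wpM2l lm h3.
have h5 : (mu - (la + 2 * mu) * T ^+ 2) / 2 * (1 + ti ^+ 2) <= mu - (la + 2 * mu) * T ^+ 2.
  rewrite -mulrA ler_piMr// mulrC ler_pdivrMr// mul1r.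
  by move: (ti ^+ 2) (T ^+ 2) h2 T1 => *; lra.
apply: (le_trans h5).
have h6 : 0 <= mu * ti ^+ 2 by rewrite mulr_ge0 ?sqr_ge0// ltW.
rewrite mulrDr mulr1; move: (_ * (_ * _)) (_ * T ^+ 2) (mu * _) h4 h6 => *; lra.
Qed.

(** The parts split off by [kre_diag_lower] and the cross terms together form [la + mu] times [(r1
    r2 a0 + r0 r2 a1 + r0 r1 a2)^2 / (r0 r1 r2)], a nonnegative quantity. *)
Lemma diag_form_lower la mu B T (r0 r1 r2 t0 t1 t2 a0 a1 a2 : R) :
  1 <= r0 <= B -> 1 <= r1 <= B -> 1 <= r2 <= B ->
  0 <= t0 <= T -> 0 <= t1 <= T -> 0 <= t2 <= T -> 3 * T ^+ 2 < 1 -> 0 < mu -> 0 <= la + mu ->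
  (la + 2 * mu) * T ^+ 2 < mu ->
  (mu - (la + 2 * mu) * T ^+ 2) / (2 * B) * (a0 ^+ 2 + a1 ^+ 2 + a2 ^+ 2) <=
  (la + 2 * mu) * (kre r0 r1 r2 t0 t1 t2 * a0 ^+ 2 + kre r1 r0 r2 t1 t0 t2 * a1 ^+ 2 +
     kre r2 r0 r1 t2 t0 t1 * a2 ^+ 2) +
  (la + mu) * (2 * (r2 * a0 * a1 + r1 * a0 * a2 + r0 * a1 * a2)).
Proof.
move=> h0 h1 h2 g0 g1 g2 T1 mu0 lm lT.
have [/andP[r01 _] /andP[r11 _] /andP[r21 _]] := And3 h0 h1 h2.
have [/andP[t00 t0T] /andP[t10 t1T] /andP[t20 t2T]] := And3 g0 g1 g2.
have lm2 : 0 <= la + 2 * mu by lra.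
have d0 := kre_diag_lower h0 r11 r21 t00 g1 g2 t0T T1 mu0 lm2 lT.
have d1 := kre_diag_lower h1 r01 r21 t10 g0 g2 t1T T1 mu0 lm2 lT.
have d2 := kre_diag_lower h2 r01 r11 t20 g0 g1 t2T T1 mu0 lm2 lT.
have e0 := ler_wpM2r (sqr_ge0 a0) d0; have e1 := ler_wpM2r (sqr_ge0 a1) d1.
have e2 := ler_wpM2r (sqr_ge0 a2) d2.
have sq : 0 <= (la + mu) * ((r1 * r2 * a0 + r0 * r2 * a1 + r0 * r1 * a2) ^+ 2 / (r0 * r1 * r2)).
  by rewrite mulr_ge0// divr_ge0 ?sqr_ge0// !mulr_ge0//; lra.
have E : (r1 * r2 * a0 + r0 * r2 * a1 + r0 * r1 * a2) ^+ 2 / (r0 * r1 * r2) =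
  r1 * r2 / r0 * a0 ^+ 2 + r0 * r2 / r1 * a1 ^+ 2 + r0 * r1 / r2 * a2 ^+ 2 +
  2 * (r2 * a0 * a1 + r1 * a0 * a2 + r0 * a1 * a2).
  by field; rewrite !lt0r_neq0//; lra.
rewrite E in sq.
rewrite mulrDl -[(la + mu) * _ * a0 ^+ 2]mulrA in e0.
rewrite mulrDl -[(la + mu) * _ * a1 ^+ 2]mulrA in e1.
rewrite mulrDl -[(la + mu) * _ * a2 ^+ 2]mulrA in e2.
rewrite -!(mulrA (la + 2 * mu)) in e0 e1 e2.
move: (kre _ _ _ _ _ _ * _) (kre _ _ _ _ _ _ * _) (kre _ _ _ _ _ _ * _) e0 e1 e2 => k0 k1 k2.
rewrite !mulrDr in sq *.
move: (_ / (2 * B)) => q.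
move: (a0 ^+ 2) (a1 ^+ 2) (a2 ^+ 2) sq => A0 A1 A2 sq e0 e1 e2; lra.
Qed.

Lemma inv_complex (z : R[i]) : z != 0 -> z^-1 = (sqn z)^-1%:C * conjc z.
Proof.
move=> z0; apply: (mulfI z0); rewrite divff// mulrCA mul_conjc_sqn -rmorphM/= mulVf//.
by apply: contraNneq z0 => /sqn_eq0 ->.
Qed.

Lemma Re_kre (ri rj rl ti tj tl : R) : 1 <= ri ->
  complex.Re ((rj%:C * (1 +i* tj)) * (rl%:C * (1 +i* tl)) / (ri%:C * (1 +i* ti))) = kre ri rj rl ti tj tl.
Proof.
move=> r1; have p0 : 0 < 1 + ti ^+ 2 by rewrite ltr_pwDl// sqr_ge0.
have r0 : ri != 0 by rewrite lt0r_neq0//; lra.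
have sq : sqn (ri%:C * (1 +i* ti)) = ri ^+ 2 * (1 + ti ^+ 2).
  by rewrite sqnM sqn_real /sqn /= expr1n.
have z0 : ri%:C * (1 +i* ti) != 0.
  apply/eqP => z0; have := sq; rewrite z0 sqn0 => /esym/eqP.
  by rewrite mulf_eq0 expf_eq0 (negbTE r0)/= gt_eqF.
rewrite inv_complex// sq /kre; simpc; rewrite /=; field.
by rewrite r0 lt0r_neq0.
Qed.

(** The real part equals [r0 r1 r2 (1 - t0 t1 - t0 t2 - t1 t2)]. The condition on [T] keeps each
    argument below pi / 6, so the three add up to less than pi / 2. *)
Lemma Re_J (r0 r1 r2 t0 t1 t2 T : R) : 1 <= r0 -> 1 <= r1 -> 1 <= r2 ->
  0 <= t0 <= T -> 0 <= t1 <= T -> 0 <= t2 <= T -> 3 * T ^+ 2 < 1 ->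
  1 - 3 * T ^+ 2 <= complex.Re ((r0%:C * (1 +i* t0)) * (r1%:C * (1 +i* t1)) * (r2%:C * (1 +i* t2))).
Proof.
move=> h0 h1 h2 /andP[t00 t0T] /andP[t10 t1T] /andP[t20 t2T] T1.
have -> : complex.Re ((r0%:C * (1 +i* t0)) * (r1%:C * (1 +i* t1)) * (r2%:C * (1 +i* t2))) =
  (r0 * r1 * r2) * (1 - t0 * t1 - t0 * t2 - t1 * t2) by simpc; rewrite /=; ring.
have [a b c] : [/\ t0 * t1 <= T ^+ 2, t0 * t2 <= T ^+ 2 & t1 * t2 <= T ^+ 2].
  by rewrite expr2; split; apply: ler_pM.
have r3 : 1 <= r0 * r1 * r2 by rewrite !mulr_ege1.
have le1 : 1 - 3 * T ^+ 2 <= 1 - t0 * t1 - t0 * t2 - t1 * t2.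
  by move: (T ^+ 2) (t0 * t1) (t0 * t2) (t1 * t2) a b c => *; lra.
apply: (le_trans le1); apply: ler_peMl => //.
by apply: le_trans le1; lra.
Qed.

Lemma Re_diag (c : R) (s U : R[i]) : complex.Re (c%:C * s * U * conjc U) = c * complex.Re s * sqn U.
Proof. by case: s => a b; case: U => u v; rewrite /sqn; simpc; rewrite /=; ring. Qed.

Lemma ReD (z w : R[i]) : complex.Re (z + w) = complex.Re z + complex.Re w.
Proof. by case: z w => a b []. Qed.

Lemma Re_pair (c : R) (s U V : R[i]) :
  complex.Re (c%:C * s * U * conjc V) + complex.Re (c%:C * s * V * conjc U) =
  c * (2 * (complex.Re s * (complex.Re U * complex.Re V + complex.Im U * complex.Im V))).
Proof. by case: s => a b; case: U => u v; case: V => w z; simpc; rewrite /=; ring. Qed.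

Lemma prod3 (A : pzSemiRingType) (F : 'I_3 -> A) (Q : pred 'I_3) : \prod_(k < 3 | Q k) F k =
  (if Q o0 then F o0 else 1) * (if Q o1 then F o1 else 1) * (if Q o2 then F o2 else 1).
Proof.
rewrite big_mkcond !big_ord_recl big_ord0 /= mulr1 mulrA.
have -> : lift ord0 ord0 = o1 by exact: val_inj.
have -> : lift ord0 (lift ord0 ord0) = o2 by exact: val_inj.
by have -> : ord0 = o0 by exact: val_inj.
Qed.

Section AtPoint.
Variables (P : pml R) (x : pt R).
Hypotheses (a0 : 0 < alpha0 P) (z0 : 0 < zeta P).
Let B := 1 + zeta P * alpha0 P.
Let T := alpha0 P / B.
Hypothesis T3 : 3 * T ^+ 2 < 1.

Let rb j : 1 <= srad P j x <= B.
Proof. by rewrite srad_ge1//= srad_le. Qed.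
Let tb j : 0 <= stan P j x <= T.
Proof. by rewrite stan_ge0//= stan_le. Qed.

Lemma Re_kcoef : [/\ complex.Re (kcoef P o0 x) = kre (srad P o0 x) (srad P o1 x) (srad P o2 x) (stan P o0 x) (stan P o1 x) (stan P o2 x),
  complex.Re (kcoef P o1 x) = kre (srad P o1 x) (srad P o0 x) (srad P o2 x) (stan P o1 x) (stan P o0 x) (stan P o2 x) &
  complex.Re (kcoef P o2 x) = kre (srad P o2 x) (srad P o0 x) (srad P o1 x) (stan P o2 x) (stan P o0 x) (stan P o1 x)].
Proof.
have [A0 A1 A2] : [/\ acoef P o0 x = stretch P o1 x * stretch P o2 x,
    acoef P o1 x = stretch P o0 x * stretch P o2 x & acoef P o2 x = stretch P o0 x * stretch P o1 x].
  by split; rewrite /acoef prod3 /= ?mulr1 ?mul1r.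
by split; rewrite /kcoef ?A0 ?A1 ?A2 !(stretchE a0 z0) Re_kre//; apply: srad_ge1.
Qed.

Lemma Re_kcoef_ge j : (2 * B)^-1 <= complex.Re (kcoef P j x).
Proof.
have [e0 e1 e2] := Re_kcoef.
have g1 k : 1 <= srad P k x by have /andP[] := rb k.
have g2 k : 0 <= stan P k x by have /andP[] := tb k.
have g3 k : stan P k x <= T by have /andP[] := tb k.
case: j => -[|[|[|//]]] lj.
- rewrite (_ : Ordinal lj = o0); last exact: val_inj.
  by rewrite e0; exact: (kre_lower (rb o0) (g1 _) (g1 _) (g2 _) (tb _) (tb _) (g3 _) T3).
- rewrite (_ : Ordinal lj = o1); last exact: val_inj.
  by rewrite e1; exact: (kre_lower (rb o1) (g1 _) (g1 _) (g2 _) (tb _) (tb _) (g3 _) T3).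
- rewrite (_ : Ordinal lj = o2); last exact: val_inj.
  by rewrite e2; exact: (kre_lower (rb o2) (g1 _) (g1 _) (g2 _) (tb _) (tb _) (g3 _) T3).
Qed.

Lemma Re_Jpml_ge : 1 - 3 * T ^+ 2 <= complex.Re (Jpml P x).
Proof.
have -> : Jpml P x = stretch P o0 x * stretch P o1 x * stretch P o2 x by rewrite /Jpml prod3.
rewrite !(stretchE a0 z0).
by apply: Re_J; rewrite ?tb//; apply: srad_ge1.
Qed.

Lemma mcoefE : [/\ mcoef P o0 o1 x = stretch P o2 x, mcoef P o1 o0 x = stretch P o2 x,
  mcoef P o0 o2 x = stretch P o1 x, mcoef P o2 o0 x = stretch P o1 x &
  mcoef P o1 o2 x = stretch P o0 x /\ mcoef P o2 o1 x = stretch P o0 x].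
Proof. by do ! split; rewrite /mcoef /= prod3 /= ?mulr1 ?mul1r. Qed.

Lemma Re_stretch j : complex.Re (stretch P j x) = srad P j x.
Proof. by rewrite stretchE//; simpc. Qed.

Variables (la mu : R).
Hypotheses (mu0 : 0 < mu) (lm : 0 <= la + mu) (lT : (la + 2 * mu) * T ^+ 2 < mu).
Variable ca : R.
Hypotheses (ca1 : ca <= mu / (2 * B)) (ca2 : ca <= (mu - (la + 2 * mu) * T ^+ 2) / (2 * B)).

(** Since [mcoef] is symmetric in its indices, the cross terms come in pairs that involve only the
    real part of a stretching. The diagonal entries therefore decouple into their real and imaginary
    parts, each governed by [diag_form_lower], and the off-diagonal entries by the bound on
    [kcoef]. *)
Lemma elastic_lower (U : 'I_3 -> 'I_3 -> R[i]) :
  ca * (\sum_i \sum_j sqn (U i j)) <=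
  complex.Re (\sum_i \sum_j (mu%:C * kcoef P j x * U i j * conjc (U i j) +
     (la + mu)%:C * mcoef P i j x * U i i * conjc (U j j))).
Proof.
have [e0 e1 e2] := Re_kcoef; have [m01 m10 m02 m20 [m12 m21]] := mcoefE.
have mkk k : mcoef P k k x = kcoef P k x by rewrite /mcoef eqxx.
have off i j : ca * sqn (U i j) <= mu * complex.Re (kcoef P j x) * sqn (U i j).
  rewrite ler_wpM2r ?sqn_ge0//; apply: (le_trans ca1); rewrite ler_pM2l//; exact: Re_kcoef_ge.
have dg a b c := diag_form_lower a b c (rb o0) (rb o1) (rb o2) (tb o0) (tb o1) (tb o2) T3 mu0 lm lT.
have h1 := dg (complex.Re (U o0 o0)) (complex.Re (U o1 o1)) (complex.Re (U o2 o2)).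
have h2 := dg (complex.Im (U o0 o0)) (complex.Im (U o1 o1)) (complex.Im (U o2 o2)).
have cd : ca * (sqn (U o0 o0) + sqn (U o1 o1) + sqn (U o2 o2)) <=
    (mu - (la + 2 * mu) * T ^+ 2) / (2 * B) * (sqn (U o0 o0) + sqn (U o1 o1) + sqn (U o2 o2)).
  by apply: ler_wpM2r ca2; rewrite addr_ge0 ?sqn_ge0// addr_ge0 ?sqn_ge0.
rewrite !sum3 !ReD !Re_diag !mkk m01 m10 m02 m20 m12 m21.
have p01 := Re_pair (la + mu) (stretch P o2 x) (U o0 o0) (U o1 o1).
have p02 := Re_pair (la + mu) (stretch P o1 x) (U o0 o0) (U o2 o2).
have p12 := Re_pair (la + mu) (stretch P o0 x) (U o1 o1) (U o2 o2).
rewrite !Re_stretch in p01 p02 p12.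
have f01 := off o0 o1; have f02 := off o0 o2; have f10 := off o1 o0.
have f12 := off o1 o2; have f20 := off o2 o0; have f21 := off o2 o1.
move: f01 f02 f10 f12 f20 f21 cd p01 p02 p12 {off dg}; rewrite e0 e1 e2.
move: (kre _ _ _ _ _ _) (kre _ _ _ _ _ _) (kre _ _ _ _ _ _) h1 h2 => k0 k1 k2 h1 h2.
rewrite /sqn.
move: ((mu - (la + 2 * mu) * T ^+ 2) / (2 * B)) h1 h2 => d h1 h2.
have := lerD h1 h2 => {h1 h2} h.
move: (complex.Re (_ * _ * U o0 o0 * conjc (U o1 o1))) (complex.Re (_ * _ * U o1 o1 * conjc (U o0 o0)))
  (complex.Re (_ * _ * U o0 o0 * conjc (U o2 o2))) (complex.Re (_ * _ * U o2 o2 * conjc (U o0 o0)))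
  (complex.Re (_ * _ * U o1 o1 * conjc (U o2 o2))) (complex.Re (_ * _ * U o2 o2 * conjc (U o1 o1))).
move=> x1 y1 x2 y2 x3 y3 f1 f2 f3 f4 f5 f6 cd.
move: (complex.Re (U o0 o0)) (complex.Re (U o1 o1)) (complex.Re (U o2 o2)) (complex.Im (U o0 o0)) (complex.Im (U o1 o1)) (complex.Im (U o2 o2)) h cd => a b c u v w h cd.
move: (srad P o0 x) (srad P o1 x) (srad P o2 x) h => r0 r1 r2 h q1 q2 q3.
clear -h cd f1 f2 f3 f4 f5 f6 q1 q2 q3.
have {q1}-> : x1 = (la + mu) * (2 * (r2 * (a * b + u * v))) - y1 by rewrite -q1 addrK.
have {q2}-> : x2 = (la + mu) * (2 * (r1 * (a * c + u * w))) - y2 by rewrite -q2 addrK.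
have {q3}-> : x3 = (la + mu) * (2 * (r0 * (b * c + v * w))) - y3 by rewrite -q3 addrK.
move: (_ ^+ 2 + complex.Im (U o0 o1) ^+ 2) (_ ^+ 2 + complex.Im (U o0 o2) ^+ 2)
  (_ ^+ 2 + complex.Im (U o1 o0) ^+ 2) (_ ^+ 2 + complex.Im (U o1 o2) ^+ 2)
  (_ ^+ 2 + complex.Im (U o2 o0) ^+ 2) (_ ^+ 2 + complex.Im (U o2 o1) ^+ 2) f1 f2 f3 f4 f5 f6.
move=> n1 n2 n3 n4 n5 n6 f1 f2 f3 f4 f5 f6.
have := lerD (lerD (lerD (lerD f1 f2) (lerD f3 f4)) (lerD f5 f6)) (lerD cd h).
rewrite -subr_ge0 => H; rewrite -subr_ge0; apply: (le_trans H); rewrite le_eqVlt; apply/orP; left.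
apply/eqP; ring.
Qed.

End AtPoint.

(** Young's inequality absorbs the coupling of [p] with [div u] into half the elastic energy and the
    mass of [p], and that of [u] with [grad p] into half the diffusion and the mass of [u]. The
    constant 6 is 2 for each of the three components of the divergence. *)
Lemma total_lower (ca cK cJ MA ga rs ks es t NU : R) (Ela J p : R[i]) (A K Ud u g : 'I_3 -> R[i]) :
  0 < ca -> 0 < cK -> 0 < t -> 0 <= rs -> 0 <= ks ->
  ca * NU <= complex.Re Ela -> \sum_j sqn (Ud j) <= NU -> cJ <= complex.Re J ->
  (forall j, cK <= complex.Re (K j)) -> (forall j, sqn (A j) <= MA) ->
  ca / 2 * NU + (rs * cJ - 2 * es ^+ 2 * MA / (t * cK)) * (\sum_j sqn (u j)) +
    (ks * cJ - 6 * ga ^+ 2 * MA / ca) * sqn p + t * cK / 2 * (\sum_j sqn (g j)) <=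
  complex.Re (Ela + \sum_j rs%:C * J * u j * conjc (u j) + \sum_j (- ga)%:C * A j * p * conjc (Ud j)
    + \sum_j t%:C * K j * g j * conjc (g j) + ks%:C * J * p * conjc p
    + \sum_j (- es)%:C * A j * u j * conjc (g j)).
Proof.
move=> ca0 cK0 t0 rs0 ks0 hE hU hJ hK hA.
have MA0 : 0 <= MA := le_trans (sqn_ge0 _) (hA o0).
have f1 : rs * cJ * \sum_j sqn (u j) <= complex.Re (\sum_j rs%:C * J * u j * conjc (u j)).
  rewrite Re_sum mulr_sumr; apply: ler_sum => j _; rewrite Re_diag.
  by apply: ler_wpM2r; [exact: sqn_ge0|exact: ler_wpM2l].
have f2 : - (ca / 2 * NU + 6 * ga ^+ 2 * MA / ca * sqn p) <=
    complex.Re (\sum_j (- ga)%:C * A j * p * conjc (Ud j)).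
  rewrite Re_sum; apply: (@le_trans _ _ (\sum_(j < 3) - (ca / 2 * sqn (Ud j) + 2 * ga ^+ 2 * MA / ca * sqn p))).
    rewrite sumrN lerN2 big_split/= -mulr_sumr sumr_const card_ord; apply: lerD.
      by apply: ler_wpM2l => //; rewrite divr_ge0// ltW.
    by rewrite -mulr_natl le_eqVlt; apply/orP; left; apply/eqP; ring.
  apply: ler_sum => j _; rewrite lerNl; apply: (le_trans (ler_norm _)); rewrite normrN.
  have hz : sqn ((- ga)%:C * A j * p * conjc (Ud j)) <= sqn (Ud j) * (ga ^+ 2 * MA * sqn p).
    rewrite !sqnM sqn_conj sqn_real sqrrN mulrC; apply: ler_wpM2l; first exact: sqn_ge0.
    by apply: ler_wpM2r; [exact: sqn_ge0|apply: ler_wpM2l; rewrite ?sqr_ge0].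
  have B0 : 0 <= ga ^+ 2 * MA * sqn p := mulr_ge0 (mulr_ge0 (sqr_ge0 _) MA0) (sqn_ge0 _).
  have c2 : 0 < ca / 2 by rewrite divr_gt0.
  apply: (le_trans (Re_le_young c2 (sqn_ge0 _) B0 hz)).
  by rewrite lerD2l le_eqVlt; apply/orP; left; apply/eqP; field; exact: lt0r_neq0.
have f3 : t * cK * \sum_j sqn (g j) <= complex.Re (\sum_j t%:C * K j * g j * conjc (g j)).
  rewrite Re_sum mulr_sumr; apply: ler_sum => j _; rewrite Re_diag.
  by apply: ler_wpM2r; [exact: sqn_ge0|rewrite ler_pM2l].
have f4 : ks * cJ * sqn p <= complex.Re (ks%:C * J * p * conjc p).
  by rewrite Re_diag; apply: ler_wpM2r; [exact: sqn_ge0|exact: ler_wpM2l].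
have tcK : 0 < t * cK by rewrite mulr_gt0.
have f5 : - (t * cK / 2 * (\sum_j sqn (g j)) + 2 * es ^+ 2 * MA / (t * cK) * \sum_j sqn (u j)) <=
    complex.Re (\sum_j (- es)%:C * A j * u j * conjc (g j)).
  rewrite Re_sum !mulr_sumr -big_split/= -sumrN; apply: ler_sum => j _.
  rewrite lerNl; apply: (le_trans (ler_norm _)); rewrite normrN.
  have hz : sqn ((- es)%:C * A j * u j * conjc (g j)) <= sqn (g j) * (es ^+ 2 * MA * sqn (u j)).
    rewrite !sqnM sqn_conj sqn_real sqrrN mulrC; apply: ler_wpM2l; first exact: sqn_ge0.
    by apply: ler_wpM2r; [exact: sqn_ge0|apply: ler_wpM2l; rewrite ?sqr_ge0].
  have B0 : 0 <= es ^+ 2 * MA * sqn (u j) := mulr_ge0 (mulr_ge0 (sqr_ge0 _) MA0) (sqn_ge0 _).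
  have c2 : 0 < t * cK / 2 by rewrite divr_gt0.
  apply: (le_trans (Re_le_young c2 (sqn_ge0 _) B0 hz)).
  rewrite lerD2l le_eqVlt; apply/orP; left; apply/eqP; field.
  by rewrite !lt0r_neq0.
rewrite !ReD; have := lerD (lerD (lerD (lerD (lerD hE f1) f2) f3) f4) f5.
apply: le_trans; rewrite le_eqVlt; apply/orP; left; apply/eqP.
move: (\sum_j sqn (u j)) (\sum_j sqn (g j)) (sqn p) (_ / (t * cK)) (_ / ca) => S1 S2 S3 X Y.
by field.
Qed.

End Pointwise.

(** * Displacement-pressure vectors and forms built from coefficient families *)

Section Families.
Context {R : realType}.

Lemma sesqui_sum (V : lmodType R[i]) (I : Type) (r : seq I) (b : I -> V -> V -> R[i]) :
  (forall i, sesqui (b i)) -> sesqui (fun x y => \sum_(i <- r) b i x y).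
Proof.
move=> sb; split=> [x y z|a x z|x y z|a x z].
- by rewrite -big_split; apply: eq_bigr => i _; exact: (sesDl (sb i)).
- by rewrite mulr_sumr; apply: eq_bigr => i _; exact: (sesZl (sb i)).
- by rewrite -big_split; apply: eq_bigr => i _; exact: (sesDr (sb i)).
- by rewrite mulr_sumr; apply: eq_bigr => i _; exact: (sesZr (sb i)).
Qed.

Section EBounded.
Variables (V : lmodType R[i]) (ip : hform V) (e : V -> R).
Hypothesis e_ge0 : forall x, 0 <= e x.

(** With [e] the full squared norm this is boundedness; with [e = lowsq], which sees only the values
    and no derivatives, it singles out the lower-order forms. *)
Definition ebounded (b : V -> V -> R[i]) :=
  exists2 K, 0 < K & forall x y, sqn (b x y) <= K * (e x * nsq ip y).

Let en0 x y : 0 <= e x * nsq ip y.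
Proof. by rewrite mulr_ge0// nsq_ge0. Qed.

Lemma eboundedD b c : ebounded b -> ebounded c -> ebounded (fun x y => b x y + c x y).
Proof.
move=> [K K0 hK] [L L0 hL]; exists (2 * K + 2 * L) => [|x y]; first by rewrite addr_gt0// mulr_gt0.
apply: (le_trans (sqnD _ _)); move: (e x * nsq ip y) (hK x y) (hL x y) => z h1 h2.
have -> : (2 * K + 2 * L) * z = 2 * (K * z) + 2 * (L * z) by ring.
by apply: lerD; rewrite ler_pM2l.
Qed.

Lemma eboundedZ a b : ebounded b -> ebounded (fun x y => a * b x y).
Proof.
move=> [K K0 hK]; exists ((sqn a + 1) * K) => [|x y]; first by rewrite mulr_gt0// ltr_wpDl ?sqn_ge0.
by rewrite sqnM -mulrA; apply: ler_pM; rewrite ?sqn_ge0 ?lerDl ?hK.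
Qed.

Lemma ebounded0 : ebounded (fun _ _ => 0).
Proof. by exists 1 => // x y; rewrite sqn0 mul1r. Qed.

Lemma ebounded_sum (I : Type) (r : seq I) (b : I -> V -> V -> R[i]) :
  (forall i, ebounded (b i)) -> ebounded (fun x y => \sum_(i <- r) b i x y).
Proof.
move=> eb; elim: r => [|i r [K K0 hK]].
  by have [K K0 hK] := ebounded0; exists K => // x y; rewrite big_nil.
have [L L0 hL] := eboundedD (eb i) (ex_intro2 _ _ K K0 hK).
by exists L => // x y; rewrite big_cons.
Qed.

End EBounded.

Variable D : bdom R.
Local Notation O := (option 'I_3).
Local Notation V := (O -> H0t D).
Local Notation l2 := (l2hform D).

(** The outer index of a vector selects the unknown, [None] for the pressure and [Some i] for a
    displacement component; the inner index selects the value ([None]) or a derivative. *)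
Definition vform : hform V := sum_hform O (h0form D).
Definition lowsq (x : V) : R := \sum_i nsq l2 (x i None).

Lemma nsq_v (x : V) : nsq vform x = \sum_i \sum_a nsq l2 (x i a).
Proof. by rewrite nsq_sum; apply: eq_bigr => i _; rewrite nsq_h0. Qed.

Lemma nsq_v_ge (x : V) i a : nsq l2 (x i a) <= nsq vform x.
Proof.
rewrite nsq_v (bigD1 i)//= (bigD1 a)//= -addrA lerDl.
by rewrite addr_ge0 ?sumr_ge0// => [j _|j _]; rewrite ?sumr_ge0// ?nsq_ge0// => k _; exact: nsq_ge0.
Qed.

Lemma lowsq_ge0 x : 0 <= lowsq x.
Proof. by apply: sumr_ge0 => i _; exact: nsq_ge0. Qed.

Lemma lowsq_le x : lowsq x <= nsq vform x.
Proof.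
rewrite nsq_v; apply: ler_sum => i _; rewrite sum_option lerDl.
by apply: sumr_ge0 => j _; exact: nsq_ge0.
Qed.

Lemma lowsq_ge (x : V) i : nsq l2 (x i None) <= lowsq x.
Proof. by rewrite /lowsq (bigD1 i)//= lerDl; apply: sumr_ge0 => j _; exact: nsq_ge0. Qed.

Section Fam.
Variables (I : finType) (c : I -> pt R -> R[i]) (ii aa kk bb : I -> O).
Hypothesis gc : forall i, good D (c i).

(** Component ([ii i], [aa i]) of the trial vector is paired with component ([kk i], [bb i]) of the
    test vector: one pattern for all seven pieces of the PML form. *)
Definition fam (x y : V) : R[i] := \sum_i mform (D := D) (c i) (x (ii i) (aa i)) (y (kk i) (bb i)).

Lemma fam_sesqui : sesqui fam.
Proof.
apply: sesqui_sum => i; have sm := mform_sesqui (gc i).1 (gc i).2; split=> [x y z|a x z|x y z|a x z].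
- exact: (sesDl sm).
- exact: (sesZl sm).
- exact: (sesDr sm).
- exact: (sesZr sm).
Qed.

Lemma fam_ebounded (e : V -> R) : (forall x, 0 <= e x) -> (forall i (x : V), nsq l2 (x (ii i) (aa i)) <= e x) ->
  ebounded vform e fam.
Proof.
move=> e0 he; apply: ebounded_sum => // i.
have [C C0 hC] := bounded_form_pos (mform_bounded (gc i).1 (gc i).2).
exists C => // x y; apply: (le_trans (hC _ _)); apply: ler_wpM2l; first exact: ltW.
by apply: ler_pM; rewrite ?nsq_ge0// nsq_v_ge.
Qed.

Lemma fam_cint (x y : V) : cintegrable D (fun t => \sum_i c i t * x (ii i) (aa i) t * conjc (y (kk i) (bb i) t)) /\
  fam x y = cint D (fun t => \sum_i c i t * x (ii i) (aa i) t * conjc (y (kk i) (bb i) t)).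
Proof.
have h i := mform_integrable (gc i).1 (gc i).2 (x (ii i) (aa i)) (y (kk i) (bb i)).
by split; [exact: cintegrable_sum|rewrite cint_sum].
Qed.

End Fam.

(** The test vector [(u, t p)] of the coercivity estimate. For [t != 0] it is a bijection of the
    space, so using it on the test side changes neither kernels nor solvability. *)
Definition scaleN (t : R) (y : V) : V := fun i => if i is None then t%:C *: y None else y i.

Lemma scaleN_sesqui t b : sesqui b -> sesqui (fun x y => b x (scaleN t y)).
Proof.
move=> sb; split=> [x y z|a x z|x y z|a x z].
- exact: (sesDl sb).
- exact: (sesZl sb).
- rewrite -(sesDr sb); congr (b z _); apply/funext => -[j|]//=; exact: scalerDr.
- rewrite -(sesZr sb); congr (b z _); apply/funext => -[j|]//=.
  by rewrite scalerA mulrC -scalerA.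
Qed.

Lemma nsq_scaleN_le t y : nsq vform (scaleN t y) <= (1 + t ^+ 2) * nsq vform y.
Proof.
rewrite /vform !nsq_sum mulr_sumr; apply: ler_sum => -[j|] _ /=.
  by rewrite mulrDl mul1r lerDl mulr_ge0 ?sqr_ge0 ?nsq_ge0.
by rewrite nsqZ sqn_real mulrDl mul1r lerDr nsq_ge0.
Qed.

Lemma scaleN_ebounded t e b : (forall x, 0 <= e x) -> ebounded vform e b ->
  ebounded vform e (fun x y => b x (scaleN t y)).
Proof.
move=> e0 [K K0 hK]; exists (K * (1 + t ^+ 2)) => [|x y]; first by rewrite mulr_gt0// ltr_pwDl// sqr_ge0.
apply: (le_trans (hK _ _)); rewrite -mulrA ler_pM2l// mulrCA ler_wpM2l//.
exact: nsq_scaleN_le.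
Qed.

Lemma scaleNK t (y : V) : t != 0 -> scaleN t (scaleN t^-1 y) = y.
Proof.
move=> t0; apply/funext => -[j|]//=; rewrite scalerA -rmorphM/= divff//.
exact: scale1r.
Qed.

End Families.

(** * The PML form sorted by powers of the frequency *)

Section PmlForm.
Context {R : realType}.
Variables (m : material R) (P : pml R) (D : bdom R).
Hypotheses (a0 : 0 < alpha0 P) (z0 : 0 < zeta P).
Local Notation O := (option 'I_3).
Local Notation V := (O -> H0t D).
Local Notation DD := (D : set (mpt R)).
Let mD := bdom_measurable D.
Local Notation ga := (gammaT m).
Local Notation et := (etaT m).
Implicit Types x y : V.

Lemma Rintegral_bigsum (I : Type) (r : seq I) (F : I -> mpt R -> R) :
  (forall i, leb3.-integrable DD (EFin \o F i)) ->
  leb3.-integrable DD (EFin \o (fun t => \sum_(i <- r) F i t)) /\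
  \int[leb3]_(t in DD) (\sum_(i <- r) F i t) = \sum_(i <- r) \int[leb3]_(t in DD) F i t.
Proof.
move=> iF; elim: r => [|i r [IH1 IH2]].
  rewrite big_nil (_ : (fun t => _) = fun=> 0); last by apply/funext => t; rewrite big_nil.
  by split; [exact: integrable0|rewrite /Rintegral integral0].
rewrite big_cons (_ : (fun t => _) = fun t => F i t + \sum_(j <- r) F j t); last first.
  by apply/funext => t; rewrite big_cons.
by split; [exact: (integrableD mD (iF i) IH1)|rewrite RintegralD// IH2].
Qed.

Lemma nsq_v_int x :
  leb3.-integrable DD (EFin \o (fun t => \sum_i \sum_a sqn (x i a t))) /\
  nsq (vform D) x = \int[leb3]_(t in DD) (\sum_i \sum_a sqn (x i a t)).
Proof.
have h i a : leb3.-integrable DD (EFin \o (fun t => sqn (x i a t))).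
  exact: L2_sqn_integrable (L2tP (x i a)).
have h1 i := Rintegral_bigsum (index_enum O) (h i).
have [h2 h3] := Rintegral_bigsum (index_enum O) (fun i => (h1 i).1).
split=> //; rewrite nsq_v h3; apply: eq_bigr => i _; rewrite (h1 i).2.
by apply: eq_bigr => a _; rewrite nsq_l2E.
Qed.

Lemma famZ (I : finType) (a : R[i]) (c : I -> pt R -> R[i]) (ii aa kk bb : I -> O) x y :
  (forall i, good D (c i)) ->
  fam (fun i t => a * c i t) ii aa kk bb x y = a * fam c ii aa kk bb x y.
Proof.
by move=> gc; rewrite /fam mulr_sumr; apply: eq_bigr => i _; apply: mformZ; case: (gc i).
Qed.

Lemma fam_scaleN (I : finType) (t : R) (c : I -> pt R -> R[i]) (ii aa bb : I -> O) x y :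
  (forall i, good D (c i)) ->
  fam c ii aa (fun=> None) bb x (scaleN t y) = t%:C * fam c ii aa (fun=> None) bb x y.
Proof.
move=> gc; rewrite /fam mulr_sumr; apply: eq_bigr => i _.
have sm := mform_sesqui (gc i).1 (gc i).2.
by have := sesZr sm t%:C (y None (bb i)) (x (ii i) (aa i)); rewrite conjc_real.
Qed.

Definition kform := fam (D := D) (fun (q : 'I_3 * 'I_3) t => (mu m)%:C * kcoef P q.2 t)
  (fun q => Some q.1) (fun q => Some q.2) (fun q => Some q.1) (fun q => Some q.2).
(** The weight [lam + mu] collects the trace term of the stress and its transposed-gradient term,
    which [mform_swap] brings to divergence form. *)
Definition divform := fam (D := D) (fun (q : 'I_3 * 'I_3) t => (lam m + mu m)%:C * mcoef P q.1 q.2 t)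
  (fun q => Some q.1) (fun q => Some q.1) (fun q => Some q.2) (fun q => Some q.2).
Definition pdivform := fam (D := D) (fun (j : 'I_3) t => (- ga)%:C * acoef P j t)
  (fun=> None) (fun=> None) (@Some _) (@Some _).
Definition gradform := fam (D := D) (kcoef P) (fun=> None) (@Some _) (fun=> None) (@Some _).
Definition massform := fam (D := D) (fun (_ : 'I_3) => Jpml P) (@Some _) (fun=> None) (@Some _) (fun=> None).
Definition pmassform := fam (D := D) (fun (_ : 'I_1) => Jpml P) (fun=> None) (fun=> None) (fun=> None) (fun=> None).
(** What the coupling [p' div(A u)] becomes, up to sign, after integration by parts: only the value
    of [u] enters, so the term is of lower order in the trial vector. *)
Definition ugradform := fam (D := D) (acoef P) (@Some _) (fun=> None) (fun=> None) (@Some _).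

Let g1 q : good D (fun t => (mu m)%:C * kcoef P (q : 'I_3 * 'I_3).2 t).
Proof. by apply: goodM; [exact: good_cst|exact: good_kcoef]. Qed.
Let g2 q : good D (fun t => (lam m + mu m)%:C * mcoef P (q : 'I_3 * 'I_3).1 q.2 t).
Proof. by apply: goodM; [exact: good_cst|exact: good_mcoef]. Qed.
Let g3 j : good D (fun t => (- ga)%:C * acoef P j t).
Proof. by apply: goodM; [exact: good_cst|exact: good_acoef]. Qed.
Let g4 j : good D (kcoef P j). Proof. exact: good_kcoef. Qed.
Let g5 : good D (Jpml P). Proof. exact: good_J. Qed.
Let g6 j : good D (acoef P j). Proof. exact: good_acoef. Qed.

Definition form0 x y : R[i] := kform x y + divform x y + pdivform x y + gradform x y.
Definition form1 x y : R[i] := - ((0 +i* 1) / (kappa m)%:C) * pmassform x y + (0 +i* 1) * et%:C * ugradform x y.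
Definition form2 x y : R[i] := - (rho m)%:C * massform x y.
Definition bform om x y : R[i] := form0 x y + (om * form1 x y + om ^+ 2 * form2 x y).

Lemma form0_sesqui : sesqui form0.
Proof.
exact: (sesquiD (sesquiD (sesquiD (fam_sesqui _ _ _ _ g1) (fam_sesqui _ _ _ _ g2))
  (fam_sesqui _ _ _ _ g3)) (fam_sesqui _ _ _ _ g4)).
Qed.
Lemma form1_sesqui : sesqui form1.
Proof. exact: (sesquiD (sesquiM _ (fam_sesqui _ _ _ _ (fun=> g5))) (sesquiM _ (fam_sesqui _ _ _ _ g6))). Qed.
Lemma form2_sesqui : sesqui form2.
Proof. exact: (sesquiM _ (fam_sesqui _ _ _ _ (fun=> g5))). Qed.
Lemma bform_sesqui om : sesqui (bform om).
Proof.
exact: (sesquiD form0_sesqui (sesquiD (sesquiM om form1_sesqui) (sesquiM _ form2_sesqui))).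
Qed.

Let en (x : V) : 0 <= nsq (vform D) x. Proof. exact: nsq_ge0. Qed.

Lemma form0_bounded : ebounded (vform D) (nsq (vform D)) form0.
Proof.
have e I := fun c ii aa kk bb gc => @fam_ebounded _ D I c ii aa kk bb gc _ en (fun i x => nsq_v_ge x _ _).
have k1 : ebounded (vform D) (nsq (vform D)) kform by exact: e.
have k2 : ebounded (vform D) (nsq (vform D)) divform by exact: e.
have k3 : ebounded (vform D) (nsq (vform D)) pdivform by exact: e.
have k4 : ebounded (vform D) (nsq (vform D)) gradform by exact: e.
exact: (eboundedD (eboundedD (eboundedD k1 k2) k3) k4).
Qed.
Lemma form1_low : ebounded (vform D) (@lowsq R D) form1.
Proof.
have l0 := @lowsq_ge0 _ D.
have k1 : ebounded (vform D) (@lowsq R D) pmassform.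
  by apply: fam_ebounded => // i x; exact: lowsq_ge.
have k2 : ebounded (vform D) (@lowsq R D) ugradform.
  by apply: fam_ebounded => // i x; exact: lowsq_ge.
exact: (eboundedD (eboundedZ _ k1) (eboundedZ _ k2)).
Qed.
Lemma form2_low : ebounded (vform D) (@lowsq R D) form2.
Proof.
have l0 := @lowsq_ge0 _ D.
have k1 : ebounded (vform D) (@lowsq R D) massform.
  by apply: fam_ebounded => // i x; exact: lowsq_ge.
exact: (eboundedZ _ k1).
Qed.

Lemma low_bounded b : ebounded (vform D) (@lowsq R D) b -> ebounded (vform D) (nsq (vform D)) b.
Proof.
move=> [K K0 hK]; exists K => // x y; apply: (le_trans (hK x y)); rewrite ler_pM2l//.
by rewrite ler_wpM2r ?nsq_ge0// lowsq_le.
Qed.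

Lemma bform_bounded om : bounded_form (vform D) (bform om).
Proof.
have [K K0 hK] := eboundedD form0_bounded
  (eboundedD (eboundedZ om (low_bounded form1_low)) (eboundedZ (om ^+ 2) (low_bounded form2_low))).
by exists K.
Qed.

(** First-order coefficient of the quadratic polynomial recentred at [om0]. *)
Definition cform1 om0 x y : R[i] := form1 x y + 2%:R * om0 * form2 x y.

Lemma bform_pencil om0 k x y : bform (om0 + k) x y = pencil (bform om0) (cform1 om0) form2 k x y.
Proof. by rewrite /bform /pencil /cform1; ring. Qed.

(** Integrand at frequency [i s] against [scaleN t x], to be read with [rs = rho s^2],
    [ks = t s / kappa] and [es = t s eta]: all frequency factors have become real. *)
Definition eint rs t ks es x (z : pt R) : R[i] :=
  \sum_i \sum_j ((mu m)%:C * kcoef P j z * x (Some i) (Some j) z * conjc (x (Some i) (Some j) z) +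
     (lam m + mu m)%:C * mcoef P i j z * x (Some i) (Some i) z * conjc (x (Some j) (Some j) z))
  + \sum_j rs%:C * Jpml P z * x (Some j) None z * conjc (x (Some j) None z)
  + \sum_j (- ga)%:C * acoef P j z * x None None z * conjc (x (Some j) (Some j) z)
  + \sum_j t%:C * kcoef P j z * x None (Some j) z * conjc (x None (Some j) z)
  + ks%:C * Jpml P z * x None None z * conjc (x None None z)
  + \sum_j (- es)%:C * acoef P j z * x (Some j) None z * conjc (x None (Some j) z).

Lemma bform_eint (s t : R) x : cintegrable D (eint (rho m * s ^+ 2) t (t * s / kappa m) (t * s * et) x) /\
  bform (0 +i* s) x (scaleN t x) = cint D (eint (rho m * s ^+ 2) t (t * s / kappa m) (t * s * et) x).
Proof.
have gZ a c : good D c -> good D (fun z => a * c z) by move=> gc; apply: goodM => //; exact: good_cst.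
set rs := rho m * s ^+ 2; set ks := t * s / kappa m; set es := t * s * et.
have [i1 e1] := fam_cint (fun q => Some q.1) (fun q => Some q.2) (fun q => Some q.1) (fun q => Some q.2) g1 x x.
have [i2 e2] := fam_cint (fun q => Some q.1) (fun q => Some q.1) (fun q => Some q.2) (fun q => Some q.2) g2 x x.
have [i3 e3] := fam_cint (fun=> None) (fun=> None) (@Some _) (@Some _) g3 x x.
have [i4 e4] := fam_cint (fun=> None) (@Some _) (fun=> None) (@Some _) (fun j => gZ t%:C _ (g4 j)) x x.
have [i5 e5] := fam_cint (@Some _) (fun=> None) (@Some _) (fun=> None) (fun _ : 'I_3 => gZ rs%:C _ g5) x x.
have [i6 e6] := fam_cint (fun=> None) (fun=> None) (fun=> None) (fun=> None) (fun _ : 'I_1 => gZ ks%:C _ g5) x x.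
have [i7 e7] := fam_cint (@Some _) (fun=> None) (fun=> None) (@Some _) (fun j => gZ (- es)%:C _ (g6 j)) x x.
have E : eint rs t ks es x = fun z =>
   (((((\sum_(q : 'I_3 * 'I_3) (mu m)%:C * kcoef P q.2 z * x (Some q.1) (Some q.2) z * conjc (x (Some q.1) (Some q.2) z)) +
   (\sum_(q : 'I_3 * 'I_3) (lam m + mu m)%:C * mcoef P q.1 q.2 z * x (Some q.1) (Some q.1) z * conjc (x (Some q.2) (Some q.2) z)))
   + \sum_j rs%:C * Jpml P z * x (Some j) None z * conjc (x (Some j) None z))
  + \sum_j (- ga)%:C * acoef P j z * x None None z * conjc (x (Some j) (Some j) z))
  + \sum_j t%:C * kcoef P j z * x None (Some j) z * conjc (x None (Some j) z))
  + \sum_(j < 1) ks%:C * Jpml P z * x None None z * conjc (x None None z)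
  + \sum_j (- es)%:C * acoef P j z * x (Some j) None z * conjc (x None (Some j) z).
  apply/funext => z; rewrite /eint big_ord1.
  rewrite -(pair_bigA _ (fun i j => (mu m)%:C * kcoef P j z * x (Some i) (Some j) z * conjc (x (Some i) (Some j) z)))/=.
  rewrite -(pair_bigA _ (fun i j => (lam m + mu m)%:C * mcoef P i j z * x (Some i) (Some i) z * conjc (x (Some j) (Some j) z)))/=.
  rewrite -[X in _ = X + _ + _ + _ + _ + _]big_split/=; do 5! apply: (congr2 +%R) => //.
  by apply: eq_bigr => i _; rewrite big_split.
have I2 := cintegrableD i1 i2; have I3 := cintegrableD I2 i5; have I4 := cintegrableD I3 i3.
have I5 := cintegrableD I4 i4; have I6 := cintegrableD I5 i6; have I7 := cintegrableD I6 i7.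
rewrite E; split; first exact: I7.
rewrite (cintD I6 i7) (cintD I5 i6) (cintD I4 i4) (cintD I3 i3) (cintD I2 i5) (cintD i1 i2).
have z4 : fam (D := D) (fun j z => t%:C * kcoef P j z) (fun=> None) (@Some _) (fun=> None) (@Some _) x x = t%:C * gradform x x.
  exact: famZ.
have z5 : fam (D := D) (fun (_ : 'I_3) z => rs%:C * Jpml P z) (@Some _) (fun=> None) (@Some _) (fun=> None) x x = rs%:C * massform x x.
  exact: famZ.
have z6 : fam (D := D) (fun (_ : 'I_1) z => ks%:C * Jpml P z) (fun=> None) (fun=> None) (fun=> None) (fun=> None) x x = ks%:C * pmassform x x.
  exact: famZ.
have z7 : fam (D := D) (fun j z => (- es)%:C * acoef P j z) (@Some _) (fun=> None) (fun=> None) (@Some _) x x = (- es)%:C * ugradform x x.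
  exact: famZ.
rewrite -e1 -e2 -e3 -e4 -e5 -e6 -e7 z4 z5 z6 z7.
have s1 : kform x (scaleN t x) = kform x x by [].
have s2 : divform x (scaleN t x) = divform x x by [].
have s3 : pdivform x (scaleN t x) = pdivform x x by [].
have s4 : gradform x (scaleN t x) = t%:C * gradform x x by exact: fam_scaleN.
have s5 : massform x (scaleN t x) = massform x x by [].
have s6 : pmassform x (scaleN t x) = t%:C * pmassform x x by exact: fam_scaleN.
have s7 : ugradform x (scaleN t x) = t%:C * ugradform x x by exact: fam_scaleN.
rewrite /bform /form0 /form1 /form2 s1 s2 s3 s4 s5 s6 s7 -/kform -/divform -/pdivform.
clear -m.
have kV : ((kappa m)%:C)^-1 = ((kappa m)^-1)%:C :> R[i] by rewrite fmorphV.
have c6 : (0 +i* s) * (- ((0 +i* 1) / (kappa m)%:C)) * t%:C = ks%:C.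
  by rewrite kV /ks; simpc; congr (_ +i* _); ring.
have c7 : (0 +i* s) * ((0 +i* 1) * et%:C) * t%:C = (- es)%:C.
  by rewrite /es; simpc; congr (_ +i* _); ring.
have c5 : (0 +i* s) ^+ 2 * (- (rho m)%:C) = rs%:C.
  by rewrite /rs expr2; simpc; congr (_ +i* _); ring.
rewrite -c5 -c6 -c7.
move: (kform x x) (divform x x) (pdivform x x) (gradform x x) (massform x x) (pmassform x x) (ugradform x x).
by move=> k1 k2 k3 k4 k5 k6 k7; ring.
Qed.

End PmlForm.

(** * Coercivity at a large imaginary frequency *)

Section Coercive.
Context {R : realType}.
Variables (m : material R) (P : pml R) (D : bdom R).
Hypotheses (a0 : 0 < alpha0 P) (z0 : 0 < zeta P).
Hypotheses (rho0 : 0 < rho m) (mu0 : 0 < mu m) (lm0 : 0 < 3 * lam m + 2 * mu m)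
  (et0 : 0 < etaT m) (kap0 : 0 < kappa m)
  (zl : (lam m + 2 * mu m) / mu m <= zeta P ^+ 2) (z3 : 3 <= zeta P ^+ 2).
Local Notation O := (option 'I_3).
Local Notation V := (O -> H0t D).
Let mD := bdom_measurable D.
Let B := 1 + zeta P * alpha0 P.
Let T := alpha0 P / B.
Let ga := gammaT m.
Let et := etaT m.

Let B0 : 0 < B. Proof. by rewrite ltr_pwDl// mulr_ge0// ltW. Qed.

(** [zeta * T] equals [zeta alpha0 / (1 + zeta alpha0)], which is below 1. The two lower bounds on
    [zeta] convert this into the two smallness conditions on [T] that follow. *)
Lemma tan_bound : zeta P ^+ 2 * T ^+ 2 < 1.
Proof.
have T0 : 0 <= T by rewrite divr_ge0// ltW.
rewrite -exprMn -(expr1n _ 2) ltrXn2r ?nnegrE ?(mulr_ge0 (ltW z0) T0)//.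
by rewrite /T mulrA ltr_pdivrMr// mul1r /B ltrDr.
Qed.

Lemma tan3 : 3 * T ^+ 2 < 1.
Proof. by apply: le_lt_trans tan_bound; rewrite ler_wpM2r ?sqr_ge0. Qed.

Lemma tan_lame : (lam m + 2 * mu m) * T ^+ 2 < mu m.
Proof.
have h : lam m + 2 * mu m <= mu m * zeta P ^+ 2 by rewrite [leRHS]mulrC -ler_pdivrMr.
apply: (@le_lt_trans _ _ (mu m * (zeta P ^+ 2 * T ^+ 2))).
  by rewrite mulrA ler_wpM2r ?sqr_ge0.
by rewrite -[ltRHS]mulr1 ltr_pM2l// tan_bound.
Qed.

Lemma bform_coercive : exists s t c : R, [/\ 0 < t, 0 < c &
  forall x : V, c * nsq (vform D) x <= complex.Re (bform m P (0 +i* s) x (scaleN t x))].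
Proof.
have lm : 0 <= lam m + mu m.
  have : 0 < 3 * (lam m + mu m).
    by rewrite (_ : 3 * _ = 3 * lam m + 2 * mu m + mu m); [exact: addr_gt0|ring].
  by rewrite pmulr_rgt0// => /ltW.
have hT := tan3; have hl := tan_lame.
have d0 : 0 < mu m - (lam m + 2 * mu m) * T ^+ 2 by rewrite subr_gt0.
have B2 : 0 < 2 * B by rewrite mulr_gt0.
pose ca := Num.min (mu m / (2 * B)) ((mu m - (lam m + 2 * mu m) * T ^+ 2) / (2 * B)).
have ca0 : 0 < ca by rewrite lt_min !divr_gt0.
have [ca1 ca2] : ca <= mu m / (2 * B) /\ ca <= (mu m - (lam m + 2 * mu m) * T ^+ 2) / (2 * B).
  by split; rewrite /ca ge_min lexx ?orbT.
pose cK := (2 * B)^-1; have cK0 : 0 < cK by rewrite invr_gt0.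
pose cJ := 1 - 3 * T ^+ 2; have cJ0 : 0 < cJ by rewrite subr_gt0.
have [MA MA0 hA] : exists2 MA, 0 < MA & forall j z, sqn (acoef P j z) <= MA.
  have /choice[f hf] : forall j, exists M, forall z, sqn (acoef P j z) <= M.
    by move=> j; have [_ _ h _] := weight_acoef a0 z0 j.
  exists (1 + \sum_j `|f j|) => [|j z]; first by rewrite ltr_pwDl// sumr_ge0.
  apply: (le_trans (hf j z)); apply: (le_trans (ler_norm _)); rewrite (bigD1 j)//=.
  have : 0 <= \sum_(i | i != j) `|f i| by apply: sumr_ge0.
  by move: (\sum_(i | _) _) (`|f j|) => *; lra.
(* Makes the cost [2 * es ^+ 2 * MA / (t * cK)] equal to half of the mass [rho s^2 cJ] of the
   displacement, for every [s]. *)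
pose t := rho m * cJ * cK / (4 * et ^+ 2 * MA).
have t0 : 0 < t.
  apply: divr_gt0; first exact: mulr_gt0 (mulr_gt0 rho0 cJ0) cK0.
  by apply: mulr_gt0 MA0; apply: mulr_gt0 => //; exact: exprn_gt0.
pose K1 := 6 * ga ^+ 2 * MA / ca.
have K10 : 0 <= K1.
  apply: divr_ge0; last exact: ltW.
  by apply: mulr_ge0 (ltW MA0); apply: mulr_ge0 => //; exact: sqr_ge0.
(* Makes the pressure mass [ks * cJ] equal to [K1 + 1], so that 1 is left after the coupling with
   the divergence is paid for. *)
pose s := kappa m * (K1 + 1) / (t * cJ).
have s0 : 0 < s.
  apply: divr_gt0; last exact: mulr_gt0.
  by apply: mulr_gt0 => //; exact: ltr_wpDl.
pose c1 := rho m * s ^+ 2 * cJ / 2.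
have c10 : 0 < c1.
  by apply: divr_gt0 => //; apply: mulr_gt0 cJ0; apply: mulr_gt0 => //; exact: exprn_gt0.
pose c := Num.min (Num.min (ca / 2) c1) (Num.min 1 (t * cK / 2)).
have c0 : 0 < c.
  by rewrite !lt_min c10 ltr01 (divr_gt0 ca0)// (divr_gt0 (mulr_gt0 t0 cK0)).
have [l1 l2 l3 l4] : [/\ c <= ca / 2, c <= c1, c <= 1 & c <= t * cK / 2].
  by rewrite /c; split; rewrite !ge_min lexx ?orbT.
exists s, t, c; split=> // x.
set rs := rho m * s ^+ 2; set ks := t * s / kappa m; set es := t * s * et.
have [ie ->] := bform_eint m a0 z0 s t x; rewrite -/et -/rs -/ks -/es in ie *.
have [iq ->] := nsq_v_int x.
rewrite /cint /= -RintegralZl//; apply: le_Rintegral => //.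
- exact: (integrableZl mD c iq).
- exact: ie.1.
move=> z _; rewrite sum_option [in X in c * X]sum_option.
have ES : \sum_(i < 3) \sum_a sqn (x (Some i) a z) =
    \sum_(i < 3) sqn (x (Some i) None z) + \sum_(i < 3) \sum_(j < 3) sqn (x (Some i) (Some j) z).
  by rewrite -big_split; apply: eq_bigr => i _; rewrite sum_option.
rewrite ES.
have el := elastic_lower z a0 z0 hT mu0 lm hl ca1 ca2 (fun i j => x (Some i) (Some j) z).
have rs0 : 0 <= rs by rewrite mulr_ge0 ?sqr_ge0// ltW.
have ks0 : 0 <= ks := divr_ge0 (mulr_ge0 (ltW t0) (ltW s0)) (ltW kap0).
have hU : \sum_j sqn (x (Some j) (Some j) z) <= \sum_i \sum_j sqn (x (Some i) (Some j) z).
  by apply: ler_sum => i _; rewrite (bigD1 i)//= lerDl sumr_ge0// => k _; exact: sqn_ge0.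
have tl := total_lower ga es (x None None z) (fun j => x (Some j) None z) (fun j => x None (Some j) z) ca0 cK0 t0 rs0 ks0 el hU (Re_Jpml_ge z a0 z0 hT)
  (fun j => Re_kcoef_ge z a0 z0 hT j) (fun j => hA j z).
apply: (le_trans _ tl) => {tl el}.
have e1 : rs * cJ - 2 * es ^+ 2 * MA / (t * cK) = c1.
  rewrite /rs /es /t /c1 -/et; field.
  by rewrite !lt0r_neq0.
have e2 : ks * cJ - 6 * ga ^+ 2 * MA / ca = 1.
  rewrite -/K1 /ks /s; field.
  by rewrite !lt0r_neq0.
rewrite -/cJ -/cK in e1 e2 *; rewrite e1 e2.
have := ler_wpM2r (sqn_ge0 (x None None z)) l3.
have S0 (F : 'I_3 -> R[i]) : 0 <= \sum_j sqn (F j) by apply: sumr_ge0 => j _; exact: sqn_ge0.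
have SS0 : 0 <= \sum_i \sum_j sqn (x (Some i) (Some j) z) by apply: sumr_ge0 => i _; exact: S0.
have := ler_wpM2r (S0 (fun j => x None (Some j) z)) l4.
have := ler_wpM2r (S0 (fun j => x (Some j) None z)) l2.
have := ler_wpM2r SS0 l1.
move=> q1 q2 q3 q4; have := lerD (lerD (lerD q1 q2) q4) q3; apply: le_trans.
rewrite le_eqVlt; apply/orP; left; apply/eqP; ring.
Qed.

End Coercive.

(** * Discreteness of the resonances *)

Section Discrete.
Context {R : realType}.
Local Notation C := (R[i] : numFieldType).

Lemma near_notin (p : C) (s : seq R[i]) : p \notin s -> \forall q \near p, (q : R[i]) \notin s.
Proof.
elim: s => [|a s IH]; first by move=> _; near=> q.
rewrite in_cons negb_or => /andP[pa ps]; have h1 := IH ps.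
have h2 : \forall q \near p, (q : R[i]) != a.
  apply/nbhs_ballP; exists `|p - a|; first by rewrite /= normr_gt0 subr_eq0.
  by move=> q; rewrite -ball_normE /=; apply: contraTneq => ->; rewrite ltxx.
by near=> q; rewrite in_cons negb_or; apply/andP; split; near: q.
Unshelve. all: by end_near. Qed.

Lemma near_sqn (p : C) : \forall q \near p, sqn ((q : R[i]) - p) <= 1.
Proof.
apply/nbhs_ballP; exists 1; first exact: ltr01.
move=> q; rewrite -ball_normE /= distrC => h.
have h2 : `|(q : R[i]) - p| ^+ 2 <= 1 by rewrite exprn_ile1// ltW.
by rewrite normCK mul_conjc_sqn lecR in h2.
Qed.

(* Finitely many points in every disc leave no room for a limit point. *)
Lemma limit_point_disc_finite (L : set R[i]) (c : R[i]) :
  (forall M, 0 < M -> exists N, forall s : seq R[i], uniq s ->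
     (forall z, z \in s -> L z /\ sqn (z - c) <= M) -> (size s <= N)%N) ->
  limit_point (L : set C) = set0.
Proof.
move=> fin; apply/seteqP; split => // p lp.
pose M := 2 * 1 + 2 * sqn (p - c).
have M0 : 0 < M by rewrite /M; have := sqn_ge0 (p - c); lra.
have [N hN] := fin M M0.
suff H n : exists s : seq R[i], [/\ uniq s, size s = n, p \notin s &
    forall z, z \in s -> L z /\ sqn (z - c) <= M].
  have [s [us ss _ hs]] := H N.+1; have := hN s us hs; by rewrite ss ltnn.
elim: n => [|n [s [us ss ps hs]]]; first by exists [::].
have U : nbhs (p : C) [set q : C | (q : R[i]) \notin s /\ sqn ((q : R[i]) - p) <= 1].
  by have := near_notin ps; have := near_sqn p; apply: filterS2.
have [q [qp Lq [qs q1]]] := lp _ U.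
exists ((q : R[i]) :: s); split=> /=.
- by rewrite qs.
- by rewrite ss.
- by rewrite in_cons negb_or ps eq_sym qp.
- move=> z; rewrite in_cons => /orP[/eqP->|]; last exact: hs.
  split=> //; rewrite (_ : q - c = (q - p) + (p - c)); last by rewrite addrA subrK.
  by apply: (le_trans (sqnD _ _)); rewrite lerD2r ler_pM2l.
Qed.

End Discrete.

(** * Resonances and solvability away from them *)

Section Solvability.
Context {R : realType}.
Variables (m : material R) (P : pml R) (D : bdom R).
Hypotheses (a0 : 0 < alpha0 P) (z0 : 0 < zeta P).
Hypotheses (rho0 : 0 < rho m) (mu0 : 0 < mu m) (lm0 : 0 < 3 * lam m + 2 * mu m)
  (et0 : 0 < etaT m) (kap0 : 0 < kappa m)
  (zl : (lam m + 2 * mu m) / mu m <= zeta P ^+ 2) (z3 : 3 <= zeta P ^+ 2).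
Local Notation V := (option 'I_3 -> H0t D).

Definition resonances : set R[i] :=
  [set om | exists2 x : V, nsq (vform D) x != 0 & forall y, bform m P om x y = 0].

Lemma v_complete : complete_on (vform D) setT.
Proof. exact: sum_complete (@h0_complete _ D). Qed.

Lemma lowsq_compact : compact_sq (vform D) (@lowsq R D).
Proof. exact: (@compact_sq_sum R (option 'I_3) _ _ _ (@h0_compact R D)). Qed.

Lemma scaleN_lin t (a : R[i]) (x y : V) : scaleN t (a *: x + y) = a *: scaleN t x + scaleN t y.
Proof.
apply/funext => -[j|]//=; rewrite -[LHS]/(t%:C *: (a *: x None + y None)).
by rewrite scalerDr scalerA mulrC -scalerA.
Qed.

(** Recentred at [om0 = i s] and tested with [scaleN t y], the form is a pencil in [om - om0] with
    coercive constant term and lower-order coefficients, so both pencil lemmas apply; invertibility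
    of [scaleN] removes the twist. *)
Lemma resonances_dichotomy : limit_point (resonances : set (R[i] : numFieldType)) = set0 /\
  forall om, ~ resonances om -> forall F : V -> R[i], clin F -> bounded_cfun (vform D) F ->
    exists x, forall y, bform m P om x y = F y.
Proof.
have [s [t [c [t0 c0 co]]]] := bform_coercive D a0 z0 rho0 mu0 lm0 et0 kap0 zl z3.
have tn0 : t != 0 by rewrite lt0r_neq0.
pose om0 : R[i] := 0 +i* s.
have l0 := @lowsq_ge0 _ D.
pose b (x y : V) := bform m P om0 x (scaleN t y).
pose c1 (x y : V) := cform1 m P om0 x (scaleN t y).
pose c2 (x y : V) := form2 m P x (scaleN t y).
have sb : sesqui b := scaleN_sesqui t (bform_sesqui m D a0 z0 om0).
have s1 : sesqui c1.
  apply: (scaleN_sesqui t); apply: sesquiD; first exact: form1_sesqui.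
  by apply: sesquiM; exact: form2_sesqui.
have s2 : sesqui c2 := scaleN_sesqui t (form2_sesqui m D a0 z0).
have bb : bounded_form (vform D) b.
  have [K hK] := bform_bounded m D a0 z0 om0.
  have K1 : ebounded (vform D) (nsq (vform D)) (bform m P om0).
    exists (`|K| + 1); first by rewrite ltr_wpDl.
    move=> x y; apply: (le_trans (hK x y)); apply: ler_wpM2r; first by rewrite mulr_ge0// nsq_ge0.
    by have := ler_norm K; lra.
  by have [K' _ hK'] := scaleN_ebounded t (fun x => nsq_ge0 (vform D) x) K1; exists K'.
have e1 : ebounded (vform D) (@lowsq R D) c1.
  apply: scaleN_ebounded => //; apply: eboundedD; first exact: form1_low.
  by apply: eboundedZ; exact: form2_low.
have e2 : ebounded (vform D) (@lowsq R D) c2.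
  by apply: scaleN_ebounded => //; exact: form2_low.
have [K1 K10 hK1] := e1; have [K2 K20 hK2] := e2.
have K0 : 0 < K1 + K2 by exact: addr_gt0.
have h1 (x y : V) : sqn (c1 x y) <= (K1 + K2) * (lowsq x * nsq (vform D) y).
  by apply: (le_trans (hK1 x y)); rewrite ler_wpM2r ?mulr_ge0 ?nsq_ge0// lerDl ltW.
have h2 (x y : V) : sqn (c2 x y) <= (K1 + K2) * (lowsq x * nsq (vform D) y).
  by apply: (le_trans (hK2 x y)); rewrite ler_wpM2r ?mulr_ge0 ?nsq_ge0// lerDr ltW.
have pE k (x y : V) : pencil b c1 c2 k x y = bform m P (om0 + k) x (scaleN t y).
  by rewrite bform_pencil.
have lowc := lowsq_compact.
split.
  apply: (@limit_point_disc_finite _ _ om0) => M M0.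
  have [N hN] := pencil_eigenvalues_finite sb c0 co s1 s2 K0 l0 (@lowsq_le _ D) lowc h1 h2 M0.
  exists N => sq us hs.
  have /choice[w hw] : forall i, exists w : V, (i < size sq)%N ->
      nsq (vform D) w != 0 /\ forall y, bform m P (sq`_i) w y = 0.
    move=> i; have [li|_] := ltnP i (size sq); last by exists 0.
    by have [[x x0 hx] _] := hs _ (mem_nth 0 li); exists x.
  apply: (hN (size sq) (fun i => sq`_i - om0) w).
  - move=> i j li lj /addIr e; apply/eqP; rewrite -(nth_uniq 0 li lj us); exact/eqP.
  - move=> i li; have [_ hM] := hs _ (mem_nth 0 li); split=> //.
    (* The centre [om0] itself is no resonance, by coercivity; this is required because the
       multipliers are inverses of [om - om0]. *)
    rewrite subr_eq0; apply/eqP => e.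
    have [w0 hb] := hw i li; have := co (w i); rewrite -/om0 -e hb => h.
    have : nsq (vform D) (w i) = 0.
      apply/eqP; rewrite eq_le nsq_ge0 andbT; move: h; rewrite /= pmulr_rle0//.
    by apply/eqP.
  - move=> i li; have [w0 hb] := hw i li; split=> // y.
    by rewrite pE addrC subrK hb.
move=> om nr F lF [KF hF].
have cF : clin (fun y => F (scaleN t y)).
  by move=> a x y; rewrite scaleN_lin lF.
have bF : bounded_cfun (vform D) (fun y => F (scaleN t y)).
  exists (`|KF| * (1 + t ^+ 2)) => y; apply: (le_trans (hF _)); rewrite -mulrA.
  apply: (@le_trans _ _ (`|KF| * nsq (vform D) (scaleN t y))).
    by apply: ler_wpM2r; [exact: nsq_ge0|exact: ler_norm].
  by apply: ler_wpM2l => //; exact: nsq_scaleN_le.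
have ker x : (forall y, pencil b c1 c2 (om - om0) x y = 0) -> nsq (vform D) x = 0.
  move=> hx; apply/eqP; apply/negPn/negP => x0; apply: nr; exists x => // y.
  by rewrite -(scaleNK y tn0) -[om](subrK om0) addrC -pE.
have [x hx] := pencil_solvable sb bb c0 co s1 s2 K0 l0 (@lowsq_le _ D) lowc h1 h2 v_complete ker cF bF.
exists x => y; have := hx (scaleN t^-1 y).
by rewrite pE addrC subrK scaleNK.
Qed.

End Solvability.

(** * The weak formulation as a sesquilinear form *)

Section Identify.
Context {R : realType}.
Variables (m : material R) (P : pml R) (D : bdom R).
Hypotheses (a0 : 0 < alpha0 P) (z0 : 0 < zeta P).
Local Notation V := (option 'I_3 -> H0t D).
Local Notation DD := (D : set (mpt R)).

Lemma mcoef_div i j z : acoef P j z / stretch P i z = mcoef P i j z.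
Proof.
rewrite /mcoef; have [->//|ij] := eqVneq i j.
rewrite /acoef (bigD1 i)//= mulrC mulKf ?stretch_neq0//.
by apply: eq_bigl => k; rewrite andbC.
Qed.

(** With [A] and [B] diagonal, entry [(i, j)] of the stress times [A] combines the gradient with
    [A_j / s_j], the transposed gradient with [A_j / s_i] and, for [i = j], the trace, whose k-th
    term meets [A_j / s_k]. All these coefficients are values of [mcoef]. *)
Lemma frob_stress (u : pt R -> 'cV[R[i]]_3) z (H : 'M[R[i]]_3) :
  frob (stress m P D u z *m Apml P z) H =
  \sum_i \sum_j ((mu m)%:C * kcoef P j z * vgrad D u z i j * H i j +
    (mu m)%:C * mcoef P i j z * vgrad D u z j i * H i j +
    (lam m)%:C * mcoef P i j z * vgrad D u z i i * H j j).
Proof.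
set G := vgrad D u z.
have sE i j : strain P D u z i j = 2^-1 * (G i j / stretch P j z + G j i / stretch P i z).
  rewrite /strain -/G; clearbody G.
  by rewrite /Bpml tr_diag_mx mul_mx_diag mul_diag_mx !mxE [(stretch P i z)^-1 * _]mulrC.
have trE : \tr (strain P D u z) = \sum_k G k k / stretch P k z.
  apply: eq_bigr => k _; rewrite sE; move: (_ / _) => g.
  have two : (2 : R[i])^-1 * 2 = 1 by rewrite mulVf// (_ : (2 : R[i]) = 2%:R)// pnatr_eq0.
  have alg : (2 : R[i])^-1 * (g + g) = 2^-1 * 2 * g by ring.
  by rewrite alg two mul1r.
have ME i j : (stress m P D u z *m Apml P z) i j =
    (mu m)%:C * kcoef P j z * G i j + (mu m)%:C * mcoef P i j z * G j i +
    ((lam m)%:C * (\sum_k G k k / stretch P k z) *+ (i == j)) * acoef P j z.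
  rewrite /Apml mul_mx_diag /stress trE; move: (strain P D u z) (sE i j) => S SE; clearbody G.
  rewrite !mxE SE -/(acoef P j z) /kcoef -mcoef_div.
  have two : (2 : R[i]) * 2^-1 = 1 by rewrite divff// (_ : (2 : R[i]) = 2%:R)// pnatr_eq0.
  have alg (c g1 g2 sj si L A : R[i]) : (2 * c * (2^-1 * (g1 / sj + g2 / si)) + L) * A =
      (2 * 2^-1) * (c * (A / sj) * g1 + c * (A / si) * g2) + L * A by ring.
  by rewrite alg two mul1r.
rewrite /frob; under eq_bigr => i _ do under eq_bigr => j _ do rewrite ME 2!mulrDl.
under eq_bigr => i _ do rewrite big_split/=; rewrite big_split/=.
under [RHS]eq_bigr => i _ do rewrite big_split/=; rewrite [RHS]big_split/=; congr (_ + _).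
transitivity (\sum_j (lam m)%:C * (\sum_k G k k / stretch P k z) * acoef P j z * H j j).
  move: (\sum_(k < 3) G k k / _) => T; apply: eq_bigr => i _; rewrite (bigD1 i)//= eqxx mulr1n big1 ?addr0// => j ji.
  by rewrite eq_sym (negbTE ji) mulr0n !mul0r.
rewrite exchange_big/=; apply: eq_bigr => j _.
rewrite mulr_sumr !mulr_suml; apply: eq_bigr => i _.
by rewrite -mcoef_div; ring.
Qed.

Lemma good_integrable c (f h : pt R -> R[i]) : good D c -> L2 D f -> L2 D h ->
  cintegrable D (fun z => c z * f z * h z).
Proof. by move=> [mc bc] Lf Lh; apply: L2_mul => //; exact: L2_bounded. Qed.

Lemma rfam_cint (I : finType) (c f h : I -> pt R -> R[i]) :
  (forall i, good D (c i)) -> (forall i, L2 D (f i)) -> (forall i, L2 D (h i)) ->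
  cintegrable D (fun z => \sum_i c i z * f i z * h i z) /\
  cint D (fun z => \sum_i c i z * f i z * h i z) = \sum_i cint D (fun z => c i z * f i z * h i z).
Proof.
move=> gc Lf Lh; have I1 i := good_integrable (gc i) (Lf i) (Lh i).
by split; [exact: cintegrable_sum|rewrite cint_sum].
Qed.

Lemma cint_mform c c' (f h : pt R -> R[i]) (v w : L2t D) : good D c -> good D c' -> L2 D f -> L2 D h ->
  {ae leb3, forall z : mpt R, DD z -> c z * f z * h z = c' z * v z * conjc (w z)} ->
  cint D (fun z => c z * f z * h z) = mform c' v w.
Proof.
move=> [mc bc] [mc' bc'] Lf Lh e; apply: cint_ae => //.
  by apply: cmeasM; [apply: cmeasM => //|]; exact: L2_cmeas.
apply: cmeasM; first by apply: cmeasM => //; apply: L2_cmeas; exact: L2tP.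
by apply: cmeas_conj; apply: L2_cmeas; exact: L2tP.
Qed.

Lemma h0_wpd_conj (f : H0t D) j : is_wpd D j (fun z => conjc (f None z)) (fun z => conjc (f (Some j) z)).
Proof. by apply: is_wpd_conj; [exact: L2tP|exact: h0_is_wpd]. Qed.

Lemma h0_wpd_acoef_conj (f : H0t D) j : is_wpd D j (fun z => acoef P j z * conjc (f None z))
  (fun z => acoef P j z * conjc (f (Some j) z)).
Proof.
have wc := weight_conj (weight_acoef a0 z0 j).
have Lf : L2 D (fun z => conjc (acoef P j z) * f None z).
  by apply: L2_bounded (L2tP _); [exact: weight_cmeas wc|exact: weight_cbdd wc].
have := is_wpd_conj Lf (h0_wpd f wc).
rewrite (_ : (fun z => conjc (conjc (acoef P j z) * f None z)) = fun z => acoef P j z * conjc (f None z)); last first.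
  by apply/funext => z; rewrite rmorphM/= conjcK.
rewrite (_ : (fun z => conjc (conjc (acoef P j z) * f (Some j) z)) = fun z => acoef P j z * conjc (f (Some j) z))//.
by apply/funext => z; rewrite rmorphM/= conjcK.
Qed.

(** For distinct indices the coefficient contains neither [s_i] nor [s_j], hence is a weight for
    both directions. *)
Lemma mform_swap (x y : V) i j :
  mform (mcoef P i j) (x (Some j) (Some i)) (y (Some i) (Some j)) =
  mform (mcoef P i j) (x (Some j) (Some j)) (y (Some i) (Some i)).
Proof.
have [->//|ij] := eqVneq i j.
have w k : (k == i) || (k == j) -> weight k (mcoef P i j).
  move=> kij; rewrite /mcoef (negbTE ij); apply: weight_prod => // l.
  by case/andP => li lj; case/orP: kij => /eqP->; rewrite eq_sym.
by apply: h0_swap; apply: w; rewrite eqxx ?orbT.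
Qed.

Lemma mcoefC i j z : mcoef P i j z = mcoef P j i z.
Proof.
rewrite /mcoef eq_sym; case: eqP => [->//|_].
by apply: eq_bigl => k; rewrite andbC.
Qed.

Variables (om : R[i]) (u u' : pt R -> 'cV[R[i]]_3) (p p' : pt R -> R[i]) (x y : V).
Hypotheses (xu : forall i, x (Some i) None = (fun z => u z i 0) :> (pt R -> R[i]))
  (xU : forall i j, x (Some i) (Some j) = wpd D j (fun z => u z i 0) :> (pt R -> R[i]))
  (xp : x None None = p :> (pt R -> R[i]))
  (xG : forall j, x None (Some j) = wpd D j p :> (pt R -> R[i]))
  (yu : forall i, y (Some i) None = (fun z => u' z i 0) :> (pt R -> R[i]))
  (yp : y None None = p' :> (pt R -> R[i])).

(** The representatives that occur in [Bform]. The one chosen for a conjugate or a product need only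
    agree almost everywhere with the conjugate or product of chosen ones, so the comparison is made
    under the integral. *)
Let H i j := wpd D j (fun z => vconj u' z i 0).
Let W j := wpd D j (fun z => (Apml P z *m vconj u' z) j 0).
Let X j := wpd D j (fun z => (Apml P z *m u z) j 0).
Let Hp j := wpd D j (fun z => conjc (p' z)).

Let wH i j : is_wpd D j (fun z => vconj u' z i 0) (fun z => conjc (y (Some i) (Some j) z)).
Proof.
have := h0_wpd_conj (y (Some i)) j; rewrite yu.
by rewrite (_ : (fun z => conjc (u' z i 0)) = fun z => vconj u' z i 0)//; apply/funext => z; rewrite !mxE.
Qed.

Let wW j : is_wpd D j (fun z => (Apml P z *m vconj u' z) j 0) (fun z => acoef P j z * conjc (y (Some j) (Some j) z)).
Proof.
have := h0_wpd_acoef_conj (y (Some j)) j; rewrite yu.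
rewrite (_ : (fun z => acoef P j z * conjc (u' z j 0)) = fun z => (Apml P z *m vconj u' z) j 0)//.
by apply/funext => z; rewrite /Apml mul_diag_mx !mxE.
Qed.

Let wX j : is_wpd D j (fun z => (Apml P z *m u z) j 0) (fun z => acoef P j z * x (Some j) (Some j) z).
Proof.
have := h0_wpd (x (Some j)) (weight_acoef a0 z0 j); rewrite xu.
rewrite (_ : (fun z => acoef P j z * u z j 0) = fun z => (Apml P z *m u z) j 0)//.
by apply/funext => z; rewrite /Apml mul_diag_mx !mxE.
Qed.

Let wHp j : is_wpd D j (fun z => conjc (p' z)) (fun z => conjc (y None (Some j) z)).
Proof. by have := h0_wpd_conj (y None) j; rewrite yp. Qed.

Let LH i j : L2 D (H i j). Proof. by have [] := is_wpd_wpd (ex_intro _ _ (wH i j)). Qed.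
Let LW j : L2 D (W j). Proof. by have [] := is_wpd_wpd (ex_intro _ _ (wW j)). Qed.
Let LX j : L2 D (X j). Proof. by have [] := is_wpd_wpd (ex_intro _ _ (wX j)). Qed.
Let LHp j : L2 D (Hp j). Proof. by have [] := is_wpd_wpd (ex_intro _ _ (wHp j)). Qed.


Lemma stress_families z : frob (stress m P D u z *m Apml P z) (vgrad D (vconj u') z) =
  \sum_(k : 'I_3 * 'I_3) (mu m)%:C * kcoef P k.2 z * x (Some k.1) (Some k.2) z * H k.1 k.2 z +
   \sum_(k : 'I_3 * 'I_3) (mu m)%:C * mcoef P k.1 k.2 z * x (Some k.2) (Some k.1) z * H k.1 k.2 z +
   \sum_(k : 'I_3 * 'I_3) (lam m)%:C * mcoef P k.1 k.2 z * x (Some k.1) (Some k.1) z * H k.2 k.2 z.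
Proof.
rewrite frob_stress.
rewrite -(pair_bigA _ (fun i j => (mu m)%:C * kcoef P j z * x (Some i) (Some j) z * H i j z))/=.
rewrite -(pair_bigA _ (fun i j => (mu m)%:C * mcoef P i j z * x (Some j) (Some i) z * H i j z))/=.
rewrite -(pair_bigA _ (fun i j => (lam m)%:C * mcoef P i j z * x (Some i) (Some i) z * H j j z))/=.
rewrite -!big_split/=; apply: eq_bigr => i _; rewrite -!big_split/=; apply: eq_bigr => j _.
by rewrite !xU /vgrad !mxE.
Qed.

Lemma mass_family z : \sum_(k < 3) (- ((rho m)%:C * om ^+ 2)) * Jpml P z * x (Some k) None z * conjc (y (Some k) None z) =
  - ((rho m)%:C * om ^+ 2 * Jpml P z * dotp (u z) (vconj u' z)).
Proof.
rewrite /dotp mulr_sumr -sumrN; apply: eq_bigr => k _; rewrite xu yu /vconj !mxE.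
by rewrite !mulNr -!mulrA.
Qed.

Lemma pdiv_family z : \sum_(k < 3) (- gammaT m)%:C * x None None z * W k z =
  - ((gammaT m)%:C * p z * vdiv D (fun y => Apml P y *m vconj u' y) z).
Proof.
rewrite /vdiv mulr_sumr -sumrN; apply: eq_bigr => k _; rewrite xp rmorphN/=.
by rewrite !mulNr.
Qed.

Lemma grad_family z : \sum_(k < 3) kcoef P k z * x None (Some k) z * Hp k z =
  dotp (grad D (fun y => conjc (p' y)) z) (Kpml P z *m grad D p z).
Proof.
apply: eq_bigr => k _; rewrite xG /Kpml mul_diag_mx /grad !mxE.
by rewrite [RHS]mulrC.
Qed.

Lemma udiv_family z : \sum_(k < 3) - ((0 +i* 1) * om * (etaT m)%:C) * X k z * conjc (y None None z) =
  - ((0 +i* 1) * om * (etaT m)%:C * conjc (p' z) * vdiv D (fun y => Apml P y *m u y) z).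
Proof.
rewrite /vdiv mulr_sumr -sumrN; apply: eq_bigr => k _; rewrite yp.
by rewrite !mulNr mulrAC.
Qed.

Lemma bform_algebra (k1 S1 S2 k2 k3 k4 k5 k6 o ii kV ee rr : R[i]) :
  k1 + S1 + S2 + - (rr * o ^+ 2) * k4 + k2 + k3 + - (ii * o * kV) * k5 + ii * o * ee * k6 =
  k1 + (S1 + S2) + k2 + k3 + (o * (- (ii * kV) * k5 + ii * ee * k6) + o ^+ 2 * (- rr * k4)).
Proof. by ring. Qed.

Lemma Bform_bform : Bform m P om D u p u' p' = bform m P om x y.
Proof.
have gC a c : good D c -> good D (fun z => a * c z) by move=> gc; apply: goodM => //; exact: good_cst.
have gK j := good_kcoef a0 z0 D j; have gM i j := good_mcoef a0 z0 D i j.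
have gA j := good_acoef a0 z0 D j; have gJ := good_J a0 z0 D.
pose q := (0 +i* 1) * om / (kappa m)%:C.
have Lc i a : L2 D (fun z => conjc (y i a z)) by apply: L2_conj; exact: L2tP.
have [i1 e1] := @rfam_cint ('I_3 * 'I_3)%type (fun k z => (mu m)%:C * kcoef P k.2 z)
  (fun k => x (Some k.1) (Some k.2)) (fun k => H k.1 k.2) (fun k => gC _ _ (gK _)) (fun k => L2tP _) (fun k => LH _ _).
have [i2 e2] := @rfam_cint ('I_3 * 'I_3)%type (fun k z => (mu m)%:C * mcoef P k.1 k.2 z)
  (fun k => x (Some k.2) (Some k.1)) (fun k => H k.1 k.2) (fun k => gC _ _ (gM _ _)) (fun k => L2tP _) (fun k => LH _ _).
have [i3 e3] := @rfam_cint ('I_3 * 'I_3)%type (fun k z => (lam m)%:C * mcoef P k.1 k.2 z)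
  (fun k => x (Some k.1) (Some k.1)) (fun k => H k.2 k.2) (fun k => gC _ _ (gM _ _)) (fun k => L2tP _) (fun k => LH _ _).
have [i4 e4] := @rfam_cint 'I_3 (fun _ z => (- ((rho m)%:C * om ^+ 2)) * Jpml P z)
  (fun k => x (Some k) None) (fun k z => conjc (y (Some k) None z)) (fun k => gC _ _ gJ) (fun k => L2tP _) (fun k => Lc _ _).
have [i5 e5] := @rfam_cint 'I_3 (fun _ z => (- gammaT m)%:C)
  (fun k => x None None) W (fun k => good_cst D _) (fun k => L2tP _) LW.
have [i6 e6] := @rfam_cint 'I_3 (kcoef P) (fun k => x None (Some k)) Hp gK (fun k => L2tP _) LHp.
have [i7 e7] := @rfam_cint 'I_1 (fun _ z => (- q) * Jpml P z)
  (fun k => x None None) (fun k z => conjc (y None None z)) (fun k => gC _ _ gJ) (fun k => L2tP _) (fun k => Lc _ _).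
have [i8 e8] := @rfam_cint 'I_3 (fun _ z => - ((0 +i* 1) * om * (etaT m)%:C))
  X (fun k z => conjc (y None None z)) (fun k => good_cst D _) LX (fun k => Lc _ _).
have j2 := cintegrableD i1 i2; have j3 := cintegrableD j2 i3; have j4 := cintegrableD j3 i4.
have j5 := cintegrableD j4 i5; have j6 := cintegrableD j5 i6; have j7 := cintegrableD j6 i7.
transitivity (cint D (fun z =>
  ((((((\sum_(k : 'I_3 * 'I_3) (mu m)%:C * kcoef P k.2 z * x (Some k.1) (Some k.2) z * H k.1 k.2 z +
   \sum_(k : 'I_3 * 'I_3) (mu m)%:C * mcoef P k.1 k.2 z * x (Some k.2) (Some k.1) z * H k.1 k.2 z) +
   \sum_(k : 'I_3 * 'I_3) (lam m)%:C * mcoef P k.1 k.2 z * x (Some k.1) (Some k.1) z * H k.2 k.2 z) +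
   \sum_(k < 3) (- ((rho m)%:C * om ^+ 2)) * Jpml P z * x (Some k) None z * conjc (y (Some k) None z)) +
   \sum_(k < 3) (- gammaT m)%:C * x None None z * W k z) +
   \sum_(k < 3) kcoef P k z * x None (Some k) z * Hp k z) +
   \sum_(k < 1) (- q) * Jpml P z * x None None z * conjc (y None None z)) +
   \sum_(k < 3) - ((0 +i* 1) * om * (etaT m)%:C) * X k z * conjc (y None None z))).
  apply: cint_eq => z _.
  rewrite stress_families mass_family pdiv_family grad_family udiv_family big_ord1 xp yp.
  by rewrite /q !mulNr.
rewrite (cintD j7 i8) (cintD j6 i7) (cintD j5 i6) (cintD j4 i5) (cintD j3 i4) (cintD j2 i3) (cintD i1 i2).
rewrite e1 e2 e3 e4 e5 e6 e7 e8.
have aH i j := wpd_ae (wH i j); have aW j := wpd_ae (wW j).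
have aX j := wpd_ae (wX j); have aP j := wpd_ae (wHp j).
have f1 : \sum_(k : 'I_3 * 'I_3) cint D (fun z => (mu m)%:C * kcoef P k.2 z * x (Some k.1) (Some k.2) z * H k.1 k.2 z) = kform m P x y.
  apply: eq_bigr => k _; apply: cint_mform => //; [exact: gC|exact: gC|exact: L2tP|].
  by apply: filterS (aH k.1 k.2) => z hz Dz; rewrite /H hz.
(* The transposed gradient pairs [d_i u_j] with [d_j v_i]; the swap replaces these by diagonal
   entries, and exchanging the summation indices gives the pattern of [divform]. *)
have f2 : \sum_(k : 'I_3 * 'I_3) cint D (fun z => (mu m)%:C * mcoef P k.1 k.2 z * x (Some k.2) (Some k.1) z * H k.1 k.2 z) =
    \sum_(k : 'I_3 * 'I_3) (mu m)%:C * mform (mcoef P k.1 k.2) (x (Some k.1) (Some k.1)) (y (Some k.2) (Some k.2)).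
  rewrite -(pair_bigA _ (fun i j => cint D (fun z => (mu m)%:C * mcoef P i j z * x (Some j) (Some i) z * H i j z)))/=.
  rewrite -(pair_bigA _ (fun i j => (mu m)%:C * mform (mcoef P i j) (x (Some i) (Some i)) (y (Some j) (Some j))))/=.
  rewrite exchange_big/=; apply: eq_bigr => j _; apply: eq_bigr => i _.
  have mC : mcoef P j i = mcoef P i j by apply/funext => z; exact: mcoefC.
  rewrite mC -(mform_swap x y i j) -(mformZ _ _ _ (gM i j).1 (gM i j).2).
  apply: cint_mform => //; [exact: gC|exact: gC|exact: L2tP|].
  by apply: filterS (aH i j) => z hz Dz; rewrite /H hz.
have f3 : \sum_(k : 'I_3 * 'I_3) cint D (fun z => (lam m)%:C * mcoef P k.1 k.2 z * x (Some k.1) (Some k.1) z * H k.2 k.2 z) =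
    \sum_(k : 'I_3 * 'I_3) (lam m)%:C * mform (mcoef P k.1 k.2) (x (Some k.1) (Some k.1)) (y (Some k.2) (Some k.2)).
  apply: eq_bigr => k _; rewrite -(mformZ _ _ _ (gM k.1 k.2).1 (gM k.1 k.2).2).
  apply: cint_mform => //; [exact: gC|exact: gC|exact: L2tP|].
  by apply: filterS (aH k.2 k.2) => z hz Dz; rewrite /H hz.
have f23 : divform m P x y =
    \sum_(k : 'I_3 * 'I_3) (mu m)%:C * mform (mcoef P k.1 k.2) (x (Some k.1) (Some k.1)) (y (Some k.2) (Some k.2)) +
    \sum_(k : 'I_3 * 'I_3) (lam m)%:C * mform (mcoef P k.1 k.2) (x (Some k.1) (Some k.1)) (y (Some k.2) (Some k.2)).
  rewrite -big_split/=; apply: eq_bigr => k _.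
  by rewrite (mformZ _ _ _ (gM k.1 k.2).1 (gM k.1 k.2).2) rmorphD/= -mulrDl addrC.
have f4 : \sum_(k < 3) cint D (fun z => (- ((rho m)%:C * om ^+ 2)) * Jpml P z * x (Some k) None z * conjc (y (Some k) None z)) =
    (- ((rho m)%:C * om ^+ 2)) * massform P x y.
  rewrite /massform /fam mulr_sumr; apply: eq_bigr => k _; rewrite -(mformZ _ _ _ gJ.1 gJ.2).
  by apply: cint_mform => //; [exact: gC|exact: gC|exact: L2tP|apply: aeW].
have f5 : \sum_(k < 3) cint D (fun z => (- gammaT m)%:C * x None None z * W k z) = pdivform m P x y.
  apply: eq_bigr => k _; apply: cint_mform => //; [exact: good_cst|exact: gC|exact: L2tP|].
  by apply: filterS (aW k) => z hz Dz; rewrite /W hz// mulrA; congr (_ * _); exact: mulrAC.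
have f6 : \sum_(k < 3) cint D (fun z => kcoef P k z * x None (Some k) z * Hp k z) = gradform P x y.
  apply: eq_bigr => k _; apply: cint_mform => //; [exact: L2tP|].
  by apply: filterS (aP k) => z hz Dz; rewrite /Hp hz.
have f7 : \sum_(k < 1) cint D (fun z => (- q) * Jpml P z * x None None z * conjc (y None None z)) = - q * pmassform P x y.
  rewrite /pmassform /fam mulr_sumr; apply: eq_bigr => k _; rewrite -(mformZ _ _ _ gJ.1 gJ.2).
  by apply: cint_mform => //; [exact: gC|exact: gC|exact: L2tP|apply: aeW].
(* Integration by parts with the weight [acoef] moves the derivative from the displacement to the
   test pressure, which accounts for the change of sign. *)
have f8 : \sum_(k < 3) cint D (fun z => - ((0 +i* 1) * om * (etaT m)%:C) * X k z * conjc (y None None z)) =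
    (0 +i* 1) * om * (etaT m)%:C * ugradform P x y.
  rewrite /ugradform /fam mulr_sumr; apply: eq_bigr => k _.
  have bp := h0_by_parts (x (Some k)) (y None) (weight_acoef a0 z0 k).
  have -> : mform (acoef P k) (x (Some k) None) (y None (Some k)) = - mform (acoef P k) (x (Some k) (Some k)) (y None None).
    by rewrite bp.
  rewrite mulrN -mulNr -(mformZ _ _ _ (gA k).1 (gA k).2).
  apply: cint_mform => //; [exact: good_cst|exact: gC|].
  by apply: filterS (aX k) => z hz Dz; rewrite /X hz// mulrA.
have cg (a b c d : R[i]) : a = b -> c = d -> a + c = b + d by move=> -> ->.
have E := cg _ _ _ _ (cg _ _ _ _ (cg _ _ _ _ (cg _ _ _ _ (cg _ _ _ _ (cg _ _ _ _ (cg _ _ _ _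
  f1 f2) f3) f4) f5) f6) f7) f8.
apply: (etrans E); rewrite /bform /form0 f23 /form1 /form2 /q.
exact: bform_algebra.
Qed.

End Identify.

Section WellPosed.
Context {R : realType}.
Variables (m : material R) (P : pml R) (D : bdom R) (Q : pt R -> 'cV[R[i]]_3) (om : R[i]).
Hypotheses (a0 : 0 < alpha0 P) (z0 : 0 < zeta P).
Hypothesis LQ : forall i, L2 D (fun z => Q z i 0).
Local Notation V := (option 'I_3 -> H0t D).
Local Notation DD := (D : set (mpt R)).
Implicit Types x y : V.
Local Notation o0 := (@Ordinal 3 0 isT).
Local Notation o1 := (@Ordinal 3 1 isT).
Local Notation o2 := (@Ordinal 3 2 isT).

Definition vpart x : pt R -> 'cV[R[i]]_3 := fun z => \col_i x (Some i) None z.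

Lemma vpartE x i : x (Some i) None = (fun z => vpart x z i 0) :> (pt R -> R[i]).
Proof. by apply/funext => z; rewrite mxE. Qed.

Lemma vpart_H10 x : H10_4 D (vpart x) (x None None).
Proof. by split => [i|]; [rewrite -vpartE|]; exact: h0_H10. Qed.

Lemma H10_4_lift u p : H10_4 D u p -> exists x,
  [/\ forall i, x (Some i) None = (fun z => u z i 0) :> (pt R -> R[i]),
      forall i j, x (Some i) (Some j) = wpd D j (fun z => u z i 0) :> (pt R -> R[i]),
      x None None = p :> (pt R -> R[i])
    & forall j, x None (Some j) = wpd D j p :> (pt R -> R[i])].
Proof.
move=> [hu hp]; have [f hf] := choice (fun i => H10_h0 (hu i)); have [g [g0 g1]] := H10_h0 hp.
exists (fun o => if o is Some i then f i else g).
by split => [i|i j||j] //; case: (hf i).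
Qed.

Definition source y : R[i] := - \sum_i conjc (l2hform D (y (Some i) None) (toL2 (LQ i))).

Lemma sourceE (u' : pt R -> 'cV[R[i]]_3) y : (forall i, y (Some i) None = (fun z => u' z i 0) :> (pt R -> R[i])) ->
  - cint D (fun z => dotp (Q z) (vconj u' z)) = source y.
Proof.
move=> yu; congr (- _).
have I1 i := l2ip_integrable (toL2 (LQ i)) (y (Some i) None).
apply: (etrans _ (etrans (@cint_sum R D _ (index_enum 'I_3) xpredT _ I1) _)).
  by apply: cint_eq => z _; apply: eq_bigr => i _; rewrite /vconj mxE yu.
by apply: eq_bigr => i _; rewrite -hipC.
Qed.

Lemma source_clin : clin source.
Proof.
move=> a x y; rewrite /source mulrN -opprD mulr_sumr -big_split; congr (- _).
apply: eq_bigr => i _.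
transitivity (conjc (l2hform D (a *: x (Some i) None + y (Some i) None) (toL2 (LQ i)))); first by [].
by rewrite hipD hipZ rmorphD rmorphM.
Qed.

Lemma sqn_sum3 (w0 w1 w2 : R[i]) (c0 c1 c2 N : R) :
  sqn w0 <= c0 * N -> sqn w1 <= c1 * N -> sqn w2 <= c2 * N ->
  sqn (w0 + w1 + w2) <= (4 * c0 + 4 * c1 + 2 * c2) * N.
Proof.
have := sqnD (w0 + w1) w2; have := sqnD w0 w1.
move: (sqn w0) (sqn w1) (sqn w2) (sqn (w0 + w1)) (sqn _) => s0 s1 s2 s3 s4 h1 h2 h3 h4 h5.
have -> : (4 * c0 + 4 * c1 + 2 * c2) * N = 4 * (c0 * N) + 4 * (c1 * N) + 2 * (c2 * N) by ring.
by move: (c0 * N) (c1 * N) (c2 * N) h3 h4 h5 => t0 t1 t2 h3 h4 h5; lra.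
Qed.

Lemma source_bounded : bounded_cfun (vform D) source.
Proof.
pose C i := nsq (l2hform D) (toL2 (LQ i)).
exists (4 * C o0 + 4 * C o1 + 2 * C o2) => x.
rewrite /source sqnN sum3.
have h i : sqn (conjc (l2hform D (x (Some i) None) (toL2 (LQ i)))) <= C i * nsq (vform D) x.
  rewrite sqn_conj; apply: (le_trans (cauchy_schwarz _ _ _)); rewrite mulrC ler_wpM2l ?nsq_ge0//.
  exact: nsq_v_ge.
exact: sqn_sum3 (h o0) (h o1) (h o2).
Qed.

Lemma nsq_l2_null (f : L2t D) : {ae leb3, forall z : mpt R, DD z -> f z = 0} -> nsq (l2hform D) f = 0.
Proof.
move=> f0; have I1 := l2ip_integrable f f; have e := cintZ 0 I1; rewrite mul0r in e.
rewrite /nsq (_ : l2hform D f f = 0)//; apply: (etrans _ e); apply: cint_ae.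
- have [h1 h2] := I1; split; apply/measurable_EFinP; [exact: measurable_int h1|exact: measurable_int h2].
- have [h1 h2] := cintegrableZ 0 I1; split; apply/measurable_EFinP; [exact: measurable_int h1|exact: measurable_int h2].
- by apply: filterS f0 => z fz Dz; rewrite fz// !mul0r.
Qed.

Lemma h0_null (e : H0t D) : (forall z, e None z = 0) -> nsq (h0form D) e = 0.
Proof.
move=> e0; rewrite nsq_h0 big1// => -[j|] _; last first.
  by apply: nsq_l2_null; apply: aeW => z _; exact: e0.
apply: nsq_l2_null.
have w1 := wpd_ae (h0_is_wpd e j); have w2 := wpd_ae (h0_is_wpd (0 : H0t D) j).
have ee : (e None : pt R -> R[i]) = ((0 : H0t D) None : pt R -> R[i]) by apply/funext => z; rewrite e0.
rewrite ee in w1.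
by apply: filterS2 w1 w2 => z h1 h2 Dz; rewrite -h1// h2.
Qed.

(** Two lifts of the same functions may carry different representatives of the derivatives. A
    vanishing value forces null derivatives by uniqueness of weak derivatives, and a bounded form
    ignores null vectors. *)
Lemma bform_congr x x' y : (forall o z, x o None z = x' o None z) -> bform m P om x y = bform m P om x' y.
Proof.
move=> xx'; have sb := bform_sesqui m D a0 z0 om.
have d0 : nsq (vform D) (x - x') = 0.
  rewrite nsq_v big1// => o _.
  have := @h0_null ((x - x') o); rewrite nsq_h0; apply => z.
  have -> : (x - x') o None z = x o None z - x' o None z by [].
  by rewrite xx' subrr.
have [K hK] := bform_bounded m D a0 z0 om.
have := hK (x - x') y; rewrite d0 mul0r mulr0 => h.
have b0 : bform m P om (x - x') y = 0.
  by apply: sqn_eq0; apply/eqP; rewrite eq_le h sqn_ge0.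
by rewrite -{1}(subrK x' x) (sesDl sb) b0 add0r.
Qed.

Lemma weak_solution_nonresonant : ~ resonances m P D om ->
  (exists x, forall y, bform m P om x y = source y) ->
  exists u p, weak_solution m P om D Q u p /\
    forall u' p', weak_solution m P om D Q u' p' ->
      {ae leb3, forall z : mpt R, DD z -> u' z = u z /\ p' z = p z}.
Proof.
move=> nres [x hx].
exists (vpart x), (x None None); split.
  split; first exact: vpart_H10.
  move=> u' p' /H10_4_lift[y [yu _ yp _]].
  (* The lift [X] carries the derivatives chosen by [wpd] and may differ from [x]; [bform_congr]
     bridges the two. *)
  have [X [Xu XU Xp XG]] := H10_4_lift (vpart_H10 x).
  rewrite (Bform_bform m a0 z0 om Xu XU Xp XG yu yp) (sourceE yu) -hx.
  by apply: bform_congr => -[i|] z; [rewrite Xu mxE|rewrite Xp].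
move=> u' p' [/H10_4_lift[X [Xu XU Xp XG]] hX].
have sb := bform_sesqui m D a0 z0 om.
have d0 y : bform m P om (X - x) y = 0.
  have yu := vpartE y.
  have := hX _ _ (vpart_H10 y).
  rewrite (Bform_bform m a0 z0 om Xu XU Xp XG yu erefl) (sourceE yu) -hx => e.
  by rewrite (sesDl sb) -scaleN1r (sesZl sb) e mulN1r subrr.
have n0 : nsq (vform D) (X - x) = 0.
  by apply: contrapT => /eqP n; apply: nres; exists (X - x).
have ae0 o : {ae leb3, forall z : mpt R, DD z -> X o None z = x o None z}.
  have := @nsq_v_ge _ _ (X - x) o None; rewrite n0 => n1.
  have n2 : nsq (l2hform D) ((X - x) o None) = 0 by apply/eqP; rewrite eq_le n1 nsq_ge0.
  apply: filterS (nsq_l2_ae n2) => z hz Dz; apply/eqP; rewrite -subr_eq0; apply/eqP.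
  exact: hz Dz.
have A : {ae leb3, forall z : mpt R, DD z -> forall o : option 'I_3, X o None z = x o None z}.
  apply: filterS (filterI (filterI (ae0 None) (ae0 (Some o0))) (filterI (ae0 (Some o1)) (ae0 (Some o2)))).
  move=> z [[hn h0] [h1 h2]] Dz -[i|]; last exact: hn.
  have [->|[->|->]] : i = o0 \/ i = o1 \/ i = o2; [|exact: h0|exact: h1|exact: h2].
  case: i => [[|[|[|//]]] hi]; [left|right; left|right; right]; exact: val_inj.
apply: filterS A => z hz Dz; split; last by have := hz Dz None; rewrite Xp.
by apply/matrixP => i j; rewrite ord1 mxE; have := hz Dz (Some i); rewrite Xu.
Qed.

End WellPosed.

(** * The truncated domain, and the well-posedness statement *)

Section Domain.
Context {R : realType}.

Lemma continuous_xcoord (j : 'I_3) : continuous (fun x : pt R => xcoord x j).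
Proof.
case: j => [[|[|[|//]]] hj] x; rewrite /xcoord/=.
- by apply: (@continuous_comp _ _ _ fst fst); exact: cvg_fst.
- by apply: (@continuous_comp _ _ _ fst snd); [exact: cvg_fst|exact: cvg_snd].
- exact: cvg_snd.
Qed.

Lemma open_box (a : 'I_3 -> R) : open (box a).
Proof.
have oj j : open [set x : pt R | `|xcoord x j| < a j].
  apply: (@open_comp _ _ (fun x : pt R => `|xcoord x j|) [set t | t < a j]); last exact: open_lt.
  move=> x _; apply: (@continuous_comp _ _ _ (fun x : pt R => xcoord x j) (fun t : R => `|t|)).
    exact: continuous_xcoord.
  exact: norm_continuous.
rewrite (_ : box a = [set x | `|xcoord x (@Ordinal 3 0 isT)| < a (@Ordinal 3 0 isT)] `&`
   ([set x | `|xcoord x (@Ordinal 3 1 isT)| < a (@Ordinal 3 1 isT)] `&`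
    [set x | `|xcoord x (@Ordinal 3 2 isT)| < a (@Ordinal 3 2 isT)])).
  by apply: openI => //; apply: openI.
apply/seteqP; split => [x hx|x [h0 [h1 h2]]]; first by split; [exact: hx|split; exact: hx].
by case=> [[|[|[|//]]] hi]; [move: h0|move: h1|move: h2];
  rewrite (bool_irrelevance hi isT).
Qed.

Lemma box_bounded (a : 'I_3 -> R) : exists M, forall x, box a x -> forall j, `|xcoord x j| < M.
Proof.
exists (\sum_k `|a k|) => x hx j; apply: (lt_le_trans (hx j)); rewrite (bigD1 j)//=.
by apply: (le_trans (ler_norm _)); rewrite lerDl sumr_ge0.
Qed.

Lemma L2_sub (A : set (pt R)) (D : bdom R) f : open A -> (D : set (pt R)) `<=` A -> L2 A f -> L2 D f.
Proof.
move=> oA DA [mr mi fin]; have mA := open_measurable3 oA; have mD := bdom_measurable D.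
split; [exact: measurable_funS mr|exact: measurable_funS mi|].
apply: le_lt_trans fin; apply: ge0_subset_integral => //.
  by apply/measurable_EFinP; apply: measurable_funD; apply: measurable_funX.
by move=> x _; rewrite lee_fin addr_ge0// sqr_ge0.
Qed.

Lemma sqrtr_le_sqr (a b : R) : 0 <= a -> Num.sqrt a <= b -> a <= b ^+ 2.
Proof.
move=> a0 ab; rewrite -(sqr_sqrtr a0) ler_pXn2r// nnegrE ?sqrtr_ge0//.
exact: le_trans (sqrtr_ge0 _) ab.
Qed.

End Domain.

Theorem corollary4p5 (R : realType) (m : material R) (P : pml R)
    (Om : set (pt R)) (Q : pt R -> 'cV[R[i]]_3) :
  let B1 := box (ell P) in
  let B2 := box (fun j => ell P j + thick P j) in
  let Om2 := B2 `\` closure Om in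
  0 < rho m -> 0 < mu m -> 0 < 3 * lam m + 2 * mu m ->
  0 < alphaT m -> 0 < T0 m -> 0 < lam0 m -> 0 < kappa m ->
  (forall j, [/\ 0 < ell P j, 0 < thick P j, ell P j < ellbar P j
               & ellbar P j <= ell P j + thick P j]) ->
  0 < alpha0 P -> 0 < zeta P ->
  is_domain Om -> bounded_set Om -> smooth_boundary Om -> closure Om `<=` B1 ->
  (forall i, H1 (~` closure Om) (fun x => Q x i 0)) ->
  (exists C : set (pt R), [/\ compact C, C `<=` B1
     & {ae leb3, forall x, (~` closure Om `\` C) x -> Q x = 0}]) ->
  Num.sqrt ((lam m + 2 * mu m) / mu m) <= zeta P ->
  1 <= rho m * gammaT m ^+ 2 / etaT m ^+ 2 ->
  2 * gammaT m * zeta P <= zeta P ^+ 2 - 1 ->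
  Num.sqrt 3 <= zeta P ->
  alpha0 P < (lam m + mu m) / (2 * gammaT m * (lam m + 2 * mu m)) ->
  exists Lambda : set R[i],
    limit_point (Lambda : set (R[i] : numFieldType)) = set0 /\
    forall omega : R[i], ~ Lambda omega ->
      exists u p, weak_solution m P omega Om2 Q u p /\
        forall u' p', weak_solution m P omega Om2 Q u' p' ->
          {ae leb3, forall x, Om2 x -> u' x = u x /\ p' x = p x}.
Proof.
move=> B1 B2 Om2 rho0 mu0 lm0 al0 T00 lz0 kap0 _ a0 z0 _ _ _ _ hQ _ hz1 _ _ hz3 _.
have oC : open (~` closure Om) by rewrite openC; exact: closed_closure.
have oD : open Om2 by rewrite /Om2 setDE; apply: openI => //; exact: open_box.
have bD : exists M, forall x, Om2 x -> forall j, `|xcoord x j| < M.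
  have [M hM] := box_bounded (fun j => ell P j + thick P j).
  by exists M => x [/hM].
pose D := BDom oD bD.
have et0 : 0 < etaT m by rewrite /etaT /gammaT divr_gt0// !mulr_gt0.
have r0 : 0 <= (lam m + 2 * mu m) / mu m by apply: divr_ge0; clear -mu0 lm0; lra.
have [lim ex] := resonances_dichotomy D a0 z0 rho0 mu0 lm0 et0 kap0
  (sqrtr_le_sqr r0 hz1) (sqrtr_le_sqr (ler0n _ 3) hz3).
have LQ i : L2 D (fun z => Q z i 0).
  by apply: L2_sub oC _ (hQ i).1 => x [].
(* The exceptional set consists of the frequencies at which the homogeneous problem has a nontrivial
   solution. *)
exists (resonances m P D); split; first exact: lim.
move=> om nres; apply: (@weak_solution_nonresonant R m P D Q om a0 z0 LQ nres).
exact: (ex om nres (source LQ) (source_clin LQ) (source_bounded LQ)).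
Qed.
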